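(* Let $n \ge 3$ be an integer, and suppose $\widetilde{\mathrm{TC}}(n,\tau)$ holds for some real number $$\tau > \frac{4n}{n+2}.$$ Then $$\tilde E_n(H) = \tilde E_n^\dagger(H) + o(H^n) \qquad (H \to \infty).$$ In particular, if also $n \ge 10$, then $\tilde E_n(H) = o(H^n)$ as $H \to \infty$.
   Context: For an integer $n \ge 3$ and $H \ge 1$, $\tilde E_n(H)$ is the number of irreducible polynomials $f = a_0X^n + a_1X^{n-1}+\cdots+a_n \in \mathbb{Z}[X]$ with $a_0 \ne 0$ such that $|a_j| \le H$ for all $0 \le j \le n$ and $G_f \not\cong S_n$; and $\tilde E_n^\dagger(H)$ is the number of irreducible polynomials $f = a_0X^n + a_1X^{n-1}+\cdots+a_n \in \mathbb{Z}[X]$ with $a_0 \ne 0$ such that $|a_j| \le H$ for all $0 \le j \le n$ and $G_f \not\ge A_n$. Here irreducibility is over $\mathbb{Q}$, $G_f$ is the Galois group over $\mathbb{Q}$ of the splitting field of $f$, regarded (up to conjugacy) as a subgroup of $S_n$ through its action on the $n$ roots of $f$, and $G_f \not\ge A_n$ means that $G_f$ does not contain the alternating group $A_n$. The statement $\widetilde{\mathrm{TC}}(n,\tau)$. For a ring $R$, let $\mathcal{A}_{\le m}(R)$ be the set of all (not necessarily monic) polynomials of degree at most $m$ in $R[X]$, including $0$. For a prime $p$ and a non-zero $f \in \mathbb{F}_p[X]$ whose factorisation (up to units) into irreducibles is $f = f_1\cdots f_r$, put $\mu_p(f) = (-1)^r$ if the $f_j$ are distinct (pairwise non-associate), and $\mu_p(f)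 = 0$ otherwise. Write $e_p(x) = e^{2\pi i x/p}$, which is well defined for $x \in \mathbb{F}_p$. For $g,\theta \in \mathcal{A}_{\le n-1}(\mathbb{F}_p)$, let $g\cdot\theta$ be the dot product of their coefficient vectors in $\mathbb{F}_p^n$. Let $\mathbb{E}_{g \in S}$ denote the average over a finite set $S$. For $n \in \mathbb{N}$ and $\tau > 0$, $\widetilde{\mathrm{TC}}(n,\tau)$ is the statement that there is a constant $K$ depending only on $n$ and $\tau$ such that, for all sufficiently large primes $p$, $$\sup_{\substack{0 \ne a_0 \in \mathbb{F}_p\\ 0 \ne h \in \mathcal{A}_{\le n-1}(\mathbb{F}_p)\\ \theta \in \mathcal{A}_{\le n-1}(\mathbb{F}_p)}} \left|\mathbb{E}_{g \in \mathcal{A}_{\le n-1}(\mathbb{F}_p)}\, \mu_p(a_0X^n+g)\,\mu_p(a_0X^n+g+h)\,e_p(g\cdot\theta)\right| \le K p^{-\tau}.$$ *)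

(* Defs.v *)
From HB Require Import structures.
From mathcomp Require Import all_boot all_order all_algebra all_fingroup.
From mathcomp Require Import all_solvable all_field.
From mathcomp Require Import finmap.
From mathcomp Require Import all_classical all_reals all_analysis.
From mathcomp Require Import complex.
Import Order.TTheory GRing.Theory Num.Theory.
Import numFieldNormedType.Exports.

Set Implicit Arguments.
Unset Strict Implicit.
Unset Printing Implicit Defensive.

Local Open Scope classical_set_scope.
Local Open Scope ring_scope.

(* Lets the library's Landau notations be used along [+oo]. *)
Canonical pinfty_filter_on (R : numFieldType) :=
  FilterType (pinfty_nbhs R) _.

Section RootPerms.
Variables (n : nat) (L : splittingFieldType rat) (r : n.-tuple L).

(* When [r] enumerates without repetition the roots of a polynomial generating
   [L], this is the Galois group of [L] over the rationals acting on (the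
   indices of) these roots. *)
Definition root_perms : {set 'S_n} :=
  [set s : 'S_n | [exists sigma in 'Gal({:L} / 1)%g,
     [forall i, sigma (tnth r i) == tnth r (s i)]]]%SET.

Lemma root_perms_group_set : group_set root_perms.
Proof.
apply/group_setP; split=> [|s t].
  rewrite inE; apply/exists_inP; exists 1%g; first exact: group1.
  by apply/forallP=> i; rewrite gal_id perm1.
rewrite !inE => /exists_inP[x xG /forallP xs] /exists_inP[y yG /forallP yt].
apply/exists_inP; exists (x * y)%g; first exact: groupM.
by apply/forallP=> i; rewrite galM ?memvf// (eqP (xs i)) (eqP (yt _)) permM.
Qed.

Canonical root_perms_group := Group root_perms_group_set.

End RootPerms.

Definition is_galois_group (n : nat) (f : {poly rat}) (G : {group 'S_n}) :=
  exists (L : splittingFieldType rat) (r : n.-tuple L),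
    [/\ map_poly (in_alg L) f %= \prod_(x <- r) ('X - x%:P),
        <<1 & r>>%VS = fullv
      & G = root_perms_group r].

(* Determined by [f] only up to conjugacy in ['S_n]: it depends on the ordering
   of the roots.  The default value [1] is never used for [f] of degree [n], see
   [galois_groupP]. *)
Definition galois_group (n : nat) (f : {poly rat}) : {group 'S_n} :=
  xget 1%G [set G : {group 'S_n} | is_galois_group f G].

Lemma galois_groupP (n : nat) (f : {poly rat}) :
  size f = n.+1 -> is_galois_group f (galois_group n f).
Proof.
move=> sf; have f0 : f != 0 by rewrite -size_poly_eq0 sf.
have [s Ds] := closed_field_poly_normal (map_poly (ratr : rat -> algC) f).
have [L [LC [r Dr genL]]] := num_field_exists s.
have lf0 : lead_coef (map_poly (ratr : rat -> algC) f) != 0.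
  by rewrite lead_coef_eq0 map_poly_eq0.
have Lf : map_poly (in_alg L) f %= \prod_(x <- r) ('X - x%:P).
  rewrite -(eqp_map LC) -map_poly_comp rmorph_prod /=.
  rewrite (eq_map_poly (g := ratr)); last first.
    by move=> x /=; rewrite alg_num_field fmorph_rat.
  rewrite Ds (eqp_ltrans (eqp_scale _ lf0)) -Dr big_map.
  under [X in _ %= X]eq_bigr do rewrite rmorphB /= map_polyX map_polyC /=.
  exact: eqpxx.
have sr : size r == n.
  have := eqp_size Lf; rewrite size_prod_XsubC size_map_poly sf => -[->].
  by [].
have split_L : splittingFieldFor 1 (map_poly (in_alg L) f) {:L} by exists r.
have axL : SplittingField.axiom L.
  exists (map_poly (in_alg L) f) => //.
  by apply/polyOver1P; exists f.
pose Lm := HB.pack_for (splittingFieldType rat) L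
  (FieldExt_isSplittingField.Build rat L axL).
suff: exists G : {group 'S_n}, is_galois_group f G.
  by move=> [G PG]; rewrite /galois_group; apply: (@xgetPex _ 1%G
    [set G : {group 'S_n} | is_galois_group f G]); exists G.
by exists (root_perms_group (Tuple sr : n.-tuple Lm)), Lm, (Tuple sr).
Qed.

Section Counting.
Variable R : realType.

(* [size f = n.+1] says that [f] has degree [n], i.e. that the coefficient of
   ['X^n] is nonzero. *)
Definition irred_box (n : nat) (H : R) : set {poly int} :=
  [set f : {poly int} | [/\ size f = n.+1,
               irreducible_poly (map_poly (intr : int -> rat) f)
             & forall j, `|f`_j|%:~R <= H]].

Definition galZ (n : nat) (f : {poly int}) : {group 'S_n} :=
  galois_group n (map_poly (intr : int -> rat) f).

Definition nonSn_set (n : nat) (H : R) : set {poly int} :=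
  [set f : {poly int} | irred_box n H f /\ ~~ (galZ n f \isog 'Sym_('I_n))].

Definition nonAn_set (n : nat) (H : R) : set {poly int} :=
  [set f : {poly int} | irred_box n H f /\ ~~ ('Alt_('I_n) \subset galZ n f)%g].

(* [fset_set] is meaningful on finite sets only, see [finite_irred_box]. *)
Definition E_count (n : nat) (H : R) : nat := #|` fset_set (nonSn_set n H)|.

Definition E_dagger_count (n : nat) (H : R) : nat :=
  #|` fset_set (nonAn_set n H)|.

Lemma finite_irred_box (n : nat) (H : R) : finite_set (irred_box n H).
Proof.
pose N := absz (Num.floor H).
pose g (c : {ffun 'I_n.+1 -> 'I_(N.*2.+1)}) : {poly int} :=
  \poly_(i < n.+1) ((c (inord i) : nat)%:Z - N%:Z).
apply: (@sub_finite_set _ _ (range g)); last exact/finite_image/finite_finset.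
move=> f [sf _ bf].
have bN j : `|f`_j| <= N%:Z.
  have fH : `|f`_j| <= Num.floor H by rewrite Num.Theory.floor_ge_int// bf.
  by rewrite /N abszE (le_trans fH)// ler_norm.
exists [ffun i : 'I_n.+1 => inord (absz (f`_i + N%:Z))] => //.
apply/polyP => i; rewrite coef_poly; case: ltnP => [lti|gei]; last first.
  by rewrite nth_default// sf.
have := bN i; rewrite ler_norml => /andP[lb ub].
have p0 : 0 <= f`_i + N%:Z by rewrite -lerBlDr sub0r.
rewrite ffunE inordK ?inordK//; first by rewrite gez0_abs// addrK.
by rewrite ltnS -lez_nat gez0_abs// -addnn PoszD lerD2r.
Qed.

End Counting.

Section Mobius.
Variable F : fieldType.

Definition is_factorisation (f : {poly F}) (s : seq {poly F}) :=
  (forall q, q \in s -> irreducible_poly q) /\ f %= \prod_(q <- s) q.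

(* Irreducible factors with multiplicity, of a nonzero [f]. *)
Definition irr_factors (f : {poly F}) : seq {poly F} :=
  xget [::] [set s : seq {poly F} | is_factorisation f s].

(* Junk value [1] at [f = 0]. *)
Definition mobius (f : {poly F}) : int :=
  let s := irr_factors f in
  if pairwise (fun q1 q2 => ~~ (q1 %= q2)) s then (-1) ^+ size s else 0.

Lemma irr_factorsP (f : {poly F}) :
  f != 0 -> is_factorisation f (irr_factors f).
Proof.
move=> f0; apply: (@xgetPex _ [::] [set s : seq {poly F} | is_factorisation f s]).
have [m] := ubnP (size f); elim: m f f0 => // m IH f f0 sf.
have [f1|f1] := leqP (size f) 1.
  exists [::]; split => //; rewrite big_nil -size_poly_eq1 eqn_leq f1.
  by rewrite lt0n size_poly_eq0.
have [irrf|nirr] := pselect (irreducible_poly f).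
  exists [:: f]; split=> [q|]; last by rewrite big_seq1 eqpxx.
  by rewrite inE => /eqP ->.
have [q [q1 qf nq]] : exists q : {poly F}, [/\ size q != 1%N, q %| f & ~~ (q %= f)].
  apply: contrapT => nex; apply: nirr; split=> // q q1 qf.
  by apply: contrapT => nq; apply: nex; exists q; split=> //; apply/negP.
have [u Du] := dvdpP _ _ qf.
have := f0; rewrite Du mulf_eq0 negb_or => /andP[u0 q0].
have ltq : (size q < size f)%N.
  rewrite ltn_neqAle dvdp_leq// andbT.
  by apply: contra nq => /eqP e; rewrite -dvdp_size_eqp// e.
have ltu : (size u < size f)%N.
  rewrite Du size_mul//.
  have : (1 < size q)%N by rewrite ltn_neqAle eq_sym q1 lt0n size_poly_eq0.
  by case: (size q) => [|[|k]]// _; rewrite !addnS ltnS leq_addr.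
have [s1 [i1 e1]] := IH u u0 (leq_trans ltu (sf : (size f <= m)%N)).
have [s2 [i2 e2]] := IH q q0 (leq_trans ltq (sf : (size f <= m)%N)).
exists (s1 ++ s2); split=> [w|]; first by rewrite mem_cat => /orP[/i1|/i2].
by rewrite big_cat /= (eqp_ltrans (eqp_mulr _ e1))
  (eqp_ltrans (eqp_mull _ e2)) eqpxx.
Qed.

End Mobius.

Section TwistedCorrelation.
Variable R : realType.

Definition e_p (p : nat) (x : 'F_p) : R[i] :=
  let t : R := 2 * pi * (x : nat)%:R / p%:R in Complex (cos t) (sin t).

Definition dot_coef (p n : nat) (g theta : {poly_n 'F_p}) : 'F_p :=
  \sum_(i < n) g`_i * theta`_i.

(* [{poly_n 'F_p}] is the finite type of polynomials of degree at most
   [n - 1] over ['F_p]. *)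
Definition mobius_correlation (p n : nat) (a0 : 'F_p)
    (h theta : {poly_n 'F_p}) : R[i] :=
  (\sum_(g : {poly_n 'F_p})
     (mobius (a0 *: 'X^n + (g : {poly 'F_p})))%:~R
     * (mobius (a0 *: 'X^n + (g : {poly 'F_p}) + (h : {poly 'F_p})))%:~R
     * e_p (dot_coef g theta))
  / #|{: {poly_n 'F_p}}|%:R.

(* The bound on the supremum is spelled out as a bound on every value. *)
Definition TC (n : nat) (tau : R) : Prop :=
  exists K : R, \forall p \near \oo, prime p ->
    forall (a0 : 'F_p) (h theta : {poly_n 'F_p}), a0 != 0 -> h != 0 ->
      ComplexField.Normc.normc (mobius_correlation a0 h theta)
        <= K * p%:R `^ (- tau).

End TwistedCorrelation.

(* Main.v *)
(** Suppose first that the Galois group of [f] contains no transposition, as is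
    the case when it is the alternating group. If a prime not dividing the leading
    coefficient divides the discriminant of [f] to an odd power, then an inertia
    group above it contains an odd permutation, which is not a transposition, so
    [f] has at most [n - 3] distinct roots modulo this prime. Such reductions lie
    on the common zeros of a flag of three integral forms, and a sieve shows that
    the product [C] of these primes is small for all but few [f]. Once [C], the
    coefficients of [f] modulo [C] and its leading coefficient are fixed, there are
    few possibilities for the square class of the discriminant; by Stickelberger's
    theorem the square class determines the Moebius function of [f] modulo most
    primes. The bound on the twisted correlations of Moebius functions, applied
    through a van der Corput shift at pairs of primes of two different sizes,
    makes this a rare event by a second moment computation.

    If the Galois group contains a transposition but not all of them, then the
    transpositions define a system of [b] blocks of [a] roots, with [a] and [b] at
    least 2, and [f] is up to a constant the product of [b] conjugate polynomials
    of degree [a] over the field generated by their values [z] at some integer [c].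
    The resolvent with roots [z] has coefficients of the size of those of [f]
    (Landau's inequality). Two such [f] with the same resolvent, whose factors take
    close values at [a - 1] further integers, are equal: the differences of these
    values are conjugate algebraic numbers whose norm, up to the leading coefficient
    and the content of the resolvent, is an integer smaller than 1. Counting the
    resolvents and the possible approximate values gives a bound of smaller order
    than [H ^ n] as soon as [n] is at least 10. *)

(* Three redundant roots are just enough. Polynomials of degree [n] with at most [n - 3] distinct
   roots form a cone of codimension 3 in the space of the [n + 1] coefficients. For a prime above
   the height, one form serves to find the prime and the other two save a variable each, leaving
   [H ^ (n - 1)]. For primes with a small product [C] there are about [C ^ (n - 2)] residues, with
   [(H / C) ^ (n + 1)] polynomials in each, so the sieve has to save slightly more than the side
   [H / C] of the box; [H ^ n / C ^ 2] can then be summed over [C].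

   Coincident primes limit the saving of a second moment to the number of primes used. Two sets of
   primes, near [W ^ x] and [W ^ z], reach the side [W ^ N] of the box with smaller moduli if
   [x + z] is about [N]. The diagonal of the shift by multiples of two small primes limits [x] to
   [N (n - 2) / (2 n)], and for the complementary [z] the correlations are small enough as soon as
   [tau > 4 n / (n + 2)].

   On the side of the blocks the obstacle is a resolvent with large content: the rigidity argument
   then needs closer values, but such resolvents are rare. *)
Require Import Defs.
From HB Require Import structures.
From mathcomp Require Import all_boot all_order all_algebra all_fingroup.
From mathcomp Require Import all_solvable all_field.
From mathcomp Require mpoly classical_sets.
From mathcomp Require Import zify ring lra boolp.
Set Implicit Arguments.
Unset Strict Implicit.
Unset Printing Implicit Defensive.
Import Order.TTheory GRing.Theory Num.Theory.
Local Open Scope ring_scope.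

(** * Integral forms and their evaluation *)

(* Monomials are encoded by their exponents; the coefficients at exponents of
   total degree other than [m] are ignored by [form_eval]. *)
Definition form (N m : nat) := {ffun {ffun 'I_N -> 'I_m.+1} -> int}.

Definition form_eval (R : comNzRingType) (N m : nat) (c : form N m)
    (y : 'I_N -> R) : R :=
  \sum_(e : {ffun 'I_N -> 'I_m.+1} | (\sum_i e i == m)%N)
     (c e)%:~R * \prod_i y i ^+ e i.

Lemma eq_form_eval (R : comNzRingType) N m (c : form N m) (y z : 'I_N -> R) :
  y =1 z -> form_eval c y = form_eval c z.
Proof.
by move=> yz; apply: eq_bigr => e _; under eq_bigr do rewrite yz.
Qed.

Lemma form_eval_rmorph (R S : comNzRingType) (phi : {rmorphism R -> S}) N m
    (c : form N m) (y : 'I_N -> R) :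
  phi (form_eval c y) = form_eval c (fun i => phi (y i)).
Proof.
rewrite rmorph_sum; apply: eq_bigr => e _; rewrite rmorphM rmorph_int.
by rewrite rmorph_prod; under eq_bigr do rewrite rmorphXn.
Qed.

Lemma form_eval_bound N m (c : form N m) : exists K : nat,
  forall (Z : nat) (y : 'I_N -> int), (forall i, `|y i|%N <= Z)%N ->
    (`|form_eval c y|%N <= K * Z ^ m)%N.
Proof.
exists (\sum_(e : {ffun 'I_N -> 'I_m.+1} | (\sum_i e i == m)%N) `|c e|%N)%N.
move=> Z y yZ; rewrite big_distrl /= -lez_nat abszE (big_morph Posz PoszD (erefl _)).
apply: le_trans (ler_norm_sum _ _ _) _; apply: ler_sum => e /eqP se.
rewrite PoszM normrM intz abszE.
apply: ler_wpM2l; first exact: normr_ge0.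
rewrite (_ : Z ^ m = \prod_i Z ^ e i)%N; last by rewrite -expn_sum se.
rewrite (big_morph Posz PoszM (erefl _)) normr_prod.
apply: ler_prod => i _; rewrite normr_ge0 normrX -natz natrX natz.
by apply: lerXn2r; rewrite ?qualifE /= // -abszE lez_nat.
Qed.

Definition form_line (N m : nat) (c : form N m) (y u : 'I_N -> int) : {poly int} :=
  form_eval c (fun i => (y i)%:P + (u i)%:P * 'X).

Lemma form_line_horner N m (c : form N m) y u t :
  (form_line c y u).[t] = form_eval c (fun i => y i + u i * t).
Proof.
rewrite -[LHS]/(horner_eval t (form_line c y u)) form_eval_rmorph.
by apply: eq_form_eval => i; rewrite /= /horner_eval !hornerE.
Qed.

Lemma line_factor_size (R : comNzRingType) (y u : R) (k : nat) :
  (size ((y%:P + u%:P * 'X) ^+ k) <= k.+1)%N /\ ((y%:P + u%:P * 'X) ^+ k)`_k = u ^+ k.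
Proof.
elim: k => [|k [sk ck]]; first by rewrite !expr0 size_poly1 coef1.
rewrite exprSr mulrDr mulrA; split.
  have sC (p : {poly R}) (a : R) : (size (p * a%:P)%R <= size p)%N.
    rewrite (leq_trans (size_polyMleq _ _))//; move: (size_polyC_leq1 a).
    by set x := size _; set z := size _; lia.
  apply: leq_trans (size_polyD _ _) _; rewrite geq_max; apply/andP; split.
    by rewrite (leq_trans (sC _ _))// (leq_trans sk).
  apply: (leq_trans (size_polyMleq _ _)); rewrite size_polyX addn2 /=.
  by rewrite ltnS (leq_trans (sC _ _)).
by rewrite coefD coefMX /= !coefMC ck nth_default// mul0r add0r exprSr.
Qed.

Lemma prod_top_coef (R : comNzRingType) (I : Type) (s : seq I) (F : I -> {poly R})
    (d : I -> nat) (u : I -> R) :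
  (forall i, (size (F i) <= (d i).+1)%N /\ (F i)`_(d i) = u i) ->
  (size (\prod_(i <- s) F i)%R <= (\sum_(i <- s) d i).+1)%N /\
  (\prod_(i <- s) F i)`_(\sum_(i <- s) d i) = \prod_(i <- s) u i.
Proof.
move=> H; elim: s => [|i s [ss cs]]; first by rewrite !big_nil size_poly1 coef1.
rewrite !big_cons; have [si ci] := H i; split.
  apply: leq_trans (size_polyMleq _ _) _.
  by move: si ss; set a := size _; set b := size _; set x := d i; set y := bigop _ _ _; lia.
rewrite coefM (bigD1 (inord (d i))) //=.
rewrite inordK ?ltnS ?leq_addr// addKn ci cs [X in _ + X]big1 ?addr0// => j jd.
have [ji|ij] := ltnP (d i) j.
  by rewrite nth_default ?mul0r// (leq_trans si).
rewrite [X in _ * X]nth_default ?mulr0//; apply: leq_trans ss _.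
have : (j : nat) != d i.
  by apply: contra jd => /eqP e; apply/eqP/val_inj; rewrite /= e inordK// ltnS leq_addr.
by move: ij; set x := d i; set y := bigop _ _ _; lia.
Qed.

(** The coefficient of degree [m] depends on the direction only. A direction where the form does not
    vanish therefore bounds the zeros on all parallel lines uniformly, also modulo every prime not
    dividing that one value. *)
Lemma form_line_size N m (c : form N m) y u :
  (size (form_line c y u) <= m.+1)%N /\ (form_line c y u)`_m = form_eval c u.
Proof.
have H (e : {ffun 'I_N -> 'I_m.+1}) (se : (\sum_i e i = m)%N) :
    (size (\prod_i ((y i)%:P + (u i)%:P * 'X) ^+ e i : {poly int})%R <= m.+1)%N /\
    (\prod_i ((y i)%:P + (u i)%:P * 'X) ^+ e i : {poly int})`_m = \prod_i u i ^+ e i.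
  have := @prod_top_coef int 'I_N (index_enum _) _ (fun i => e i : nat) _
    (fun i => line_factor_size (y i) (u i) (e i)).
  by rewrite se.
split.
  apply: leq_trans (size_sum _ _ _) _; apply/bigmax_leqP => e /eqP se.
  rewrite -[_%:~R](rmorph_int (@polyC int)) mul_polyC.
  by apply: (leq_trans (size_scale_leq _ _)); case: (H e se).
rewrite coef_sum; apply: eq_bigr => e /eqP se; have [_ <-] := H e se.
by rewrite -[X in X * _](rmorph_int (@polyC int)) coefCM.
Qed.

Lemma digits_inj (B v : nat) (a b : 'I_v -> 'I_B) :
  (\sum_i a i * B ^ i = \sum_i b i * B ^ i)%N -> a =1 b.
Proof.
elim: v a b => [|v IH] a b; first by move=> _ [].
rewrite !big_ord_recl /= !expn0 !muln1.
have sh (c : 'I_v.+1 -> 'I_B) : (\sum_(i < v) c (lift ord0 i) * B ^ bump 0 i =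
   (\sum_(i < v) c (lift ord0 i) * B ^ i) * B)%N.
  by rewrite big_distrl; apply: eq_bigr => i _; rewrite /= /bump add1n expnSr mulnA.
rewrite !sh => E.
have B0 : (0 < B)%N by case: B a {b sh IH E} => [a|//]; case: (a ord0).
have E0 : a ord0 = b ord0.
  by apply/val_inj; have := congr1 (modn^~ B) E; rewrite /= ![(_ + _ * B)%N]addnC !modnMDl !modn_small.
move: E; rewrite E0 => /addnI /eqP; rewrite eqn_pmul2r// => /eqP /IH Ei i.
by case: (unliftP ord0 i) => [j ->|->//]; exact: Ei.
Qed.

Lemma row_common_denominator (k : nat) (x : 'rV[rat]_k) :
  exists d : int, exists w : 'rV[int]_k, d != 0 /\ map_mx intr w = d%:~R *: x.
Proof.
exists (\prod_j denq (x 0 j)), (\row_j (numq (x 0 j) * \prod_(i | i != j) denq (x 0 i))).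
split; first by apply/prodf_neq0 => j _; rewrite denq_eq0.
apply/rowP => j; rewrite !mxE [in RHS](bigD1 j) //=.
by rewrite !intrM numqE [RHS]mulrC mulrA.
Qed.

(** A rational solution exists by comparing ranks; denominators are then cleared. *)
Lemma short_kernel_vector (I J : finType) (A : I -> J -> int) :
  (#|J| < #|I|)%N -> exists c : {ffun I -> int}, c != [ffun => 0] /\
    forall j, \sum_i c i * A i j = 0.
Proof.
move=> JI; pose M := \matrix_(i < #|I|, j < #|J|) ((A (enum_val i) (enum_val j))%:~R : rat).
have : ~~ row_free M by rewrite /row_free neq_ltn (leq_ltn_trans (rank_leq_col _)).
rewrite -kermx_eq0 => /rowV0Pn[x /sub_kermxP xM x0].
have [d [w [d0 wx]]] := row_common_denominator x.
exists [ffun i => w 0 (enum_rank i)]; split.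
  apply: contra x0 => /eqP c0; rewrite -(inj_eq (scalerI (_ : (d%:~R : rat) != 0))) ?intr_eq0//.
  rewrite -wx scaler0; apply/eqP/rowP => i; rewrite !mxE.
  by have /ffunP/(_ (enum_val i)) := c0; rewrite !ffunE enum_valK => ->.
move=> j; apply/eqP; rewrite -(intr_eq0 rat) rmorph_sum /=; apply/eqP.
have := congr1 (fun N : 'rV[rat]_#|J| => d%:~R * N 0 (enum_rank j)) xM; rewrite !mxE mulr0 => E0.
rewrite -[RHS]E0 big_distrr /= (reindex _ (onW_bij _ (@enum_val_bij I))) /=.
apply: eq_bigr => i _; rewrite ffunE enum_valK rmorphM /= mulrA !mxE enum_rankK; congr (_ * _).
by have := congr1 (fun N : 'rV[rat]_#|I| => N 0 i) wx; rewrite !mxE.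
Qed.

Lemma exists_nonroot_nat (P : {poly int}) : P != 0 -> exists t : nat, P.[t%:Z] != 0.
Proof.
move=> P0; pose s := [seq t%:Z | t <- iota 0 (size P)].
have us : uniq s by rewrite map_inj_uniq ?iota_uniq// => a b [].
have [/allP al|] := boolP (all (root P) s).
  have := max_poly_roots P0 (introT allP al) us.
  by rewrite size_map size_iota ltnn.
by case/allPn => _ /mapP[t _ ->] ?; exists t.
Qed.

(** * Homogeneous relations between polynomials in few variables *)

Module Dependence.
Import mpoly.

Section Dep.
Variables (Phi : finType) (v rho : nat) (rv : (rho < v)%N).
Variable w : Phi -> 'I_v.+1 -> {mpoly int[rho]}.

Lemma msize_prod_le (I : Type) (s : seq I) (F : I -> {mpoly int[rho]}) (k : nat) (d : I -> nat) :
  (forall i, msize (F i) <= (d i * k).+1)%N ->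
  (msize (\prod_(i <- s) F i) <= ((\sum_(i <- s) d i) * k).+1)%N.
Proof.
move=> H; elim: s => [|i s IH]; first by rewrite !big_nil msize1.
rewrite !big_cons mulnDl; have := H i.
have [->|Fi0] := eqVneq (F i) 0; first by rewrite mul0r msize0.
have [->|Fs0] := eqVneq (\prod_(j <- s) F j) 0; first by rewrite mulr0 msize0.
rewrite msizeM //; move: IH; set a := msize _; set b := msize _; lia.
Qed.

Lemma msize_exp_le (p : {mpoly int[rho]}) k e : (msize p <= k.+1)%N ->
  (msize (p ^+ e) <= (e * k).+1)%N.
Proof.
move=> H; have := @msize_prod_le 'I_e (index_enum _) (fun=> p) k (fun=> 1%N).
by rewrite prodr_const card_ord sum1_card card_ord; apply=> i; rewrite mul1n.
Qed.

(** A count of unknowns and equations: there are [(D + 1) ^ v] monomials of degree [v * D] to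
    combine, and the degree of their values grows linearly in [D], but in only [rho < v] variables.
    Homogeneity lets the relation survive a common factor of all coordinates, later the leading
    coefficient. One relation serves the whole finite family [Phi], and [ord_max] is normalised in
    [u] so that the projection along [u] is integral. *)
Lemma exists_relation : exists m (c : form v.+1 m) (u : 'I_v.+1 -> int),
  [/\ u ord_max = 1, form_eval c u != 0 & forall phi, form_eval c (w phi) = 0].
Proof.
pose k := (\max_phi \max_i msize (w phi i))%N.
(* With this [D] there are at most [D * (D + 1) ^ rho] equations, fewer than the [(D + 1) ^ v]
   unknowns. *)
have [D eD] : exists D, D = (#|Phi| * (v * k).+1 ^ rho)%N by eexists.
have [m em] : exists m, m = (v * D)%N by eexists.
pose E := {ffun 'I_v -> 'I_D.+1}.
have sE (e : E) : (\sum_i e i <= m)%N.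
  rewrite em -[X in (X * _)%N](card_ord v) -sum_nat_const leq_sum// => i _.
  by rewrite -ltnS.
(* The last exponent fills the degree up to [m], so setting the last variable to 1 keeps the
   monomials distinct. *)
pose full (e : E) : {ffun 'I_v.+1 -> 'I_m.+1} := [ffun i =>
  if unlift ord_max i is Some j then inord (e j) else inord (m - \sum_i e i)].
have fullE e : (forall j, full e (lift ord_max j) = e j :> nat) /\
    full e ord_max = (m - \sum_i e i)%N :> nat.
  split=> [j|]; rewrite ffunE; last by rewrite unlift_none inordK// ltnS leq_subr.
  have h : (e j < m.+1)%N by rewrite ltnS (leq_trans _ (sE e))// (bigD1 j)//= leq_addr.
  rewrite liftK.
  rewrite inordK.
  by [].
  exact: h.
have fullS e : (\sum_i full e i = m)%N.
  have [f1 f2] := fullE e; rewrite (bigD1_ord ord_max)//= f2.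
  have -> : (\sum_(i < v) full e (lift ord_max i) = \sum_i e i)%N.
    by apply: eq_bigr => i _; exact: (f1 i).
  exact: subnK.
have full_inj : injective full.
  move=> e e' ee; apply/ffunP => j; apply/val_inj.
  by rewrite /= -(fullE e).1 ee (fullE e').1.
pose B := (m * k).+1%N.
pose J := {ffun 'I_rho -> 'I_B}.
pose mon (j : J) : 'X_{1..rho} := [multinom (j i : nat) | i < rho].
pose W phi (e : E) := \prod_i w phi i ^+ full e i.
have sW phi e : (msize (W phi e) <= B)%N.
  apply: leq_trans (@msize_prod_le _ _ _ k (fun i => full e i : nat) _) _.
    move=> i; apply: msize_exp_le; apply: leqW.
    apply: leq_trans (leq_bigmax phi); exact: (leq_bigmax i).
  by rewrite fullS.
have cardJE : (#|{: Phi * J}| < #|E|)%N.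
  rewrite card_prod !card_ffun !card_ord /B.
  apply: (@leq_ltn_trans (#|Phi| * ((v * k).+1 * D.+1) ^ rho)).
    rewrite leq_mul2l; apply/orP; right.
    case: (posnP rho) => [->|r0]; first by rewrite !expn0.
    by rewrite leq_exp2r// em; nia.
  rewrite expnMn mulnA -eD; apply: leq_trans (_ : D.+1 * D.+1 ^ rho <= _)%N.
    by rewrite ltn_pmul2r ?expn_gt0.
  by rewrite -expnS leq_pexp2l.
have [c [c0 cA]] := short_kernel_vector (fun e (j : Phi * J) => (W j.1 e)@_(mon j.2)) cardJE.
exists m, [ffun f => \sum_(e | full e == f) c e].
have formE (R : comNzRingType) (y : 'I_v.+1 -> R) :
   form_eval [ffun f => \sum_(e | full e == f) c e] y =
   \sum_e (c e)%:~R * \prod_i y i ^+ full e i.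
  rewrite /form_eval [RHS](partition_big full (fun f => \sum_i f i == m)%N) /=; last first.
    by move=> e _; apply/eqP.
  apply: eq_bigr => f _; rewrite ffunE rmorph_sum /= mulr_suml.
  by apply: eq_bigr => e /eqP ->.
(* Kronecker substitution: exponents are read in base [D + 1], so distinct monomials cannot cancel,
   and a value [t] with [P.[t]] non-zero yields the direction [u]. *)
pose P : {poly int} := \sum_e (c e)%:P * 'X^(\sum_i e i * D.+1 ^ i).
have P0 : P != 0.
  apply: contra c0 => /eqP P0; apply/eqP/ffunP => e; rewrite ffunE.
  have := congr1 (fun Q : {poly int} => Q`_(\sum_i e i * D.+1 ^ i)) P0.
  rewrite coef0 coef_sum (bigD1 e) //= coefCM coefXn eqxx mulr1 big1 ?addr0//.
  move=> e' e'e; rewrite coefCM coefXn; case: eqP => [h|]; last by rewrite mulr0.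
  by move: e'e; rewrite (_ : e' = e) ?eqxx//; apply/ffunP/digits_inj.
have [t Pt] := exists_nonroot_nat P0.
exists (fun i => if unlift ord_max i is Some j then t%:Z ^+ (D.+1 ^ j) else 1).
split; first by rewrite unlift_none.
  rewrite formE; move: Pt; rewrite horner_sum; congr (_ != _).
  apply: eq_bigr => e _; rewrite hornerCM hornerXn intz; congr (_ * _).
  rewrite (bigD1_ord ord_max)//= unlift_none expr1n mul1r.
  rewrite -prodrXr; apply: eq_bigr => j _; rewrite liftK (fullE e).1 -exprM mulnC.
  by [].
move=> phi; rewrite formE; apply/mpolyP => mm; rewrite mcoeff0.
have Wcoef e : ((c e)%:~R * W phi e)@_mm = c e * (W phi e)@_mm.
  by rewrite mulrzl raddfMz -mulrzl intz.
rewrite raddf_sum /=; under eq_bigr => e _ do rewrite -/(W phi e) Wcoef.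
have [lt|ge] := ltnP (mdeg mm) B; last first.
  apply: big1 => e _; rewrite [X in _ * X](_ : _ = 0) ?mulr0//; apply/eqP.
  by rewrite mcoeff_eq0 msize_mdeg_ge// (leq_trans (sW phi e)).
have mi i : (mm i < B)%N.
  apply: leq_ltn_trans lt; rewrite mdegE (bigD1 i)//=; exact: leq_addr.
have -> : mm = mon [ffun i => inord (mm i)]; last by rewrite -[RHS](cA (phi, [ffun i => inord (mm i)])).
by apply/mnmP => i; rewrite mnmE ffunE inordK//; exact: mi.
Qed.

End Dep.
End Dependence.

(** * Points on a flag of forms *)

Lemma size_le_fibers (A B : eqType) (g : A -> B) (s : seq A) (k : nat) :
  (forall b, b \in map g s -> (size [seq a <- s | g a == b] <= k)%N) ->
  (size s <= k * size (undup (map g s)))%N.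
Proof.
move=> H.
have -> : size s = (\sum_(b <- undup (map g s)) size [seq a <- s | g a == b])%N.
  under eq_bigr do rewrite size_filter -sum1_count.
  under eq_bigr do rewrite big_mkcond.
  rewrite exchange_big /= -sum1_size; apply: eq_big_seq => a sa.
  rewrite (bigD1_seq (g a)) ?undup_uniq ?mem_undup ?map_f//= eqxx big1 ?addn0// => b ba.
  by rewrite eq_sym (negPf ba).
rewrite mulnC -[X in (X * _)%N]sum1_size big_distrl /= !big_seq.
by apply: leq_sum => b; rewrite mem_undup mul1n => /H.
Qed.

Lemma size_le_cover (A B : eqType) (Rl : A -> B -> bool) (s : seq A) (D : seq B) (k : nat) :
  (forall a, a \in s -> has (Rl a) D) ->
  (forall b, b \in D -> (size [seq a <- s | Rl a b] <= k)%N) ->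
  (size s <= k * size D)%N.
Proof.
move=> H1 H2; apply: (@leq_trans (\sum_(b <- D) size [seq a <- s | Rl a b])); last first.
  rewrite mulnC -[X in (X * _)%N]sum1_size big_distrl /= !big_seq.
  by apply: leq_sum => b /H2; rewrite mul1n.
under eq_bigr do rewrite size_filter -sum1_count big_mkcond.
rewrite exchange_big /= -sum1_size !big_seq; apply: leq_sum => a /H1.
by rewrite -big_mkcond sum1_count -has_count.
Qed.

Definition ffun_bounded (m : nat) (Z : nat) (s : seq {ffun 'I_m -> int}) :=
  forall y, y \in s -> forall i, (`|y i| <= Z)%N.

Lemma size_bounded_ffun (m Z : nat) (s : seq {ffun 'I_m -> int}) :
  uniq s -> ffun_bounded Z s -> (size s <= (2 * Z + 1) ^ m)%N.
Proof.
move=> us bs; pose g (y : {ffun 'I_m -> int}) : {ffun 'I_m -> 'I_(2 * Z).+1} :=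
  [ffun i => inord (absz (y i + Z%:Z)%R)].
have ginj : {in s &, injective g}.
  move=> y z ys zs /ffunP gyz; apply/ffunP => i; have := gyz i; rewrite !ffunE.
  move/(congr1 val); have := bs _ ys i; have := bs _ zs i => h1 h2.
  by move: (y i) (z i) h1 h2 => a b h1 h2 /=; rewrite !inordK; lia.
rewrite -(size_map g) addn1 -[X in (_ <= X ^ _)%N]card_ord -[m in (_ ^ m)%N]card_ord.
rewrite -card_ffun -(card_uniqP _) ?max_card//.
by rewrite map_inj_in_uniq.
Qed.

Lemma intr_Fp_eq0 (p : nat) (x : int) : prime p -> ((x%:~R : 'F_p) == 0) = (p %| x)%Z.
Proof.
move=> pp; have H (k : nat) : ((k%:R : 'F_p) == 0) = (p %| k)%N.
  by rewrite -(dvdn_pcharf (pchar_Fp pp)).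
by case: x => k; rewrite ?NegzE ?rmorphN ?oppr_eq0 -?pmulrn H /dvdz /= ?abszN.
Qed.

Lemma intr_Fp_eq (p : nat) (x y : int) :
  prime p -> ((x%:~R : 'F_p) == y%:~R) = (p %| x - y)%Z.
Proof. by move=> pp; rewrite -subr_eq0 -rmorphB intr_Fp_eq0. Qed.

Lemma size_congruent (D Z : nat) (ts : seq int) : (0 < D)%N -> uniq ts ->
  (forall t, t \in ts -> (`|t| <= Z)%N) ->
  (forall t t', t \in ts -> t' \in ts -> (D %| t - t')%Z) ->
  (size ts <= (2 * Z) %/ D + 1)%N.
Proof.
move=> D0 us bs cs; pose g (t : int) := (absz (t + Z%:Z)%R %/ D)%N.
rewrite -(size_map g) addn1 -(size_iota 0 ((2 * Z) %/ D).+1); apply: uniq_leq_size.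
  rewrite map_inj_in_uniq// => t t' ts1 ts2.
  have := bs _ ts1; have := bs _ ts2; have /dvdzP[k E] := cs _ _ ts1 ts2 => h1 h2.
  wlog tt : t t' k ts1 ts2 h1 h2 E / t' <= t => [W gt|gt].
    have [/(W t t' k)|] := boolP (t' <= t); first by apply.
    rewrite -ltNge => /ltW /(W t' t (- k)) H; apply/esym/H => //.
    by rewrite mulNr -E opprB.
  apply/eqP; rewrite -subr_eq0 E mulf_eq0; apply/orP; left.
  case: k E => [[|k]|k] E //; last by move: E; rewrite NegzE; nia.
  have e : (absz (t + Z%:Z)%R = k.+1 * D + absz (t' + Z%:Z)%R)%N by lia.
  by move: gt; rewrite /g e divnMDl//; lia.
move=> _ /mapP[t ts1 ->]; rewrite mem_iota /= add0n ltnS leq_div2r//.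
by have := bs _ ts1; lia.
Qed.

(** Induction on the primes: each leaves at most [m] residue classes, and inside a class the common
    modulus [D] of the differences is multiplied by it. Coprimality of the primes with [D] plays the
    part of the Chinese remainder theorem. *)
Lemma size_roots_mod (P : {poly int}) (m Z D : nat) (ps : seq nat) (ts : seq int) :
  (size P <= m.+1)%N -> uniq ps ->
  (forall p, p \in ps -> [/\ prime p, coprime p D & ~~ (p %| P`_m)%Z]) ->
  (0 < D)%N -> uniq ts -> (forall t, t \in ts -> (`|t| <= Z)%N) ->
  (forall t t', t \in ts -> t' \in ts -> (D %| t - t')%Z) ->
  (forall t p, t \in ts -> p \in ps -> (p %| P.[t])%Z) ->
  (size ts <= m ^ size ps * ((2 * Z) %/ (D * \prod_(p <- ps) p) + 1))%N.
Proof.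
move=> sP; elim: ps D ts => [|p ps IH] D ts /=.
  by move=> _ _ D0 us bs cs _; rewrite big_nil muln1 expn0 mul1n; exact: size_congruent.
case/andP=> pps ups hps D0 us bs cs rs.
have [pp pD pP] := hps p (mem_head _ _).
pose g (t : int) := (t%:~R : 'F_p).
have h1 : (size (undup (map g ts)) <= m)%N.
  pose Q := map_poly (intr : int -> 'F_p) P.
  have Q0 : Q != 0.
    apply/eqP => /polyP/(_ m); rewrite coef_map coef0 /= => /eqP.
    by rewrite intr_Fp_eq0// (negPf pP).
  have sQ : (size Q <= size P)%N := size_poly _ _.
  rewrite -ltnS; apply: leq_trans (leq_trans sQ sP).
  apply: (max_poly_roots Q0 _ (undup_uniq _)).
  apply/allP => x; rewrite mem_undup => /mapP[t tts ->].
  by rewrite /root horner_map /= intr_Fp_eq0// rs// mem_head.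
rewrite big_cons mulnCA expnS.
apply: leq_trans (@size_le_fibers _ _ g ts
  (m ^ size ps * ((2 * Z) %/ (p * (D * \prod_(q <- ps) q)) + 1))%N _) _; last first.
  by rewrite mulnC -mulnA leq_mul2r h1 orbT.
move=> b _; rewrite mulnA; apply: IH => //.
- move=> q qps; have [|qp qD qP] := hps q; first by rewrite inE qps orbT.
  split=> //; rewrite coprimeMr qD andbT prime_coprime// dvdn_prime2//.
  by apply: contra pps => /eqP <-.
- by rewrite muln_gt0 prime_gt0.
- by rewrite filter_uniq.
- by move=> t; rewrite mem_filter => /andP[_ /bs].
- move=> t t'; rewrite !mem_filter => /andP[/eqP e1 t1] /andP[/eqP e2 t2].
  rewrite PoszM Gauss_dvdz ?cs//.
  by rewrite andbT -intr_Fp_eq// -/(g t) -/(g t') e1 e2.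
- move=> t q; rewrite mem_filter => /andP[_ tt] qps.
  by apply: rs => //; rewrite inE qps orbT.
Qed.

(** The projection along [u], when the last coordinate of [u] is 1. Its fibres are the lines in
    direction [u], parametrised by the last coordinate ([shearK]). *)
Definition shear (m : nat) (u : 'I_m.+1 -> int) (y : {ffun 'I_m.+1 -> int}) :
    {ffun 'I_m -> int} :=
  [ffun i => y (widen_ord (leqnSn m) i) - u (widen_ord (leqnSn m) i) * y ord_max].

Definition extend0 (m : nat) (z : {ffun 'I_m -> int}) (i : 'I_m.+1) : int :=
  if insub (i : nat) is Some j then z j else 0.

Lemma shearK (m : nat) (u : 'I_m.+1 -> int) (y : {ffun 'I_m.+1 -> int}) :
  u ord_max = 1 -> forall i, y i = extend0 (shear u y) i + u i * y ord_max.
Proof.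
move=> u1 i; rewrite /extend0; case: insubP => [j _ ji|]; last first.
  rewrite -leqNgt => mi; rewrite add0r.
  have -> : i = ord_max by apply/val_inj/eqP; rewrite eqn_leq mi /= -ltnS ltn_ord.
  by rewrite u1 mul1r.
have -> : i = widen_ord (leqnSn m) j by exact/val_inj.
by rewrite ffunE subrK.
Qed.

Lemma shear_bounded m (u : 'I_m.+1 -> int) (s : seq {ffun 'I_m.+1 -> int}) (Z : nat) :
  ffun_bounded Z s -> ffun_bounded (Z * (\max_i `|u i|).+1) (map (shear u) s).
Proof.
move=> bs _ /mapP[y ys ->] i; rewrite ffunE.
have h1 := bs _ ys (widen_ord (leqnSn m) i); have h2 := bs _ ys ord_max.
have h3 := @leq_bigmax _ (fun i => `|u i|%N) (widen_ord (leqnSn m) i).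
move: h3 h1 h2; set a := y _; set b := y _; set c := u _; set M := (\max__ _)%N.
move=> h3 h1 h2; apply: (@leq_trans (`|a| + `|c| * `|b|)); last by nia.
by rewrite -abszM; lia.
Qed.

Lemma ffun_bounded_undup m Z (s : seq {ffun 'I_m -> int}) :
  ffun_bounded Z s -> ffun_bounded Z (undup s).
Proof. by move=> bs y; rewrite mem_undup => /bs. Qed.

Section OneLevel.
Variables (m d : nat) (Q : form m.+1 d) (u : 'I_m.+1 -> int).
Hypotheses (u1 : u ord_max = 1) (Qu : form_eval Q u != 0).
Variables (s : seq {ffun 'I_m.+1 -> int}) (z : {ffun 'I_m -> int}).
Hypotheses (us : uniq s) (sz : forall y, y \in s -> shear u y = z).

Let lasts := [seq y ord_max | y : {ffun 'I_m.+1 -> int} <- s].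
Let P := form_line Q (extend0 z) u.

Lemma fiber_lasts_uniq : uniq lasts.
Proof.
rewrite map_inj_in_uniq// => y y' ys ys' e; apply/ffunP => i.
by rewrite (shearK y u1) (shearK y' u1) (sz ys) (sz ys') e.
Qed.

Lemma fiber_horner y : y \in s -> P.[y ord_max] = form_eval Q y.
Proof.
by move=> ys; rewrite form_line_horner; apply: eq_form_eval => i; rewrite [RHS](shearK y u1) (sz ys).
Qed.

Lemma size_fiber_zero : (forall y, y \in s -> form_eval Q y = 0) -> (size s <= d)%N.
Proof.
move=> H; have [sP cP] := form_line_size Q (extend0 z) u.
have P0 : P != 0 by apply: contra Qu => /eqP e; rewrite -cP -/P e coef0.
rewrite -(size_map (fun y : {ffun 'I_m.+1 -> int} => y ord_max)) -ltnS.
apply: leq_trans sP; apply: max_poly_roots P0 _ fiber_lasts_uniq.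
by apply/allP => _ /mapP[y ys ->]; rewrite /root fiber_horner// H.
Qed.

Lemma size_fiber_mod (Z : nat) (ps : seq nat) :
  uniq ps -> (forall p, p \in ps -> prime p /\ ~~ (p %| form_eval Q u)%Z) ->
  ffun_bounded Z s -> (forall y p, y \in s -> p \in ps -> (p %| form_eval Q y)%Z) ->
  (size s <= d ^ size ps * ((2 * Z) %/ (\prod_(p <- ps) p) + 1))%N.
Proof.
move=> ups hps bs H; have [sP cP] := form_line_size Q (extend0 z) u.
rewrite -(size_map (fun y : {ffun 'I_m.+1 -> int} => y ord_max)) -[X in (_ %/ X)%N]mul1n.
apply: (size_roots_mod sP) => //.
- by move=> p /hps[pp pQ]; rewrite coprimen1 -/P cP.
- exact: fiber_lasts_uniq.
- by move=> _ /mapP[y ys ->]; exact: bs.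
- by move=> _ p /mapP[y ys ->] pp; rewrite fiber_horner// H.
Qed.

End OneLevel.

(** The constant is absorbed crudely by [2 ^ K > K]; what matters is that the bound [m + K] does not
    depend on [Z]. *)
Lemma size_prime_divisors (a : int) (Z K m : nat) (ps : seq nat) :
  a != 0 -> (`|a| <= K * Z ^ m)%N -> (0 < Z)%N -> uniq ps ->
  (forall p, p \in ps -> [/\ prime p, (Z < p)%N & (p %| a)%Z]) -> (size ps <= m + K)%N.
Proof.
move=> a0 aK Z0 ups hps; rewrite leqNgt; apply/negP => lt.
have dv : (\prod_(p <- ps) p %| `|a|)%N.
  elim: ps ups hps {lt} => [|p ps IH] /=; first by rewrite big_nil dvd1n.
  case/andP=> pps ups hps; have [pp _ pa] := hps p (mem_head _ _).
  rewrite big_cons Gauss_dvd; first by rewrite [(p %| _)%N]pa IH// => q qps; apply: hps; rewrite inE qps orbT.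
  rewrite big_seq; apply: (big_ind (coprime p)) => [|x y|q qps]; rewrite ?coprimen1//.
    by rewrite coprimeMr => -> ->.
  rewrite prime_coprime//; apply/negP; have [|qp _ _] := hps q; first by rewrite inE qps orbT.
  by rewrite dvdn_prime2// => /eqP pq; rewrite pq qps in pps.
have : (Z.+1 ^ size ps <= \prod_(p <- ps) p)%N.
  elim: ps {ups dv lt} hps => [|p ps IH] hps; first by rewrite big_nil.
  rewrite big_cons expnS leq_mul ?IH//; last by move=> q qps; apply: hps; rewrite inE qps orbT.
  by have [] := hps p (mem_head _ _).
move=> /leq_trans/(_ (dvdn_leq _ dv)); rewrite absz_gt0 a0 => /(_ isT)/leq_trans/(_ aK).
rewrite leqNgt => /negP; apply.
apply: (@leq_trans (Z.+1 ^ (m + K))); last by rewrite leq_pexp2l// ltnW.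
rewrite addnC expnD; apply: (@leq_ltn_trans (K * Z.+1 ^ m)).
  by rewrite leq_mul2l; case: (m) => [|m']; rewrite ?expn0 ?leq_exp2r ?leqnSn ?orbT.
rewrite ltn_pmul2r ?expn_gt0//; apply: leq_trans (ltn_expl K (ltnSn 1)) _.
by case: K {aK lt} => // K; rewrite leq_exp2r.
Qed.

(** * Sieving with three forms on successive projections *)

Section Flag.
Variables (k d1 d2 d3 : nat) (Q1 : form k.+2 d1) (Q2 : form k.+3 d2) (Q3 : form k.+4 d3).
Variables (u1 : 'I_k.+2 -> int) (u2 : 'I_k.+3 -> int) (u3 : 'I_k.+4 -> int).
Hypotheses (u1E : u1 ord_max = 1) (u2E : u2 ord_max = 1) (u3E : u3 ord_max = 1).
Hypotheses (Qu1 : form_eval Q1 u1 != 0) (Qu2 : form_eval Q2 u2 != 0)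
  (Qu3 : form_eval Q3 u3 != 0).

Definition flag_bad (p : nat) (y : {ffun 'I_k.+4 -> int}) :=
  [&& (p %| form_eval Q3 y)%Z, (p %| form_eval Q2 (shear u3 y))%Z
    & (p %| form_eval Q1 (shear u2 (shear u3 y)))%Z].

Let E : nat := absz (form_eval Q1 u1 * form_eval Q2 u2 * form_eval Q3 u3).

Lemma flag_lead_ndvd p : prime p -> (E < p)%N ->
  [/\ ~~ (p %| form_eval Q1 u1)%Z, ~~ (p %| form_eval Q2 u2)%Z & ~~ (p %| form_eval Q3 u3)%Z].
Proof.
move=> pp Ep.
have : ~~ (p %| E)%N.
  by apply/negP => /dvdn_leq; rewrite absz_gt0 !mulf_neq0// => /(_ isT); rewrite leqNgt Ep.
by rewrite /E !abszM !Euclid_dvdM// !negb_or => /andP[/andP[? ?] ?].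
Qed.

Let V := ((\max_i `|u3 i|).+1 * (\max_i `|u2 i|).+1 * (\max_i `|u1 i|).+1)%N.

Lemma ffun_bounded_le m Z Z' (s : seq {ffun 'I_m -> int}) :
  (Z <= Z')%N -> ffun_bounded Z s -> ffun_bounded Z' s.
Proof. by move=> ZZ bs y ys i; apply: leq_trans (bs y ys i) ZZ. Qed.

Lemma flag_bounds (s : seq {ffun 'I_k.+4 -> int}) Z : ffun_bounded Z s ->
  [/\ ffun_bounded (Z * V) s, ffun_bounded (Z * V) (map (shear u3) s),
   ffun_bounded (Z * V) (map (shear u2) (map (shear u3) s)) &
   ffun_bounded (Z * V) (map (shear u1) (map (shear u2) (map (shear u3) s)))].
Proof.
move=> b0; have b1 := @shear_bounded _ u3 _ _ b0.
have b2 := @shear_bounded _ u2 _ _ b1; have b3 := @shear_bounded _ u1 _ _ b2.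
split; [apply: ffun_bounded_le b0|apply: ffun_bounded_le b1|
  apply: ffun_bounded_le b2|apply: ffun_bounded_le b3]; rewrite /V ?mulnA ?leq_pmulr//.
  by rewrite -!mulnA leq_pmulr.
by rewrite -[X in (_ <= X)%N]mulnA leq_pmulr.
Qed.

Lemma filter_fiber_bounded m Z (s : seq {ffun 'I_m -> int}) a :
  ffun_bounded Z s -> ffun_bounded Z (filter a s).
Proof. by move=> bs y; rewrite mem_filter => /andP[_ /bs]. Qed.

Lemma undup_map_undup (A B : eqType) (g : A -> B) (s : seq A) :
  size (undup (map g s)) = size (undup (map g (undup s))).
Proof.
apply/eqP; rewrite eqn_leq; apply/andP; split; apply: uniq_leq_size; rewrite ?undup_uniq//;
  by move=> b; rewrite !mem_undup => /mapP[a]; rewrite ?mem_undup => sa ->; rewrite map_f ?mem_undup.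
Qed.

(** Along each of the three projections the fibre is a line on which the form has bounded degree, so
    every form saves about the full product of [ps]; only [k + 1] coordinates remain free. *)
Lemma flag_count_mod (s : seq {ffun 'I_k.+4 -> int}) (Z : nat) (ps : seq nat) :
  uniq s -> ffun_bounded Z s -> uniq ps ->
  (forall p, p \in ps -> prime p /\ (E < p)%N) ->
  (forall y p, y \in s -> p \in ps -> flag_bad p y) ->
  (size s <= ((d1 * d2 * d3) ^ size ps * ((2 * (Z * V)) %/ (\prod_(p <- ps) p) + 1) ^ 3) *
     (2 * (Z * V) + 1) ^ k.+1)%N.
Proof.
move=> us bs ups hps H.
have [b0 b1 b2 b3] := flag_bounds bs.
set T := ((2 * (Z * V)) %/ _ + 1)%N.
pose s2 := undup (map (shear u3) s); pose s1 := undup (map (shear u2) s2).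
pose s0 := undup (map (shear u1) s1).
have e1 : s2 =i map (shear u3) s by move=> y; rewrite mem_undup.
have e2 : s1 =i map (shear u2) (map (shear u3) s).
  move=> y; rewrite mem_undup; apply/mapP/mapP => -[x xs ->]; exists x => //.
    by rewrite -e1.
  by rewrite e1.
have e3 : s0 =i map (shear u1) (map (shear u2) (map (shear u3) s)).
  move=> y; rewrite mem_undup; apply/mapP/mapP => -[x xs ->]; exists x => //.
    by rewrite -e2.
  by rewrite e2.
have h3 : (size s <= d3 ^ size ps * T * size s2)%N.
  apply: size_le_fibers => z _.
  apply: (@size_fiber_mod _ _ Q3 _ u3E _ z (filter_uniq _ us)) => //.
  - by move=> y; rewrite mem_filter => /andP[/eqP].
  - by move=> p /hps[pp Ep]; have [] := flag_lead_ndvd pp Ep.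
  - exact: filter_fiber_bounded.
  - by move=> y p; rewrite mem_filter => /andP[_ ys] pps; have /and3P[] := H y p ys pps.
have h2 : (size s2 <= d2 ^ size ps * T * size s1)%N.
  apply: size_le_fibers => z _.
  apply: (@size_fiber_mod _ _ Q2 _ u2E _ z (filter_uniq _ (undup_uniq _))) => //.
  - by move=> y; rewrite mem_filter => /andP[/eqP].
  - by move=> p /hps[pp Ep]; have [] := flag_lead_ndvd pp Ep.
  - by apply: filter_fiber_bounded; exact: ffun_bounded_undup.
  - move=> y p; rewrite mem_filter e1 => /andP[_ /mapP[x xs ->]] pps.
    by have /and3P[] := H x p xs pps.
have h1 : (size s1 <= d1 ^ size ps * T * size s0)%N.
  apply: size_le_fibers => z _.
  apply: (@size_fiber_mod _ _ Q1 _ u1E _ z (filter_uniq _ (undup_uniq _))) => //.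
  - by move=> y; rewrite mem_filter => /andP[/eqP].
  - by move=> p /hps[pp Ep]; have [] := flag_lead_ndvd pp Ep.
  - by apply: filter_fiber_bounded => y; rewrite e2; exact: b2.
  - move=> y p; rewrite mem_filter e2 => /andP[_ /mapP[_ /mapP[x xs ->] ->]] pps.
    by have /and3P[] := H x p xs pps.
have h0 : (size s0 <= (2 * (Z * V) + 1) ^ k.+1)%N.
  by apply: size_bounded_ffun (undup_uniq _) _ => y; rewrite e3; exact: b3.
apply: leq_trans h3 _; rewrite !expnMn.
apply: (@leq_trans (d3 ^ size ps * T * (d2 ^ size ps * T * (d1 ^ size ps * T * (2 * (Z * V) + 1) ^ k.+1)))).
  rewrite leq_mul2l; apply/orP; right; apply: leq_trans h2 _.
  rewrite leq_mul2l; apply/orP; right; apply: leq_trans h1 _.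
  by rewrite leq_mul2l h0 orbT.
apply: eq_leq; ring.
Qed.

(* Either [Q1] does not vanish and determines the prime up to finitely many
   choices, or it vanishes and one variable is gained; the same alternative for
   [Q2] then pays for the second variable. *)
Lemma flag_count_large : exists K : nat,
  forall (s : seq {ffun 'I_k.+4 -> int}) (Z : nat), (0 < Z)%N ->
  uniq s -> ffun_bounded Z s ->
  (forall y, y \in s -> exists p, [/\ prime p, (Z < p)%N, (E < p)%N & flag_bad p y]) ->
  (size s <= K * Z ^ k.+2)%N.
Proof.
have [K1 HK1] := form_eval_bound Q1; have [K2 HK2] := form_eval_bound Q2.
pose R1 := (d1 + K1 * V ^ d1)%N; pose R2 := (d2 + K2 * V ^ d2)%N.
pose T := (2 * V + 1)%N; pose W := (2 * V + 1)%N.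
have V0 : (0 < V)%N by rewrite /V !muln_gt0.
pose A1 := (d3 * T * (d2 * T * R1))%N.
pose A2 := (d3 * T * R2 * (W * d1))%N.
pose A3 := (W * (d2 * d1))%N.
exists (A1 * W ^ k.+2 + A2 * W ^ k.+1 + A3 * W ^ k.+1)%N => s Z Z0 us bs H.
have ZW : (2 * (Z * V) + 1 <= W * Z)%N by rewrite /W; nia.
have TT p : (Z < p)%N -> ((2 * (Z * V)) %/ p + 1 <= T)%N.
  move=> Zp; rewrite /T leq_add2r.
  apply: (@leq_trans ((2 * V * p) %/ p)); last by rewrite mulnK ?(leq_ltn_trans _ Zp).
  by apply: leq_div2r; nia.
pose z2 y := shear u3 y; pose z1 y := shear u2 (z2 y).
pose a1 y := form_eval Q1 (z1 y); pose a2 y := form_eval Q2 (z2 y).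
pose good p := prime p && (Z < p)%N && (E < p)%N.
pose D (a : int) := [seq p <- primes `|a| | good p].
have Ds a m K : a != 0 -> (`|a| <= K * (Z * V) ^ m)%N -> (size (D a) <= m + K * V ^ m)%N.
  move=> a0 aK; apply: (@size_prime_divisors a Z) => //.
  - by rewrite -mulnA -expnMn [(V * Z)%N]mulnC.
  - by rewrite filter_uniq// primes_uniq.
  - move=> p; rewrite mem_filter => /andP[/andP[/andP[pp Zp] Ep]].
    by rewrite mem_primes => /and3P[_ _ pa].
have memD a p : a != 0 -> good p -> (p %| a)%Z -> p \in D a.
  move=> a0 gp pa; rewrite mem_filter gp mem_primes absz_gt0 a0; apply/and3P; split=> //.
  by case/andP: gp => /andP[].
have step3 p t z : good p -> uniq t -> ffun_bounded (Z * V) t ->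
    (forall y, y \in t -> z2 y = z /\ flag_bad p y) -> (size t <= d3 * T)%N.
  move=> /andP[/andP[pp Zp] Ep] ut bt ht.
  apply: leq_trans (@size_fiber_mod _ _ Q3 _ u3E t z ut _ (Z * V) [:: p] _ _ bt _) _ => //.
  - by move=> y /ht[].
  - by move=> q; rewrite inE => /eqP ->; split=> //; have [] := flag_lead_ndvd pp Ep.
  - by move=> y q /ht[_ /and3P[? _ _]]; rewrite inE => /eqP ->.
  by rewrite expn1 big_seq1 leq_mul2l TT ?orbT.
have bs0 : ffun_bounded (Z * V) s by have [] := flag_bounds bs.
have bs2 : ffun_bounded (Z * V) (map z2 s) by have [] := flag_bounds bs.
have bs1 : ffun_bounded (Z * V) (map z1 s).
  have [_ _ + _] := flag_bounds bs; rewrite -map_comp; exact.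
have sub2 a : ffun_bounded (Z * V) (map z2 (filter a s)).
  by move=> _ /mapP[y + ->]; rewrite mem_filter => /andP[_ ys]; apply/bs2/map_f.
have sub1 a : ffun_bounded (Z * V) (map z1 (filter a s)).
  by move=> _ /mapP[y + ->]; rewrite mem_filter => /andP[_ ys]; apply/bs1/map_f.
have goodH y : y \in s -> exists2 p, good p & flag_bad p y.
  by move=> /H[p [pp Zp Ep by_]]; exists p; rewrite /good ?pp ?Zp.
pose s1 := [seq y <- s | a1 y != 0].
pose s23 := [seq y <- s | a1 y == 0].
pose s2 := [seq y <- s23 | a2 y != 0].
pose s3 := [seq y <- s23 | a2 y == 0].
have szs : (size s = size s1 + (size s2 + size s3))%N.
  have F (t : seq {ffun 'I_k.+4 -> int}) (b : pred {ffun 'I_k.+4 -> int}) :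
      size t = (size [seq y <- t | ~~ b y] + size [seq y <- t | b y])%N.
    by rewrite !size_filter addnC count_predC.
  by rewrite (F s (fun y => a1 y == 0)) (F s23 (fun y => a2 y == 0)).
(* Here [Q1] does not vanish at the point projected twice. Its value has boundedly many prime
   factors above [Z], and for each of them the two coordinates to be restored take boundedly many
   values. *)
have C1 : (size s1 <= A1 * (W * Z) ^ k.+2)%N.
  have B : (size (undup (map z1 s1)) <= (W * Z) ^ k.+2)%N.
    apply: leq_trans (size_bounded_ffun (undup_uniq _) (ffun_bounded_undup (sub1 _))) _.
    by rewrite leq_exp2r.
  apply: (@leq_trans (A1 * size (undup (map z1 s1)))); last by rewrite leq_mul2l B orbT.
  apply: size_le_fibers => z /mapP[x]; rewrite mem_filter => /andP[x0 xs] zE.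
  have za : form_eval Q1 z != 0 by rewrite zE.
  apply: (@leq_trans ((d3 * T * (d2 * T)) * size (D (form_eval Q1 z)))).
    apply: (@size_le_cover _ _ (fun y p => good p && flag_bad p y)) => [y|p pD].
      rewrite mem_filter => /andP[/eqP e]; rewrite mem_filter => /andP[_ /goodH[p gp byp]].
      apply/hasP; exists p; rewrite ?gp//; apply: memD => //.
      by rewrite -e; case/and3P: byp.
    have gp : good p by move: pD; rewrite mem_filter => /andP[].
    set t := filter _ _.
    have tP y : y \in t -> [/\ y \in s, z1 y = z & flag_bad p y].
      by rewrite !mem_filter => /and4P[/andP[_ ?] /eqP ? _ ?].
    have ut : uniq t by rewrite !filter_uniq.
    have bt : ffun_bounded (Z * V) t by move=> y /tP[/bs0].
    apply: (@leq_trans (d3 * T * size (undup (map z2 t)))).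
      apply: size_le_fibers => z' _; apply: (step3 p _ z' gp (filter_uniq _ ut)).
        exact: filter_fiber_bounded.
      by move=> y; rewrite mem_filter => /andP[/eqP ? /tP[]].
    rewrite leq_mul2l; apply/orP; right.
    case/andP: (gp) => /andP[pp Zp] Ep.
    apply: leq_trans (@size_fiber_mod _ _ Q2 _ u2E _ z (undup_uniq _) _ (Z * V) [:: p] _ _ _ _) _ => //.
    - by move=> y'; rewrite mem_undup => /mapP[y /tP[_ ? _] ->].
    - by move=> q; rewrite inE => /eqP ->; split=> //; have [] := flag_lead_ndvd pp Ep.
    - by apply: ffun_bounded_undup => _ /mapP[y /tP[ys _ _] ->]; apply/bs2/map_f.
    - by move=> y' q; rewrite mem_undup inE => /mapP[y /tP[_ _ /and3P[_ ? _]] ->] /eqP ->.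
    by rewrite expn1 big_seq1 leq_mul2l TT ?orbT.
  rewrite -mulnA [X in (_ <= X)%N](_ : _ = d3 * T * (d2 * T * R1))%N//.
  rewrite -!mulnA !leq_mul2l (Ds _ d1 K1) ?orbT//.
  by apply: HK1 => i; rewrite zE; apply/bs1/map_f.
have Q1zero t : uniq t -> ffun_bounded (Z * V) t -> ffun_bounded (Z * V) (map (shear u1) t) ->
   (forall z, z \in t -> form_eval Q1 z = 0) -> (size t <= d1 * (W * Z) ^ k.+1)%N.
  move=> ut bt bt' t0; apply: (@leq_trans (d1 * size (undup (map (shear u1) t)))).
    apply: size_le_fibers => z _; apply: (@size_fiber_zero _ _ Q1 _ u1E Qu1 _ z (filter_uniq _ ut)).
      by move=> y; rewrite mem_filter => /andP[/eqP].
    by move=> y; rewrite mem_filter => /andP[_ /t0].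
  rewrite leq_mul2l; apply/orP; right.
  apply: leq_trans (size_bounded_ffun (undup_uniq _) (ffun_bounded_undup bt')) _.
  by rewrite leq_exp2r.
have s23E y : y \in s23 -> y \in s /\ a1 y = 0 by rewrite mem_filter => /andP[/eqP].
have N1 (t : seq {ffun 'I_k.+4 -> int}) : {subset t <= s23} ->
    (size (undup (map z1 t)) <= d1 * (W * Z) ^ k.+1)%N.
  move=> ts; apply: Q1zero (undup_uniq _) _ _ _.
  - by apply: ffun_bounded_undup => _ /mapP[y /ts/s23E[ys _] ->]; apply/bs1/map_f.
  - have [_ _ _ b] := flag_bounds bs => _ /mapP[z + ->]; rewrite mem_undup => /mapP[y /ts/s23E[ys _] ->].
    by apply: b; rewrite -!map_comp; apply/mapP; exists y.
  - by move=> z; rewrite mem_undup => /mapP[y /ts/s23E[_ y0] ->].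
have lastc (t : seq {ffun 'I_k.+3 -> int}) z : uniq t -> ffun_bounded (Z * V) t ->
    (forall y, y \in t -> shear u2 y = z) -> (size t <= W * Z)%N.
  move=> ut bt ht.
  have uL := fiber_lasts_uniq u2E ut ht.
  rewrite -(size_map (fun y : {ffun 'I_k.+3 -> int} => y ord_max)).
  apply: leq_trans (@size_congruent 1 (Z * V) _ _ uL _ _) _ => //.
  - by move=> _ /mapP[y yt ->]; exact: bt.
  - by rewrite divn1.
have lastc3 (t : seq {ffun 'I_k.+4 -> int}) z : uniq t -> ffun_bounded (Z * V) t ->
    (forall y, y \in t -> shear u3 y = z) -> (size t <= W * Z)%N.
  move=> ut bt ht.
  have uL := fiber_lasts_uniq u3E ut ht.
  rewrite -(size_map (fun y : {ffun 'I_k.+4 -> int} => y ord_max)).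
  apply: leq_trans (@size_congruent 1 (Z * V) _ _ uL _ _) _ => //.
  - by move=> _ /mapP[y yt ->]; exact: bt.
  - by rewrite divn1.
(* The vanishing of [Q1] saves a variable. The coordinate restored first is free; the prime is then
   among the boundedly many large divisors of the value of [Q2], and it confines the last
   coordinate. *)
have C2 : (size s2 <= A2 * (W * Z) ^ k.+1 * Z)%N.
  have s2P y : y \in s2 -> [/\ y \in s, y \in s23 & a2 y != 0].
    by rewrite mem_filter => /andP[? h]; have [] := s23E _ h.
  have us2 : uniq s2 by rewrite !filter_uniq.
  apply: (@leq_trans (d3 * T * R2 * size (undup (map z2 s2)))).
    apply: size_le_fibers => z /mapP[x /s2P[xs _ x0] zE].
    have za : form_eval Q2 z != 0 by rewrite zE.
    apply: (@leq_trans (d3 * T * size (D (form_eval Q2 z)))); last first.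
      rewrite leq_mul2l Ds ?orbT//; apply: HK2 => i; rewrite zE; exact/bs2/map_f.
    apply: (@size_le_cover _ _ (fun y p => good p && flag_bad p y)) => [y|p pD].
      rewrite mem_filter => /andP[/eqP e /s2P[/goodH[p gp byp] _ _]].
      apply/hasP; exists p; rewrite ?gp//; apply: memD => //.
      by rewrite -e; case/and3P: byp.
    have gp : good p by move: pD; rewrite mem_filter => /andP[].
    apply: (step3 p _ z gp); rewrite ?filter_uniq//.
      by do 2!apply: filter_fiber_bounded; move=> y /s2P[/bs0].
    by move=> y; rewrite !mem_filter => /andP[/andP[_ ?] /andP[/eqP]].
  have : (size (undup (map z2 s2)) <= W * Z * size (undup (map (shear u2) (undup (map z2 s2)))))%N.
    apply: size_le_fibers => z _; apply: (@lastc _ z) => [||y].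
    - by rewrite filter_uniq ?undup_uniq.
    - apply: filter_fiber_bounded; apply: ffun_bounded_undup => _ /mapP[y /s2P[ys _ _] ->].
      exact/bs2/map_f.
    - by rewrite mem_filter => /andP[/eqP].
  rewrite -undup_map_undup -map_comp => h2.
  have h1 := N1 s2 (fun y ys => let: And3 _ h _ := s2P y ys in h).
  apply: leq_trans (leq_mul (leqnn _) (leq_trans h2 (leq_mul (leqnn _) h1))) _.
  by apply: eq_leq; rewrite /A2; ring.
(* The vanishing of both [Q1] and [Q2] saves two variables, so the last coordinate may be left
   free. *)
have C3 : (size s3 <= A3 * (W * Z) ^ k.+1 * Z)%N.
  have s3P y : y \in s3 -> [/\ y \in s, y \in s23 & a2 y = 0].
    by rewrite mem_filter => /andP[/eqP ? h]; have [] := s23E _ h.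
  have us3 : uniq s3 by rewrite !filter_uniq.
  have h3 : (size s3 <= W * Z * size (undup (map z2 s3)))%N.
    apply: size_le_fibers => z _; apply: (@lastc3 _ z) => [||y].
    - by rewrite filter_uniq.
    - by apply: filter_fiber_bounded => y /s3P[/bs0].
    - by rewrite mem_filter => /andP[/eqP].
  have : (size (undup (map z2 s3)) <= d2 * size (undup (map (shear u2) (undup (map z2 s3)))))%N.
    apply: size_le_fibers => z _.
    apply: (@size_fiber_zero _ _ Q2 _ u2E Qu2 _ z); first by rewrite filter_uniq ?undup_uniq.
      by move=> y; rewrite mem_filter => /andP[/eqP].
    by move=> y; rewrite mem_filter mem_undup => /andP[_ /mapP[x /s3P[_ _ x0] ->]].
  rewrite -undup_map_undup -map_comp => h2.
  have h1 := N1 s3 (fun y ys => let: And3 _ h _ := s3P y ys in h).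
  apply: leq_trans h3 _.
  apply: leq_trans (leq_mul (leqnn _) (leq_trans h2 (leq_mul (leqnn _) h1))) _.
  by apply: eq_leq; rewrite /A3; ring.
rewrite szs; apply: leq_trans (leq_add C1 (leq_add C2 C3)) _.
by apply: eq_leq; rewrite !expnMn ![(Z ^ k.+2)%N]expnSr; ring.
Qed.

End Flag.

(** * Forms vanishing on polynomials with few distinct roots *)

(** Only integers are required to be related to themselves, because congruence modulo a prime ideal
    will relate integral elements only ([modP]). Divisibility of differences of integers is the
    other instance. *)
Record ring_congruence (R : comNzRingType) (E : R -> R -> Prop) : Prop := RingCongruence {
  congr_int : forall z : int, E z%:~R z%:~R;
  congr_add : forall x x' y y', E x x' -> E y y' -> E (x + y) (x' + y');
  congr_mul : forall x x' y y', E x x' -> E y y' -> E (x * y) (x' * y') }.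

Section Congruence.
Variables (R : comNzRingType) (E : R -> R -> Prop) (cE : ring_congruence E).

Lemma congr_sum (I : Type) (s : seq I) (Q : pred I) (F G : I -> R) :
  (forall i, Q i -> E (F i) (G i)) -> E (\sum_(i <- s | Q i) F i) (\sum_(i <- s | Q i) G i).
Proof.
move=> H; apply: (big_ind2 E) => //; first exact: (congr_int cE 0).
by move=> *; exact: (congr_add cE).
Qed.

Lemma congr_prod (I : Type) (s : seq I) (Q : pred I) (F G : I -> R) :
  (forall i, Q i -> E (F i) (G i)) -> E (\prod_(i <- s | Q i) F i) (\prod_(i <- s | Q i) G i).
Proof.
move=> H; apply: (big_ind2 E) => //; first exact: (congr_int cE 1).
by move=> *; exact: (congr_mul cE).
Qed.

Lemma congr_exp x y k : E x y -> E (x ^+ k) (y ^+ k).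
Proof.
move=> H; rewrite -[k]card_ord -!prodr_const; exact: congr_prod.
Qed.

Lemma form_eval_congr N m (c : form N m) (y z : 'I_N -> R) :
  (forall i, E (y i) (z i)) -> E (form_eval c y) (form_eval c z).
Proof.
move=> H; apply: congr_sum => e _; apply: (congr_mul cE); first exact: congr_int.
by apply: congr_prod => i _; apply: congr_exp.
Qed.

End Congruence.

Lemma form_eval_scale (R : comNzRingType) N m (c : form N m) (t : R) (y : 'I_N -> R) :
  form_eval c (fun i => t * y i) = t ^+ m * form_eval c y.
Proof.
rewrite mulr_sumr; apply: eq_bigr => e /eqP se; rewrite mulrCA; congr (_ * _).
under eq_bigr do rewrite exprMn.
by rewrite big_split /= prodrXr se.
Qed.

Definition shear_ring (R : comNzRingType) (m : nat) (u : 'I_m.+1 -> int) (y : 'I_m.+1 -> R) :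
  'I_m -> R :=
  fun i => y (widen_ord (leqnSn m) i) - (u (widen_ord (leqnSn m) i))%:~R * y ord_max.

Module RootLocus.
Import mpoly.

Definition generic_coef (k : nat) (phi : {ffun 'I_k.+3 -> 'I_k}) (i : 'I_k.+4) : {mpoly int[k]} :=
  (\prod_j ('X - (mpolyX int U_(phi j))%:P))`_i.

(** The map [phi] records which of the [k + 3] roots coincide. With a scalar and [k] roots there are
    [k + 1] parameters for [k + 4] coefficients, so a relation still exists after the number of
    coordinates has been lowered to [k + 2] by two projections. *)
Lemma exists_flag (k : nat) : exists d1 d2 d3
    (Q1 : form k.+2 d1) (Q2 : form k.+3 d2) (Q3 : form k.+4 d3)
    (u1 : 'I_k.+2 -> int) (u2 : 'I_k.+3 -> int) (u3 : 'I_k.+4 -> int),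
  [/\ u1 ord_max = 1, u2 ord_max = 1 & u3 ord_max = 1] /\
  [/\ form_eval Q1 u1 != 0, form_eval Q2 u2 != 0 & form_eval Q3 u3 != 0] /\
  forall (R : comNzRingType) (E : R -> R -> Prop) (a0 : R) (phi : {ffun 'I_k.+3 -> 'I_k})
    (gam : 'I_k -> R) (y : {ffun 'I_k.+4 -> int}), ring_congruence E ->
    (forall i : 'I_k.+4, E (y i)%:~R (a0 * (\prod_j ('X - (gam (phi j))%:P))`_i)) ->
    [/\ E (form_eval Q3 y)%:~R 0, E (form_eval Q2 (shear u3 y))%:~R 0
      & E (form_eval Q1 (shear u2 (shear u3 y)))%:~R 0].
Proof.
pose w3 := @generic_coef k.
have [d3 [Q3 [u3 [u3E Qu3 w3E]]]] := @Dependence.exists_relation _ k.+3 k (ltnW (ltnW (ltnSn _))) w3.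
pose w2 phi := shear_ring u3 (w3 phi).
have [d2 [Q2 [u2 [u2E Qu2 w2E]]]] := @Dependence.exists_relation _ k.+2 k (ltnW (ltnSn _)) w2.
pose w1 phi := shear_ring u2 (w2 phi).
have [d1 [Q1 [u1 [u1E Qu1 w1E]]]] := @Dependence.exists_relation _ k.+1 k (ltnSn _) w1.
exists d1, d2, d3, Q1, Q2, Q3, u1, u2, u3; do 2!split=> //.
move=> R E a0 phi gam y cE yE.
pose ev : {rmorphism {mpoly int[k]} -> R} := mmap (intr : int -> R) gam.
have evw i : ev (w3 phi i) = (\prod_j ('X - (gam (phi j))%:P))`_i.
  rewrite /w3 /generic_coef -coef_map rmorph_prod /=.
  suff -> : \prod_(j < k.+3) map_poly ev ('X - (mpolyX int U_(phi j))%:P) =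
    \prod_j ('X - (gam (phi j))%:P) by [].
  apply: eq_bigr => j _; rewrite rmorphB /= map_polyX map_polyC /= mmapX mmap1U.
  by [].
have relE N m (c : form N m) (w : 'I_N -> {mpoly int[k]}) (z : 'I_N -> int) :
    form_eval c w = 0 -> (forall i, E (z i)%:~R (a0 * ev (w i))) -> E (form_eval c z)%:~R 0.
  move=> c0 H; have := form_eval_congr cE c H; rewrite form_eval_scale.
  rewrite -(form_eval_rmorph ev) c0 rmorph0 mulr0.
  by rewrite -(form_eval_rmorph (intr : {rmorphism int -> R})).
have shE m (u : 'I_m.+1 -> int) (w : 'I_m.+1 -> {mpoly int[k]}) (z : {ffun 'I_m.+1 -> int}) :
    (forall i, E (z i)%:~R (a0 * ev (w i))) ->
    forall i, E (shear u z i)%:~R (a0 * ev (shear_ring u w i)).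
  move=> H i; rewrite ffunE /shear_ring [ev (_ - _)]rmorphB [ev (_ * _)]rmorphM.
  rewrite [ev _%:~R](rmorph_int ev) mulrBr intrB intrM.
  apply: (congr_add cE) (H _) _; rewrite mulrCA -[- (_ * (z _)%:~R)]mulN1r -[- (_ * (a0 * _))]mulN1r.
  apply: (congr_mul cE); first exact: (congr_int cE (-1)).
  by apply: (congr_mul cE) (H _); exact: congr_int.
have y3 i : E (y i)%:~R (a0 * ev (w3 phi i)) by rewrite evw.
split; first exact: relE (w3E phi) y3.
  exact: relE (w2E phi) (shE _ _ _ _ y3).
exact: relE (w1E phi) (shE _ _ _ _ (shE _ _ _ _ y3)).
Qed.

End RootLocus.

(** Hides the forms behind a predicate on a prime and a point. The four properties listed here are
    all that the counting of polynomials uses about them. *)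
Lemma flag_package (k : nat) :
  exists (bad : nat -> {ffun 'I_k.+4 -> int} -> bool) (E V D K : nat), (0 < V)%N /\ (0 < D)%N /\
  [/\ forall (R : comNzRingType) (Eq : R -> R -> Prop) (a0 : R) (phi : {ffun 'I_k.+3 -> 'I_k})
        (gam : 'I_k -> R) (p : nat) (y : {ffun 'I_k.+4 -> int}), ring_congruence Eq ->
        (forall z : int, Eq z%:~R 0 -> (p %| z)%Z) ->
        (forall i : 'I_k.+4, Eq (y i)%:~R (a0 * (\prod_j ('X - (gam (phi j))%:P))`_i)) -> bad p y,
      forall (p : nat) (y y' : {ffun 'I_k.+4 -> int}), (forall i, (p %| y i - y' i)%Z) -> bad p y -> bad p y',
      forall (s : seq {ffun 'I_k.+4 -> int}) (Z : nat) (ps : seq nat),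
        uniq s -> ffun_bounded Z s -> uniq ps ->
        (forall p, p \in ps -> prime p /\ (E < p)%N) ->
        (forall y p, y \in s -> p \in ps -> bad p y) ->
        (size s <= (D ^ size ps * ((2 * (Z * V)) %/ (\prod_(p <- ps) p) + 1) ^ 3) *
          (2 * (Z * V) + 1) ^ k.+1)%N
    & forall (s : seq {ffun 'I_k.+4 -> int}) (Z : nat), (0 < Z)%N ->
        uniq s -> ffun_bounded Z s ->
        (forall y, y \in s -> exists p, [/\ prime p, (Z < p)%N, (E < p)%N & bad p y]) ->
        (size s <= K * Z ^ k.+2)%N].
Proof.
have [d1 [d2 [d3 [Q1 [Q2 [Q3 [u1 [u2 [u3 [[u1E u2E u3E] [[Qu1 Qu2 Qu3] H]]]]]]]]]]] := RootLocus.exists_flag k.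
have [K HK] := flag_count_large u1E u2E u3E Qu1 Qu2 Qu3.
have M := flag_count_mod u1E u2E u3E Qu1 Qu2 Qu3.
exists (flag_bad Q1 Q2 Q3 u2 u3).
set E := absz _ in M HK; pose V := ((\max_i `|u3 i|).+1 * (\max_i `|u2 i|).+1 * (\max_i `|u1 i|).+1)%N.
exists E, (V.+1), ((d1 * d2 * d3).+1), K; split=> //; split=> //; split=> //.
- move=> R Eq a0 phi gam p y cE hp Hy; have [h3 h2 h1] := H _ _ _ _ _ _ cE Hy.
  by rewrite /flag_bad !hp.
- move=> p y y' hy.
  pose Eq (x z : int) := (p %| x - z)%Z.
  have cE : ring_congruence Eq.
    split=> [z|x x' t t' h1 h2|x x' t t' h1 h2]; rewrite /Eq ?subrr ?dvdz0//.
      by rewrite (_ : x + t - (x' + t') = (x - x') + (t - t')); [exact: (rpredD h1 h2)|ring].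
    have -> : x * t - x' * t' = (x - x') * t + x' * (t - t') by ring.
    by apply: rpredD; [exact: dvdz_mulr|exact: dvdz_mull].
  have sh (m : nat) (u : 'I_m.+1 -> int) (a b : {ffun 'I_m.+1 -> int}) :
      (forall i, Eq (a i) (b i)) -> forall i, Eq (shear u a i) (shear u b i).
    move=> ab i; rewrite !ffunE; have h1 := ab (widen_ord (leqnSn m) i); have h2 := ab ord_max.
    move: h1 h2; rewrite /Eq; move: (a _) (b _) (a _) (b _) (u _) => a1 b1 a2 b2 c h1 h2.
    have -> : a2 - c * a1 - (b2 - c * b1) = (a2 - b2) - c * (a1 - b1) by ring.
    by apply: rpredB => //; exact: dvdz_mull.
  have fe (N d : nat) (Q : form N d) (a b : {ffun 'I_N -> int}) : (forall i, Eq (a i) (b i)) ->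
      (p %| form_eval Q a)%Z -> (p %| form_eval Q b)%Z.
    move=> ab; have := form_eval_congr cE Q ab; rewrite /Eq => h1 h2.
    by rewrite (_ : form_eval Q b = form_eval Q a - (form_eval Q a - form_eval Q b)); [exact: rpredB|ring].
  rewrite /flag_bad => /and3P[b3 b2 b1].
  have hy2 := sh _ u3 _ _ hy; have hy3 := sh _ u2 _ _ hy2.
  by rewrite (fe _ _ _ _ _ hy b3) (fe _ _ _ _ _ hy2 b2) (fe _ _ _ _ _ hy3 b1).
- move=> s Z ps us bs ups hps Hs; apply: leq_trans (M s Z ps us bs ups hps Hs) _.
  have VV : (2 * (Z * V) <= 2 * (Z * V.+1))%N by rewrite !leq_mul2l leqnSn !orbT.
  apply: leq_mul; last by rewrite leq_exp2r// leq_add2r.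
  apply: leq_mul; last by rewrite leq_exp2r// leq_add2r leq_div2r.
  by case: (size ps) => // w; rewrite leq_exp2r.
Qed.

(** * Integral elements and primes above a rational prime *)

Definition intg (R : nzRingType) : R -> Prop := integralOver (intr : int -> R).

Lemma intgD (R : comNzRingType) (x y : R) : intg x -> intg y -> intg (x + y).
Proof. exact: (@integral_add _ _ (intr : {rmorphism int -> R})). Qed.
Lemma intgB (R : comNzRingType) (x y : R) : intg x -> intg y -> intg (x - y).
Proof. exact: (@integral_sub _ _ (intr : {rmorphism int -> R})). Qed.
Lemma intgM (R : comNzRingType) (x y : R) : intg x -> intg y -> intg (x * y).
Proof. exact: (@integral_mul _ _ (intr : {rmorphism int -> R})). Qed.
Lemma intgN (R : comNzRingType) (x : R) : intg x -> intg (- x).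
Proof. exact: (@integral_opp _ _ (intr : {rmorphism int -> R})). Qed.
Lemma intg_int (R : comNzRingType) (z : int) : intg (z%:~R : R).
Proof. exact: (@integral_id _ _ (intr : {rmorphism int -> R})). Qed.
Lemma intg_sum (R : comNzRingType) (I : Type) (s : seq I) (Q : pred I) (F : I -> R) :
  (forall i, Q i -> intg (F i)) -> intg (\sum_(i <- s | Q i) F i).
Proof. by move=> H; apply: big_ind => //; [exact: (intg_int _ 0)|exact: intgD]. Qed.
Lemma intg_prod (R : comNzRingType) (I : Type) (s : seq I) (Q : pred I) (F : I -> R) :
  (forall i, Q i -> intg (F i)) -> intg (\prod_(i <- s | Q i) F i).
Proof. by move=> H; apply: big_ind => //; [exact: (intg_int _ 1)|exact: intgM]. Qed.
Lemma intgX (R : comNzRingType) (x : R) k : intg x -> intg (x ^+ k).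
Proof. by move=> ix; rewrite -[k]card_ord -prodr_const; apply: intg_prod. Qed.

Lemma intg_rmorph (R S : comNzRingType) (phi : {rmorphism R -> S}) (x : R) :
  intg x -> intg (phi x).
Proof.
move=> [p pm rp]; exists p => //.
have -> : map_poly (intr : int -> S) p = map_poly phi (map_poly (intr : int -> R) p).
  by rewrite -map_poly_comp; apply: eq_map_poly => z /=; rewrite rmorph_int.
by rewrite rmorph_root.
Qed.

Lemma intg_algC (x : algC) : intg x <-> x \in Aint.
Proof.
split=> [[p pm rp]|xA].
  apply: (root_monic_Aint rp); first exact: monic_map.
  by apply/polyOverP => i; rewrite coef_map /= intr_int.
have [p [pE pm] _] := minCpolyP x.
have [q qE] : exists q, minCpoly x = map_poly (intr : int -> algC) q.
  by have [q] := floorpP xA; exists q.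
exists q; last by rewrite -qE root_minCpoly.
move: (minCpoly_monic x); rewrite qE !monicE lead_coef_map_inj//; last exact: intr_inj.
by move=> /eqP/(@intr_inj _ _ 1) ->.
Qed.

Lemma intg_rat (q : rat) : intg q -> exists z : int, q = z%:~R.
Proof.
move=> /(intg_rmorph (ratr : {rmorphism rat -> algC})) /intg_algC qA.
have : ratr q \is a @Num.int algC by apply: Cint_rat_Aint => //; exact: Crat_rat.
move=> /intrP[z qz]; exists z.
by apply: (fmorph_inj (ratr : {rmorphism rat -> algC})); rewrite /= qz rmorph_int.
Qed.

Lemma intg_base (L : fieldExtType rat) (x : L) :
  x \in 1%VS -> intg x -> exists z : int, x = z%:~R.
Proof.
case/vlineP => q -> [p pm rp]; have [|z ->] := @intg_rat q.
  exists p => //; rewrite -(fmorph_root (in_alg L)) -map_poly_comp /=.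
  by rewrite (eq_map_poly (g := intr))// => z; exact: (rmorph_int (in_alg L)).
by exists z; rewrite -[LHS]/(in_alg L _) rmorph_int.
Qed.

(** A prime ideal above [p] of the ring of integral elements, encoded as a predicate on the ambient
    ring. *)
Record prime_over (R : comNzRingType) (p : nat) (P : R -> Prop) : Prop := PrimeOver {
  prime_intg : forall x, P x -> intg x;
  primeD : forall x y, P x -> P y -> P (x + y);
  primeMl : forall a x, intg a -> P x -> P (a * x);
  prime_p : P p%:R;
  prime1 : ~ P 1;
  primeM : forall x y, intg x -> intg y -> P (x * y) -> P x \/ P y }.

Module MaximalIdeal.
Import classical_sets.

Lemma exists_prime_over (L : fieldExtType rat) (p : nat) :
  prime p -> exists P : L -> Prop, prime_over p P.
Proof.
move=> pp; pose ideal (P : set L) := [/\ forall x, P x -> intg x,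
  forall x y, P x -> P y -> P (x + y), forall a x, intg a -> P x -> P (a * x) & ~ P 1].
pose pI (x : L) := exists2 a, intg a & x = p%:R * a.
have pI_ideal : ideal pI.
  split.
  - by move=> _ [a ia ->]; apply: intgM ia; rewrite pmulrn; exact: intg_int.
  - by move=> _ _ [a ia ->] [b ib ->]; exists (a + b); [exact: intgD|rewrite mulrDr].
  - by move=> a _ ia [b ib ->]; exists (a * b); [exact: intgM|rewrite mulrCA].
  case=> a ia a1.
  have p0 : (p%:R : L) != 0.
    by rewrite -(rmorph_nat (in_alg L)) fmorph_eq0 pnatr_eq0 -lt0n prime_gt0.
  have a1V : a \in 1%VS.
    have -> : a = in_alg L (p%:R^-1).
      by rewrite fmorphV rmorph_nat; apply: (mulfI p0); rewrite -a1 divff.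
    exact: memvZ (mem1v _).
  have [z az] := intg_base a1V ia.
  have /fmorph_inj/intr_inj e1 : in_alg L 1%:~R = in_alg L (p%:Z * z)%:~R.
    by rewrite !rmorph_int intrM -pmulrn -az -a1.
  have := prime_gt1 pp; have := congr1 absz e1; rewrite abszM /= => e2.
  have : (p %| 1)%N by rewrite e2 dvdn_mulr.
  by rewrite dvdn1 => /eqP ->.
pose good (P : set L) := ideal P /\ (pI `<=` P)%classic.
pose good0 (P : set L) := P = (@set0 L)%classic \/ good P.
have [M [Mg Mmax]] : exists M, good0 M /\ forall B, (M `<` B)%classic -> ~ good0 B.
  apply: Zorn_bigcup => F Fg Ft.
  have [[X0 FX0 X0g]|nX] := pselect (exists2 X, F X & good X); last first.
    left; rewrite -subset0 => x [X FX Xx]; have [X0|Xg] := Fg _ FX; first by move: Xx; rewrite X0.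
    by case: nX; exists X.
  right; split; last by move=> x px; exists X0 => //; apply: X0g.2.
  have Fg' X x : F X -> X x -> good X.
    by move=> FX Xx; have [X0e|] := Fg _ FX => //; move: Xx; rewrite X0e.
  split.
  - by move=> x [X FX Xx]; have [[+ _ _ _] _] := Fg' _ _ FX Xx; exact.
  - move=> x y [X FX Xx] [Y FY Yy].
    have [[_ XD _ _] _] := Fg' _ _ FX Xx; have [[_ YD _ _] _] := Fg' _ _ FY Yy.
    have [XY|YX] := Ft _ _ FX FY; [exists Y|exists X] => //; first exact: YD (XY _ Xx) Yy.
    exact: XD Xx (YX _ Yy).
  - by move=> a x ia [X FX Xx]; have [[_ _ XM _] _] := Fg' _ _ FX Xx; exists X => //; exact: XM.
  - by case=> X FX X1; have [[_ _ _ +] _] := Fg' _ _ FX X1; exact.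
have {}Mg : good M.
  case: Mg => // M0; exfalso; apply: (Mmax pI); last by right; split.
  rewrite M0; split=> [x []|/(_ p%:R)]; apply.
  by exists 1; rewrite ?mulr1//; exact: (intg_int _ 1).
have [[MA MD MM M1] pIM] := Mg.
exists M; split=> //; first by apply: pIM; exists 1; rewrite ?mulr1//; exact: (intg_int _ 1).
move=> x y ix iy Mxy; apply: contrapT => /not_orP[nMx nMy].
(* [B] is the ideal generated by [M] and [x]. It is proper, since [1 = m + b * x] multiplied by [y]
   would put [y] in [M]; being strictly larger than [M], it contradicts maximality. *)
pose B z := exists m b, [/\ M m, intg b & z = m + b * x].
have M0 : M 0 by apply: pIM; exists 0; rewrite ?mulr0//; exact: (intg_int _ 0).
have BM : (M `<` B)%classic.
  split.
    by move=> z Mz; exists z, 0; rewrite mul0r addr0; split=> //; exact: (intg_int _ 0).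
  move=> BsubM; apply: nMx; apply: BsubM; exists 0, 1; rewrite mul1r add0r; split=> //.
  exact: (intg_int _ 1).
apply: (Mmax B BM); right; split; last by move=> z /pIM; case: BM => + _; exact.
split.
- by move=> _ [m [b [Mm ib ->]]]; apply: intgD (MA _ Mm) (intgM _ ix).
- move=> _ _ [m [b [Mm ib ->]]] [m' [b' [Mm' ib' ->]]].
  exists (m + m'), (b + b'); split; [exact: MD|exact: intgD|by ring].
- move=> a _ ia [m [b [Mm ib ->]]].
  exists (a * m), (a * b); split; [exact: MM|exact: intgM|by ring].
- case=> m [b [Mm ib e]]; apply: nMy.
  have -> : y = y * m + b * (x * y) by rewrite -[LHS]mulr1 e; ring.
  by apply: MD; apply: MM.
Qed.

End MaximalIdeal.
Import MaximalIdeal.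

Section PrimeOver.
Variables (R : comNzRingType) (p : nat) (P : R -> Prop) (pp : prime p) (PP : prime_over p P).

Lemma prime_over_int (z : int) : P z%:~R -> (p %| z)%Z.
Proof.
move=> Pz; apply: contrapT => /negP pz; apply: (prime1 PP).
have cop : coprimez p z.
  by rewrite coprimezE /= prime_coprime.
have [[u v] /= e] := coprimezP _ _ cop.
have -> : (1 : R) = u%:~R * p%:R + v%:~R * z%:~R by rewrite pmulrn -!intrM -intrD e.
by apply: (primeD PP); apply: (primeMl PP) => //; [exact: intg_int|exact: (prime_p PP)|exact: intg_int].
Qed.

Lemma prime_over_dvd (z : int) : (p %| z)%Z -> P z%:~R.
Proof.
case/dvdzP => q ->; rewrite intrM -pmulrn; apply: (primeMl PP); first exact: intg_int.
exact: prime_p PP.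
Qed.

Lemma prime_over0 : P 0.
Proof. exact: (@prime_over_dvd 0 (dvdz0 _)). Qed.

Lemma prime_overN x : P x -> P (- x).
Proof. by move=> Px; rewrite -mulN1r; apply: (primeMl PP) => //; exact: (intg_int _ (-1)). Qed.

Lemma prime_overB x y : P x -> P y -> P (x - y).
Proof. by move=> Px Py; apply: (primeD PP) => //; exact: prime_overN. Qed.

Lemma prime_over_sum (I : Type) (s : seq I) (Q : pred I) (F : I -> R) :
  (forall i, Q i -> P (F i)) -> P (\sum_(i <- s | Q i) F i).
Proof. by move=> H; apply: big_ind => //; [exact: prime_over0|exact: primeD PP]. Qed.

Definition modP (x y : R) := [/\ intg x, intg y & P (x - y)].

Lemma modP_refl x : intg x -> modP x x.
Proof. by move=> ix; split=> //; rewrite subrr; exact: prime_over0. Qed.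

Lemma modP_sym x y : modP x y -> modP y x.
Proof. by case=> ix iy Pxy; split=> //; rewrite -opprB; exact: prime_overN. Qed.

Lemma modP_trans y x z : modP x y -> modP y z -> modP x z.
Proof.
case=> ix iy Pxy [_ iz Pyz]; split=> //.
by rewrite -(subrK y x) -addrA; exact: (primeD PP).
Qed.

Lemma modP_congruence : ring_congruence modP.
Proof.
split=> [z|x x' y y' [ix ix' Px] [iy iy' Py]|x x' y y' [ix ix' Px] [iy iy' Py]].
- by apply: modP_refl; exact: intg_int.
- split; [exact: intgD|exact: intgD|].
  by rewrite (_ : _ - _ = x - x' + (y - y')); [exact: (primeD PP)|ring].
- split; [exact: intgM|exact: intgM|].
  rewrite (_ : _ - _ = y * (x - x') + x' * (y - y')); last by ring.
  by apply: (primeD PP); apply: (primeMl PP).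
Qed.

End PrimeOver.

(** * Inertia groups and odd valuations *)

Section Inertia.
Variables (L : splittingFieldType rat) (p : nat) (P : L -> Prop).
Hypotheses (pp : prime p) (PP : prime_over p P).
Local Notation Gt := (gal_of {:L}).

Lemma intg_gal (s : Gt) x : intg x -> intg (s x).
Proof. exact: intg_rmorph. Qed.

(* Dedekind's independence of distinct homomorphisms into the domain of
   integral elements modulo [P]. *)
Lemma gal_independence (s : seq Gt) (c : Gt -> L) : uniq s ->
  (forall x y : Gt, x \in s -> y \in s -> x != y -> exists2 a : L, intg a & ~ P (x a - y a)) ->
  (forall x, x \in s -> intg (c x)) ->
  (forall a, intg a -> P (\sum_(x <- s) c x * x a)) ->
  forall x, x \in s -> P (c x).
Proof.
elim: s c => [//|x s IH] c /= /andP[xs us] sep ic H.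
have Hs y : y \in s -> P (c y).
  move=> ys; have [b ib Pb] : exists2 b : L, intg b & ~ P (x b - y b).
    apply: sep; rewrite ?mem_head ?inE ?ys ?orbT//.
    by apply: contra xs => /eqP ->.
  have icy : intg (c y) by apply: ic; rewrite inE ys orbT.
  have idf (z : Gt) : intg (z b - x b) by apply: intgB; exact: (intg_gal _ ib).
  have Pcy : P (c y * (y b - x b)).
    apply: (IH (fun z : Gt => c z * (z b - x b)) us) ys.
    - by move=> z t zs ts; apply: sep; rewrite inE ?zs ?ts orbT.
    - by move=> z zs; apply: intgM; [apply: ic; rewrite inE zs orbT|].
    move=> a ia; have e : \sum_(z <- s) c z * (z b - x b) * z a =
       \sum_(z <- x :: s) c z * z (a * b) - x b * \sum_(z <- x :: s) c z * z a.
      rewrite !big_cons [x (a * b)]rmorphM /= mulrDr opprD addrACA.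
      rewrite [X in X + _](_ : _ = 0) ?add0r; last by ring.
      rewrite mulr_sumr -sumrB.
      by apply: eq_bigr => z _; rewrite [z (a * b)]rmorphM /=; ring.
    rewrite e; apply: (prime_overB PP); first by apply: H; exact: intgM.
    by apply: (primeMl PP); [exact: intg_gal|exact: H].
  have [//|h] := primeM PP icy (idf y) Pcy.
  by case: Pb; rewrite -opprB; exact: (prime_overN PP h).
move=> y; rewrite inE => /orP[/eqP ->|/Hs//].
have := H 1 (intg_int _ 1); rewrite big_cons rmorph1 mulr1 => Px.
rewrite -[c x](addrK (\sum_(z <- s) c z * z 1)); apply: (prime_overB PP) => //.
rewrite big_seq; apply: (prime_over_sum PP) => z /Hs Pz.
by rewrite rmorph1 mulr1.
Qed.

Definition gal_eqv (s t : Gt) : bool := `[< forall a, intg a -> P (s a - t a) >].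

Lemma gal_eqv_refl s : gal_eqv s s.
Proof. by apply/asboolP => a _; rewrite subrr; exact: (prime_over0 PP). Qed.
Lemma gal_eqv_sym s t : gal_eqv s t = gal_eqv t s.
Proof.
by apply/asboolP/asboolP => H a ia; rewrite -opprB; apply: (prime_overN PP); exact: H.
Qed.
Lemma gal_eqv_trans t s u : gal_eqv s t -> gal_eqv t u -> gal_eqv s u.
Proof.
move=> /asboolP H1 /asboolP H2; apply/asboolP => a ia.
by rewrite -(subrK (t a) (s a)) -addrA; apply: (primeD PP); [exact: H1|exact: H2].
Qed.

Local Notation Gal := ('Gal({:L} / 1)%g).

Definition inertia : {set Gt} := [set s in Gal | gal_eqv s 1%g]%SET.

Lemma inertia_group_set : group_set inertia.
Proof.
apply/group_setP; split=> [|s t]; first by rewrite inE group1 gal_eqv_refl.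
rewrite !inE => /andP[sG /asboolP s1] /andP[tG /asboolP t1].
rewrite groupM//=; apply/asboolP => a ia; rewrite galM ?memvf//.
rewrite gal_id -(subrK (s a) (t (s a))) -addrA.
have := t1 (s a) (intg_gal s ia); have := s1 a ia; rewrite !gal_id => h1 h2.
exact: (primeD PP).
Qed.

Lemma gal_eqv_mulV s t : s \in Gal -> t \in Gal -> gal_eqv s t -> (s * t^-1)%g \in inertia \/ (t^-1 * s)%g \in inertia.
Proof.
move=> sG tG /asboolP st; right; rewrite inE groupM ?groupV//=.
apply/asboolP => a ia; rewrite galM ?memvf// gal_id.
have := st (t^-1 a)%g (intg_gal _ ia).
by rewrite -[t (t^-1%g a)]galM ?memvf// mulVg gal_id.
Qed.

(* If the inertia group fixed [delta], the trace of [a * delta] would be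
   [y * delta] with [y] a twisted trace whose square is an integer of odd
   [p]-valuation, so that all the twisted traces would vanish modulo [P],
   contradicting independence. *)
Lemma exists_odd_inertia (delta : L) (Delta : int) (chi : Gt -> int) :
  galois 1 {:L} -> ~~ (p %| #|Gal|)%N -> intg delta -> delta ^+ 2 = Delta%:~R ->
  Delta != 0 -> odd (logn p `|Delta|) ->
  (forall s, s \in Gal -> s delta = (chi s)%:~R * delta) ->
  (forall s, s \in Gal -> chi s = 1 \/ chi s = -1) ->
  exists2 s, s \in inertia & chi s = -1.
Proof.
move=> galL pG id dD D0 oD sd chi1; apply: contrapT => nex.
have chiI s : s \in inertia -> chi s = 1.
  move=> sI; have : s \in Gal by move: sI; rewrite inE => /andP[].
  by case/chi1 => // c; case: nex; exists s.
have d0 : delta != 0.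
  by apply: contra D0 => /eqP d0; move/eqP: dD; rewrite d0 expr0n /= eq_sym -(rmorph_int (in_alg L)) fmorph_eq0 intr_eq0.
have chiE s t : s \in Gal -> t \in Gal -> gal_eqv s t -> chi s = chi t.
  move=> sG tG st.
  have fixI r : r \in inertia -> r delta = delta.
    move=> rI; have rG : r \in Gal by move: rI; rewrite inE => /andP[].
    by rewrite sd// (chiI _ rI) mul1r.
  suff e : s delta = t delta.
    move: e; rewrite !sd// => /(mulIf d0); rewrite -!(rmorph_int (in_alg L)).
    by move=> /fmorph_inj/intr_inj.
  have [rI|rI] := gal_eqv_mulV sG tG st.
    have := fixI _ rI; rewrite galM ?memvf// => /(congr1 t).
    by rewrite -[t (t^-1%g _)]galM ?memvf// mulVg gal_id.
  have := fixI _ rI; rewrite galM ?memvf// => e1.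
  have [h|h] : t delta = delta \/ t delta = - delta.
    by rewrite sd//; case: (chi1 t tG) => ->; [left; rewrite mul1r|right; rewrite mulN1r].
  - have tV : (t^-1)%g delta = delta.
      by rewrite -[in LHS]h -galM ?memvf// mulgV gal_id.
    by rewrite h -[in LHS]tV e1.
  - have tV : (t^-1)%g delta = - delta.
      by apply: oppr_inj; rewrite opprK -raddfN /= -h -galM ?memvf// mulgV gal_id.
    by move: e1; rewrite tV raddfN /= h => /eqP; rewrite eqr_oppLR => /eqP.
have twisted a : intg a -> P (\sum_(s in Gal) (chi s)%:~R * s a).
  move=> ia; set y := \sum_(s in _) _.
  have iy : intg y.
    by apply: intg_sum => s sG; apply: intgM; [exact: intg_int|exact: intg_gal].
  have [z zE] : exists z : int, y * delta = z%:~R.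
    apply: intg_base; last exact: intgM.
    rewrite (_ : _ * _ = galTrace 1 {:L} (a * delta)); first exact: mem_galTrace (memvf _).
    rewrite /galTrace mulr_suml; apply: eq_bigr => s sG.
    by rewrite [s (_ * _)]rmorphM /= sd//; ring.
  (* The square of [y] equals [z ^ 2 / Delta], a rational number, and it is integral. *)
  have [w wE] : exists w : int, y ^+ 2 = w%:~R.
    apply: intg_base; last exact: intgX.
    have -> : y ^+ 2 = in_alg L ((z ^+ 2)%:~R / Delta%:~R).
      rewrite fmorph_div !rmorph_int -dD rmorphXn /= -zE exprMn mulfK//.
      by rewrite expf_neq0.
    exact: memvZ (mem1v _).
  have e : z ^+ 2 = w * Delta.
    have : in_alg L (z ^+ 2)%:~R = in_alg L (w * Delta)%:~R.
      by rewrite !rmorph_int intrM -wE -dD -exprMn zE -rmorphXn.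
    by move=> /fmorph_inj/intr_inj.
  suff Pw : P w%:~R by have := primeM PP iy iy; rewrite -expr2 wE => /(_ Pw)[].
  apply: (prime_over_dvd PP).
  have [->|w0] := eqVneq w 0; first exact: dvdz0.
  have := congr1 (fun x => logn p (absz x)) e; rewrite abszX abszM lognX lognM ?absz_gt0//.
  move=> /(congr1 odd); rewrite oddM oddD oD addbT => /esym/negbFE ow.
  have := pfactor_dvdn 1 pp (_ : 0 < `|w|)%N; rewrite expn1 absz_gt0 => /(_ w0).
  by rewrite odd_gt0// => pw; rewrite /dvdz /= pw.
(* Independence needs pairwise distinct reductions modulo [P], so one automorphism is kept per
   class; [c] adds up the signs in a class. *)
pose rep (s : Gt) : Gt := odflt s [pick t in Gal | gal_eqv s t].
have repP s : s \in Gal -> rep s \in Gal /\ gal_eqv s (rep s).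
  move=> sG; rewrite /rep; case: pickP => [t /andP[]//|/(_ s)].
  by rewrite sG gal_eqv_refl.
have repE s t : s \in Gal -> t \in Gal -> gal_eqv s t -> rep s = rep t.
  move=> sG tG st; rewrite /rep.
  have -> : [pick u in Gal | gal_eqv s u] = [pick u in Gal | gal_eqv t u].
    apply: eq_pick => u /=; congr (_ && _); apply/idP/idP => h.
      by apply: gal_eqv_trans h; rewrite gal_eqv_sym.
    exact: gal_eqv_trans st h.
  by case: pickP => [//|/(_ t)]; rewrite tG gal_eqv_refl.
pose S := [seq s <- enum Gal | rep s == s].
pose c (r : Gt) : L := \sum_(s in Gal | rep s == r) (chi s)%:~R.
have memS (x : Gt) : (x \in S) = (rep x == x) && (x \in Gal).
  by rewrite mem_filter; congr (_ && _); exact: mem_enum.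
have repS s : s \in Gal -> rep s \in S.
  move=> sG; have [rG sr] := repP s sG; rewrite mem_filter mem_enum rG andbT.
  by rewrite -(repE _ _ sG rG sr).
have Pc : P (c (rep 1%g)).
  apply: (@gal_independence S c) => //.
  - by rewrite filter_uniq ?enum_uniq.
  - move=> x y; rewrite !memS => /andP[/eqP rx xG] /andP[/eqP ry yG] xy.
    apply: contrapT => nsep; move/negP: xy; apply; apply/eqP.
    rewrite -rx -ry; apply: repE => //; apply/asboolP => a ia.
    by apply: contrapT => nP; apply: nsep; exists a.
  - by move=> x _; apply: intg_sum => s _; exact: intg_int.
  - move=> a ia; have := twisted a ia.
    have -> : \sum_(s in Gal) (chi s)%:~R * s a =
        \sum_(x <- S) c x * x a + \sum_(s in Gal) (chi s)%:~R * (s a - rep s a).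
      have -> : \sum_(x <- S) c x * x a = \sum_(s in Gal) (chi s)%:~R * rep s a.
        rewrite [RHS](partition_big rep (fun x => x \in S)) /=; last by move=> s; exact: repS.
        have uS : uniq S by rewrite filter_uniq ?enum_uniq.
        rewrite big_uniq //=.
        apply: eq_bigr => x _; rewrite /c mulr_suml.
        by apply: eq_bigr => s /andP[_ /eqP ->].
      by rewrite -big_split /=; apply: eq_bigr => s _; ring.
    move=> h; rewrite -[X in P X](addrK (\sum_(s in Gal) (chi s)%:~R * (s a - rep s a))).
    apply: (prime_overB PP) => //; apply: (prime_over_sum PP) => s sG.
    apply: (primeMl PP); first exact: intg_int.
    by have [_ /asboolP] := repP s sG; apply.
  - by apply: repS; exact: group1.
(* On the class of the identity all signs are 1, so this coefficient is the order of the inertia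
   group; being in [P], it would be divisible by [p]. *)
have cE : c (rep 1%g) = (#|inertia|%:Z)%:~R.
  rewrite /c (eq_bigl (mem inertia)).
    rewrite (eq_bigr (fun=> 1)); first by rewrite sumr_const -pmulrn.
    by move=> s sI; rewrite chiI.
  move=> s; rewrite /= !inE; case sG: (s \in Gal) => //=.
  have [rG sr] := repP s sG; have [r1G r1] := repP 1%g (group1 _).
  apply/eqP/idP => [e|/(repE _ _ sG (group1 _))//].
  by apply: gal_eqv_trans sr _; rewrite e gal_eqv_sym.
move: Pc; rewrite cE => /(prime_over_int pp PP); rewrite /dvdz /= => pI.
move/negP: pG; apply; apply: dvdn_trans pI _.
have -> : #|inertia| = #|Group inertia_group_set| by [].
by apply: cardSg; apply/fintype.subsetP => s; rewrite inE => /andP[].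
Qed.

End Inertia.

(** * Galois groups without transpositions *)

(* An odd permutation that is not a transposition moves enough points for three
   of them to be redundant as representatives of an equivalence it preserves. *)
Lemma odd_perm_clusters k (s : 'S_k.+3) (e : rel 'I_k.+3) :
  reflexive e -> symmetric e -> transitive e -> (forall i, e i (s i)) -> odd_perm s ->
  (exists i j, i != j /\ s = tperm i j) \/
  exists (phi : {ffun 'I_k.+3 -> 'I_k}) (r : 'I_k -> 'I_k.+3), forall i, e i (r (phi i)).
Proof.
move=> er es et se os.
have moved (t : 'S_k.+3) : t != 1%g -> exists i, t i != i.
  move=> t1; apply/existsP; rewrite -negb_forall; apply: contra t1 => /forallP h.
  by apply/eqP/permP => x; rewrite perm1; apply/eqP.
(* Composing with the transposition of a moved point and its image fixes that point and preserves
   the classes. Three such rounds produce the three redundant points; if the permutation is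
   exhausted after the first one, it was a transposition. *)
have e_tperm (t : 'S_k.+3) i : (forall x, e x (t x)) -> forall x, e x ((t * tperm i (t i))%g x).
  move=> te x; rewrite permM; case: tpermP => [h|h|_ _].
  - by apply: et (te x) _; rewrite h; exact: te.
  - by apply: et (te x) _; rewrite h es; exact: te.
  - exact: te.
have [i si] : exists i, s i != i by apply: moved; apply: contraL os => /eqP ->; rewrite odd_perm1.
pose s1 := (s * tperm i (s i))%g.
have s1i : s1 i = i by rewrite permM tpermR.
have os1 : odd_perm s1 = false by rewrite odd_permM os odd_tperm eq_sym si.
have s1e := e_tperm s i se.
have [s11|s11] := eqVneq s1 1%g.
  left; exists i, (s i); rewrite eq_sym; split=> //.
  have h : (s1 * tperm i (s i) = s)%g by rewrite -mulgA tperm2 mulg1.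
  by rewrite -[LHS]h s11 mul1g.
right; have [j s1j] := moved _ s11.
have ji : j != i by apply: contra s1j => /eqP ->; rewrite s1i.
have s1ji : s1 j != i by rewrite -[X in _ != X]s1i (inj_eq perm_inj).
pose s2 := (s1 * tperm j (s1 j))%g.
have s2j : s2 j = j by rewrite permM tpermR.
have s2i : s2 i = i by rewrite permM s1i tpermD.
have os2 : odd_perm s2 by rewrite odd_permM os1 odd_tperm eq_sym s1j.
have s2e := e_tperm s1 j s1e.
have [l s2l] : exists l, s2 l != l by apply: moved; apply: contraL os2 => /eqP ->; rewrite odd_perm1.
have li : l != i by apply: contra s2l => /eqP ->; rewrite s2i.
have lj : l != j by apply: contra s2l => /eqP ->; rewrite s2j.
pose B := ~: [set i; j; l].
have cB : #|B| = k.
  have := cardsC [set i; j; l]; rewrite -/B card_ord setUC cardsU1 cards2 !inE.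
  by rewrite (eq_sym i) (negPf li) (negPf lj) (negPf ji) /= => -[].
have repl : exists2 y, y \in B & e l y.
  exists (s2 l); last exact: s2e.
  by rewrite !inE (negPf s2l) -[X in _ == X]s2i -[X in _ || (_ == X)]s2j !(inj_eq perm_inj) (negPf li) (negPf lj).
have repj : exists2 y, y \in B & e j y.
  have [s1jl|s1jl] := eqVneq (s1 j) l.
    have [y yB ey] := repl; exists y => //; apply: et ey; rewrite -s1jl; exact: s1e.
  by exists (s1 j); [rewrite !inE (negPf s1jl) (negPf s1j) (negPf s1ji)|exact: s1e].
have repi : exists2 y, y \in B & e i y.
  have [sij|sij] := eqVneq (s i) j.
    by have [y yB ey] := repj; exists y => //; apply: et ey; rewrite -sij.
  have [sil|sil] := eqVneq (s i) l.
    by have [y yB ey] := repl; exists y => //; apply: et ey; rewrite -sil.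
  by exists (s i); [rewrite !inE (negPf sil) (negPf sij) (negPf si)|exact: se].
have rep x : exists2 y, y \in B & e x y.
  have [->//|xi] := eqVneq x i; have [->//|xj] := eqVneq x j; have [->//|xl] := eqVneq x l.
  by exists x => //; rewrite !inE (negPf xi) (negPf xj) (negPf xl).
pose r (a : 'I_k) : 'I_k.+3 := enum_val (cast_ord (esym cB) a).
have /fin_all_exists[f fP] (x : 'I_k.+3) : exists a, e x (r a).
  have [y yB ey] := rep x; exists (cast_ord cB (enum_rank_in yB y)).
  by rewrite /r cast_ordK enum_rankK_in.
by exists [ffun x => f x], r => x; rewrite ffunE.
Qed.

Section RootCongruence.
Variables (R : comNzRingType) (E : R -> R -> Prop) (cE : ring_congruence E).

Lemma congr_coef_prod (s : seq (R * R)) (i : nat) :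
  (forall c, c \in s -> E c.1 c.2) ->
  E (\prod_(c <- s) ('X - c.1%:P))`_i (\prod_(c <- s) ('X - c.2%:P))`_i.
Proof.
elim: s i => [|c s IH] i H.
  by rewrite !big_nil !coef1; exact: (congr_int cE (i == 0%N)).
rewrite !big_cons !mulrBl !coefB !coefXM !coefCM; apply: (congr_add cE).
  case: ifP => _; first exact: (congr_int cE 0).
  by apply: IH => d ds; apply: H; rewrite inE ds orbT.
rewrite -mulN1r -[X in E _ X]mulN1r; apply: (congr_mul cE); first exact: (congr_int cE (-1)).
apply: (congr_mul cE); first by apply: H; rewrite mem_head.
by apply: IH => d ds; apply: H; rewrite inE ds orbT.
Qed.

End RootCongruence.

Lemma coef_prod_scale (R : comNzRingType) (t : R) (s : seq R) (i : nat) : (i <= size s)%N ->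
  (\prod_(x <- s) ('X - (t * x)%:P))`_i = t ^+ (size s - i) * (\prod_(x <- s) ('X - x%:P))`_i.
Proof.
elim: s i => [|x s IH] i; first by rewrite leqn0 => /eqP ->; rewrite !big_nil expr0 mul1r.
move=> /= ilt; rewrite !big_cons !mulrBl !coefB !coefXM !coefCM.
have sz (u : R) : (\prod_(y <- s) ('X - (u * y)%:P))`_(size s).+1 = 0.
  by rewrite nth_default// (eq_big_seq (fun y => 'X - (id (u * y))%:P))// -(big_map ( *%R u) xpredT (fun y => 'X - y%:P)) size_prod_XsubC size_map.
case: i ilt => [|i] ilt /=; first by rewrite !sub0r IH// !subn0 exprS; ring.
rewrite IH// subSS mulrBr; congr (_ - _).
have [->|ni] := eqVneq i (size s).
  have := sz 1; under eq_bigr do rewrite mul1r.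
  by move=> ->; rewrite sz !mulr0.
have il : (i < size s)%N by rewrite ltn_neqAle ni.
by rewrite IH// -[in RHS](subnSK il) exprS; ring.
Qed.

Section GaloisLemma.
Variables (k : nat) (f : {poly int}) (L : splittingFieldType rat) (r : k.+3.-tuple L).
Hypotheses (sf : size f = k.+4)
  (fr : map_poly (in_alg L) (map_poly (intr : int -> rat) f) %= \prod_(x <- r) ('X - x%:P))
  (genr : <<1 & r>>%VS = fullv) (ur : uniq r).

Local Notation a0 := (lead_coef f).

Lemma map_in_alg_int (g : {poly int}) :
  map_poly (in_alg L) (map_poly (intr : int -> rat) g) = map_poly (intr : int -> L) g.
Proof.
by rewrite -map_poly_comp; apply: eq_map_poly => z; exact: (rmorph_int (in_alg L)).
Qed.

Lemma intrL_inj : injective (intr : int -> L).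
Proof.
by move=> x y; rewrite -!(rmorph_int (in_alg L)) => /fmorph_inj/intr_inj.
Qed.

Lemma lead_neq0 : a0 != 0.
Proof. by rewrite lead_coef_eq0 -size_poly_eq0 sf. Qed.

Lemma root_factorisation : map_poly (intr : int -> L) f = a0%:~R *: \prod_(x <- r) ('X - x%:P).
Proof.
move: fr; rewrite map_in_alg_int => /eqpfP; rewrite lead_coef_map_inj ?rmorph0//; last exact: intrL_inj.
by rewrite (monicP (monic_prod_XsubC _ _ _)) invr1 mulr1 => ->.
Qed.

(** The roots of [f] need not be integral, but [a0] times a root is: it is a root of the monic
    integral polynomial [a0 ^ (n - 1) * f (X / a0)], with [n = k + 3]. *)
Definition scaled_root (i : 'I_k.+3) : L := a0%:~R * tnth r i.

Lemma intg_scaled_root i : intg (scaled_root i).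
Proof.
have sp : size (\prod_(x <- r) ('X - (a0%:~R * x)%:P)) = k.+4.
  by rewrite -(big_map ( *%R a0%:~R) xpredT (fun y => 'X - y%:P)) size_prod_XsubC size_map size_tuple.
apply: (@integral_root_monic _ _ (intr : {rmorphism int -> L}) _ (\prod_(x <- r) ('X - (a0%:~R * x)%:P))).
- by rewrite -(big_map ( *%R a0%:~R) xpredT (fun y => 'X - y%:P)) monic_prod_XsubC.
- by rewrite -(big_map ( *%R a0%:~R) xpredT (fun y => 'X - y%:P)) root_prod_XsubC; apply: map_f; exact: mem_tnth.
- apply/(integral_poly (intr : {rmorphism int -> L})) => j; rewrite -/(intg _).
  have [jlt|jge] := ltnP j k.+4; last by rewrite nth_default ?sp//; exact: (intg_int _ 0).
  rewrite coef_prod_scale size_tuple//.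
  have [->|jn] := eqVneq j k.+3.
    have := monic_prod_XsubC r xpredT id; rewrite monicE /lead_coef size_prod_XsubC size_tuple /= => /eqP ->.
    by rewrite subnn mulr1; exact: (intg_int _ 1).
  have {}jlt : (j < k.+3)%N by move: jlt; rewrite ltnS leq_eqVlt (negPf jn).
  rewrite subSn -1?ltnS// exprSr -mulrA.
  have -> : a0%:~R * (\prod_(x <- r) ('X - x%:P))`_j = (f`_j)%:~R :> L.
    by rewrite -coefZ -root_factorisation coef_map.
  by apply: intgM (intg_int _ _); apply: intgX; exact: intg_int.
Qed.

Definition vandet : L := \det (Vandermonde k.+3 (\row_i scaled_root i)).

Lemma intg_vandet : intg vandet.
Proof.
apply: intg_sum => s _; apply: intgM.
  by apply: intgX; exact: (intg_int _ (-1)).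
by apply: intg_prod => i _; rewrite !mxE; apply: intgX; exact: intg_scaled_root.
Qed.

Lemma vandet_neq0 : vandet != 0.
Proof.
rewrite /vandet det_Vandermonde; apply/prodf_neq0 => i _; apply/prodf_neq0 => j ij.
rewrite !mxE subr_eq0 /scaled_root (inj_eq (mulfI _)); last first.
  by rewrite -(rmorph_int (in_alg L)) fmorph_eq0 intr_eq0 lead_neq0.
rewrite (tnth_nth 0) (tnth_nth 0 r i) nth_uniq ?size_tuple//.
by rewrite neq_ltn ij orbT.
Qed.

Lemma galL : galois 1 {:L}.
Proof.
apply/splitting_galoisField; exists (\prod_(x <- r) ('X - x%:P)); split.
- have -> : \prod_(x <- r) ('X - x%:P) = a0%:~R^-1 *: map_poly (in_alg L) (map_poly (intr : int -> rat) f).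
    rewrite map_in_alg_int root_factorisation scalerA mulVf ?scale1r//.
    by rewrite -(rmorph_int (in_alg L)) fmorph_eq0 intr_eq0 lead_neq0.
  apply: polyOverZ; first by rewrite rpredV rpred_int.
  by apply/polyOver1P; exists (map_poly intr f).
- by rewrite separable_prod_XsubC.
- by exists r => //; exact: eqpxx.
Qed.

Local Notation Gal := ('Gal({:L} / 1)%g).

Lemma gal_root (s : gal_of {:L}) : s \in Gal -> exists t : 'S_k.+3, forall i, s (tnth r i) = tnth r (t i).
Proof.
move=> sG; have rt x : x \in (r : seq L) -> s x \in (r : seq L).
  move=> xr; rewrite -root_prod_XsubC; move: fr; rewrite map_in_alg_int => fr'.
  rewrite -(eqp_root fr'); have fx : root (map_poly (intr : int -> L) f) x.
    by rewrite (eqp_root fr') root_prod_XsubC.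
  have -> : map_poly (intr : int -> L) f = map_poly s (map_poly (intr : int -> L) f).
    by rewrite -map_poly_comp; apply: eq_map_poly => z /=; rewrite rmorph_int.
  by rewrite rmorph_root.
pose g (i : 'I_k.+3) : 'I_k.+3 := inord (index (s (tnth r i)) r).
have gE i : tnth r (g i) = s (tnth r i).
  have sr := rt _ (mem_tnth i r).
  by rewrite (tnth_nth 0) inordK ?nth_index// -[X in (_ < X)%N](size_tuple r) index_mem.
have ginj : injective g.
  move=> i j /(congr1 (tnth r)); rewrite !gE => /fmorph_inj.
  by move/(tuple_uniqP _ ur).
by exists (perm ginj) => i; rewrite permE gE.
Qed.

Lemma gal_vandet (s : gal_of {:L}) (t : 'S_k.+3) : (forall i, s (tnth r i) = tnth r (t i)) ->
  s vandet = (-1) ^+ t * vandet.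
Proof.
move=> st; rewrite /vandet -[s _](det_map_mx s).
have -> : map_mx s (Vandermonde k.+3 (\row_i scaled_root i)) =
    col_perm t (Vandermonde k.+3 (\row_i scaled_root i)).
  apply/matrixP => i j; rewrite !mxE rmorphXn /= /scaled_root rmorphM /= rmorph_int.
  by rewrite st.
by rewrite col_permE det_mulmx det_perm odd_permV mulrC.
Qed.

Definition gal_perm (s : gal_of {:L}) : 'S_k.+3 :=
  odflt 1%g [pick t : 'S_k.+3 | [forall i, s (tnth r i) == tnth r (t i)]].

Lemma gal_permE (s : gal_of {:L}) : s \in Gal -> forall i, s (tnth r i) = tnth r (gal_perm s i).
Proof.
move=> /gal_root[t tE] i; rewrite /gal_perm; case: pickP => [u /forallP/(_ i)/eqP//|/(_ t)/negP[]].
by apply/forallP => j; rewrite tE.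
Qed.

Lemma tnth_r_inj : injective (tnth r).
Proof. exact/tuple_uniqP. Qed.

Lemma gal_permM : {in Gal &, {morph gal_perm : s t / (s * t)%g}}.
Proof.
move=> s t sG tG; apply/permP => i; apply: tnth_r_inj.
by rewrite -gal_permE ?groupM// galM ?memvf// !gal_permE// permM.
Qed.

Canonical gal_perm_morphism := Morphism gal_permM.

Lemma gal_perm_inj : ('injm gal_perm)%g.
Proof.
apply/injmP => s t sG tG e; apply/eqP/gal_eqP => x _.
have : (<<1 & r>> <= fixedField [set (s * t^-1)%g])%VS.
  apply/Fadjoin_seqP; split; first exact: sub1v.
  move=> y /tnthP[i ->]; apply/fixedFieldP; first exact: memvf.
  move=> _ /set1P ->; rewrite galM ?memvf// gal_permE// e -gal_permE//.
  by rewrite -galM ?memvf// mulgV gal_id.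
rewrite genr => /subvP/(_ x (memvf x))/fixedFieldP; rewrite memvf => /(_ isT _ (set11 _)).
by rewrite galM ?memvf// => /(congr1 t); rewrite -[t ((t^-1)%g _)]galM ?memvf// mulVg gal_id.
Qed.

Lemma card_Gal_dvd : (#|Gal| %| (k.+3)`!)%N.
Proof.
rewrite -(card_injm gal_perm_inj (subxx _)).
have -> : ((k.+3)`! = #|[set: 'S_k.+3]|)%N by rewrite cardsT card_Sn.
exact: cardSg (finset.subsetT _).
Qed.

(** The Vandermonde determinant of the scaled roots is a square root of [Delta] on which
    automorphisms act by the sign of their permutation. So [exists_odd_inertia] gives an odd
    permutation moving each root within its residue class. It is not a transposition, and
    [odd_perm_clusters] leaves [k] representatives. *)
Lemma bad_prime (p : nat) (Delta : int) : prime p -> (k.+3 < p)%N -> ~~ (p %| a0)%Z ->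
  vandet ^+ 2 = Delta%:~R -> odd (logn p `|Delta|) ->
  (forall i j, i != j -> tperm i j \notin root_perms r) ->
  exists (E : L -> L -> Prop) (phi : {ffun 'I_k.+3 -> 'I_k}) (gam : 'I_k -> L),
    [/\ ring_congruence E, forall z : int, E z%:~R 0 -> (p %| z)%Z &
      forall i : 'I_k.+4, E (f`_i)%:~R (a0%:~R * (\prod_j ('X - (gam (phi j))%:P))`_i)].
Proof.
move=> pp np pa0 dD oD nt.
have [P PP] := exists_prime_over L pp.
have D0 : Delta != 0 by apply: contraTneq oD => ->; rewrite logn0.
have pG : ~~ (p %| #|Gal|)%N.
  apply/negP => /dvdn_trans/(_ card_Gal_dvd); apply/negP.
  elim: k.+3 np => [_|m IH np]; first by rewrite fact0 dvdn1 neq_ltn prime_gt1 ?orbT.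
  by rewrite factS Euclid_dvdM// negb_or IH ?gtnNdvd// ltnW.
pose chi s : int := (-1) ^+ (gal_perm s).
have [s sI chis] : exists2 s, s \in inertia P & chi s = -1.
  apply: (exists_odd_inertia pp PP galL pG intg_vandet dD D0 oD) => s sG.
    by rewrite (gal_vandet (gal_permE sG)) /chi rmorphXn rmorphN1.
  by rewrite /chi; case: (odd_perm _); [right|left].
have [sG sP] : s \in Gal /\ forall a, intg a -> P (s a - a).
  move: sI; rewrite inE => /andP[sG /asboolP h]; split=> // a ia.
  by have := h a ia; rewrite gal_id.
have os : odd_perm (gal_perm s) by move: chis; rewrite /chi; case: (odd_perm _).
pose e : rel 'I_k.+3 := fun i j => `[< modP P (scaled_root i) (scaled_root j) >].
have er : reflexive e by move=> i; apply/asboolP/(modP_refl PP)/intg_scaled_root.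
have es : symmetric e by move=> i j; apply/asboolP/asboolP; exact: (modP_sym PP).
have et : transitive e.
  by move=> j i l /asboolP h1 /asboolP h2; apply/asboolP; exact: (modP_trans PP h1 h2).
have se i : e i (gal_perm s i).
  rewrite es; apply/asboolP; split; try exact: intg_scaled_root.
  have := sP _ (intg_scaled_root i).
  by rewrite /scaled_root [s (_ * _)]rmorphM /= rmorph_int gal_permE.
have [[i [j [ij sij]]]|[phi [rr rrE]]] := odd_perm_clusters er es et se os.
  case/negP: (nt i j ij); rewrite inE; apply/exists_inP; exists s => //.
  by apply/forallP => l; rewrite -sij gal_permE.
(* [u] inverts [a0] modulo [p]. Unlike a root [x], the element [u * a0 * x] is integral, and using
   it in place of [x] multiplies each coefficient of [f] by a power of [u * a0], which is 1 modulo
   [p]. *)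
have cop : coprimez a0 p by rewrite coprimezE /= coprime_sym prime_coprime.
have [[u v] /= uv] := coprimezP _ _ cop.
have cE := modP_congruence PP.
exists (modP P), phi, (fun j => u%:~R * scaled_root (rr j)); split=> //.
  by move=> z [_ _]; rewrite subr0; exact: (prime_over_int pp PP).
move=> i.
apply: (modP_trans PP (y := a0%:~R * (\prod_(x <- r) ('X - ((u * a0)%:~R * x)%:P))`_i)).
  have il : (i <= size r)%N by rewrite size_tuple -ltnS.
  have e0 : a0%:~R * (\prod_(x <- r) ('X - x%:P))`_i = (f`_i)%:~R :> L.
    by rewrite -coefZ -root_factorisation coef_map.
  rewrite (coef_prod_scale _ il) size_tuple mulrCA e0.
  split; first exact: intg_int.
    by apply: intgM (intg_int _ _); apply: intgX; exact: intg_int.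
  rewrite -rmorphXn -intrM -intrB; apply: (prime_over_dvd PP).
  rewrite -[X in X - _]mul1r -mulrBl; apply: dvdz_mulr.
  rewrite -[X in X - _](expr1n _ (k.+3 - i)) subrXX; apply: dvdz_mulr.
  by apply/dvdzP; exists v; rewrite -[X in X - _]uv; ring.
apply: (congr_mul cE); first exact: (congr_int cE).
have -> : \prod_(x <- r) ('X - ((u * a0)%:~R * x)%:P) = \prod_(j < k.+3) ('X - (u%:~R * scaled_root j)%:P).
  by rewrite big_tuple; apply: eq_bigr => j _; rewrite intrM mulrA.
have := @congr_coef_prod _ _ cE [seq (u%:~R * scaled_root j, u%:~R * scaled_root (rr (phi j))) | j <- index_enum 'I_k.+3] i.
rewrite !big_map /=; apply=> _ /mapP[j _ ->] /=.
apply: (congr_mul cE); first exact: (congr_int cE).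
exact/asboolP/rrE.
Qed.

End GaloisLemma.

Lemma irreducible_uniq_roots (L : splittingFieldType rat) (r : seq L) (g : {poly rat}) :
  irreducible_poly g -> map_poly (in_alg L) g %= \prod_(x <- r) ('X - x%:P) -> uniq r.
Proof.
move=> [g1 irr] gr; rewrite -separable_prod_XsubC -(eqp_separable gr) separable_map.
have dg0 : g^`() != 0.
  have g0 : g != 0 by rewrite -size_poly_gt0 ltnW.
  have lg : lead_coef g != 0 by rewrite lead_coef_eq0.
  apply/eqP => /polyP/(_ (size g).-2); rewrite coef_deriv coef0.
  rewrite lead_coefE in lg; case: (size g) g1 lg => [|[|m]]//= _ lg /eqP.
  by rewrite mulrn_eq0 /= (negPf lg).
rewrite unlock /separable_poly; apply: contraT => nc.
have /irr h : size (gcdp g g^`()) != 1%N by [].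
have := h (dvdp_gcdl _ _) => e.
have : g %| g^`() by rewrite -(eqp_dvdl _ e) dvdp_gcdr.
move=> /(dvdp_leq dg0); rewrite leqNgt lt_size_deriv//.
by rewrite -size_poly_gt0 ltnW.
Qed.

(** * The discriminant *)

Module Discriminant.
Import mpoly.

Section Disc.
Variable n : nat.

Definition generic_disc : {mpoly int[n]} :=
  (\det (Vandermonde n (\row_(i < n) mpolyX int U_(i)))) ^+ 2.

Lemma generic_disc_sym : generic_disc \is symmetric.
Proof.
apply/issymP => s; rewrite /generic_disc rmorphXn /= -det_map_mx.
have -> : map_mx (msym s) (Vandermonde n (\row_(i < n) mpolyX int U_(i))) =
    col_perm s (Vandermonde n (\row_(i < n) mpolyX int U_(i))).
  apply/matrixP => i j; rewrite !mxE rmorphXn /=; congr (_ ^+ _).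
  rewrite /msym mmapX mmap1U.
  by [].
rewrite col_permE det_mulmx det_perm exprMn -exprM muln2 -signr_odd odd_double expr0.
by rewrite mulr1.
Qed.

Lemma disc_sym_poly : {t : {mpoly int[n]} | t \mPo [tuple mesym n int i.+1 | i < n] = generic_disc}.
Proof. by have [t [tE _]] := sym_fundamental generic_disc_sym; exists t. Qed.

(* The arguments of the polynomial [disc_sym_poly] are the elementary symmetric
   functions of the roots, hence the signs and the reversal. *)
Definition disc (R : comNzRingType) (c : 'I_n -> R) : R :=
  mmap intr (fun i => (-1) ^+ i.+1 * c (rev_ord i)) (sval disc_sym_poly).

Lemma disc_rmorph (R S : comNzRingType) (phi : {rmorphism R -> S}) (c : 'I_n -> R) :
  phi (disc c) = disc (fun i => phi (c i)).
Proof.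
rewrite /disc /mmap rmorph_sum; apply: eq_bigr => m _.
rewrite rmorphM rmorph_int; congr (_ * _).
rewrite /mmap1 rmorph_prod; apply: eq_bigr => i _.
by rewrite rmorphXn rmorphM rmorphXn rmorphN1.
Qed.

Lemma disc_roots (R : idomainType) (b : 'I_n -> R) :
  disc (fun i => (\prod_j ('X - (b j)%:P))`_i) =
  (\det (Vandermonde n (\row_i b i))) ^+ 2.
Proof.
pose ev : {rmorphism {mpoly int[n]} -> R} := mmap (intr : int -> R) b.
have evX i : ev (mpolyX int U_(i)) = b i by rewrite /ev /= mmapX mmap1U.
have -> : (\det (Vandermonde n (\row_i b i))) ^+ 2 = ev generic_disc.
  rewrite rmorphXn /= -[mmap intr b _](det_map_mx ev); congr (\det _ ^+ 2).
  by apply/matrixP => i j; rewrite !mxE rmorphXn evX.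
rewrite -(svalP disc_sym_poly) /disc; set t := sval _.
rewrite /comp_mpoly /mmap rmorph_sum; apply: eq_bigr => m _.
rewrite rmorphM; congr (_ * _); first by rewrite /ev /= mmapC.
rewrite /mmap1 rmorph_prod; apply: eq_bigr => i _; rewrite rmorphXn /=; congr (_ ^+ _).
have evS (k : nat) : ev (mesym n int k) = (mesym n R k).@[b].
  rewrite /mesym !raddf_sum; apply: eq_bigr => A _.
  apply: (etrans (rmorph_prod ev _ _ _)); apply: esym.
  apply: (etrans (rmorph_prod (meval b) _ _ _)).
  by apply: eq_bigr => j _; exact: etrans (mevalXU b j) (esym (evX j)).
rewrite tnth_mktuple -/ev -[mmap _ _ _]/(ev _) evS.
have := @mroots_coeff R n [tuple b i | i < n] (lift ord0 i).
have -> : \prod_(c <- [tuple b i0 | i0 < n]) ('X - c%:P) = \prod_j ('X - (b j)%:P).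
  by rewrite big_tuple; apply: eq_bigr => j _; rewrite tnth_mktuple.
rewrite /= /bump /= add1n => ->; rewrite mulrA -exprD addnn -signr_odd odd_double expr0 mul1r.
by apply: meval_eq => j; rewrite tnth_mktuple.
Qed.

Lemma disc_bound : exists K d : nat, forall (Z : nat) (c : 'I_n -> int), (0 < Z)%N ->
  (forall i, `|c i| <= Z)%N -> (`|disc c| <= K * Z ^ d)%N.
Proof.
pose t := sval disc_sym_poly.
exists (\sum_(m <- msupp t) `|t@_m|)%N, (msize t) => Z c Z0 cZ.
rewrite big_distrl /= /disc /mmap -/t.
elim: (msupp t) (fun m => @msize_mdeg_lt _ _ t m) => [|m s IH] H; first by rewrite !big_nil.
rewrite !big_cons; apply: (@leq_trans (`|intr (t@_m) * mmap1 (fun i : 'I_n => (-1) ^+ i.+1 * c (rev_ord i)) m| +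
   `|(\sum_(j <- s) intr (t@_j) * mmap1 (fun i : 'I_n => (-1) ^+ i.+1 * c (rev_ord i)) j)%R|)).
  by rewrite -lez_nat PoszD !abszE ler_normD.
apply: leq_add; last first.
  by apply: IH => m' ms; apply: H; rewrite inE ms orbT.
rewrite abszM intz leq_mul2l; apply/orP; right.
have ms : (mdeg m <= msize t)%N.
  exact: ltnW (H m (mem_head _ _)).
apply: (@leq_trans (Z ^ mdeg m)); last by rewrite leq_pexp2l.
rewrite /mmap1 mdegE expn_sum.
elim/big_rec2: _ => // i x y _ h; rewrite abszM leq_mul// abszX.
by case: (m i) => // e; rewrite leq_exp2r// abszM abszX exp1n mul1n.
Qed.

End Disc.
End Discriminant.

Import Discriminant.

(** * The Moebius function of a reduction *)

Lemma mobius_abs (F : fieldType) (f : {poly F}) : `|mobius f| <= 1.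
Proof. by rewrite /mobius; case: ifP => _; rewrite ?normr0// normrX normrN1 expr1n. Qed.

Lemma separable_prod_pairwise (F : fieldType) (s : seq {poly F}) :
  separable_poly (\prod_(q <- s) q) -> pairwise (@coprimep F) s.
Proof.
elim: s => [|q s IH] //=; rewrite big_cons separable_mul => /and3P[_ /IH -> cop].
rewrite andbT; elim: s cop {IH} => [|q' s IH]//=.
by rewrite big_cons coprimepMr => /andP[-> /IH].
Qed.

Lemma card_orbit_classes (T : finType) (s : {perm T}) (m : nat) (f : T -> 'I_m) :
  (forall a, exists i, f i = a) ->
  (forall i j, (f i == f j) = (j \in porbit s i)) -> #|porbits s| = m.
Proof.
move=> fs fE; rewrite -[RHS]card_ord.
have /fin_all_exists[g gK] := fs.
have -> : porbits s = [set porbit s (g a) | a : 'I_m].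
  apply/setP => O; apply/imsetP/imsetP => -[x _ ->]; last by exists (g x).
  exists (f x) => //; apply/eqP; rewrite eq_porbit_mem.
  by rewrite -fE gK.
rewrite card_imset// => a b /eqP; rewrite eq_porbit_mem -fE !gK => /eqP.
by [].
Qed.

Section Stickelberger.
Variables (p n : nat) (g : {poly 'F_p}).
Hypotheses (pp : prime p) (po : odd p) (sg : size g = n.+1).

(** The lower coefficients of the monic polynomial [a ^ (n - 1) * g (X / a)], for [g] of degree [n]
    with leading coefficient [a]; its roots are those of [g] multiplied by [a]. *)
Definition monic_coefs (R : comNzRingType) (g : {poly R}) (i : 'I_n) : R :=
  g`_i * g`_n ^+ (n.-1 - i).

(** Stickelberger's theorem. Frobenius permutes the roots and its cycles are the root sets of the
    irreducible factors, so the number of factors has the parity of [n] plus that of the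
    permutation. It multiplies the Vandermonde determinant [V] by the sign, but it is also the
    [p]-th power, so the sign is [V ^ (p - 1)], the quadratic character of the discriminant. *)
Lemma mobius_disc : disc (monic_coefs g) != 0 ->
  exists b : bool, disc (monic_coefs g) ^+ (p.-1)./2 = (-1) ^+ b
    /\ mobius g = (-1) ^+ (n + b).
Proof.
move=> D0.
have [K [iota _]] := countable_algebraic_closure 'F_p.
have chK : p \in [pchar K].
  by rewrite (fmorph_pchar iota) pchar_Fp.
have a0E : lead_coef g = g`_n by rewrite lead_coefE sg.
have g0 : g != 0 by rewrite -size_poly_eq0 sg.
have [r Dr] := closed_field_poly_normal (map_poly iota g).
have sr : size r = n.
  have := congr1 (fun q : {poly _} => size q) Dr.
  by rewrite size_map_poly sg size_scale ?lead_coef_eq0 ?map_poly_eq0// size_prod_XsubC => -[].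
rewrite lead_coef_map a0E in Dr.
pose x (i : 'I_n) := r`_i.
have prx (u : K) : \prod_(z <- r) ('X - (u * z)%:P) = \prod_j ('X - (u * x j)%:P).
  by rewrite (big_nth 0) sr big_mkord.
pose V := \det (Vandermonde n (\row_i (iota g`_n * x i))).
have VE : V ^+ 2 = iota (disc (monic_coefs g)).
  rewrite -(disc_roots (fun i => iota g`_n * x i)) disc_rmorph; congr (disc _).
  apply/funext => i; rewrite -prx coef_prod_scale ?sr; last exact: ltnW.
  rewrite /monic_coefs rmorphM rmorphXn /=.
  have -> : iota g`_i = iota g`_n * (\prod_(z <- r) ('X - z%:P))`_i.
    by rewrite -coefZ -Dr coef_map.
  have -> : (n - i = (n.-1 - i).+1)%N by have := ltn_ord i; lia.
  by rewrite exprS; ring.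
have V0 : V != 0 by rewrite -sqrf_eq0 VE fmorph_eq0.
have xinj : injective x.
  move=> i j xij; apply: contraNeq V0 => ij; rewrite /V det_Vandermonde.
  wlog ltij : i j xij ij / (i < j)%N.
    move=> W; case: (ltngtP i j) => h; [exact: (W i j)|apply: (W j i) => //|].
      by rewrite eq_sym.
    by case/eqP: ij; apply: val_inj.
  by rewrite (bigD1 i)//= (bigD1 j)//= !mxE xij subrr !mul0r.
have mem_r z : (z \in r) = [exists i, x i == z].
  apply/idP/existsP => [zr|[i /eqP <-]]; last by rewrite mem_nth// sr.
  have lt : (index z r < n)%N by rewrite -sr index_mem.
  by exists (Ordinal lt); rewrite /x /= nth_index.
have ur : uniq r.
  apply/(uniqP 0) => i j; rewrite !inE sr => il jl e.
  by have := xinj (Ordinal il) (Ordinal jl) e => /(congr1 val).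
have rootE' z : root (map_poly iota g) z = (z \in r).
  by rewrite Dr rootZ ?root_prod_XsubC// fmorph_eq0 -a0E lead_coef_eq0.
have [phi phiE] : exists phi : {rmorphism K -> K}, forall z, phi z = z ^+ p.
  by exists (pFrobenius_aut chK) => z; exact: pFrobenius_autE.
have phi_iota c : phi (iota c) = iota c.
  by rewrite phiE -rmorphXn -[X in _ ^+ X](card_Fp pp) expf_card.
have phi_map (q : {poly 'F_p}) : map_poly phi (map_poly iota q) = map_poly iota q.
  by apply/polyP => i; rewrite !coef_map /= phi_iota.
have phi_root (q : {poly 'F_p}) z : root (map_poly iota q) z -> root (map_poly iota q) (phi z).
  by rewrite -[X in root X (phi z)]phi_map fmorph_root.
have /fin_all_exists[s0 s0E] : forall i, exists j, x j = phi (x i).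
  move=> i; have : root (map_poly iota g) (phi (x i)).
    by apply: phi_root; rewrite rootE' mem_r; apply/existsP; exists i.
  by rewrite rootE' mem_r => /existsP[j /eqP]; exists j.
have s0inj : injective s0.
  by move=> i j e; apply: xinj; apply: (fmorph_inj phi); rewrite -!s0E e.
pose s := perm s0inj.
have sE i : x (s i) = phi (x i) by rewrite permE s0E.
have phiV : phi V = (-1) ^+ s * V.
  rewrite /V -det_map_mx mulrC -odd_permV -det_perm -det_mulmx -col_permE; congr (\det _).
  by apply/matrixP => i j; rewrite !mxE rmorphXn rmorphM phi_iota sE.
have Vp1 : V ^+ p.-1 = (-1) ^+ s.
  apply: (mulIf V0); rewrite -exprSr prednK ?prime_gt0// -phiV.
  by rewrite phiE.
have Dh : disc (monic_coefs g) ^+ (p.-1)./2 = (-1) ^+ s.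
  apply: (fmorph_inj iota); rewrite rmorphXn -VE -exprM rmorphXn rmorphN1 -Vp1.
  by congr (_ ^+ _); have := prime_gt1 pp; lia.
exists (odd_perm s); split=> //.
have [irr fs] := irr_factorsP g0; set t := irr_factors g in irr fs.
have sepg : separable_poly g.
  rewrite -(separable_map iota) Dr (eqp_separable (eqp_scale _ _)) ?separable_prod_XsubC//.
  by rewrite fmorph_eq0 -a0E lead_coef_eq0.
have cop : pairwise (@coprimep _) t.
  by apply: separable_prod_pairwise; rewrite -(eqp_separable fs).
have irrt (a : 'I_(size t)) : irreducible_poly t`_a by apply/irr/mem_nth.
have copn (a b : 'I_(size t)) : a != b -> coprimep t`_a t`_b.
  move=> ab; wlog lt : a b ab / (a < b)%N.
    move=> W; case: (ltngtP a b) => h; [exact: W|rewrite coprimep_sym; apply: W => //|].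
      by rewrite eq_sym.
    by case/eqP: ab; apply: val_inj.
  by have /(pairwiseP 0) := cop; apply; rewrite ?inE.
pose rt (i : 'I_n) (a : 'I_(size t)) := root (map_poly iota t`_a) (x i).
have rtu i a b : rt i a -> rt i b -> a = b.
  move=> ra rb; apply/eqP; apply: contraTT rb => /copn.
  rewrite -(coprimep_map iota) => /coprimep_root/(_ ra).
  by [].
have /fin_all_exists[f fE] : forall i, exists a, rt i a.
  move=> i; have : root (map_poly iota g) (x i).
    by rewrite rootE' mem_r; apply/existsP; exists i.
  rewrite (eqp_root (q := map_poly iota (\prod_(q <- t) q))) ?eqp_map//.
  rewrite (big_nth 0) big_mkord rmorph_prod /= => h.
  apply/existsP; apply: contraLR h => /existsPn h.
  by rewrite /root horner_prod; apply/prodf_neq0 => a _; exact: h.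
have fs_ i : f (s i) = f i.
  apply: (rtu (s i)) => //; rewrite /rt sE; apply: phi_root; exact: fE.
have fsur a : exists i, f i = a.
  have : size (map_poly iota t`_a) != 1%N.
    by rewrite size_map_poly; have [+ _] := irrt a; case: size => [|[]].
  move=> /closed_rootP[z rz].
  have : root (map_poly iota g) z.
    rewrite (eqp_root (q := map_poly iota (\prod_(q <- t) q))) ?eqp_map//.
    by rewrite (big_nth 0) big_mkord (bigD1 a)//= rmorphM rootM rz.
  rewrite rootE' mem_r => /existsP[i /eqP xi]; exists i.
  by apply: (rtu i) => //; rewrite /rt xi.
have forb i j : (f i == f j) = (j \in porbit s i).
  apply/eqP/idP => [fij|/porbitP[k ->]]; last first.
    by elim: k => [|k IH]; rewrite ?expg0 ?perm1// expgSr permM fs_.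
  (* The product over one Frobenius orbit has coefficients fixed by Frobenius, so it descends to the
     prime field, where the irreducible factor of any of its roots divides it. Hence the roots of
     one irreducible factor form a single orbit. *)
  pose h := \prod_(k in porbit s i) ('X - (x k)%:P).
  have hphi : map_poly phi h = h.
    rewrite /h rmorph_prod /= [RHS](reindex_inj (@perm_inj _ s)) /=.
    apply: eq_big => k; first rewrite -!eq_porbit_mem.
      by have /eqP -> : porbit s (s k) == porbit s k by rewrite eq_porbit_mem (mem_porbit s 1 k).
    by move=> _; rewrite rmorphB /= map_polyX map_polyC /= sE.
  have [h' hh'] : exists h', h = map_poly iota h'.
    have fixed (c : K) : phi c = c -> exists c', c = iota c'.
      move=> /eqP; rewrite -subr_eq0 => pc.
      have : root (map_poly iota ('X^#|'F_p| - 'X)) c.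
        rewrite (card_Fp pp) rmorphB /= map_polyXn map_polyX /root !hornerE.
        by rewrite -phiE.
      rewrite finField_genPoly rmorph_prod /= /root horner_prod prodf_seq_eq0 => /hasP[c' _ /=].
      rewrite map_polyXsubC !hornerE subr_eq0 => /eqP ->; by exists c'.
    have /choice[cf cfE] : forall k, exists c', h`_k = iota c'.
      by move=> k; apply: fixed; rewrite -[in RHS]hphi coef_map.
    exists (\poly_(k < size h) cf k); apply/polyP => k; rewrite coef_map coef_poly.
    by case: ltnP => lt; [exact: cfE|rewrite (nth_default _ lt); exact: (esym (rmorph0 iota))].
  have rooth k : root h (x k) = (k \in porbit s i).
    rewrite /root horner_prod; apply/prodf_eq0/idP => [[l li]|ki].
      by rewrite !hornerE subr_eq0 => /eqP/xinj ->.
    by exists k => //; rewrite !hornerE subrr.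
  have q_h : t`_(f i) %| h'.
    have [_ id] := irrt (f i); rewrite -(eqp_dvdl _ (id (gcdp t`_(f i) h') _ _)).
    - by rewrite dvdp_gcdr.
    - rewrite -/(coprimep _ _); apply/negP; rewrite -(coprimep_map iota) => /coprimep_root/(_ (fE i)).
      by rewrite -hh' -/(root _ _) => /negP; apply; rewrite rooth porbit_id.
    - exact: dvdp_gcdl.
  rewrite -rooth hh'; rewrite -dvdp_XsubCl.
  apply: (@dvdp_trans _ (map_poly iota t`_(f j))); first by rewrite dvdp_XsubCl; exact: fE.
  by rewrite -fij dvdp_map.
have sizet := card_orbit_classes fsur forb.
rewrite /mobius -/t.
have -> : pairwise (fun q1 q2 => ~~ (q1 %= q2)) t.
  apply/(pairwiseP 0) => a b; rewrite !inE => al bl ab.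
  have := copn (Ordinal al) (Ordinal bl); rewrite -val_eqE /= ltn_eqF// => /(_ isT) c.
  apply/negP => /eqp_coprimepr; move: c => + e; rewrite -e.
  have [+ _] := irrt (Ordinal al); rewrite coprimepp /= => h1 /eqP h2; by rewrite h2 ltnn in h1.
rewrite -signr_odd -[X in _ = X]signr_odd; congr (_ ^+ (nat_of_bool _)).
rewrite -sizet oddD oddb /odd_perm card_ord.
by case: (odd n); case: (odd _).
Qed.
End Stickelberger.

(** As their product is a square prime to [p], the discriminant and [d] have the same quadratic
    character: the Moebius value depends on [n], [d] and [p] only. *)
Lemma mobius_sign (p n : nat) (f : {poly int}) (d m : int) :
  prime p -> odd p -> size f = n.+1 -> ~~ (p %| f`_n)%Z ->
  disc (@monic_coefs n _ f) * d = m ^+ 2 -> ~~ (p %| disc (@monic_coefs n _ f) * d)%Z ->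
  mobius (map_poly (intr : int -> 'F_p) f) =
    if d%:~R ^+ (p.-1)./2 == 1 :> 'F_p then (-1) ^+ n else (-1) ^+ n.+1.
Proof.
move=> pp po sf a0 Dd Dp; set g := map_poly _ _.
have z0 (z : int) : (z%:~R == 0 :> 'F_p) = (p %| z)%Z by exact: intr_Fp_eq0.
have sg : size g = n.+1.
  by rewrite size_map_poly_id0 // lead_coefE sf z0.
have DE : disc (@monic_coefs n _ g) = (disc (@monic_coefs n _ f))%:~R.
  rewrite (disc_rmorph (intr : int -> 'F_p)); congr disc; apply/funext => i.
  by rewrite /monic_coefs !coef_map /= rmorphM rmorphXn.
have D0 : disc (@monic_coefs n _ g) != 0.
  by rewrite DE z0; apply: contra Dp => h; exact: dvdz_mulr.
have [b [hb ->]] := mobius_disc pp po sg D0.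
have dE : d%:~R ^+ (p.-1)./2 = (-1) ^+ b :> 'F_p.
  have e : ((-1) ^+ b * d%:~R ^+ (p.-1)./2 : 'F_p) = 1.
    rewrite -hb -exprMn DE -rmorphM Dd rmorphXn -exprM.
    have -> : (2 * (p.-1)./2 = p.-1)%N by have := prime_gt1 pp; lia.
    have m0 : m%:~R != 0 :> 'F_p by apply: contra Dp; rewrite z0 Dd expr2 => h; exact: dvdz_mulr.
    apply: (mulIf m0); rewrite -exprSr prednK ?prime_gt0// mul1r.
    by rewrite -[X in _ ^+ X](card_Fp pp) expf_card.
  by rewrite -[LHS](signrMK b) e mulr1.
rewrite dE; case: b {hb dE} => /=; rewrite ?addn1 ?addn0 ?expr0 ?eqxx// expr1.
case: eqP => // /eqP; rewrite eq_sym -subr_eq0 opprK -(natrD _ 1 1) => /eqP e.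
have := dvdn_pcharf (pchar_Fp pp) 2; rewrite e eqxx dvdn_prime2//.
by move=> /eqP pe; rewrite pe in po.
Qed.

(** * Counting primes *)

Section PrimeCounts.
Local Open Scope nat_scope.

(** In Legendre's formula each power of [p] contributes at most 1 to the valuation, and nothing once
    it exceeds [2 m]. *)
Lemma pfactor_central_binomial (p m : nat) : prime p -> 0 < m ->
  p ^ logn p 'C(m.*2, m) <= m.*2.
Proof.
move=> pp m0; have p1 := prime_gt1 pp.
suff le : logn p 'C(m.*2, m) <= trunc_log p m.*2.
  by apply: leq_trans (trunc_logP p1 _); rewrite ?leq_pexp2l ?double_gt0// prime_gt0.
have fE : m.*2`! = 'C(m.*2, m) * (m`! * m`!).
  have le : m <= m.*2 by rewrite -addnn leq_addr.
  by rewrite -(bin_fact le) (_ : m.*2 - m = m)//; lia.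
have := congr1 (logn p) fE.
rewrite !lognM ?muln_gt0 ?fact_gt0 ?bin_gt0//; last by rewrite -addnn leq_addr.
rewrite !logn_fact//.
have -> : \sum_(1 <= k < m.+1) m %/ p ^ k = \sum_(1 <= k < m.*2.+1) m %/ p ^ k.
  rewrite [RHS](@big_cat_nat _ _ _ m.+1)//=; last by rewrite ltnS -addnn leq_addr.
  rewrite [X in _ = _ + X]big_nat_cond [X in _ = _ + X]big1 ?addn0// => k /andP[/andP[h _] _].
  by rewrite divn_small// (leq_trans h)// ltnW// ltn_expl.
rewrite addnn => e.
have e2 : \sum_(1 <= k < m.*2.+1) m.*2 %/ p ^ k <=
   trunc_log p m.*2 + (\sum_(1 <= k < m.*2.+1) m %/ p ^ k).*2.
  have -> : (\sum_(1 <= k < m.*2.+1) m %/ p ^ k).*2 = \sum_(1 <= k < m.*2.+1) (m %/ p ^ k).*2.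
    by rewrite -mul2n big_distrr /=; apply: eq_bigr => k _; rewrite mul2n.
  apply: (@leq_trans (\sum_(1 <= k < m.*2.+1) ((p ^ k <= m.*2) + (m %/ p ^ k).*2))).
    apply: leq_sum => k _; have pk : 0 < p ^ k by rewrite expn_gt0 prime_gt0.
    have [le|lt] := leqP (p ^ k) m.*2.
      by rewrite /= -ltnS ltn_divLR//; have := ltn_ceil m pk; nia.
    by rewrite divn_small.
  rewrite big_split /= leq_add2r.
  apply: (@leq_trans (\sum_(1 <= k < m.*2.+1) (k <= trunc_log p m.*2))).
    apply: leq_sum => k _; case: (leqP (p ^ k)) => // le; rewrite lt0b.
    by apply: trunc_log_max.
  elim: m.*2 (trunc_log p _) => [|N IH] t; first by rewrite big_nil.
  suff -> : \sum_(1 <= k < N.+2) (k <= t) = minn N.+1 t by exact: geq_minr.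
  elim: N {IH} => [|N IH]; first by rewrite big_nat1; lia.
  by rewrite big_nat_recr//= IH; lia.
by rewrite e leq_add2r in e2.
Qed.

Definition primes_upto (X : nat) : seq nat := [seq p <- iota 1 X | prime p].

Lemma central_binomial_le (m : nat) : 0 < m ->
  'C(m.*2, m) <= m.*2 ^ size (primes_upto m.*2).
Proof.
move=> m0; have b0 : 0 < 'C(m.*2, m) by rewrite bin_gt0 -addnn leq_addr.
rewrite {1}(prod_prime_decomp b0) prime_decompE big_map /=.
have sub : {subset primes 'C(m.*2, m) <= primes_upto m.*2}.
  move=> p pp; rewrite mem_filter mem_iota; move: (pp); rewrite mem_primes => /and3P[ppr _ _].
  rewrite ppr /= prime_gt0// ltnS; apply: leq_trans (pfactor_central_binomial ppr m0).
  have : 0 < logn p 'C(m.*2, m) by rewrite logn_gt0.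
  by case: (logn p _) => // k _; rewrite expnS leq_pmulr// expn_gt0 prime_gt0.
apply: (@leq_trans (\prod_(p <- primes 'C(m.*2, m)) m.*2)).
  rewrite !big_seq; elim/big_ind2: _ => // [a b c d h1 h2|p]; first exact: leq_mul.
  by rewrite mem_primes => /andP[pp _]; exact: pfactor_central_binomial.
rewrite big_const_seq count_predT iter_muln_1 leq_pexp2l ?double_gt0//.
by rewrite uniq_leq_size ?primes_uniq.
Qed.

Lemma central_binomial_ge (m : nat) : 2 ^ m.*2 <= m.*2.+1 * 'C(m.*2, m).
Proof.
rewrite -[2]/(1 + 1) expnDn.
under eq_bigr do rewrite !exp1n !muln1.
rewrite -[X in X * _](card_ord m.*2.+1) -sum_nat_const leq_sum// => i _.
have up j : j < m -> 'C(m.*2, j) <= 'C(m.*2, j.+1).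
  move=> jm; rewrite -(leq_pmul2l (ltn0Sn j)) mul_bin_left leq_mul2r.
  by apply/orP; right; lia.
have low j : j <= m -> 'C(m.*2, j) <= 'C(m.*2, m).
  move=> jm; rewrite -(subKn jm); elim: (m - j) (leq_subr j m) => [|k IH] km; first by rewrite subn0.
  apply: leq_trans (up _ _) _; first by lia.
  by rewrite subnSK// IH// ltnW.
have [le|lt] := leqP i m; first exact: low.
rewrite -bin_sub; last by rewrite -ltnS.
by apply: low; lia.
Qed.

Lemma log_small (c : nat) : exists W0, forall W, W0 <= W -> c * (up_log 2 W).+1 <= W.
Proof.
exists (2 ^ (20 * c).+3) => W hW.
set l := up_log 2 W.
have W1 : 1 < W by apply: leq_trans hW; rewrite (@leq_exp2l 2 1).
have /andP[lW Wl] := up_log_bounds (isT : 1 < 2) W1.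
have cl : (20 * c).+3 <= l by rewrite -(@leq_exp2l 2)//; exact: leq_trans hW Wl.
apply: leq_trans lW => //.
have : ((l.-1)./2).+1 ^ 2 <= 2 ^ l.-1.
  apply: (@leq_trans (2 ^ ((l.-1)./2 * 2))).
    by rewrite expnM leq_exp2r// ltn_expl.
  by rewrite leq_exp2l//; lia.
by rewrite -/l; nia.
Qed.

(** Chebyshev's lower bound from the central binomial coefficient loses a logarithm of [W]. Giving
    away a whole factor [W] instead leaves room to discard the primes up to [W ^ (e - 1)], and no
    logarithm enters the later exponents. *)
Lemma many_primes (e : nat) : 1 < e -> exists W0, forall W, W0 <= W ->
  2 * W ^ e.-1 <= size [seq p <- primes_upto (W ^ e) | W ^ e.-1 < p].
Proof.
move=> e1; have [W0 HW0] := log_small (10 * e); exists (W0 + 2) => W hW.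
have {HW0} hl := HW0 W ltac:(lia).
set l := up_log 2 W in hl.
have W1 : 1 < W by lia.
have [_ Wl] := andP (up_log_bounds (isT : 1 < 2) W1); rewrite -/l in Wl.
have split_ : size (primes_upto (W ^ e)) <= size [seq p <- primes_upto (W ^ e) | W ^ e.-1 < p] + W ^ e.-1.
  rewrite -(count_predC (fun p => W ^ e.-1 < p) (primes_upto _)) size_filter leq_add2l.
  rewrite -size_filter -[X in _ <= X](size_iota 1); apply: uniq_leq_size.
    by rewrite !filter_uniq// iota_uniq.
  by move=> p; rewrite !mem_filter !mem_iota /= -leqNgt; lia.
suff h : 3 * W ^ e.-1 <= size (primes_upto (W ^ e)) by lia.
rewrite leqNgt; apply/negP => lt.
set m := (W ^ e)./2.
have Xe : W ^ e = W * W ^ e.-1 by rewrite -expnS prednK//; lia.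
have Wp : 0 < W ^ e.-1 by rewrite expn_gt0; lia.
have m0 : 0 < m by rewrite /m; nia.
have mX : m.*2 <= W ^ e by rewrite /m; lia.
have szm : size (primes_upto m.*2) <= size (primes_upto (W ^ e)).
  apply: uniq_leq_size; first by rewrite filter_uniq// iota_uniq.
  by move=> p; rewrite !mem_filter !mem_iota; lia.
have Xl : W ^ e <= 2 ^ (l * e) by rewrite expnM leq_exp2r//; lia.
have : 2 ^ m.*2 <= 2 ^ (l * e * (3 * W ^ e.-1).+1).
  apply: leq_trans (central_binomial_ge m) _.
  apply: (@leq_trans ((W ^ e).+1 * (W ^ e) ^ (3 * W ^ e.-1).-1)).
    apply: leq_mul; first by lia.
    apply: leq_trans (central_binomial_le m0) _.
    apply: (@leq_trans (m.*2 ^ (3 * W ^ e.-1).-1)); first by rewrite leq_pexp2l ?double_gt0//; lia.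
    by rewrite leq_exp2r//; lia.
  apply: (@leq_trans ((W ^ e) ^ (3 * W ^ e.-1).+1)).
    have -> : (3 * W ^ e.-1).+1 = 2 + (3 * W ^ e.-1).-1 by lia.
    by rewrite expnD leq_mul2r; apply/orP; right; nia.
  by rewrite [X in _ <= X]expnM leq_exp2r.
rewrite leq_exp2l// => h.
have : W * W ^ e.-1 <= (l * e * 4 + 1) * W ^ e.-1.
  have := odd_double_half (W ^ e); rewrite -/m Xe; nia.
rewrite leq_mul2r; nia.
Qed.

End PrimeCounts.

(** * Elementary counting lemmas *)

Lemma size_le_cover_sum (A B : eqType) (Rl : A -> B -> bool) (s : seq A) (D : seq B) :
  (forall a, a \in s -> has (Rl a) D) ->
  (size s <= \sum_(b <- D) size [seq a <- s | Rl a b])%N.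
Proof.
move=> H1; under eq_bigr do rewrite size_filter -sum1_count big_mkcond.
rewrite exchange_big /= -sum1_size !big_seq; apply: leq_sum => a /H1.
by rewrite -big_mkcond sum1_count -has_count.
Qed.

Local Open Scope nat_scope.

Lemma exp_size_le_prod (T : nat) (s : seq nat) : all (fun p => T < p) s -> T ^ size s <= \prod_(p <- s) p.
Proof.
elim: s => [|p s IH] /=; first by rewrite big_nil.
by move=> /andP[Tp /IH h]; rewrite big_cons expnS leq_mul// ltnW.
Qed.

(** The prime factors above the constant [T] are so few that they account for at most the square
    root of [Z]; the others number at most [T], which costs a constant. *)
Lemma exp_omega_small (c B : nat) : 0 < c -> exists Z0, forall Z m, Z0 <= Z -> 0 < m ->
  m <= Z ^ B -> c ^ size (primes m) <= Z.
Proof.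
move=> c0; pose T := c ^ (2 * B.+1); exists (c ^ (2 * T)).+1 => Z m hZ m0 mZ.
have Z0 : 0 < Z by lia.
pose big := [seq p <- primes m | T < p].
have bigle : T ^ size big <= m.
  apply: (@leq_trans (\prod_(p <- big) p)).
    exact/exp_size_le_prod/filter_all.
  rewrite [leqRHS](prod_prime_decomp m0) prime_decompE big_map /= /big big_filter big_mkcond /=.
  rewrite !big_seq; elim/big_ind2: _ => // [a b c' d h1 h2|p]; first exact: leq_mul.
  move=> pm; case: ifP => _; last by rewrite expn_gt0 (prime_gt0 _)//; move: pm; rewrite mem_primes => /andP[].
  have : 0 < logn p m by rewrite logn_gt0.
  have pp : 0 < p by move: pm; rewrite mem_primes => /andP[/prime_gt0].
  by case: (logn p m) => // e _; rewrite expnS leq_pmulr// expn_gt0 pp.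
have small : size [seq p <- primes m | ~~ (T < p)] <= T.
  rewrite -[X in _ <= X](size_iota 1); apply: uniq_leq_size; first by rewrite filter_uniq// primes_uniq.
  move=> p; rewrite mem_filter mem_iota -leqNgt mem_primes => /andP[pT /and3P[/prime_gt0 p0 _ _]].
  by rewrite p0 add1n ltnS.
have cbig : c ^ (2 * size big) <= Z.
  rewrite -(@leq_exp2r _ _ B.+1)//; apply: (@leq_trans m).
    by apply: leq_trans bigle; rewrite /T -!expnM leq_pexp2l//; nia.
  by apply: leq_trans mZ _; rewrite leq_pexp2l.
have e : size (primes m) = size big + size [seq p <- primes m | ~~ (T < p)].
  by rewrite !size_filter count_predC.
rewrite -(@leq_exp2r _ _ 2)// -expnM e mulnDl expnD expnS expn1 leq_mul//; first by rewrite mulnC.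
by apply: leq_trans (ltnW hZ); rewrite leq_pexp2l// mulnC leq_mul2l small orbT.
Qed.

Definition odd_primes (D : nat) : seq nat := [seq p <- primes D | odd (logn p D)].

Lemma odd_primes_square (D : nat) : 0 < D ->
  exists m, D * \prod_(p <- odd_primes D) p = m ^ 2.
Proof.
move=> D0; exists (\prod_(p <- primes D) p ^ uphalf (logn p D)).
rewrite big_filter big_mkcond /= {1}(prod_prime_decomp D0) prime_decompE big_map /= -big_split /=.
rewrite expnS expn1 -big_split /=; apply: eq_bigr => p _; rewrite -expnD.
case: ifP => o; first by rewrite -expnSr; congr (_ ^ _); lia.
by rewrite muln1; congr (_ ^ _); lia.
Qed.

Lemma prod_odd_primes_dvd (D : nat) : 0 < D -> (\prod_(p <- odd_primes D) p) %| D.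
Proof.
move=> D0; rewrite big_filter big_mkcond /= {3}(prod_prime_decomp D0) prime_decompE big_map /=.
elim/big_ind2: _ => // [a b c d|p _]; first exact: dvdn_mul.
by case: ifP => // o; apply: dvdn_exp => //; case: (logn p D) o.
Qed.

Lemma prod_primes_uniq_primes (ps : seq nat) : uniq ps -> all prime ps ->
  primes (\prod_(p <- ps) p) =i ps.
Proof.
elim: ps => [|p ps IH] /=; first by rewrite big_nil.
move=> /andP[pps ups] /andP[pp aps] q.
have pos : 0 < \prod_(j <- ps) j.
  by rewrite big_seq; apply: prodn_cond_gt0 => j /(allP aps)/prime_gt0.
have e1 := IH ups aps q; have e2 := primesM q (prime_gt0 pp) pos.
rewrite big_cons inE; apply: etrans e2 _; rewrite e1; congr (_ || _).
by rewrite primes_prime// inE.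
Qed.

Lemma size_bitseqs (w : nat) (t : seq bitseq) : uniq t -> (forall b, b \in t -> size b = w) ->
  size t <= 2 ^ w.
Proof.
move=> ut ht; pose f (b : bitseq) : w.-tuple bool := insubd [tuple of nseq w false] b.
rewrite -(size_map f) -[2]card_bool -card_tuple -(card_uniqP _) ?max_card//.
have fE b : b \in t -> val (f b) = b by move=> bt; rewrite val_insubd ht ?eqxx.
by rewrite map_inj_in_uniq// => b c bt ct /(congr1 val); rewrite !fE.
Qed.

(** Either one element already exceeds [X], or all are at most [X] and a product built up one factor
    at a time cannot jump over the interval. *)
Lemma subproduct_between (X : nat) (ps : seq nat) : uniq ps -> all (fun p => p <= X ^ 2) ps ->
  0 < X -> X < \prod_(p <- ps) p ->
  exists qs, [/\ uniq qs, {subset qs <= ps} & X < \prod_(p <- qs) p <= X ^ 2].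
Proof.
move=> ups aps X0; have [/hasP[p pps Xp] _|/hasPn nh] := boolP (has (fun p => X < p) ps).
  exists [:: p]; split=> //; last by rewrite big_seq1 Xp (allP aps).
  by move=> q; rewrite inE => /eqP ->.
elim: ps ups nh {aps} => [|p ps IH] /=; first by rewrite big_nil => *; lia.
move=> /andP[pps ups] nh; rewrite big_cons => lt.
have [h|h] := ltnP X (\prod_(j <- ps) j).
  have [q qps|qs [uq sq bq]] := IH ups _ h; first by apply: nh; rewrite inE qps orbT.
  by exists qs; split=> // q /sq; rewrite inE => ->; rewrite orbT.
exists (p :: ps); split=> //=; first by rewrite pps.
rewrite big_cons lt /= expnS expn1 leq_mul//.
by rewrite leqNgt nh ?mem_head.
Qed.

Lemma exists_root_above (N x : nat) : 0 < N -> exists W, x < W ^ N /\ W.-1 ^ N <= x.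
Proof.
move=> N0; have ex : exists W, x < W ^ N by exists x.+1; rewrite (leq_trans (ltnSn x))// -{1}(expn1 x.+1) leq_pexp2l.
case: (ex_minnP ex) => W hW min; exists W; split=> //.
rewrite leqNgt; apply/negP => /min; case: W hW {min} => [|W _ /=]; first by rewrite exp0n.
by rewrite ltnn.
Qed.

Local Open Scope ring_scope.

Lemma sum_inv_sq (F : realFieldType) (a b : nat) : (0 < a)%N ->
  \sum_(a.+1 <= c < b.+1) (c%:R ^- 2 : F) <= a%:R^-1.
Proof.
move=> a0; have [ab|ba] := leqP a b; last by rewrite big_geq ?invr_ge0 ?ler0n//; lia.
have : \sum_(a.+1 <= c < b.+1) (c%:R ^- 2 : F) <= a%:R^-1 - b%:R^-1.
  elim: b ab => [|b IH] ab; first by rewrite big_geq ?subr_ge0 ?lef_pV2 ?posrE ?ltr0n ?ler_nat//; lia.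
  have [e|ne] := eqVneq a b.+1; first by rewrite e big_geq ?subrr.
  have ab' : (a <= b)%N by lia.
  rewrite big_nat_recr//=; apply: le_trans (lerD (IH ab') (lexx _)) _.
  have b0 : (0 : F) < b%:R by rewrite ltr0n; lia.
  have bs : b.+1%:R = b%:R + 1 :> F by rewrite -natr1.
  rewrite bs; suff : (b%:R + 1) ^- 2 <= b%:R^-1 - (b%:R + 1)^-1 :> F by lra.
  have b1 : b%:R + 1 != 0 :> F by rewrite gt_eqF// ltr_wpDr.
  have -> : b%:R^-1 - (b%:R + 1)^-1 = (b%:R * (b%:R + 1))^-1 :> F.
    by field; rewrite b1 gt_eqF.
  rewrite lef_pV2 ?posrE ?mulr_gt0 ?exprn_gt0 ?ltr_wpDr//.
  by move: (b%:R) b0 => t t0; nra.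
by move=> h; apply: le_trans h _; rewrite lerBlDr lerDl invr_ge0 ler0n.
Qed.

Lemma sum_inv_sq2 (F : realFieldType) (b : nat) : \sum_(1 <= c < b.+1) (c%:R ^- 2 : F) <= 2.
Proof.
case: b => [|b]; first by rewrite big_geq.
rewrite big_ltn// expr1n invr1 -[2]/(1 + 1) lerD2l.
by have := @sum_inv_sq F 1 b.+1 isT; rewrite invr1.
Qed.

(** * Integrality and size of products of roots *)

Section IntegralCoefficients.
Variable K : fieldType.
Implicit Types (q : {poly K}) (al : K).

Lemma intg_lead_root (g : {poly K}) al : (1 < size g)%N -> root g al ->
  (forall i, intg g`_i) -> intg (lead_coef g * al).
Proof.
move=> sg /rootP rg ig; set a := lead_coef g; pose n := (size g).-2.
have sgE : size g = n.+2 by rewrite /n; case: (size g) sg => [|[]].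
pose h : {poly K} := \poly_(i < n.+2) (if i == n.+1 then 1 else g`_i * a ^+ (n - i)).
have sh : size h = n.+2 by rewrite size_poly_eq// eqxx oner_neq0.
apply: (@integral_root_monic _ _ (intr : {rmorphism int -> K}) _ h).
- by rewrite monicE lead_coefE sh coef_poly ltnSn eqxx.
- apply/rootP; rewrite horner_poly big_ord_recr /= eqxx mul1r.
  have -> : (a * al) ^+ n.+1 = a ^+ n * (a * al ^+ n.+1) by rewrite exprMn exprSr mulrA.
  transitivity (a ^+ n * g.[al]); last by rewrite rg mulr0.
  rewrite [X in _ = _ * X]horner_coef sgE [X in _ = _ * X]big_ord_recr /= mulrDr mulr_sumr.
  congr (_ + _); last by rewrite /a lead_coefE sgE mulrA.
  apply: eq_bigr => i _; have /= := ltn_ord i; rewrite ltnS => lin.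
  rewrite ltn_eqF// exprMn mulrA -[g`_i * _ * _]mulrA -exprD subnK//.
  by rewrite [a ^+ n * _]mulrA [g`_i * _]mulrC.
apply/(integral_poly (intr : {rmorphism int -> K})) => i; rewrite -/(intg _).
rewrite coef_poly; case: ltnP => _; last exact: (intg_int _ 0).
case: ifP => _; first exact: (intg_int _ 1).
by apply: intgM => //; apply: intgX; exact: ig.
Qed.

(** Induction on the degree: the leading coefficient of [q] times [al] is integral by
    [intg_lead_root], so removing the leading term of [q] keeps the product with the linear factor
    integral. *)
Lemma intg_quotient_root q al : (forall i, intg (('X - al%:P) * q)`_i) -> forall i, intg q`_i.
Proof.
have [m] := ubnP (size q); elim: m q => // m IH q sq iq.
have [->|q0] := eqVneq q 0; first by move=> i; rewrite coef0; exact: (intg_int _ 0).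
pose g := ('X - al%:P) * q; pose n := (size q).-1.
have sqE : size q = n.+1 by rewrite /n polySpred.
have sg : size g = n.+2 by rewrite size_monicM ?monicXsubC// size_XsubC sqE.
have lg : lead_coef g = lead_coef q by rewrite lead_coefM lead_coefXsubC mul1r.
have rg : root g al by rewrite rootE hornerM !hornerE subrr mul0r.
have ial : intg (lead_coef q * al) by rewrite -lg; apply: intg_lead_root => //; rewrite sg.
have ilq : intg (lead_coef q) by rewrite -lg lead_coefE; exact: iq.
pose q' := q - (lead_coef q) *: 'X^n.
have sq' : (size q' <= n)%N.
  apply/leq_sizeP => j nj; rewrite coefB coefZ coefXn.
  have [->|nj'] := eqVneq j n; first by rewrite mulr1 lead_coefE sqE subrr.
  by rewrite mulr0 subr0 nth_default// sqE ltn_neqAle eq_sym nj'.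
have iq' i : intg q'`_i.
  apply: IH => [|j]; first by rewrite (leq_ltn_trans sq')// -ltnS -sqE.
  have -> : ('X - al%:P) * q' = g - lead_coef q *: 'X^(n.+1) + (lead_coef q * al) *: 'X^n.
    rewrite /q' mulrBr -/g -addrA; congr (_ + _).
    by rewrite exprS -!mul_polyC polyCM; ring.
  rewrite coefD coefB !coefZ !coefXn; apply: intgD.
    by apply: intgB => //; apply: intgM => //; case: (_ == _); [exact: (intg_int _ 1)|exact: (intg_int _ 0)].
  by apply: intgM => //; case: (_ == _); [exact: (intg_int _ 1)|exact: (intg_int _ 0)].
move=> i; rewrite -[q](subrK (lead_coef q *: 'X^n)) coefD coefZ coefXn.
apply: intgD => //; apply: intgM => //.
by case: (_ == _); [exact: (intg_int _ 1)|exact: (intg_int _ 0)].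
Qed.

(** Each linear factor is either divided out or replaced by its value at the integer [q j], and both
    operations keep the coefficients integral. For [q = 0] this is the classical fact that the
    leading coefficient times any subproduct of the roots is integral. *)
Lemma intg_partial_prod (I : Type) (s : seq I) (al : I -> K) (q : I -> int) (B : pred I) (A : K) :
  (forall i, intg (A *: \prod_(j <- s) ('X - (al j)%:P))`_i) ->
  intg (A * \prod_(j <- s | B j) ((q j)%:~R - al j)).
Proof.
elim: s A => [|j s IH] A; first by rewrite !big_nil mulr1 => /(_ 0%N); rewrite coefZ coef1 mulr1.
rewrite !big_cons => iA.
have iQ : forall i, intg (A *: \prod_(j <- s) ('X - (al j)%:P))`_i.
  by apply: (@intg_quotient_root _ (al j)) => i; rewrite -scalerAr.
case: (B j); last exact: IH.
rewrite mulrA; apply: IH => i.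
have -> : (A * ((q j)%:~R - al j)) *: \prod_(j <- s) ('X - (al j)%:P) =
  A *: (('X - (al j)%:P) * \prod_(j <- s) ('X - (al j)%:P)) -
  ('X - (q j)%:~R%:P) * (A *: \prod_(j <- s) ('X - (al j)%:P)).
  by rewrite -!mul_polyC polyCM polyCB; ring.
rewrite coefB; apply: intgB => //.
rewrite mulrBl coefB coefXM coefCM; apply: intgB; last by apply: intgM => //; exact: intg_int.
by case: (i == 0)%N; [exact: (intg_int _ 0)|].
Qed.

Lemma intg_coef_prod (I : eqType) (s : seq I) (w : I -> K) (A : K) : uniq s ->
  (forall e : I -> K, (forall i, e i = 1 \/ e i = w i) -> intg (A * \prod_(i <- s) e i)) ->
  forall i, intg (A *: \prod_(j <- s) ('X - (w j)%:P))`_i.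
Proof.
elim: s A => [|j s IH] A.
  move=> _ /(_ (fun=> 1) (fun=> or_introl erefl)); rewrite !big_nil mulr1 => iA i.
  by rewrite coefZ coef1; apply: intgM => //; case: (i == 0)%N; [exact: (intg_int _ 1)|exact: (intg_int _ 0)].
rewrite cons_uniq => /andP[js us] iA i.
have ext (x : K) : x = 1 \/ x = w j -> forall e : I -> K, (forall i, e i = 1 \/ e i = w i) ->
    intg (A * x * \prod_(i <- s) e i).
  move=> hx e he; have := iA (fun i => if i == j then x else e i).
  rewrite big_cons eqxx mulrA => H; rewrite (eq_big_seq (fun i => if i == j then x else e i)).
    by apply: H => i'; case: eqP => [->|].
  by move=> i' i's; case: eqP => // e'; move: js; rewrite -e' i's.
rewrite big_cons.
have -> : A *: (('X - (w j)%:P) * \prod_(j <- s) ('X - (w j)%:P)) =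
  'X * (A *: \prod_(j <- s) ('X - (w j)%:P)) - (A * w j) *: \prod_(j <- s) ('X - (w j)%:P).
  by rewrite -!mul_polyC polyCM; ring.
rewrite coefB coefXM; apply: intgB; last by apply: IH => // e he; apply: ext => //; right.
case: (i == 0)%N; first exact: (intg_int _ 0).
by apply: IH => // e he; rewrite -[A]mulr1; apply: ext => //; left.
Qed.

(* Each [z] contributes [(v z - v' z) * ('X - w z)]; the four terms of this
   product are distributed over two factors, of which the first only involves
   [v] and [w] and the second only [v'] and [w]. *)
Lemma intg_mixed_prod (I : eqType) (s : seq I) (v v' w : I -> K) (A A' : K) : uniq s ->
  (forall e : I -> K, (forall i, [\/ e i = 1, e i = v i | e i = w i]) -> intg (A * \prod_(i <- s) e i)) ->
  (forall e : I -> K, (forall i, [\/ e i = 1, e i = v' i | e i = w i]) -> intg (A' * \prod_(i <- s) e i)) ->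
  forall i, intg ((A * A' * \prod_(j <- s) (v j - v' j)) *: \prod_(j <- s) ('X - (w j)%:P))`_i.
Proof.
elim: s A A' => [|j s IH] A A'.
  move=> _ /(_ (fun=> 1) (fun=> Or31 _ _ erefl)); rewrite !big_nil mulr1 => iA.
  move=> /(_ (fun=> 1) (fun=> Or31 _ _ erefl)) iA' i.
  rewrite !big_nil in iA' *; rewrite mulr1 in iA'; rewrite mulr1 coefZ coef1; apply: intgM; first exact: intgM.
  by case: (i == 0)%N; [exact: (intg_int _ 1)|exact: (intg_int _ 0)].
rewrite cons_uniq => /andP[js us] iA iA' i.
have ext (B : K) (u : I -> K) :
    (forall e : I -> K, (forall i, [\/ e i = 1, e i = u i | e i = w i]) -> intg (B * \prod_(i <- j :: s) e i)) ->
    forall x, [\/ x = 1, x = u j | x = w j] -> forall e : I -> K,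
    (forall i, [\/ e i = 1, e i = u i | e i = w i]) -> intg (B * x * \prod_(i <- s) e i).
  move=> iB x hx e he; have := iB (fun i => if i == j then x else e i).
  rewrite big_cons eqxx mulrA => H; rewrite (eq_big_seq (fun i => if i == j then x else e i)).
    by apply: H => i'; case: eqP => [->|].
  by move=> i' i's; case: eqP => // e'; move: js; rewrite -e' i's.
pose T B B' := (B * B' * \prod_(j <- s) (v j - v' j)) *: \prod_(j <- s) ('X - (w j)%:P).
have iT B B' : [\/ B = 1, B = v j | B = w j] -> [\/ B' = 1, B' = v' j | B' = w j] ->
    forall i, intg (T (A * B) (A' * B'))`_i.
  by move=> hB hB'; apply: IH => // e he; apply: ext he => //.
rewrite !big_cons.
have -> : (A * A' * ((v j - v' j) * \prod_(j <- s) (v j - v' j))) *: (('X - (w j)%:P) * \prod_(j <- s) ('X - (w j)%:P)) =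
  'X * T (A * v j) (A' * 1) - T (A * v j) (A' * w j) - 'X * T (A * 1) (A' * v' j) + T (A * w j) (A' * v' j).
  rewrite /T -!mul_polyC !polyCM !polyCB; ring.
have iX B B' : (forall i, intg (T B B')`_i) -> intg ('X * T B B')`_i.
  by move=> iB; rewrite coefXM; case: (i == 0)%N; [exact: (intg_int _ 0)|].
rewrite coefD !coefB; apply: intgD; first apply: intgB; first apply: intgB.
- by apply: iX; apply: iT; [exact: Or32|exact: Or31].
- by apply: iT; [exact: Or32|exact: Or33].
- by apply: iX; apply: iT; [exact: Or31|exact: Or32].
by apply: iT; [exact: Or33|exact: Or32].
Qed.

Lemma intg_gcd (x : K) (m n : int) : intg (x * m%:~R) -> intg (x * n%:~R) -> intg (x * (gcdz m n)%:~R).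
Proof.
move=> im jn; have [u [v <-]] := Bezoutz m n.
rewrite rmorphD !rmorphM /= mulrDr; apply: intgD; rewrite mulrCA; apply: intgM => //; exact: intg_int.
Qed.

Lemma intg_biggcd (x : K) (b : nat) (P : 'I_b -> int) : (forall i, intg (x * (P i)%:~R)) ->
  intg (x * (\big[gcdn/0%N]_(i < b) `|P i|%N)%:R).
Proof.
move=> iP; apply: (big_ind (fun m : nat => intg (x * m%:R))).
- by rewrite mulr0; exact: (intg_int _ 0).
- by move=> m n im jn; exact: (@intg_gcd x m n).
move=> i _; rewrite -[_%:R]/((`|P i|%N : int)%:~R) -[`|P i|%N : int]/(`|P i|%N%:Z) abszE.
have [p0|p0] := leP 0 (P i); first by rewrite ger0_norm.
by rewrite ltr0_norm// rmorphN mulrN; apply: intgN; exact: iP.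
Qed.

End IntegralCoefficients.

(** * Landau's inequality *)

Section Landau.
Variable C : numClosedFieldType.
Implicit Types (q : {poly C}) (al : C).

(** The recursion for the coefficients of a quotient is stable from the top when [al] has absolute
    value at most 1, and from the bottom otherwise. *)
Lemma quotient_root_bound q al (n : nat) (B : C) : (size q <= n)%N ->
  (forall i, `|(('X - al%:P) * q)`_i| <= B) -> forall i, `|q`_i| * (1 + `|al|) <= (2 * n)%N%:R * B.
Proof.
move=> sq hB.
have B0 : 0 <= B := le_trans (normr_ge0 _) (hB 0%N).
have gE i : (('X - al%:P) * q)`_i.+1 = q`_i - al * q`_i.+1.
  by rewrite mulrBl coefB coefXM coefCM.
have g0 : (('X - al%:P) * q)`_0 = - (al * q`_0).
  by rewrite mulrBl coefB coefXM coefCM sub0r.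
have q0 i : (n <= i)%N -> q`_i = 0 by move=> ni; rewrite nth_default// (leq_trans sq).
have [al1|al1] := real_leP (normr_real al) (@real1 C).
  have H d i : (n <= i + d)%N -> `|q`_i| <= d%:R * B.
    elim: d i => [|d IH] i hi; first by rewrite q0 ?normr0 ?mul0r// -[i]addn0.
    have -> : q`_i = (('X - al%:P) * q)`_i.+1 + al * q`_i.+1 by rewrite gE subrK.
    apply: le_trans (ler_normD _ _) _; rewrite (_ : d.+1%:R * B = B + d%:R * B); last by rewrite -natr1 mulrDl mul1r addrC.
    rewrite lerD//.
    rewrite normrM -[X in _ <= X]mul1r ler_pM//.
    by apply: IH; rewrite addSn -addnS.
  move=> i; have h := H n i (leq_addl _ _).
  rewrite natrM -mulrA mulrC ler_pM ?addr_ge0//.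
  by rewrite -[2]/(1 + 1) lerD2l.
have H i : `|q`_i| * `|al| <= i.+1%:R * B.
  elim: i => [|i IH].
    by have := hB 0%N; rewrite g0 normrN normrM mulrC mul1r.
  rewrite -normrM mulrC; have -> : al * q`_i.+1 = q`_i - (('X - al%:P) * q)`_i.+1 by rewrite gE opprB addrC subrK.
  apply: le_trans (ler_normB _ _) _; rewrite (_ : i.+2%:R * B = i.+1%:R * B + B); last by rewrite -natr1 mulrDl mul1r.
  rewrite lerD//.
  apply: le_trans IH; rewrite ler_peMr// ltW//.
move=> i; have [lt|ge] := ltnP i n; last by rewrite q0// normr0 mul0r mulr_ge0.
rewrite natrM -mulrA mulrDr mulr1 -[2]/(1 + 1) [leRHS]mulrDl !mul1r.
have h : `|q`_i| * `|al| <= n%:R * B by apply: le_trans (H i) _; rewrite ler_wpM2r// ler_nat.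
by rewrite lerD//; apply: le_trans h; rewrite ler_peMr// ltW.
Qed.

(** The roots are divided out one by one, each leaving its weight in the constant [A]. The loss of
    [2 n] per root is harmless for a fixed degree. *)
Lemma landau (s : seq C) (A B : C) : (forall i, `|(A *: \prod_(x <- s) ('X - x%:P))`_i| <= B) ->
  `|A| * \prod_(x <- s) (1 + `|x|) <= (2 * size s)%N%:R ^+ size s * B.
Proof.
suff H n : (size s <= n)%N -> (forall i, `|(A *: \prod_(x <- s) ('X - x%:P))`_i| <= B) ->
    `|A| * \prod_(x <- s) (1 + `|x|) <= (2 * n)%N%:R ^+ size s * B by apply: H.
elim: s A B => [|x s IH] A B /=.
  by move=> _ /(_ 0%N); rewrite !big_nil mulr1 coefZ coef1 mulr1 mul1r.
move=> sn; rewrite !big_cons scalerAr => hB.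
have sq : (size (A *: \prod_(x <- s) ('X - x%:P))%R <= n)%N.
  by apply: leq_trans (size_scale_leq _ _) _; rewrite size_prod_XsubC.
have h := quotient_root_bound sq hB.
have x0 : 0 < 1 + `|x| by rewrite ltr_pwDl.
have := IH ((1 + `|x|) * A) ((2 * n)%N%:R * B) (ltnW sn).
rewrite normrM ger0_norm ?(ltW x0)// => IH'.
rewrite exprSr -[leRHS]mulrA [leLHS]mulrA [`|A| * _]mulrC; apply: IH' => i.
rewrite -scalerA coefZ normrM ger0_norm ?(ltW x0)// mulrC.
exact: h.
Qed.

Lemma coef_prod_bound (s : seq C) (A : C) (i : nat) :
  `|(A *: \prod_(x <- s) ('X - x%:P))`_i| <= `|A| * \prod_(x <- s) (1 + `|x|).
Proof.
elim: s A i => [|x s IH] A i.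
  rewrite !big_nil mulr1 coefZ coef1 normrM; case: (i == 0)%N; first by rewrite normr1 mulr1.
  by rewrite normr0 mulr0.
rewrite !big_cons scalerAr mulrBl coefB coefXM coefCM mulrCA mulrDl mul1r.
apply: le_trans (ler_normB _ _) _; apply: lerD; last by rewrite normrM ler_wpM2l.
case: (i == 0)%N; last exact: IH.
by rewrite normr0 mulr_ge0// prodr_ge0// => y _; rewrite addr_ge0.
Qed.

End Landau.

(** * Polynomials with a system of blocks *)

Local Notation ratP h := (map_poly (ratr : rat -> algC) h).

(* The factorisation of [f] attached to a system of blocks: [F z] is the
   product of the linear factors indexed by the block whose value at [c] is
   [z]. *)
Record block_data (f : {poly int}) (a c : nat) (P : {poly int}) (rs : seq algC)
    (F : algC -> {poly algC}) (g : nat -> {poly rat}) : Prop := BlockData {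
  block_uniq : uniq rs;
  block_P : map_poly (intr : int -> algC) P = (lead_coef f)%:~R *: \prod_(z <- rs) ('X - z%:P);
  block_f : map_poly (intr : int -> algC) f = (lead_coef f)%:~R *: \prod_(z <- rs) F z;
  block_monic : forall z, z \in rs -> [/\ F z \is monic, size (F z) = a.+1 & (F z).[c%:R] = z];
  block_rat : forall z, z \in rs -> forall t : nat, (F z).[t%:R] = (ratP (g t)).[z];
  block_intg : forall e : algC -> algC,
    (forall z, z \in rs -> e z = 1 \/ exists t : nat, e z = (F z).[t%:R]) ->
    intg ((lead_coef f)%:~R * \prod_(z <- rs) e z);
  block_trans : forall (h : {poly rat}) z z', z \in rs -> z' \in rs ->
    (ratP h).[z] = 0 -> (ratP h).[z'] = 0;
  block_norm : forall h : {poly rat}, \prod_(z <- rs) (ratP h).[z] \in Crat }.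

Lemma block_data_perm f a c P rs rs' F g : perm_eq rs rs' ->
  block_data f a c P rs F g -> block_data f a c P rs' F g.
Proof.
move=> pr [h1 h2 h3 h4 h5 h6 h7 h8]; have m := perm_mem pr.
split.
- by rewrite -(perm_uniq pr).
- by rewrite -(perm_big _ pr).
- by rewrite -(perm_big _ pr).
- by move=> z; rewrite -m; exact: h4.
- by move=> z; rewrite -m; exact: h5.
- by move=> e he; rewrite -(perm_big _ pr); apply: h6 => z; rewrite m; exact: he.
- by move=> h z z'; rewrite -!m; exact: h7.
- by move=> h; rewrite -(perm_big _ pr).
Qed.

(** Of two conjugate values the real part is recorded at one point and the imaginary part at the
    other, which makes one real number per root instead of two. At a real [z] the relevant values
    are real. *)
Definition cpart (z u : algC) : algC := if 0 <= 'Im z then 'Re u else 'Im u.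

Lemma cpart_real z u : cpart z u \is Num.real.
Proof. by rewrite /cpart; case: ifP => _; [exact: Creal_Re|exact: Creal_Im]. Qed.

Lemma cpartB z u v : cpart z (u - v) = cpart z u - cpart z v.
Proof. by rewrite /cpart; case: ifP => _; rewrite raddfB. Qed.

Lemma cpart_norm z u : `|cpart z u| <= `|u|.
Proof.
have H (x : algC) : x \is Num.real -> x ^+ 2 <= `|u| ^+ 2 -> `|x| <= `|u|.
  by move=> xr h; rewrite -(@ler_pXn2r _ 2) ?nnegrE// real_normK.
rewrite /cpart; case: ifP => _; apply: H; rewrite ?Creal_Re ?Creal_Im// normC2_Re_Im.
  by rewrite lerDl real_exprn_even_ge0 ?Creal_Im.
by rewrite lerDr real_exprn_even_ge0 ?Creal_Re.
Qed.

Lemma ratr_horner_conj (h : {poly rat}) (z : algC) : (ratP h).[z^*] = (ratP h).[z]^*.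
Proof.
rewrite -horner_map -map_poly_comp; congr (_.[_]).
by apply: eq_map_poly => q /=; rewrite conj_Crat ?Crat_rat.
Qed.

Lemma norm_cpart_bound (h : {poly rat}) (z eps : algC) :
  `|cpart z (ratP h).[z]| <= eps -> `|cpart z^* (ratP h).[z^*]| <= eps ->
  `|(ratP h).[z]| <= 2 * eps.
Proof.
rewrite ratr_horner_conj /cpart Im_conj oppr_ge0 Im_conj Re_conj.
set u := (ratP h).[z] => h1 h2'.
have h2 : `|if 'Im z <= 0 then 'Re u else 'Im u| <= eps by move: h2'; case: ifP; rewrite ?normrN.
have H (e : algC) : 0 <= e -> `|'Re u| <= e -> `|'Im u| <= e -> `|u| <= 2 * e.
  move=> e0 hr hi; rewrite [u]Crect; apply: le_trans (ler_normD _ _) _.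
  by rewrite normrM normCi mul1r mulrDl mul1r lerD.
have eps0 : 0 <= eps := le_trans (normr_ge0 _) h1.
have [zr|zr] := eqVneq ('Im z) 0.
  have uc : u^* = u by rewrite /u -ratr_horner_conj; congr (_.[_]); apply/CrealP/Creal_ImP.
  have /Creal_ImP ui : u \is Num.real by apply/CrealP.
  by apply: H => //; [move: h1; rewrite zr lexx|rewrite ui normr0].
have zi := Creal_Im z.
have [z0|z0|z0] := real_ltgtP zi (@real0 algC).
- apply: H => //; [move: h2; rewrite (ltW z0)//|move: h1; rewrite (lt_geF z0)//].
- apply: H => //; [move: h1; rewrite (ltW z0)//|move: h2; rewrite (lt_geF z0)//].
by rewrite z0 eqxx in zr.
Qed.

Definition content_gcd (P : {poly int}) : nat := \big[gcdn/0%N]_(i < size P) absz P`_i.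

(** * Rigidity of polynomials with the same resolvent *)

Section Rigidity.
Variables (f f' : {poly int}) (a c : nat) (P : {poly int}) (rs : seq algC).
Variables (F F' : algC -> {poly algC}) (g g' : nat -> {poly rat}).
Hypotheses (bf : block_data f a c P rs F g) (bf' : block_data f' a c P rs F' g').
Hypothesis f0 : f != 0.
Local Notation kap := (content_gcd P).

Lemma block_lead : lead_coef f' = lead_coef f.
Proof.
have m : \prod_(z <- rs) ('X - z%:P) \is monic by rewrite monic_prod_XsubC.
have := block_P bf; rewrite (block_P bf') => /(congr1 lead_coef).
by rewrite !lead_coefZ (monicP m) !mulr1 => /intr_inj.
Qed.

Lemma block_conj z : z \in rs -> z^* \in rs.
Proof.
have E x : x \in rs = root (map_poly (intr : int -> algC) P) x.
  by rewrite (block_P bf) rootZ ?root_prod_XsubC// intr_eq0 lead_coef_eq0.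
rewrite !E => /rootP zr; apply/rootP.
have -> : map_poly (intr : int -> algC) P = map_poly (Num.conj : algC -> algC) (map_poly (intr : int -> algC) P).
  by rewrite -map_poly_comp; apply: eq_map_poly => q /=; rewrite rmorph_int.
by rewrite horner_map zr rmorph0.
Qed.

Lemma kap_gt0 : (0 < kap)%N.
Proof.
have l0 : lead_coef P != 0.
  rewrite lead_coef_eq0; apply: contraNneq f0 => P0; have := block_P bf.
  have m : \prod_(z <- rs) ('X - z%:P) \is monic by rewrite monic_prod_XsubC.
  rewrite P0 rmorph0 => /(congr1 lead_coef).
  by rewrite lead_coef0 lead_coefZ (monicP m) mulr1 => /esym/eqP; rewrite intr_eq0 lead_coef_eq0.
have sP : (0 < size P)%N by rewrite size_poly_gt0 -lead_coef_eq0.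
have d : (kap %| `|lead_coef P|)%N.
  rewrite lead_coefE; have lt : ((size P).-1 < size P)%N by rewrite prednK.
  by have /= := @biggcdn_inf _ (Ordinal lt) xpredT (fun i : 'I_(size P) => absz P`_i) (absz P`_(size P).-1) isT (dvdnn _).
by apply: dvdn_gt0 d; rewrite absz_gt0.
Qed.

(** The values for [f] and for [f'] each need a leading coefficient to become integral. One of the
    two can be traded for the content of [P]: by [intg_mixed_prod] the expression is integral with
    any coefficient of [P] in place of [kap], and Bezout's identity passes to their gcd. This
    matters because a large content leaves fewer choices for [P]. *)
Lemma block_integer (t : nat) :
  ((lead_coef f)%:~R * kap%:R * \prod_(z <- rs) (ratP (g t - g' t)).[z] : algC) \is a Num.int.
Proof.
set h := g t - g' t.
apply: Cint_rat_Aint.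
  by rewrite rpredM ?(block_norm bf)// rpredM ?rpred_int ?rpred_nat.
apply/intg_algC.
have hE : \prod_(z <- rs) (ratP h).[z] = \prod_(z <- rs) ((F z).[t%:R] - (F' z).[t%:R]).
  apply: eq_big_seq => z zr; rewrite (block_rat bf zr) (block_rat bf' zr).
  by rewrite /h rmorphB /= hornerD hornerN.
rewrite mulrAC.
apply: intg_biggcd => i.
have E : (lead_coef f)%:~R * \prod_(z <- rs) (ratP h).[z] * (P`_i)%:~R =
   (((lead_coef f)%:~R * (lead_coef f')%:~R * \prod_(z <- rs) ((F z).[t%:R] - (F' z).[t%:R])) *:
     \prod_(z <- rs) ('X - z%:P))`_i :> algC.
  have -> : (P`_i)%:~R = (map_poly (intr : int -> algC) P)`_i by rewrite coef_map.
  rewrite (block_P bf) !coefZ block_lead hE; ring.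
rewrite E; apply: (@intg_mixed_prod _ _ rs (fun z => (F z).[t%:R]) (fun z => (F' z).[t%:R]) id).
- exact: block_uniq bf.
- move=> e he; apply: (block_intg bf) => z zr; have [] := he z; [by left| |].
    by move=> ->; right; exists t.
  by move=> ->; right; exists c; have [] := block_monic bf zr.
- move=> e he; apply: (block_intg bf') => z zr; have [] := he z; [by left| |].
    by move=> ->; right; exists t.
  by move=> ->; right; exists c; have [] := block_monic bf' zr.
Qed.

(** Both factors take the value [z] at [c] by construction, so [a - 1] further points determine a
    monic factor of degree [a]. The tolerance has to be invariant under conjugation, since the parts
    recorded at [z] and at its conjugate together bound the difference. *)
Lemma block_rigidity (eps : algC -> algC) :
  (forall z, z \in rs -> eps z^* = eps z) ->
  `|(lead_coef f)%:~R| * kap%:R * \prod_(z <- rs) (2 * eps z) < 1 ->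
  (forall (t : 'I_a.-1) z, z \in rs ->
     `|cpart z (F z).[(c.+1 + t)%N%:R] - cpart z (F' z).[(c.+1 + t)%N%:R]| <= eps z) -> f = f'.
Proof.
move=> he lt1 hb.
have l0 : (lead_coef f)%:~R != 0 :> algC by rewrite intr_eq0 lead_coef_eq0.
have k0 : (0 : algC) < kap%:R by rewrite ltr0n kap_gt0.
have FF z : z \in rs -> forall t : 'I_a.-1, (F z).[(c.+1 + t)%N%:R] = (F' z).[(c.+1 + t)%N%:R].
  move=> zr t; set u := (c.+1 + t)%N; pose h := g u - g' u.
  have hE w : w \in rs -> (ratP h).[w] = (F w).[u%:R] - (F' w).[u%:R].
    by move=> wr; rewrite (block_rat bf wr) (block_rat bf' wr) /h rmorphB /= hornerD hornerN.
  have hw w : w \in rs -> `|cpart w (ratP h).[w]| <= eps w.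
    by move=> wr; rewrite hE// cpartB; exact: hb.
  have hn w : w \in rs -> `|(ratP h).[w]| <= 2 * eps w.
    move=> wr; apply: norm_cpart_bound; first exact: hw.
    by rewrite -(he w wr); apply: hw; exact: block_conj.
  set X : algC := (lead_coef f)%:~R * kap%:R * \prod_(w <- rs) (ratP h).[w].
  have Xi : X \is a Num.int := block_integer u.
  have X1 : `|X| < 1.
    apply: le_lt_trans lt1; rewrite !normrM normr_prod [`|kap%:R|]ger0_norm ?(ltW k0)//.
    rewrite ler_wpM2l ?mulr_ge0 ?(ltW k0)//.
    rewrite big_seq [leRHS]big_seq; apply: ler_prod => w wr.
    by rewrite normr_ge0 hn.
  have X0 : X = 0.
    by apply/eqP; apply: contraLR X1 => X0; rewrite -real_leNgt ?normr_real ?real1// norm_intr_ge1.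
  (* One vanishing factor suffices: the differences are the values of one rational polynomial at
     conjugate points. *)
  move: X0 => /eqP; rewrite /X !mulf_eq0 (negPf l0) (gt_eqF k0) !orFb prodf_seq_eq0 => /hasP[w wr /andP[_ /eqP hw0]].
  by apply/eqP; rewrite -subr_eq0 -hE//; apply/eqP; apply: (block_trans bf wr zr hw0).
have FE z : z \in rs -> F z = F' z.
  move=> zr; have [m1 s1 c1] := block_monic bf zr; have [m2 s2 c2] := block_monic bf' zr.
  apply/eqP; rewrite -subr_eq0; apply/eqP.
  apply: (@roots_geq_poly_eq0 _ _ [seq (c + t)%N%:R | t <- iota 0 a]).
  - apply/allP => x /mapP[t]; rewrite mem_iota add0n => ta ->.
    rewrite rootE hornerD hornerN subr_eq0; case: t ta => [|t] ta; first by rewrite addn0 c1 c2.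
    have ta' : (t < a.-1)%N by rewrite -ltnS prednK//; exact: leq_ltn_trans ta.
    by rewrite addnS -addSn; apply/eqP; exact: (FF z zr (Ordinal ta')).
  - rewrite map_inj_uniq ?iota_uniq// => x y /eqP; rewrite eqr_nat eqn_add2l => /eqP//.
  rewrite size_map size_iota; apply/leq_sizeP => j aj; rewrite coefB.
  have [->|ja] := eqVneq j a.
    move: m1 m2; rewrite !monicE !lead_coefE s1 s2 /= => /eqP -> /eqP ->; exact: subrr.
  by rewrite !nth_default ?s1 ?s2 ?subr0// ltn_neqAle eq_sym ja.
have : map_poly (intr : int -> algC) f = map_poly (intr : int -> algC) f'.
  rewrite (block_f bf) (block_f bf') block_lead; congr (_ *: _).
  by apply: eq_big_seq => z /FE.
move=> E; apply/polyP => i; apply: (@intr_inj algC).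
by rewrite -!(coef_map (intr : {rmorphism int -> algC})) /= E.
Qed.

End Rigidity.

(** * Blocks of a transitive group containing a transposition *)

(** A primitive element is sent to a complex root of its minimal polynomial. The embedding gives
    access to the absolute values of the conjugates, which the counting needs. *)
Lemma exists_algC_embedding (L : splittingFieldType rat) : galois 1 {:L} ->
  exists iota : {rmorphism L -> algC}, True.
Proof.
case/and3P => _ sepL _.
have genL := eq_adjoin_separable_generator sepL (sub1v _).
set w := separable_generator _ _ in genL.
have ex (y : L) : exists q : {poly rat}, y = (map_poly (in_alg L) q).[w].
  have : y \in <<1%AS; w>>%VS by rewrite -genL memvf.
  by case/Fadjoin_polyP => _ /polyOver1P[q ->] ->; exists q.
have [rep repE] := choice ex.
have [p pE] := polyOver1P (minPolyOver 1 w).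
have sp : (1 < size p)%N.
  by have := size_minPoly 1 w; rewrite pE size_map_poly => ->.
have [z zr] : exists z, root (map_poly (ratr : rat -> algC) p) z.
  by apply: closed_rootP; rewrite size_map_poly gtn_eqF.
have ann (q : {poly rat}) : (map_poly (in_alg L) q).[w] = 0 -> (map_poly (ratr : rat -> algC) q).[z] = 0.
  move=> qw; have : minPoly 1 w %| map_poly (in_alg L) q.
    by apply: minPoly_dvdp; [apply/polyOver1P; exists q|apply/rootP].
  rewrite pE dvdp_map => /dvdpP[u ->]; rewrite rmorphM hornerM.
  by rewrite (rootP zr) mulr0.
pose io (y : L) : algC := (map_poly (ratr : rat -> algC) (rep y)).[z].
have ioE (y : L) q : y = (map_poly (in_alg L) q).[w] -> io y = (map_poly (ratr : rat -> algC) q).[z].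
  move=> yq; apply/eqP; rewrite -subr_eq0 -hornerN -hornerD -rmorphB /=; apply/eqP/ann.
  by rewrite rmorphB /= hornerD hornerN -yq -repE subrr.
have io_add : zmod_morphism io.
  move=> x y; rewrite (ioE (x - y) (rep x - rep y)).
    by rewrite rmorphB /= hornerD hornerN.
  by rewrite rmorphB /= hornerD hornerN -!repE.
have io_mul : monoid_morphism io.
  split; first by rewrite (ioE 1 1) ?rmorph1 ?hornerC.
  move=> x y; rewrite (ioE (x * y) (rep x * rep y)).
    by rewrite rmorphM hornerM.
  by rewrite rmorphM hornerM -!repE.
pose f1 := GRing.isZmodMorphism.Build L algC io io_add.
pose f2 := GRing.isMonoidMorphism.Build L algC io io_mul.
pose iota : {rmorphism L -> algC} := HB.pack io f1 f2.
by exists iota.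
Qed.

Lemma gal_fixed_base (L : splittingFieldType rat) (x : L) : galois 1 {:L} ->
  (forall s, s \in 'Gal({:L} / 1)%g -> s x = x) -> x \in 1%VS.
Proof.
move=> gL H; have /galois_fixedField <- := gL; apply/fixedFieldP; [exact: memvf|exact: H].
Qed.

Lemma gal_fixed_adjoin (L : splittingFieldType rat) (th x : L) : galois 1 {:L} ->
  (forall s, s \in 'Gal({:L} / 1)%g -> s th = th -> s x = x) ->
  exists g : {poly rat}, x = (map_poly (in_alg L) g).[th].
Proof.
move=> gL H; have : x \in <<1%AS; th>>%VS.
  have /galois_fixedField <- : galois <<1%AS; th>>%AS {:L}.
    by apply: galoisS gL; rewrite sub1v subvf.
  apply/fixedFieldP; first exact: memvf.
  move=> s sG; apply: H; last by apply: (fixed_gal _ sG); rewrite ?subvf ?memv_adjoin.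
  by apply: (subsetP (galS _ _)) sG; exact: sub1v.
by case/Fadjoin_polyP => _ /polyOver1P[g ->] ->; exists g.
Qed.

Section TranspositionBlocks.
Variables (n : nat) (G : {group 'S_n}).

(** Being joined by a transposition of [G] is an equivalence relation, because conjugating one
    transposition by another gives the third; its classes are blocks of [G]. *)
Definition swap_block (i : 'I_n) : {set 'I_n} := [set j | tperm i j \in G]%SET.

Lemma swap_block_refl i : i \in swap_block i.
Proof. by rewrite inE tperm1 group1. Qed.

Lemma swap_block_sym i j : (j \in swap_block i) = (i \in swap_block j).
Proof. by rewrite !inE tpermC. Qed.

Lemma swap_block_trans i j l : j \in swap_block i -> l \in swap_block j -> l \in swap_block i.
Proof.
rewrite !inE => ij jl; have [->|lj] := eqVneq l j; first exact: ij.
have [->|li] := eqVneq l i; first by rewrite tperm1 group1.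
have [->|ji] := eqVneq i j; first exact: jl.
have -> : tperm i l = (tperm i j ^ tperm j l)%g by rewrite tpermJ tpermL [tperm j l i]tpermD// eq_sym.
by rewrite groupJ.
Qed.

Lemma swap_block_eq i j : (swap_block i == swap_block j) = (j \in swap_block i).
Proof.
apply/eqP/idP => [->|ij]; first exact: swap_block_refl.
apply/setP => l; apply/idP/idP; first by apply: swap_block_trans; rewrite swap_block_sym.
exact: swap_block_trans.
Qed.

Lemma swap_block_perm (s : 'S_n) i : s \in G -> swap_block (s i) = [set s x | x in swap_block i]%SET.
Proof.
move=> sG; apply/setP => l; apply/idP/imsetP.
  rewrite inE => h; exists ((s^-1)%g l); last by rewrite permKV.
  by rewrite inE -(groupJr _ sG) tpermJ permKV.
by move=> [x]; rewrite !inE => h ->; rewrite -tpermJ groupJ.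
Qed.

Lemma swap_block_card (i j : 'I_n) (s : 'S_n) : s \in G -> s i = j ->
  #|swap_block i| = #|swap_block j|.
Proof. by move=> sG <-; rewrite swap_block_perm// card_imset//; exact: perm_inj. Qed.

Lemma swap_block_full i : swap_block i = [set: 'I_n]%SET -> G :=: [set: 'S_n]%SET.
Proof.
move=> full; apply/setP => s; rewrite inE.
have all_tperm x y : tperm x y \in G.
  have : y \in swap_block x.
    by apply: (@swap_block_trans _ i); [rewrite swap_block_sym|]; rewrite full inE.
  by rewrite inE.
by have [ts -> _] := prod_tpermP s; apply: group_prod.
Qed.

End TranspositionBlocks.

Lemma exists_nonroot (R : numDomainType) (D : {poly R}) (m : nat) : D != 0 -> (size D <= m.+1)%N ->
  exists c, (c <= m)%N /\ ~~ root D c%:R.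
Proof.
move=> D0 sD; apply: contrapT => H.
have : (size [seq i%:R : R | i <- iota 0 m.+1] < size D)%N.
  apply: max_poly_roots => //.
    apply/allP => x /mapP[i]; rewrite mem_iota add0n ltnS => im ->.
    by apply: contraT => nr; case: H; exists i.
  by rewrite map_inj_uniq ?iota_uniq// => i j /eqP; rewrite eqr_nat => /eqP.
by rewrite size_map size_iota ltnNge sD.
Qed.

(** * The blocks of roots and their factors *)

Section BlockSystem.
Variables (k : nat) (f : {poly int}) (L : splittingFieldType rat) (r : k.+3.-tuple L).
Hypotheses (sf : size f = k.+4)
  (fr : map_poly (in_alg L) (map_poly (intr : int -> rat) f) %= \prod_(x <- r) ('X - x%:P))
  (genr : <<1 & r>>%VS = fullv) (ur : uniq r)
  (irr : irreducible_poly (map_poly (intr : int -> rat) f)).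

Local Notation Gal := ('Gal({:L} / 1)%g).
Local Notation gp := (gal_perm r).

Let gL : galois 1 {:L} := galL sf fr genr ur.
Let gpE := gal_permE fr ur.

Lemma gal_perm_mem s : s \in Gal -> gp s \in root_perms r.
Proof.
move=> sG; rewrite inE; apply/exists_inP; exists s => //.
by apply/forallP => i; rewrite gpE.
Qed.

Lemma gal_perm_transitive (i j : 'I_k.+3) : exists2 s, s \in Gal & gp s i = j.
Proof.
have rt l : root (map_poly (in_alg L) (map_poly (intr : int -> rat) f)) (tnth r l).
  by rewrite (eqp_root fr) root_prod_XsubC mem_tnth.
have [p pE] := polyOver1P (minPolyOver 1 (tnth r i)).
have pf : p %| map_poly (intr : int -> rat) f.
  rewrite -(dvdp_map (in_alg L)) -pE; apply: minPoly_dvdp => //.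
  by apply/polyOver1P; exists (map_poly (intr : int -> rat) f).
have p1 : size p != 1%N by have := size_minPoly 1 (tnth r i); rewrite pE size_map_poly => ->.
have pe : p %= map_poly (intr : int -> rat) f by case: irr => _; apply.
have mj : root (minPoly 1 (tnth r i)) (tnth r j).
  by rewrite pE (eqp_root (_ : _ %= map_poly (in_alg L) (map_poly (intr : int -> rat) f))) ?eqp_map.
case/and3P: gL => _ _ nL.
have [s sG sij] := normalField_root_minPoly (sub1v _) nL (memvf _) mj.
by exists s => //; apply: (tnth_r_inj ur); rewrite -gpE.
Qed.

Local Notation bl := (swap_block (root_perms_group r)).
Definition blocks : {set {set 'I_k.+3}} := [set bl i | i in 'I_k.+3]%SET.
Definition gal_act (s : gal_of {:L}) (B : {set 'I_k.+3}) : {set 'I_k.+3} := [set gp s x | x in B]%SET.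
Local Notation a := #|bl ord0|.

Lemma gal_act_inj s : injective (gal_act s).
Proof. by move=> B B' /imset_inj; apply; exact: perm_inj. Qed.

Lemma gal_act_block s i : s \in Gal -> bl (gp s i) = gal_act s (bl i).
Proof. by move=> sG; apply: swap_block_perm; exact: gal_perm_mem. Qed.

Lemma mem_blocks i : bl i \in blocks.
Proof. exact: imset_f. Qed.

Lemma gal_act_blocks s B : s \in Gal -> (gal_act s B \in blocks) = (B \in blocks).
Proof.
move=> sG; apply/imsetP/imsetP => -[i _ e].
  exists ((gp s)^-1%g i) => //; apply: (@gal_act_inj s).
  by rewrite e -gal_act_block// permKV.
by exists (gp s i) => //; rewrite gal_act_block// e.
Qed.

Lemma gal_act_transitive B B' : B \in blocks -> B' \in blocks -> exists2 s, s \in Gal & gal_act s B = B'.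
Proof.
move=> /imsetP[i _ ->] /imsetP[j _ ->]; have [s sG <-] := gal_perm_transitive i j.
by exists s; rewrite ?gal_act_block.
Qed.

Lemma card_block i : #|bl i| = a.
Proof.
have [s sG sij] := gal_perm_transitive i ord0.
by apply: (swap_block_card (s := gp s)) => //; exact: gal_perm_mem.
Qed.

Lemma card_blockE B : B \in blocks -> #|[pred i | bl i == B]| = a.
Proof.
move=> /imsetP[i _ ->]; rewrite -(card_block i); apply: eq_card => j.
by rewrite inE eq_sym swap_block_eq.
Qed.

Lemma card_blocks : (a * #|blocks| = k.+3)%N.
Proof.
rewrite -[RHS]card_ord -[in RHS]sum1_card [in RHS](partition_big bl (mem blocks)) /=; last by move=> i _; exact: mem_blocks.
rewrite [in RHS](eq_bigr (fun=> a)); first by rewrite sum_nat_const mulnC.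
by move=> B Bb; rewrite sum1_card; exact: card_blockE.
Qed.

Definition block_poly (B : {set 'I_k.+3}) : {poly L} := \prod_(i | bl i == B) ('X - (tnth r i)%:P).

Lemma block_poly_gal s B : s \in Gal -> map_poly s (block_poly B) = block_poly (gal_act s B).
Proof.
move=> sG; rewrite /block_poly rmorph_prod /= [RHS](reindex_inj (@perm_inj _ (gp s))) /=.
apply: eq_big => [i|i _]; first by rewrite gal_act_block// (inj_eq (@gal_act_inj s)).
by rewrite rmorphB /= map_polyX map_polyC /= gpE.
Qed.

Lemma block_poly_filter B : block_poly B = \prod_(i <- [seq i <- index_enum 'I_k.+3 | bl i == B]) ('X - (tnth r i)%:P).
Proof. by rewrite big_filter. Qed.

Lemma size_block_poly B : B \in blocks -> size (block_poly B) = a.+1.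
Proof.
move=> Bb; rewrite block_poly_filter size_prod_XsubC -(card_blockE Bb) cardE.
by congr (size _).+1.
Qed.

Lemma monic_block_poly B : block_poly B \is monic.
Proof. by rewrite block_poly_filter monic_prod_XsubC. Qed.

Lemma block_poly_inj : {in blocks &, injective block_poly}.
Proof.
move=> _ B' /imsetP[i _ ->] _ e; apply/eqP.
have rE B j : root (block_poly B) (tnth r j) = (bl j == B).
  rewrite block_poly_filter -(big_map (tnth r) xpredT (fun x => 'X - x%:P)) root_prod_XsubC.
  by rewrite mem_map ?mem_filter ?mem_index_enum ?andbT//; exact: (tnth_r_inj ur).
by rewrite -rE -e rE.
Qed.

Lemma block_poly_value_gal s B (t : nat) : s \in Gal -> s (block_poly B).[t%:R] = (block_poly (gal_act s B)).[t%:R].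
Proof. by move=> sG; rewrite -block_poly_gal// -[X in _ = _.[X]](rmorph_nat s) horner_map. Qed.

Lemma exists_separating : exists c, (c <= k.+3 * 2 ^ k.+3 * 2 ^ k.+3)%N /\
  {in blocks &, injective (fun B => (block_poly B).[c%:R])}.
Proof.
pose I := ({set 'I_k.+3} * {set 'I_k.+3})%type.
pose Pr := [pred u : I | [&& u.1 \in blocks, u.2 \in blocks & u.1 != u.2]].
pose D := \prod_(u : I | Pr u) (block_poly u.1 - block_poly u.2).
have [iota _] := exists_algC_embedding gL.
have D0 : map_poly iota D != 0.
  rewrite map_poly_eq0 prodf_seq_neq0; apply/allP => u _; apply/implyP => /and3P[b1 b2 ne].
  by rewrite subr_eq0; apply: contraNneq ne => /block_poly_inj ->.
have sD : (size (map_poly iota D) <= (k.+3 * 2 ^ k.+3 * 2 ^ k.+3).+1)%N.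
  rewrite size_map_poly; apply: leq_trans (size_poly_prod_leq _ _) _.
  have h : (\sum_(u : I | Pr u) size (block_poly u.1 - block_poly u.2)%R <= k.+4 * #|Pr|)%N.
    rewrite mulnC -sum_nat_const; apply: leq_sum => u /and3P[b1 b2 _].
    have ak : (a <= k.+3)%N by rewrite -[X in (_ <= X)%N]card_ord; exact: max_card.
    apply: leq_trans (size_polyD _ _) _; rewrite size_polyN !size_block_poly// maxnn.
    by rewrite ltnS.
  have cP : (#|Pr| <= 2 ^ k.+3 * 2 ^ k.+3)%N.
    apply: leq_trans (max_card _) _; rewrite card_prod.
    have -> : #|{: {set 'I_k.+3}}| = (2 ^ k.+3)%N; last by [].
    by rewrite -cardsT -powersetT card_powerset cardsT card_ord.
  move: h cP; set S := (\sum_(u | _) _)%N; set N := (2 ^ _)%N; set q := #|_|; clearbody S N q.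
  by nia.
have [c [cm nr]] := exists_nonroot D0 sD.
exists c; split=> // B B' Bb Bb' e; apply/eqP; apply: contraNT nr => ne.
rewrite -(rmorph_nat iota) fmorph_root /D; apply/rootP; rewrite horner_prod.
rewrite (bigD1 (B, B')) /=; last by rewrite Bb Bb' ne.
by rewrite hornerD hornerN e subrr mul0r.
Qed.

End BlockSystem.

Lemma horner_rat_morph (L K : fieldExtType rat) (phi : {rmorphism L -> K}) (h : {poly rat}) (x : L) :
  phi (map_poly (in_alg L) h).[x] = (map_poly (in_alg K) h).[phi x].
Proof.
rewrite -horner_map -map_poly_comp; congr (_.[_]); apply: eq_map_poly => q /=.
by rewrite -[LHS]/((phi \o in_alg L) q) -[RHS]/(in_alg K q) !fmorph_eq_rat.
Qed.

Lemma horner_rat_embed (L : fieldExtType rat) (phi : {rmorphism L -> algC}) (h : {poly rat}) (x : L) :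
  phi (map_poly (in_alg L) h).[x] = (ratP h).[phi x].
Proof.
rewrite -horner_map -map_poly_comp; congr (_.[_]); apply: eq_map_poly => q.
by rewrite -[LHS]/((phi \o in_alg L) q) fmorph_eq_rat.
Qed.

Section BlockConstruction.
Variables (k : nat) (f : {poly int}) (L : splittingFieldType rat) (r : k.+3.-tuple L).
Hypotheses (sf : size f = k.+4)
  (fr : map_poly (in_alg L) (map_poly (intr : int -> rat) f) %= \prod_(x <- r) ('X - x%:P))
  (genr : <<1 & r>>%VS = fullv) (ur : uniq r)
  (irr : irreducible_poly (map_poly (intr : int -> rat) f)).
Local Notation Gal := ('Gal({:L} / 1)%g).
Local Notation Q := (blocks r).
Local Notation bl := (swap_block (root_perms_group r)).
Local Notation bp := (block_poly r).
Local Notation act := (@gal_act k L r).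
Local Notation a := #|bl ord0|.
Let gL : galois 1 {:L} := galL sf fr genr ur.

Variable c : nat.
Let th (B : {set 'I_k.+3}) : L := (bp B).[c%:R].
Hypothesis th_inj : {in Q &, injective th}.
Variable iota : {rmorphism L -> algC}.

Lemma th_gal s B : s \in Gal -> s (th B) = th (act s B).
Proof. by move=> sG; exact: (block_poly_value_gal fr ur). Qed.

Lemma blocks_prod_gal (R : comNzRingType) (s : gal_of {:L}) (W : {set 'I_k.+3} -> R) : s \in Gal ->
  \prod_(B in Q) W (act s B) = \prod_(B in Q) W B.
Proof.
move=> sG; rewrite [RHS](reindex_inj (@gal_act_inj k L r s)) /=.
by apply: eq_bigl => B; rewrite (gal_act_blocks fr ur).
Qed.

Lemma blocks_prod_index (R : comNzRingType) (W : 'I_k.+3 -> R) :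
  \prod_(B in Q) \prod_(i | bl i == B) W i = \prod_i W i.
Proof. by rewrite [RHS](partition_big bl (mem Q))//= => i _; exact: mem_blocks. Qed.

(** An instance of [intg_partial_prod] whose integer shift is constant on each block; blocks with
    value 1 are left out of the subproduct. *)
Lemma block_values_intg (e : {set 'I_k.+3} -> L) :
  (forall B, B \in Q -> e B = 1 \/ exists t : nat, e B = (bp B).[t%:R]) ->
  intg ((lead_coef f)%:~R * \prod_(B in Q) e B).
Proof.
move=> he; have ex B : exists o : option nat, B \in Q -> e B = if o is Some t then (bp B).[t%:R] else 1.
  have [Bb|_] := boolP (B \in Q); last by exists None.
  by case: (he B Bb) => [->|[t ->]]; [exists None|exists (Some t)].
have [o oE] := choice ex.
have -> : \prod_(B in Q) e B = \prod_(i <- index_enum 'I_k.+3 | o (bl i)) ((odflt 0%N (o (bl i)) : int)%:~R - tnth r i).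
  rewrite [RHS]big_mkcond /= -[RHS]blocks_prod_index; apply: eq_bigr => B Bb.
  rewrite (oE B Bb); case oB : (o B) => [t|].
    rewrite /block_poly horner_prod; apply: eq_bigr => i /eqP ->.
    by rewrite oB /= !hornerE -pmulrn.
  by rewrite big1// => i /eqP ->; rewrite oB.
apply: intg_partial_prod => i.
have -> : \prod_(j <- index_enum 'I_k.+3) ('X - (tnth r j)%:P) = \prod_(x <- r) ('X - x%:P).
  by rewrite [RHS]big_tuple.
by rewrite -(root_factorisation fr) coef_map; exact: intg_int.
Qed.

Lemma exists_block_resolvent : exists P : {poly int},
  map_poly (intr : int -> L) P = (lead_coef f)%:~R *: \prod_(B in Q) ('X - (th B)%:P).
Proof.
set PL := _ *: _.
have ex i : exists z : int, PL`_i = z%:~R.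
  apply: intg_base.
    apply: gal_fixed_base => // s sG; rewrite -coef_map; congr (_`_i).
    rewrite [in LHS]/PL map_polyZ rmorph_int rmorph_prod /PL.
    rewrite (eq_bigr (fun B => 'X - (th (act s B))%:P)).
      by rewrite (blocks_prod_gal (fun B => 'X - (th B)%:P) sG).
    by move=> B _; rewrite rmorphB /= map_polyX map_polyC /= th_gal.
  rewrite /PL -big_enum /=; apply: intg_coef_prod; first exact: enum_uniq.
  move=> e he; rewrite big_enum /=; apply: block_values_intg => B _.
  by case: (he B) => ->; [left|right; exists c].
have [z zE] := choice ex.
exists (\poly_(i < size PL) z i); apply/polyP => i.
rewrite coef_map coef_poly; case: ltnP => [_|ge]; first by rewrite zE.
by rewrite nth_default.
Qed.

Definition block_value_list : seq algC := [seq iota (th B) | B <- enum Q].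
Local Notation rs := block_value_list.
(** Inverts the labelling of blocks by their values: as [th] is injective, exactly one term remains
    when [z] is the value of a block. *)
Definition block_factor (z : algC) : {poly algC} :=
  \sum_(B in Q | iota (th B) == z) map_poly iota (bp B).
Local Notation F := block_factor.

Lemma block_factorE B : B \in Q -> F (iota (th B)) = map_poly iota (bp B).
Proof.
move=> Bb; rewrite /block_factor (big_pred1 B)// => B' /=.
apply/andP/eqP => [[B'b /eqP/fmorph_inj e]|->//].
by apply: th_inj.
Qed.

Lemma block_factor_value B (t : nat) : B \in Q -> (F (iota (th B))).[t%:R] = iota (bp B).[t%:R].
Proof. by move=> Bb; rewrite block_factorE// -(rmorph_nat iota) horner_map. Qed.

Lemma block_value_listP z : reflect (exists2 B, B \in Q & z = iota (th B)) (z \in rs).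
Proof.
apply: (iffP mapP) => [[B]|[B Bb ->]]; first by rewrite mem_enum => Bb ->; exists B.
by exists B; rewrite ?mem_enum.
Qed.

Lemma prod_block_values (R : comNzRingType) (W : algC -> R) :
  \prod_(z <- rs) W z = \prod_(B in Q) W (iota (th B)).
Proof. by rewrite big_map big_enum. Qed.

Lemma size_block_values : size rs = #|Q|.
Proof. by rewrite size_map -cardE. Qed.

Lemma block_data_exists : exists (P : {poly int}) (g : nat -> {poly rat}), block_data f a c P rs F g.
Proof.
have [P PE] := exists_block_resolvent.
have B0 := mem_blocks r ord0.
(* The value at [t] is fixed by every automorphism that fixes [th] of the block, hence is a rational
   polynomial in [th]; by transitivity the same polynomial serves for all blocks. *)
have exg (t : nat) : exists g : {poly rat}, (bp (bl ord0)).[t%:R] = (map_poly (in_alg L) g).[th (bl ord0)].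
  apply: gal_fixed_adjoin => // s sG; rewrite th_gal// => e.
  rewrite (block_poly_value_gal fr ur)// (th_inj _ _ e)// ?(gal_act_blocks fr ur)//.
have [g gE] := choice exg.
have mapint (p : {poly int}) : map_poly (intr : int -> algC) p = map_poly iota (map_poly (intr : int -> L) p).
  by rewrite -map_poly_comp; apply: eq_map_poly => z /=; rewrite rmorph_int.
exists P, g; split.
- rewrite map_inj_in_uniq ?enum_uniq// => B B'; rewrite !mem_enum => Bb Bb' /fmorph_inj.
  exact: th_inj.
- rewrite mapint PE map_polyZ rmorph_int; congr (_ *: _).
  rewrite prod_block_values rmorph_prod; apply: eq_bigr => B _.
  by rewrite rmorphB /= map_polyX map_polyC.
- rewrite mapint (root_factorisation fr) map_polyZ rmorph_int; congr (_ *: _).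
  rewrite prod_block_values big_tuple -blocks_prod_index rmorph_prod.
  by apply: eq_bigr => B Bb; rewrite block_factorE.
- move=> _ /block_value_listP[B Bb ->]; split.
  + by rewrite block_factorE// map_monic monic_block_poly.
  + by rewrite block_factorE// size_map_poly (size_block_poly sf fr genr ur irr).
  by rewrite block_factor_value.
- move=> _ /block_value_listP[B Bb ->] t.
  rewrite block_factor_value// -horner_rat_embed; congr (iota _).
  have [s sG <-] := gal_act_transitive sf fr genr ur irr B0 Bb.
  by rewrite -th_gal// -(block_poly_value_gal fr ur)// gE horner_rat_morph.
- move=> e he; rewrite prod_block_values.
  have ex B : exists x : L, B \in Q -> iota x = e (iota (th B)) /\ (x = 1 \/ exists t : nat, x = (bp B).[t%:R]).
    have [Bb|_] := boolP (B \in Q); last by exists 0.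
    have zr : iota (th B) \in rs by apply/block_value_listP; exists B.
    case: (he _ zr) => [->|[t ->]].
      by exists 1; rewrite rmorph1; split=> //; left.
    by exists (bp B).[t%:R]; rewrite block_factor_value//; split=> //; right; exists t.
  have [x xE] := choice ex.
  rewrite (eq_bigr (fun B => iota (x B))); last by move=> B /xE[].
  rewrite -rmorph_prod -(rmorph_int iota) -rmorphM; apply: intg_rmorph.
  by apply: block_values_intg => B /xE[].
- move=> h _ _ /block_value_listP[B Bb ->] /block_value_listP[B' Bb' ->].
  rewrite -!horner_rat_embed => /eqP; rewrite fmorph_eq0 => /eqP h0.
  have [s sG <-] := gal_act_transitive sf fr genr ur irr Bb Bb'.
  by rewrite -th_gal// -horner_rat_morph h0 !rmorph0.
move=> h; rewrite prod_block_values (eq_bigr (fun B => iota (map_poly (in_alg L) h).[th B])); last first.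
  by move=> B _; rewrite horner_rat_embed.
rewrite -rmorph_prod; set X := \prod_(_ in _) _.
have /vlineP[q ->] : X \in 1%VS.
  apply: gal_fixed_base => // s sG; rewrite /X rmorph_prod.
  rewrite -[RHS](blocks_prod_gal (fun B => (map_poly (in_alg L) h).[th B]) sG).
  by apply: eq_bigr => B _; rewrite -th_gal// -horner_rat_morph.
by rewrite -[iota _]/((iota \o in_alg L) q) fmorph_eq_rat Crat_rat.
Qed.

(** Each value is at most a constant times the product of [1 + |al i|] over the block, so the
    product over the blocks reduces to Landau's inequality for [f]. *)
Lemma block_values_bound (M m : nat) (ts : seq nat) : (forall i : nat, (absz (f`_i)%R <= M)%N) ->
  (forall t, t \in ts -> (t <= m)%N) ->
  `|(lead_coef f)%:~R| * \prod_(z <- rs) (1 + \sum_(t <- ts) `|(F z).[t%:R]|) <=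
  ((2 * k.+3) ^ k.+3 * (1 + size ts * m.+1 ^ k.+3) ^ k.+3 * M)%N%:R :> algC.
Proof.
move=> fM tm; pose al i := iota (tnth r i).
have fE : map_poly (intr : int -> algC) f = (lead_coef f)%:~R *: \prod_(x <- [seq al i | i <- index_enum 'I_k.+3]) ('X - x%:P).
  have -> : map_poly (intr : int -> algC) f = map_poly iota (map_poly (intr : int -> L) f).
    by rewrite -map_poly_comp; apply: eq_map_poly => z /=; rewrite rmorph_int.
  rewrite (root_factorisation fr) map_polyZ rmorph_int; congr (_ *: _).
  rewrite big_map big_tuple rmorph_prod; apply: eq_bigr => i _.
  by rewrite rmorphB /= map_polyX map_polyC.
have LB := @landau algC [seq al i | i <- index_enum 'I_k.+3] (lead_coef f)%:~R M%:R.
have {}LB : `|(lead_coef f)%:~R| * \prod_i (1 + `|al i|) <= ((2 * k.+3) ^ k.+3 * M)%N%:R.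
  have sI : size (index_enum 'I_k.+3) = k.+3 by rewrite -sum1_size sum1_card card_ord.
  have -> : ((2 * k.+3) ^ k.+3 * M)%N%:R = (2 * k.+3)%N%:R ^+ k.+3 * M%:R :> algC by rewrite natrM natrX.
  have hB i : `|((lead_coef f)%:~R *: \prod_(x <- [seq al i | i <- index_enum 'I_k.+3]) ('X - x%:P))`_i| <= M%:R.
    rewrite -fE coef_map /= -intr_norm -[M%:R]/(M%:~R) ler_int.
    by rewrite -abszE lez_nat.
  by have := LB hB; rewrite big_map size_map sI.
set q := (1 + size ts * m.+1 ^ k.+3)%N.
have al1 i : 1 <= 1 + `|al i| by rewrite lerDl.
have al0 i : 0 <= 1 + `|al i| by rewrite addr_ge0.
have vB B : B \in Q -> 1 + \sum_(t <- ts) `|(F (iota (th B))).[t%:R]| <= q%:R * \prod_(i | bl i == B) (1 + `|al i|).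
  move=> Bb; set Pi := \prod_(i | _) _.
  have Pi1 : 1 <= Pi by apply: (big_ind (fun x => 1 <= x)) => // x y; exact: mulr_ege1.
  rewrite natrD mulrDl mul1r lerD// natrM -mulrA -[size ts]sum1_size natr_sum mulr_suml.
  rewrite big_seq [leRHS]big_seq; apply: ler_sum => t tts; rewrite mul1r block_factor_value//.
  rewrite /block_poly horner_prod rmorph_prod normr_prod.
  apply: (@le_trans _ _ (\prod_(i | bl i == B) (m.+1%:R * (1 + `|al i|)))).
    apply: ler_prod => i _; rewrite normr_ge0 /= !hornerE rmorphB /= rmorph_nat -/(al i).
    apply: le_trans (ler_normB _ _) _; rewrite normr_nat mulrDr mulr1 lerD//.
      by rewrite ler_nat leqW// tm.
    by rewrite ler_peMl// (ler_nat _ 1).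
  rewrite big_split /= prodr_const ler_wpM2r ?(le_trans ler01)//.
  rewrite -natrX ler_nat leq_pexp2l//; apply: leq_trans (max_card _) _.
  by rewrite card_ord.
rewrite prod_block_values.
apply: (@le_trans _ _ (`|(lead_coef f)%:~R| * \prod_(B in Q) (q%:R * \prod_(i | bl i == B) (1 + `|al i|)))).
  rewrite ler_wpM2l//; apply: ler_prod => B Bb; rewrite vB// andbT.
  by rewrite addr_ge0// sumr_ge0.
rewrite big_split /= blocks_prod_index prodr_const mulrCA mulrC.
have -> : ((2 * k.+3) ^ k.+3 * q ^ k.+3 * M)%N%:R = ((2 * k.+3) ^ k.+3 * M)%N%:R * (q ^ k.+3)%N%:R :> algC.
  by rewrite -natrM mulnAC.
apply: ler_pM => //; [by rewrite mulr_ge0// prodr_ge0|exact: exprn_ge0|].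
rewrite -natrX ler_nat leq_pexp2l//.
rewrite -[X in (_ <= X)%N](card_blocks sf fr genr ur irr) leq_pmull//.
by rewrite card_gt0; apply/set0Pn; exists ord0; exact: swap_block_refl.
Qed.

End BlockConstruction.

(** * Counting polynomials with a system of blocks *)

Lemma size_le_card_inj (A : eqType) (D : finType) (Rl : A -> D -> Prop) (s : seq A) : uniq s ->
  (forall x, x \in s -> exists d, Rl x d) ->
  (forall x y d, x \in s -> y \in s -> Rl x d -> Rl y d -> x = y) -> (size s <= #|D|)%N.
Proof.
move=> us hex hinj.
apply: (@leq_trans (\sum_(d <- enum D) size [seq x <- s | `[< Rl x d >]])%N).
  apply: size_le_cover_sum => x xs; apply/hasP; have [d hd] := hex x xs.
  by exists d; rewrite ?mem_enum//; apply/asboolP.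
rewrite cardE -[leqRHS]sum1_size; apply: leq_sum => d _.
have : uniq [seq x <- s | `[< Rl x d >]] by rewrite filter_uniq.
have : {in [seq x <- s | `[< Rl x d >]] &, forall x y, x = y}.
  move=> x y; rewrite !mem_filter => /andP[/asboolP h1 xs] /andP[/asboolP h2 ys].
  exact: (hinj x y d).
case: [seq x <- s | _] => [|x [|y t]]//= H; rewrite inE.
by rewrite (H x y) ?inE ?eqxx ?orbT.
Qed.

Section Cells.
Variables (T Y : nat).
Hypotheses (T0 : (0 < T)%N) (Y0 : (0 < Y)%N).

(** The index of a subinterval of length [2 * Y / T] of the interval from [-Y] to [Y]. The right end
    point has index [T], whence [T + 1] indices in the counts. *)
Definition cell (x : algC) : nat := Num.truncn ((x + Y%:R) * T%:R / (2 * Y%:R)).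

Let Y2 : (0 : algC) < 2 * Y%:R. Proof. by rewrite mulr_gt0// ltr0n. Qed.
Let TR : (0 : algC) < T%:R. Proof. by rewrite ltr0n. Qed.

Lemma cell_arg_ge0 (x : algC) : x \is Num.real -> `|x| <= Y%:R -> 0 <= (x + Y%:R) * T%:R / (2 * Y%:R).
Proof.
move=> xr xY; rewrite divr_ge0 ?(ltW Y2)// mulr_ge0//.
by rewrite -lerBlDr sub0r; have /andP[] : - Y%:R <= x <= Y%:R by rewrite -real_ler_norml.
Qed.

Lemma cell_le (x : algC) : x \is Num.real -> `|x| <= Y%:R -> (cell x <= T)%N.
Proof.
move=> xr xY; rewrite /cell -ltnS truncn_lt_nat ?cell_arg_ge0//.
apply: (@le_lt_trans _ _ T%:R); last by rewrite ltr_nat.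
rewrite ler_pdivrMr// mulrC ler_wpM2l ?(ltW TR)//.
rewrite mulrDl mul1r lerD2r.
by have /andP[] : - Y%:R <= x <= Y%:R by rewrite -real_ler_norml.
Qed.

Lemma cell_close (x y : algC) : x \is Num.real -> y \is Num.real -> `|x| <= Y%:R -> `|y| <= Y%:R ->
  cell x = cell y -> `|x - y| <= 2 * Y%:R / T%:R.
Proof.
move=> xr yr xY yY e.
have /andP[lx ux] := truncn_itv (cell_arg_ge0 xr xY).
have /andP[ly uy] := truncn_itv (cell_arg_ge0 yr yY).
rewrite -/(cell x) e in lx ux; rewrite -/(cell y) in ly uy.
have E : (x - y) = ((x + Y%:R) * T%:R / (2 * Y%:R) - (y + Y%:R) * T%:R / (2 * Y%:R)) * (2 * Y%:R / T%:R).
  by field; rewrite !gt_eqF//= ltr0n.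
have q0 : (0 : algC) < 2 * Y%:R / T%:R by rewrite divr_gt0.
rewrite E normrM (gtr0_norm q0) ler_piMl ?(ltW q0)//.
set u := (x + _) * _ / _ in lx ux *; set v := (y + _) * _ / _ in ly uy *.
have uvr : u - v \is Num.real by rewrite rpredB// ger0_real ?cell_arg_ge0.
rewrite real_ler_norml//; apply/andP; split.
  rewrite lerBrDr addrC lerBlDr; apply: le_trans (ltW uy) _.
  by rewrite -natr1 lerD2r.
rewrite lerBlDr; apply: le_trans (ltW ux) _.
by rewrite -natr1 addrC lerD2l.
Qed.

End Cells.

(** The summand 1 keeps every factor of the product over the roots at least 1, so that a single one
    is bounded by the whole product. *)
Definition block_size (a c : nat) (F : algC -> {poly algC}) (z : algC) : algC :=
  1 + \sum_(t <- iota c.+1 a.-1) `|(F z).[t%:R]|.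

Lemma block_size_ge1 a c F z : 1 <= block_size a c F z.
Proof. by rewrite lerDl sumr_ge0. Qed.

Lemma block_size_ge a c F z (t : 'I_a.-1) : `|(F z).[(c.+1 + t)%N%:R]| <= block_size a c F z.
Proof.
rewrite /block_size (bigD1_seq (c.+1 + t)%N) ?iota_uniq//=; last first.
  by rewrite mem_iota leq_addr ltn_add2l /=.
by rewrite addrCA lerDl addr_ge0// sumr_ge0.
Qed.

(** A list of roots chosen from [P] alone, so that polynomials with the same resolvent share one
    enumeration of the conjugates. *)
Definition rootsC (P : {poly int}) : seq algC :=
  sval (closed_field_poly_normal (map_poly (intr : int -> algC) P)).

Lemma block_roots_perm f a c P rs F g : f != 0 -> block_data f a c P rs F g -> perm_eq rs (rootsC P).
Proof.
move=> f0 bf; rewrite /rootsC; case: closed_field_poly_normal => rs' /= E.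
apply: prod_XsubC_eq.
have m (u : seq algC) : \prod_(z <- u) ('X - z%:P) \is monic by rewrite monic_prod_XsubC.
have l0 : (lead_coef f)%:~R != 0 :> algC by rewrite intr_eq0 lead_coef_eq0.
move: E; rewrite {2}(block_P bf) lead_coefZ (monicP (m rs)) mulr1 (block_P bf) => /(congr1 (fun p => (lead_coef f)%:~R^-1 *: p)).
by rewrite !scalerA mulVf// !scale1r => ->.
Qed.

Lemma block_size_P f a c P rs F g : f != 0 -> block_data f a c P rs F g -> size P = (size rs).+1.
Proof.
move=> f0 bf; have l0 : (lead_coef f)%:~R != 0 :> algC by rewrite intr_eq0 lead_coef_eq0.
have : size (map_poly (intr : int -> algC) P) = (size rs).+1.
  by rewrite (block_P bf) size_scale// size_prod_XsubC.
by rewrite size_map_inj_poly//; exact: intr_inj.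
Qed.

Lemma content_gcd_dvd (P : {poly int}) (i : nat) : (content_gcd P %| absz (P`_i)%R)%N.
Proof.
have [lt|ge] := ltnP i (size P); last by rewrite nth_default.
by have /= := @biggcdn_inf _ (Ordinal lt) xpredT (fun i : 'I_(size P) => absz P`_i) (absz P`_i) isT (dvdnn _).
Qed.

Definition block_package (a b c B : nat) (f P : {poly int}) (rs : seq algC) (F : algC -> {poly algC})
    (g : nat -> {poly rat}) : Prop :=
  [/\ block_data f a c P rs F g, size rs = b, forall i : nat, (absz (P`_i)%R <= B)%N
    & `|(lead_coef f)%:~R| * \prod_(z <- rs) block_size a c F z <= B%:R ].

(** The code of a polynomial consists of its resolvent divided by [q], the power of [Z] just below
    the size at each root, and the cells of the values on the scale of that size. Adapting the scale
    to each root costs one factor [Z] per root, and then only the product of the sizes, bounded by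
    [B], enters the condition on [T]. *)
Lemma count_blocks (a b c B q T Z w : nat) (s : seq {poly int}) : uniq s -> (1 < Z)%N ->
  (0 < T)%N -> (B < Z ^ w)%N -> (q * B * (4 * Z) ^ b < T ^ b)%N ->
  (forall f, f \in s -> f != 0 /\ exists P rs F g, block_package a b c B f P rs F g /\ content_gcd P = q) ->
  (size s <= (2 * (B %/ q) + 1) ^ b.+1 * w ^ b * T.+1 ^ (b * a.-1))%N.
Proof.
move=> us Z1 T0 BZ hT hs.
pose DP := {ffun 'I_b.+1 -> 'I_(2 * (B %/ q)).+1}; pose DK := {ffun 'I_b -> 'I_w}.
pose DC := {ffun 'I_b * 'I_a.-1 -> 'I_T.+1}.
pose Pof (d : DP) : {poly int} := \poly_(i < b.+1) (q%:Z * ((d (inord i) : nat)%:Z - (B %/ q)%N%:Z)).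
have cD : ((2 * (B %/ q) + 1) ^ b.+1 * w ^ b * T.+1 ^ (b * a.-1) = #|{: DP * DK * DC}|)%N.
  by rewrite addn1 !card_prod !card_ffun !card_prod !card_ord.
pose Y (k : nat) := (Z ^ k.+1)%N.
have Y0 k : (0 < Y k)%N by rewrite expn_gt0 ltnW.
pose Rl (f : {poly int}) (d : DP * DK * DC) := exists F g, let P := Pof d.1.1 in let rs := rootsC P in
  [/\ block_data f a c P rs F g, size rs = b, content_gcd P = q,
     `|(lead_coef f)%:~R| * \prod_(z <- rs) block_size a c F z <= B%:R
   & forall i : 'I_b, let z := rs`_i in let k := d.1.2 i in
     (Z ^ k)%N%:R <= block_size a c F z < (Y k)%:R /\
     forall t, (d.2 (i, t) : nat) = cell T (Y k) (cpart z (F z).[(c.+1 + t)%N%:R])].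
rewrite cD; apply: (@size_le_card_inj _ _ Rl) => //.
  move=> f fs; have [f0 [P [rs0 [F [g [[bf0 sz0 PB lB0] cq]]]]]] := hs f fs.
  have pr := block_roots_perm f0 bf0.
  have bf := block_data_perm pr bf0.
  have sz : size (rootsC P) = b by rewrite -(perm_size pr).
  have lB : `|(lead_coef f)%:~R| * \prod_(z <- rootsC P) block_size a c F z <= B%:R by rewrite -(perm_big _ pr).
  have sP : size P = b.+1 by rewrite (block_size_P f0 bf) sz.
  have l1 : (1 : algC) <= `|(lead_coef f)%:~R|.
    by rewrite norm_intr_ge1 ?rpred_int// intr_eq0 lead_coef_eq0.
  have q0 : (0 < q)%N by rewrite -cq; exact: (kap_gt0 bf f0).
  have qd i : (q %| absz (P`_i)%R)%N by rewrite -cq content_gcd_dvd.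
  have SB z : z \in rootsC P -> block_size a c F z <= B%:R.
    move=> zr; apply: le_trans lB; rewrite (big_rem z)//=.
    have p1 : 1 <= \prod_(y <- rem z (rootsC P)) block_size a c F y.
      apply: (big_ind (fun x => 1 <= x)) => // [x y|y _]; [exact: mulr_ege1|exact: block_size_ge1].
    have s0 := le_trans ler01 (block_size_ge1 a c F z).
    rewrite mulrA -[leLHS]mulr1 ler_pM//; first by rewrite ler_peMl.
  set m := (B %/ q)%N in DP DK DC Pof Rl cD *.
  have pE i : P`_i = (P`_i %/ q)%Z * q%:Z.
    by apply/esym/eqP; rewrite -dvdz_eq; exact: qd.
  have pm i : (absz (P`_i %/ q)%Z <= m)%N.
    by rewrite /m leq_divRL// -[q]/(absz q%:Z) -abszM -pE.
  pose vP : DP := [ffun i : 'I_b.+1 => inord (absz ((P`_i %/ q)%Z + m%:Z)%R)].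
  have PofE : Pof vP = P.
    apply/polyP => i; rewrite coef_poly; case: ltnP => [ib|]; last by move=> ge; rewrite nth_default ?sP.
    rewrite ffunE inordK ?inordK//; last by have := pm i; clear; lia.
    rewrite gez0_abs; last by have := pm i; clear; lia.
    by rewrite addrK mulrC -pE.
  have exK (i : 'I_b) : exists k : 'I_w, (Z ^ k)%N%:R <= block_size a c F (rootsC P)`_i < (Y k)%:R.
    set S := block_size _ _ _ _.
    have zr : (rootsC P)`_i \in rootsC P by rewrite mem_nth// sz.
    have S1 : 1 <= S := block_size_ge1 _ _ _ _.
    have S0 : 0 <= S := le_trans ler01 S1.
    have /andP[l1' l2] := truncn_itv S0; set t := Num.truncn S in l1' l2.
    have t0 : (0 < t)%N by rewrite truncn_gt0.
    have := trunc_log_bounds Z1 t0; set k := trunc_log Z t => /andP[k1 k2].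
    have kw : (k < w)%N.
      rewrite -(@ltn_exp2l Z)//; apply: leq_ltn_trans BZ.
      rewrite -(ler_nat algC); apply: le_trans (SB _ zr); apply: le_trans l1'.
      by rewrite ler_nat.
    exists (Ordinal kw); apply/andP; split=> /=; first by apply: le_trans l1'; rewrite ler_nat.
    by apply: lt_le_trans l2 _; rewrite ler_nat.
  have [vk vkE] := choice exK.
  pose vC : DC := [ffun u : 'I_b * 'I_a.-1 => inord (cell T (Y (vk u.1)) (cpart (rootsC P)`_u.1 (F (rootsC P)`_u.1).[(c.+1 + u.2)%N%:R]))].
  exists (vP, [ffun i => vk i], vC), F, g; rewrite /= PofE; split=> // i.
  rewrite ffunE; split=> // t; rewrite ffunE inordK//= ltnS.
  apply: cell_le => //; first exact: cpart_real.
  apply: le_trans (cpart_norm _ _) _; apply: le_trans (block_size_ge _ _ _ _) _.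
  by apply: ltW; have /andP[] := vkE i.
move=> f f' [[dP dK] dC] fs fs' [F [g [bf sz cq lB hd]]] [F' [g' [bf' _ _ _ hd']]] /=.
move: bf sz cq lB hd bf' hd' => /=; set P := Pof dP; set rs := rootsC P => bf sz cq lB hd bf' hd'.
have [f0 _] := hs f fs.
pose kz (z : algC) : nat := if insub (index z rs) is Some i then dK i else 0%N.
have kzE (i : 'I_b) : kz rs`_i = dK i.
  by rewrite /kz index_uniq ?sz ?(block_uniq bf)// insubT// => ii; congr (nat_of_ord (dK _)); exact: val_inj.
have rsE z : z \in rs -> exists i : 'I_b, z = rs`_i.
  move=> zr; have lt : (index z rs < b)%N by rewrite -sz index_mem.
  by exists (Ordinal lt); rewrite /= nth_index.
have Zk (u v : nat) : (Z ^ u)%N%:R < (Z ^ v.+1)%N%:R :> algC -> (u <= v)%N.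
  by rewrite ltr_nat ltn_exp2l.
have Ssym z : z \in rs -> block_size a c F z^* = block_size a c F z.
  move=> zr; congr (_ + _); apply: eq_bigr => t _.
  rewrite (block_rat bf (block_conj bf f0 zr)) (block_rat bf zr) ratr_horner_conj.
  by rewrite norm_conjC.
pose eps z : algC := 2 * (Y (kz z))%:R / T%:R.
apply: (@block_rigidity f f' a c P rs F F' g g' bf bf' f0 eps).
- move=> z zr; rewrite /eps; congr (2 * (Y _)%:R / _).
  have [i iE] := rsE z zr; have [i' iE'] := rsE _ (block_conj bf f0 zr).
  have [/andP[h1 h2] _] := hd i; have [/andP[h3 h4] _] := hd i'.
  move: h3 h4; rewrite -iE' Ssym// => h3 h4; move: h1 h2; rewrite -iE => h1 h2.
  rewrite iE' iE !kzE; apply/eqP; rewrite eqn_leq; apply/andP; split; apply: Zk.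
    exact: le_lt_trans h3 h2.
  exact: le_lt_trans h1 h4.
- have TR : (0 : algC) < T%:R by rewrite ltr0n.
  have le1 : \prod_(z <- rs) (2 * eps z) <= \prod_(z <- rs) ((4 * Z)%N%:R / T%:R * block_size a c F z).
    rewrite big_seq [leRHS]big_seq; apply: ler_prod => z zr; apply/andP; split.
      by rewrite mulr_ge0// /eps divr_ge0// mulr_ge0.
    have [i iE] := rsE z zr; have [/andP[h1 _] _] := hd i.
    rewrite /eps iE kzE /Y expnS natrM natrM.
    have -> : 2 * (2 * (Z%:R * (Z ^ dK i)%:R) / T%:R) = 4 * Z%:R / T%:R * (Z ^ dK i)%:R :> algC by ring.
    by rewrite ler_wpM2l// divr_ge0// mulr_ge0.
  have kp : (0 : algC) <= (content_gcd P)%:R by [].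
  apply: (@le_lt_trans _ _ ((q * B * (4 * Z) ^ b)%N%:R / T%:R ^+ b)).
    apply: le_trans (ler_wpM2l _ le1) _; first by rewrite mulr_ge0.
    rewrite big_split /= big_const_seq count_predT sz iter_mulr_1 expr_div_n cq.
    have -> : (q * B * (4 * Z) ^ b)%N%:R = q%:R * B%:R * (4 * Z)%N%:R ^+ b :> algC by rewrite !natrM natrX natrM.
    set S := \prod_(_ <- _) _ in lB *; set u := _ ^+ b; set v := _ ^+ b.
    have -> : `|(lead_coef f)%:~R| * q%:R * (u / v * S) = (`|(lead_coef f)%:~R| * S) * (q%:R * (u / v)) by ring.
    have -> : q%:R * B%:R * u / v = B%:R * (q%:R * (u / v)) by ring.
    by rewrite ler_wpM2r// mulr_ge0// divr_ge0 ?exprn_ge0// ltW.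
  by rewrite ltr_pdivrMr ?exprn_gt0// mul1r -natrX ltr_nat.
move=> t z zr; have [i iE] := rsE z zr; rewrite iE /eps kzE -cpartB.
have [/andP[_ h2] hc] := hd i; have [/andP[_ h2'] hc'] := hd' i.
rewrite cpartB; apply: cell_close => //; rewrite ?cpart_real//.
- apply: le_trans (cpart_norm _ _) _; apply: le_trans (block_size_ge _ _ _ _) _; exact: ltW.
- apply: le_trans (cpart_norm _ _) _; apply: le_trans (block_size_ge _ _ _ _) _; exact: ltW.
by rewrite -hc -hc'.
Qed.

Definition has_transposition (k : nat) (f : {poly int}) : Prop :=
  exists (L : splittingFieldType rat) (r : k.+3.-tuple L),
    [/\ map_poly (in_alg L) (map_poly (intr : int -> rat) f) %= \prod_(x <- r) ('X - x%:P),
        <<1 & r>>%VS = fullv, root_perms r != [set: 'S_k.+3]%SET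
      & exists i j : 'I_k.+3, i != j /\ tperm i j \in root_perms r].

Lemma exists_block_package (k : nat) : exists c0 K : nat, (0 < K)%N /\ forall (f : {poly int}) (M : nat),
  size f = k.+4 -> irreducible_poly (map_poly (intr : int -> rat) f) -> has_transposition k f ->
  (forall i : nat, (absz (f`_i)%R <= M)%N) ->
  exists a b c P rs F g, [/\ (a * b = k.+3)%N, (2 <= a)%N, (2 <= b)%N, (c <= c0)%N
    & block_package a b c (K * M) f P rs F g].
Proof.
(* [m] bounds all points of evaluation: [c], and the next [a - 1] integers with [a] at most
   [k + 3]. *)
pose c0 := (k.+3 * 2 ^ k.+3 * 2 ^ k.+3)%N; pose m := (c0 + k.+3)%N.
pose K := ((2 * k.+3) ^ k.+3 * (1 + k.+3 * m.+1 ^ k.+3) ^ k.+3)%N.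
exists c0, K; split; first by rewrite muln_gt0 !expn_gt0.
move=> f M sf irr [L [r [fr genr nT [i [j [ij tij]]]]]] fM.
have ur := irreducible_uniq_roots irr fr.
have gL := galL sf fr genr ur.
have [emb _] := exists_algC_embedding gL.
have [c [cc inj]] := exists_separating sf fr genr ur irr.
have [P [g bf]] := block_data_exists sf fr genr ur irr inj emb.
pose a := #|swap_block (root_perms_group r) ord0|; pose b := #|blocks r|.
have ab : (a * b = k.+3)%N := card_blocks sf fr genr ur irr.
have a2 : (2 <= a)%N.
  rewrite /a -(card_block sf fr genr ur irr i).
  apply: (@leq_trans #|[set i; j]%SET|); first by rewrite cards2 ij.
  apply: subset_leq_card; apply/subsetP => l /set2P[->|->]; first exact: swap_block_refl.
  by rewrite inE.
have an : (a <= k.+3)%N by rewrite -[X in (_ <= X)%N]card_ord; exact: max_card.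
have b2 : (2 <= b)%N.
  have b0 : (0 < b)%N by case: (b) ab => //; rewrite muln0.
  rewrite ltn_neqAle b0 andbT eq_sym; apply: contraNneq nT => b1.
  apply/eqP; apply: (@swap_block_full _ (root_perms_group r) ord0).
  apply/eqP; rewrite eqEcard finset.subsetT cardsT card_ord.
  by move: ab; rewrite b1 muln1 /a => ->; rewrite leqnn.
have bnd := block_values_bound sf fr genr ur irr inj emb fM.
exists a, b, c, P, (block_value_list r c emb), (block_factor r c emb), g; split=> //.
split=> //; first exact: size_block_values.
  move=> l; rewrite -(ler_nat algC) natr_absz intr_norm.
  rewrite -[(P`_l)%:~R](coef_map (intr : {rmorphism int -> algC})) (block_P bf).
  apply: le_trans (coef_prod_bound _ _ _) _.
  have := bnd m [:: c] _; rewrite /= mul1n => h.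
  apply: (@le_trans _ _ (((2 * k.+3) ^ k.+3 * (1 + m.+1 ^ k.+3) ^ k.+3 * M)%N%:R)); last first.
    rewrite ler_nat leq_mul2r /K leq_mul2l leq_exp2r// leq_add2l leq_pmull// !orbT//.
  apply: le_trans (h _).
    rewrite le_eqVlt; apply/orP; left; apply/eqP; congr (_ * _).
    by apply: eq_big_seq => z zr; rewrite big_seq1; have [_ _ ->] := block_monic bf zr.
  by move=> t; rewrite inE => /eqP ->; rewrite /m (leq_trans cc)// leq_addr.
have h t : t \in iota c.+1 a.-1 -> (t <= m)%N.
  rewrite mem_iota => /andP[_ h]; rewrite /m -ltnS; apply: leq_trans h _.
  by rewrite addSn ltnS leq_add// (leq_trans (leq_pred _)).
rewrite /block_size; apply: le_trans (bnd m _ h) _.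
rewrite ler_nat leq_mul2r /K leq_mul2l leq_exp2r// leq_add2l size_iota leq_mul2r.
by rewrite (leq_trans (leq_pred _) an) !orbT.
Qed.

(** The two terms of the maximum are the exponents for the smallest and the largest content; the
    additional 1 pays for the sum over all contents. *)
Lemma block_exponents (n a b : nat) : (10 <= n)%N -> (a * b = n)%N -> (2 <= a)%N -> (2 <= b)%N ->
  ((maxn (b.+1 + a.-1) (2 * a.-1)).+1 <= n.-1)%N.
Proof.
move=> n10 ab a2 b2; have h1 : (a + b + 1 <= n.-1)%N by nia.
have h2 : (2 * a - 1 <= n.-1)%N by nia.
rewrite -maxnSS geq_max; apply/andP; split; clear -h1 h2 a2; lia.
Qed.

(** Up to rounding the left side is a monomial in [q], so the extreme cases are [q = 1] and
    [q = B]. *)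
Lemma quotient_power_bound (B q e1 e2 : nat) : (0 < q <= B)%N ->
  ((B %/ q) ^ e1 * (q * B) ^ e2 <= B ^ maxn (e1 + e2) (2 * e2))%N.
Proof.
move=> /andP[q0 qB]; have B0 : (0 < B)%N by apply: leq_trans qB.
have qd : ((B %/ q) * q <= B)%N by exact: leq_trunc_div.
have qd' : (B %/ q <= B)%N by exact: leq_div.
have lexp u v e : (u <= v)%N -> (u ^ e <= v ^ e)%N by case: e => [|e]//; rewrite leq_exp2r.
have [le|lt] := leqP e2 e1.
  apply: (@leq_trans (B ^ (e1 + e2))); last by rewrite leq_pexp2l// leq_maxl.
  rewrite -(subnK le) expnD -mulnA -expnMn mulnA -addnA expnD.
  apply: leq_mul; first exact: lexp.
  by rewrite expnMn expnD leq_mul// lexp.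
apply: (@leq_trans (B ^ (2 * e2))); last by rewrite leq_pexp2l// leq_maxr.
rewrite mul2n -addnn expnD expnMn mulnA leq_mul//.
rewrite -(subnK (ltnW lt)) addnC [(q ^ _)%N]expnD mulnA -expnMn expnD.
by rewrite leq_mul// lexp.
Qed.

Lemma block_count_bound (n a b B q T Z w : nat) : (10 <= n)%N -> (a * b = n)%N -> (2 <= a)%N -> (2 <= b)%N ->
  (0 < q <= B)%N -> (0 < Z)%N -> (0 < w)%N -> (T ^ b <= 2 ^ b * (q * B * (4 * Z) ^ b))%N ->
  (B * ((2 * (B %/ q) + 1) ^ b.+1 * w ^ b * T ^ (b * a.-1)) <=
    3 ^ n * w ^ n * (8 * Z) ^ n * B ^ n.-1)%N.
Proof.
move=> n10 ab a2 b2 /andP[q0 qB] Z0 w0 hT.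
have E := block_exponents n10 ab a2 b2.
have lexp u v e : (u <= v)%N -> (u ^ e <= v ^ e)%N by case: e => [|e]//; rewrite leq_exp2r.
have B0 : (0 < B)%N by apply: leq_trans qB.
have bn : (b.+1 <= n)%N by rewrite -ab; nia.
have h1 : ((2 * (B %/ q) + 1) ^ b.+1 <= 3 ^ n * (B %/ q) ^ b.+1)%N.
  apply: (@leq_trans ((3 * (B %/ q)) ^ b.+1)).
    have Bq : (0 < B %/ q)%N by rewrite divn_gt0.
    by apply: lexp; move: Bq; move: (B %/ q)%N => u; lia.
  by rewrite expnMn leq_mul2r leq_pexp2l// orbT.
have h2 : (w ^ b <= w ^ n)%N by rewrite leq_pexp2l// ltnW.
have h3 : (T ^ (b * a.-1) <= (8 * Z) ^ n * (q * B) ^ a.-1)%N.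
  rewrite expnM; apply: (@leq_trans ((2 ^ b * (q * B * (4 * Z) ^ b)) ^ a.-1)); first exact: lexp.
  have -> : (2 ^ b * (q * B * (4 * Z) ^ b) = (8 * Z) ^ b * (q * B))%N.
    by rewrite mulnCA -expnMn mulnA mulnC.
  rewrite expnMn leq_mul2r -expnM.
  by rewrite leq_pexp2l ?muln_gt0// ?orbT// -ab mulnC leq_mul2r leq_pred orbT.
apply: (@leq_trans (B * ((3 ^ n * (B %/ q) ^ b.+1) * w ^ n * ((8 * Z) ^ n * (q * B) ^ a.-1)))).
  by rewrite leq_mul2l !leq_mul ?orbT.
have h4 := @quotient_power_bound B q b.+1 a.-1.
have {}h4 : (B * ((B %/ q) ^ b.+1 * (q * B) ^ a.-1) <= B ^ n.-1)%N.
  apply: (@leq_trans (B * B ^ maxn (b.+1 + a.-1) (2 * a.-1))).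
    by rewrite leq_mul2l h4 ?orbT// q0.
  by rewrite -expnS leq_pexp2l.
have -> : (B * (3 ^ n * (B %/ q) ^ b.+1 * w ^ n * ((8 * Z) ^ n * (q * B) ^ a.-1)) =
  3 ^ n * w ^ n * (8 * Z) ^ n * (B * ((B %/ q) ^ b.+1 * (q * B) ^ a.-1)))%N by ring.
by rewrite leq_mul2l h4 orbT.
Qed.

Lemma has_transposition_count (k : nat) : (10 <= k.+3)%N -> exists (G c Z0 : nat), (0 < G)%N /\
  forall Z : nat, (Z0 <= Z)%N -> forall s : seq {poly int}, uniq s ->
  (forall f, f \in s -> [/\ size f = k.+4, irreducible_poly (map_poly (intr : int -> rat) f),
     has_transposition k f & forall i : nat, (absz (f`_i)%R <= Z ^ G)%N]) ->
  (size s <= c * Z ^ (G * k.+3).-1)%N.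
Proof.
move=> n10; have [c0 [K [K0 HK]]] := exists_block_package k.
(* The rounding to powers of [Z] loses [Z ^ n]. With [G = n + 1] this stays one factor [Z] below the
   saving of [Z ^ G]. *)
pose n := k.+3; pose G := k.+4.
pose C1 := (3 ^ n * G.+1 ^ n * 8 ^ n * K ^ n.-1)%N.
exists G, (n.+1 * (n.+1 * (c0.+1 * C1)))%N, (K + 2)%N; split=> // Z hZ s us Hs.
have Z1 : (1 < Z)%N by lia.
have KZ : (K < Z)%N by lia.
have Z0 : (0 < Z)%N by rewrite ltnW.
set B := (K * Z ^ G)%N.
have BZ : (B < Z ^ G.+1)%N by rewrite expnS ltn_mul2r expn_gt0 Z0 KZ.
pose Rl (f : {poly int}) (d : nat * (nat * (nat * nat))) := exists P rs F g,
  block_package d.1 d.2.1 d.2.2.1 B f P rs F g /\ content_gcd P = d.2.2.2 /\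
  [/\ (d.1 * d.2.1 = n)%N, (2 <= d.1)%N, (2 <= d.2.1)%N & (0 < d.2.2.2 <= B)%N].
pose D := [seq (a, u) | a <- iota 0 n.+1, u <- [seq (b, v) | b <- iota 0 n.+1,
   v <- [seq (c, q) | c <- iota 0 c0.+1, q <- iota 1 B]]].
have szD : size D = (n.+1 * (n.+1 * (c0.+1 * B)))%N by rewrite !size_allpairs !size_iota.
have cov : (size s <= \sum_(d <- D) size [seq f <- s | `[< Rl f d >]])%N.
  apply: size_le_cover_sum => f fs; have [sf irr ht fM] := Hs f fs.
  have [a [b [c [P [rs [F [g [ab a2 b2 cc pk]]]]]]]] := HK f _ sf irr ht fM.
  have f0 : f != 0 by rewrite -size_poly_gt0 sf.
  have [bf srs PB _] := pk.
  have q0 := kap_gt0 bf f0.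
  have qB : (content_gcd P <= B)%N.
    have sP := block_size_P f0 bf.
    have lP : (0 < absz (lead_coef P))%N by rewrite absz_gt0 lead_coef_eq0 -size_poly_gt0 sP.
    apply: leq_trans (PB (size P).-1); rewrite lead_coefE in lP.
    by apply: dvdn_leq => //; exact: content_gcd_dvd.
  have an : (a <= n)%N by rewrite /n -ab leq_pmulr// ltnW.
  have bn : (b <= n)%N by rewrite /n -ab leq_pmull// ltnW.
  apply/hasP; exists (a, (b, (c, content_gcd P))).
    apply/allpairsP; exists (a, (b, (c, content_gcd P))); rewrite mem_iota add0n ltnS an; split=> //.
    apply/allpairsP; exists (b, (c, content_gcd P)); rewrite mem_iota add0n ltnS bn; split=> //.
    by apply/allpairsP; exists (c, content_gcd P); rewrite !mem_iota add0n !ltnS cc q0.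
  by apply/asboolP; exists P, rs, F, g; rewrite q0 qB.
have key d : (B * size [seq f <- s | `[< Rl f d >]] <= 3 ^ n * G.+1 ^ n * (8 * Z) ^ n * B ^ n.-1)%N.
  have [->|[f ft]] : [seq f <- s | `[< Rl f d >]] = [::] \/ exists f, f \in [seq f <- s | `[< Rl f d >]].
    by case: [seq f <- s | _] => [|f t]; [left|right; exists f; rewrite mem_head].
    by rewrite muln0.
  move: ft; rewrite mem_filter => /andP[/asboolP[_ [_ [_ [_ [_ [_ [ab a2 b2 qB]]]]]]] _].
  have [T [WT TW]] := exists_root_above (d.2.2.2 * B * (4 * Z) ^ d.2.1) (ltnW b2).
  have T2 : (2 < T)%N.
    rewrite ltnNge; apply/negP => T2; move: WT; rewrite ltnNge => /negP; apply.
    apply: (@leq_trans ((4 * Z) ^ d.2.1)).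
      by rewrite leq_exp2r ?(ltnW b2)//; apply: leq_trans T2 _; lia.
    case/andP: qB => q0 qB; apply: leq_pmull; rewrite muln_gt0 q0 (leq_trans q0 qB)//.
  have hT : (T.+1 ^ d.2.1 <= 2 ^ d.2.1 * (d.2.2.2 * B * (4 * Z) ^ d.2.1))%N.
    apply: (@leq_trans ((2 * T.-1) ^ d.2.1)).
      by rewrite leq_exp2r ?(ltnW b2)//; lia.
    by rewrite expnMn leq_mul2l TW orbT.
  apply: leq_trans (block_count_bound n10 ab a2 b2 qB Z0 (ltn0Sn _) hT).
  rewrite leq_mul2l; apply/orP; right.
  apply: (count_blocks (c := d.2.2.1) (filter_uniq _ us) Z1 _ BZ WT); first by apply: leq_trans T2.
  move=> f'; rewrite mem_filter => /andP[/asboolP[P [rs [F [g [pk [cP _]]]]]] fs].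
  have [sf' _ _ _] := Hs f' fs.
  by split; [rewrite -size_poly_gt0 sf'|exists P, rs, F, g].
have B0 : (0 < B)%N by rewrite muln_gt0 K0 expn_gt0 Z0.
rewrite -(@leq_pmul2l B)//.
apply: (@leq_trans (B * \sum_(d <- D) size [seq f <- s | `[< Rl f d >]])); first by rewrite leq_mul2l cov orbT.
rewrite big_distrr.
apply: (@leq_trans (\sum_(d <- D) (3 ^ n * G.+1 ^ n * (8 * Z) ^ n * B ^ n.-1))); first by apply: leq_sum => d _.
rewrite big_const_seq count_predT iter_addn_0 szD.
have GE : (G * k.+3).-1 = (n + G * n.-1)%N by rewrite /G /n /= mulSn mulnS; lia.
have E : (3 ^ n * G.+1 ^ n * (8 * Z) ^ n * B ^ n.-1 = C1 * Z ^ (G * k.+3).-1)%N.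
  by rewrite GE expnD expnM /B !expnMn /C1; ring.
rewrite E; move: (Z ^ _)%N n.+1 c0.+1 => u v w; clearbody C1 B.
by apply: eq_leq; ring.
Qed.

From mathcomp Require Import all_classical all_reals all_analysis complex.
From mathcomp Require Import zify ring lra.
Import Order.TTheory GRing.Theory Num.Theory.
Import numFieldNormedType.Exports.

(** * Exponential sums over a box *)

Section Exponential.
Variable R : realType.
Implicit Types x y : R.

Definition expi x : R[i] := Complex (cos (2 * pi * x)) (sin (2 * pi * x)).

Lemma expiD x y : expi (x + y) = expi x * expi y.
Proof.
rewrite /expi mulrDr cosD sinD; apply/eqP; rewrite eq_complex /= eqxx /=.
by apply/eqP; rewrite addrC [X in _ + X]mulrC [X in X + _]mulrC; ring.
Qed.

Lemma expi0 : expi 0 = 1.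
Proof. by rewrite /expi mulr0 cos0 sin0. Qed.

Lemma expiXn x (k : nat) : expi (k%:R * x) = expi x ^+ k.
Proof.
elim: k => [|k IH]; first by rewrite mul0r expi0 expr0.
by rewrite exprS -IH -expiD -natr1 mulrDl mul1r addrC.
Qed.

Lemma expi_nat (k : nat) : expi k%:R = 1.
Proof.
rewrite -[k%:R]mulr1 expiXn /expi mulr1 mulr_natl cos2pi.
by rewrite -[pi *+ 2]add0r sinD2pi sin0 expr1n.
Qed.

Lemma norm_expi x : `|expi x| = 1.
Proof. by rewrite normc_def /= cos2Dsin2 sqrtr1. Qed.

Lemma expi_modn (k p : nat) : (0 < p)%N -> expi ((k %% p)%N%:R / p%:R) = expi (k%:R / p%:R).
Proof.
move=> p0; rewrite {2}(divn_eq k p) natrD natrM mulrDl mulfK ?pnatr_eq0 -?lt0n//.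
by rewrite expiD expi_nat mul1r.
Qed.

Lemma expiN_norm x : `|1 - expi (- x)| = `|1 - expi x|.
Proof.
have -> : 1 - expi x = - expi x * (1 - expi (- x)).
  by rewrite mulrBr mulr1 mulNr -expiD subrr expi0; ring.
by rewrite normrM normrN norm_expi mul1r.
Qed.

(** Doubling the angle at most doubles [|1 - z|], because [|1 + z|] is at most 2. The doubling stops
    when the angle is at least a quarter turn, where the real part of [1 - z] is at least 1. *)
Lemma norm_1_expi_ge_small (u s : nat) : (0 < u)%N -> (u.*2 <= s)%N ->
  u.*2%:R / s%:R <= `|1 - expi (u%:R / s%:R)|.
Proof.
have [m] := ubnP (s - u); elim: m u => // m IH u lem u0 us.
have s0 : (0 < s)%N by lia.
have sR : (0 : R) < s%:R by rewrite ltr0n.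
have sC : (0 : R[i]) < s%:R by rewrite ltr0n.
have [h|h] := leqP (u * 4) s.
  have := IH u.*2 ltac:(lia) ltac:(lia) ltac:(lia).
  have -> : (u.*2)%:R / s%:R = 2%:R * (u%:R / s%:R) :> R by rewrite -muln2 natrM; ring.
  rewrite expiXn => g.
  have f : `|1 - expi (u%:R / s%:R) ^+ 2| <= `|1 - expi (u%:R / s%:R)| * 2.
    have -> : 1 - expi (u%:R / s%:R) ^+ 2 = (1 - expi (u%:R / s%:R)) * (1 + expi (u%:R / s%:R)) by ring.
    rewrite normrM ler_wpM2l// (le_trans (ler_normD _ _))// normr1 norm_expi.
    by rewrite -(natrD _ 1 1).
  have := le_trans g f; rewrite -[(u.*2.*2)%N]muln2 natrM mulrAC ler_pM2r//.
apply: (@le_trans _ _ 1).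
  by rewrite ler_pdivrMr// mul1r ler_nat.
apply: le_trans (normc_ge_Re _) => /=.
have -> : (1 : R[i]) = 1%:C%C by [].
rewrite lecR.
have c0 : cos (2 * pi * (u%:R / s%:R)) <= 0 :> R.
  have -> : 2 * pi * (u%:R / s%:R) = (2 * pi * (u%:R / s%:R) - pi) + pi :> R by ring.
  rewrite cosDpi oppr_le0; apply: cos_ge0_pihalf.
  have p0 := pi_gt0 R.
  have e1 : u%:R / s%:R <= 2^-1 :> R.
    by rewrite ler_pdivrMr// ler_pdivlMl// -natrM ler_nat mul2n.
  have e2 : 4^-1 <= u%:R / s%:R :> R.
    by rewrite ler_pdivlMr// ler_pdivrMl// -natrM ler_nat; lia.
  by nra.
by rewrite ler_normr; apply/orP; left; lra.
Qed.

Lemma norm_1_expi_ge (u s : nat) : (0 < u < s)%N ->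
  (minn u (s - u)).*2%:R / s%:R <= `|1 - expi (u%:R / s%:R)|.
Proof.
move=> /andP[u0 us]; have [h|h] := leqP u.*2 s.
  by rewrite (minn_idPl _); [exact: norm_1_expi_ge_small|lia].
rewrite (minn_idPr _); last by lia.
rewrite -expiN_norm.
have -> : expi (- (u%:R / s%:R)) = expi (1%:R - u%:R / s%:R) by rewrite expiD expi_nat mul1r.
have s0 : s%:R != 0 :> R by rewrite pnatr_eq0; lia.
have -> : 1%:R - u%:R / s%:R = (s - u)%N%:R / s%:R :> R.
  by rewrite natrB ?(ltnW us)//; field.
by apply: norm_1_expi_ge_small; lia.
Qed.

Lemma expi_neq1 (u s : nat) : (0 < u < s)%N -> expi (u%:R / s%:R) != 1.
Proof.
move=> us; rewrite eq_sym -subr_eq0 -normr_gt0; apply: lt_le_trans (norm_1_expi_ge us).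
by rewrite divr_gt0// ltr0n; lia.
Qed.

Lemma geometric_interval (z : R[i]) (A u v : nat) :
  (\sum_(b < A | (u <= b < v)%N) z ^+ b) * (1 - z) =
  z ^+ minn u (minn v A) - z ^+ minn v A.
Proof.
rewrite big_mkcond /=; elim: A => [|A IH]; first by rewrite big_ord0 minn0 minn0 mul0r subrr.
rewrite big_ord_recr /= mulrDl IH; case: ifP => [/andP[h1 h2]|/negbT h].
  have -> : minn v A = A by lia.
  have -> : minn v A.+1 = A.+1 by lia.
  have -> : minn u A = u by lia.
  have -> : minn u A.+1 = u by lia.
  by rewrite exprS; ring.
rewrite mul0r addr0; have [hv|hv] := leqP v A.
  by rewrite (minn_idPl (leqW hv)).
have -> : minn u A = A by lia.
have -> : minn u (minn v A.+1) = minn v A.+1 by lia.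
by rewrite !subrr.
Qed.

Lemma norm_geometric_le (z : R[i]) (A u v : nat) : `|z| = 1 ->
  `|\sum_(b < A | (u <= b < v)%N) z ^+ b| * `|1 - z| <= 2.
Proof.
move=> nz; rewrite -normrM geometric_interval (le_trans (ler_normB _ _))//.
by rewrite !normrX nz !expr1n.
Qed.

Lemma norm_interval_le (z : R[i]) (A u v Y : nat) : `|z| = 1 -> (v <= u + Y)%N ->
  `|\sum_(b < A | (u <= b < v)%N) z ^+ b| <= Y%:R.
Proof.
move=> nz vu; apply: le_trans (ler_norm_sum _ _ _) _.
under eq_bigr do rewrite normrX nz expr1n.
suff H : (\sum_(b < A | (u <= b < v)%N) 1 <= minn v A - u)%N.
  rewrite -(natr_sum _ _ _ (fun=> 1%N)) ler_nat (leq_trans H)//; lia.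
rewrite big_mkcond /=; elim: A => [|A IH]; first by rewrite big_ord0.
by rewrite big_ord_recr /=; case: ifP => [/andP[h1 h2]|_]; lia.
Qed.

Definition harmonic (s : nat) : R[i] := \sum_(1 <= u < s) u%:R^-1.

Lemma norm_interval_expi (A u v k s : nat) : (0 < k < s)%N ->
  `|\sum_(b < A | (u <= b < v)%N) expi (k%:R / s%:R) ^+ b| <=
  s%:R * (k%:R^-1 + (s - k)%N%:R^-1).
Proof.
move=> /andP[k0 ks].
have lb := norm_1_expi_ge (introT andP (conj k0 ks)).
have m0 : (0 : R[i]) < (minn k (s - k)).*2%:R / s%:R by rewrite divr_gt0// ltr0n; lia.
have n0 := lt_le_trans m0 lb.
have := norm_geometric_le A u v (norm_expi (k%:R / s%:R)).
rewrite -ler_pdivlMr// => h; apply: le_trans h _.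
apply: (@le_trans _ _ (2 / ((minn k (s - k)).*2%:R / s%:R))).
  by rewrite ler_pM2l// lef_pV2.
have e (w : nat) : (0 < w)%N -> 2 / (w.*2%:R / s%:R) = s%:R * w%:R^-1 :> R[i].
  move=> w0; rewrite -muln2 natrM; field.
  by rewrite !pnatr_eq0; lia.
rewrite e; last by lia.
rewrite ler_pM2l ?ltr0n; last by lia.
by rewrite /minn; case: ifP => _; rewrite ?lerDl ?lerDr invr_ge0 ler0n.
Qed.

(** The frequency 0 contributes at most [Y]. The others are bounded by the inverse distance of
    [k / s] to the nearest integer, which sums to a harmonic series from either end. *)
Lemma dirichlet_sum (A u v Y s : nat) : (0 < s)%N -> (v <= u + Y)%N ->
  \sum_(k < s) `|\sum_(b < A | (u <= b < v)%N) expi (k%:R / s%:R) ^+ b| <=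
  Y%:R + s%:R * (harmonic s * 2).
Proof.
case: s => // s _ vu; rewrite big_ord_recl; apply: lerD.
  by apply: norm_interval_le => //; exact: norm_expi.
pose f k : R[i] := k%:R^-1.
have h0 : harmonic s.+1 = \sum_(i < s) f i.+1.
  by rewrite /harmonic big_add1 /= big_mkord.
apply: (@le_trans _ _ (\sum_(i < s) s.+1%:R * (f i.+1 + f (s - i)%N))).
  apply: ler_sum => i _; rewrite lift0.
  by have := @norm_interval_expi A u v i.+1 s.+1; rewrite subSS; apply; have := ltn_ord i; lia.
rewrite -mulr_sumr big_split /= -h0 (reindex_inj rev_ord_inj) /=.
have -> : \sum_(i < s) f (s - (s - i.+1))%N = harmonic s.+1.
  by rewrite h0; apply: eq_bigr => i _; congr f; have := ltn_ord i; lia.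
by rewrite mulr_natr mulr2n.
Qed.

Lemma harmonic_le (s k : nat) : (s <= 2 ^ k)%N -> harmonic s <= k%:R.
Proof.
move=> sk; apply: (@le_trans _ _ (harmonic (2 ^ k))).
  rewrite /harmonic; have [s0|s0] := posnP s.
    by rewrite s0 big_geq// sumr_ge0// => i _; rewrite invr_ge0 ler0n.
  by rewrite [leRHS](big_cat_nat s0)//= lerDl sumr_ge0// => i _; rewrite invr_ge0 ler0n.
elim: k {sk} => [|k IH]; first by rewrite /harmonic big_geq.
rewrite /harmonic (@big_cat_nat _ _ _ (2 ^ k)) ?expn_gt0// ?leq_pexp2l//=.
rewrite -natr1 lerD//.
apply: (@le_trans _ _ (\sum_(2 ^ k <= i < 2 ^ k.+1) (2 ^ k)%:R^-1)).
  apply: ler_sum_nat => i /andP[h _].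
  by rewrite lef_pV2 ?posrE ?ltr0n ?ler_nat ?(leq_trans _ h) ?expn_gt0.
rewrite big_const_nat iter_addr addr0 expnS; have -> : (2 * 2 ^ k - 2 ^ k = 2 ^ k)%N by lia.
by rewrite -(mulr_natr (_^-1)) mulVf// pnatr_eq0 -lt0n expn_gt0.
Qed.

(** * Characters of prime fields *)

Section PrimeField.
Variable p : nat.
Hypothesis pp : prime p.

Lemma e_p_nat (k : nat) : e_p R (k%:R : 'F_p) = expi (k%:R / p%:R).
Proof.
rewrite -(expi_modn _ (prime_gt0 pp)) /e_p /expi val_Fp_nat//.
by rewrite !mulrA.
Qed.

Lemma Fp_natE (x : 'F_p) : x = (x : nat)%:R.
Proof. by rewrite natr_Zp. Qed.

Lemma e_pD (x y : 'F_p) : e_p R (x + y) = e_p R x * e_p R y.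
Proof. by rewrite (Fp_natE x) (Fp_natE y) -natrD !e_p_nat natrD mulrDl expiD. Qed.

Lemma e_p0 : e_p R (0 : 'F_p) = 1.
Proof. by rewrite (e_p_nat 0) mul0r expi0. Qed.

Lemma norm_e_p (x : 'F_p) : `|e_p R x| = 1.
Proof. by rewrite (Fp_natE x) e_p_nat norm_expi. Qed.

Lemma e_p_sum (I : finType) (F : I -> 'F_p) : e_p R (\sum_i F i) = \prod_i e_p R (F i).
Proof. exact: (big_morph _ e_pD e_p0). Qed.

Lemma e_pMn (x : 'F_p) (k : nat) : e_p R (k%:R * x) = e_p R x ^+ k.
Proof. by rewrite (Fp_natE x) -natrM !e_p_nat natrM -mulrA expiXn. Qed.

Lemma e_p_orthogonality (c : 'F_p) : \sum_(t : 'F_p) e_p R (c * t) = (c == 0)%:R * p%:R.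
Proof.
have [->|c0] := eqVneq c 0.
  under eq_bigr do rewrite mul0r e_p0.
  by rewrite sumr_const mul1r card_Fp.
rewrite mul0r; set S := \sum_t _.
have e : e_p R c * S = S.
  rewrite /S mulr_sumr [RHS](reindex_inj (addrI 1)) /=.
  by apply: eq_bigr => t _; rewrite mulrDr mulr1 e_pD.
have c1 : e_p R c != 1.
  rewrite (Fp_natE c) e_p_nat expi_neq1// lt0n.
  have := ltn_ord c; rewrite [X in (_ < X)%N](Fp_cast pp) => ->; rewrite andbT.
  by apply: contra c0 => /eqP h; rewrite (Fp_natE c) h.
apply/eqP; have /eqP := e; rewrite -subr_eq0 -{2}[S]mul1r -mulrBl mulf_eq0 subr_eq0.
by rewrite (negPf c1).
Qed.

Variable n : nat.
Implicit Types (g b th : {ffun 'I_n -> 'F_p}).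

Definition dotp g th : 'F_p := \sum_i g i * th i.

Lemma fourier_inversion (Phi : {ffun 'I_n -> 'F_p} -> R[i]) b :
  p%:R ^+ n * Phi b =
  \sum_(th : {ffun 'I_n -> 'F_p}) (\sum_g Phi g * e_p R (dotp g [ffun i => - th i])) * e_p R (dotp b th).
Proof.
under eq_bigr do rewrite mulr_suml.
rewrite exchange_big /=.
have H g : \sum_(th : {ffun 'I_n -> 'F_p}) Phi g * e_p R (dotp g [ffun i => - th i]) * e_p R (dotp b th) =
    Phi g * \prod_i ((b i - g i == 0)%:R * p%:R).
  under [in RHS]eq_bigr do rewrite -e_p_orthogonality.
  rewrite bigA_distr_bigA mulr_sumr; apply: eq_bigr => th _.
  rewrite -mulrA; congr (_ * _); rewrite -e_pD -e_p_sum /dotp -big_split /=; congr e_p.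
  by apply: eq_bigr => i _; rewrite ffunE; ring.
under eq_bigr do rewrite H.
rewrite (bigD1 b)//= [X in _ + X]big1 ?addr0 => [|g gb].
  under eq_bigr do rewrite subrr eqxx mul1r.
  by rewrite prodr_const card_ord mulrC.
have [i bi] : exists i, b i != g i.
  by apply/existsP; rewrite -negb_forall; apply: contra gb => /forallP h; apply/eqP/ffunP => i; rewrite (eqP (h i)).
by rewrite (bigD1 i)//= subr_eq0 (negPf bi) !mul0r mulr0.
Qed.

End PrimeField.

Lemma eqn_modMr_coprime (d m a b : nat) : coprime d m -> (a * m == b * m %[mod d])%N -> (a == b %[mod d])%N.
Proof.
move=> dm; wlog ab : a b / (b <= a)%N.
  move=> W h; have [le|/ltnW le] := leqP b a; first exact: W.
  by rewrite eq_sym; apply: W; rewrite // eq_sym.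
rewrite !eqn_mod_dvd ?leq_mul2r ?ab ?orbT// -mulnBl Gauss_dvdl//.
Qed.

(** The Chinese remainder theorem on frequencies: [t / q + t' / q'] runs modulo 1 over all fractions
    with denominator [q * q']. *)
Lemma expi_crt_sum (q q' : nat) (F : R[i] -> R[i]) : prime q -> prime q' -> q != q' ->
  \sum_(t : 'F_q) \sum_(t' : 'F_q') F (e_p R t * e_p R t') =
  \sum_(k < q * q') F (expi (k%:R / (q * q')%N%:R)).
Proof.
move=> pq pq' qq'; rewrite pair_big /=.
have q0 := prime_gt0 pq; have q'0 := prime_gt0 pq'.
have s0 : (0 < q * q')%N by rewrite muln_gt0 q0.
pose h (x : 'F_q * 'F_q') : 'I_(q * q') := Ordinal (ltn_pmod (x.1 * q' + x.2 * q) s0).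
have cop : coprime q q' by rewrite prime_coprime// dvdn_prime2.
have lt1 (t : 'F_q) : (t < q)%N by have := ltn_ord t; rewrite [X in (_ < X)%N](Fp_cast pq).
have lt2 (t : 'F_q') : (t < q')%N by have := ltn_ord t; rewrite [X in (_ < X)%N](Fp_cast pq').
have hinj : injective h.
  move=> [a b] [c d] /(congr1 val) /= e.
  have e1 : (a * q' = c * q' %[mod q])%N.
    have := congr1 (fun z => z %% q)%N e; rewrite !modn_dvdm ?dvdn_mulr//.
    by rewrite ![(_ * q' + _)%N]addnC !modnMDl.
  have e2 : (b * q = d * q %[mod q'])%N.
    have := congr1 (fun z => z %% q')%N e; rewrite !modn_dvdm ?dvdn_mull//.
    by rewrite !modnMDl.
  congr (_, _); apply: val_inj => /=.
    apply/eqP; rewrite -(modn_small (lt1 a)) -(modn_small (lt1 c)).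
    by apply: (@eqn_modMr_coprime _ q') => //; apply/eqP.
  apply/eqP; rewrite -(modn_small (lt2 b)) -(modn_small (lt2 d)).
  by apply: (@eqn_modMr_coprime _ q); rewrite ?[coprime q' q]coprime_sym//; apply/eqP.
have hbij : bijective h.
  apply: inj_card_bij => //; rewrite card_ord card_prod.
  by rewrite (card_Fp pq) (card_Fp pq').
rewrite [RHS](reindex h) /=; last exact: onW_bij.
apply: eq_bigr => -[t t'] _ /=; congr F.
rewrite expi_modn// (Fp_natE t) (Fp_natE t') !e_p_nat// -expiD -!Fp_natE; congr expi.
rewrite natrD !natrM; field.
by rewrite !pnatr_eq0 -!lt0n q0 q'0.
Qed.

(** Completion of the sum: both functions are expanded in characters, and the box contributes a
    product of one-dimensional geometric sums for each pair of frequencies. Summed over all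
    frequencies, these exceed the modulus by a logarithm only. *)
Lemma box_sum (n q q' A Y : nat) (u v : 'I_n -> nat)
    (Phi1 : {ffun 'I_n -> 'F_q} -> R[i]) (Phi2 : {ffun 'I_n -> 'F_q'} -> R[i])
    (d1 d2 : R[i]) :
  prime q -> prime q' -> q != q' -> (forall i, v i <= u i + Y)%N ->
  (forall th, `|\sum_g Phi1 g * e_p R (dotp g th)| <= d1 * q%:R ^+ n) ->
  (forall th, `|\sum_g Phi2 g * e_p R (dotp g th)| <= d2 * q'%:R ^+ n) ->
  `|\sum_(b : {ffun 'I_n -> 'I_A} | [forall i, (u i <= b i < v i)%N])
     Phi1 [ffun i => (b i : nat)%:R] * Phi2 [ffun i => (b i : nat)%:R]| <=
  d1 * d2 * (Y%:R + (q * q')%N%:R * (harmonic (q * q') * 2)) ^+ n.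
Proof.
move=> pq pq' qq' uv h1 h2.
have q0 : (0 : R[i]) < q%:R by rewrite ltr0n prime_gt0.
have q'0 : (0 : R[i]) < q'%:R by rewrite ltr0n prime_gt0.
have Q0 : (0 : R[i]) < q%:R ^+ n * q'%:R ^+ n by rewrite mulr_gt0 ?exprn_gt0.
pose hat1 (th : {ffun 'I_n -> 'F_q}) := \sum_g Phi1 g * e_p R (dotp g [ffun i => - th i]).
pose hat2 (th : {ffun 'I_n -> 'F_q'}) := \sum_g Phi2 g * e_p R (dotp g [ffun i => - th i]).
pose D (i : 'I_n) (z : R[i]) := \sum_(b < A | (u i <= b < v i)%N) z ^+ b.
rewrite -(ler_pM2l Q0) -{1}(ger0_norm (ltW Q0)) -normrM.
have -> : q%:R ^+ n * q'%:R ^+ n *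
   (\sum_(b : {ffun 'I_n -> 'I_A} | [forall i, (u i <= b i < v i)%N])
     Phi1 [ffun i => (b i : nat)%:R] * Phi2 [ffun i => (b i : nat)%:R]) =
   \sum_th \sum_th' hat1 th * hat2 th' * \prod_i D i (e_p R (th i) * e_p R (th' i)).
  rewrite mulr_sumr.
  under eq_bigr => b _ do rewrite mulrACA (fourier_inversion pq) (fourier_inversion pq') big_distrlr /=.
  rewrite exchange_big /=; apply: eq_bigr => th _.
  rewrite exchange_big /=; apply: eq_bigr => th' _.
  under eq_bigr do rewrite mulrACA.
  rewrite -mulr_sumr; congr (_ * _).
  under [RHS]eq_bigr do rewrite /D big_mkcond.
  rewrite bigA_distr_bigA [LHS]big_mkcond /=; apply: eq_bigr => b _.
  case: ifP => [/forallP bP|/negbT/forallPn[i /negPf bi]]; last by rewrite (bigD1 i)//= bi mul0r.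
  rewrite /dotp !e_p_sum// -big_split /=; apply: eq_bigr => i _.
  by rewrite bP !ffunE !e_pMn// exprMn.
apply: (@le_trans _ _ (\sum_(th : {ffun 'I_n -> 'F_q}) \sum_(th' : {ffun 'I_n -> 'F_q'}) d1 * q%:R ^+ n * (d2 * q'%:R ^+ n) *
   \prod_i `|D i (e_p R (th i) * e_p R (th' i))|)).
  apply: le_trans (ler_norm_sum _ _ _) _; apply: ler_sum => th _.
  apply: le_trans (ler_norm_sum _ _ _) _; apply: ler_sum => th' _.
  rewrite !normrM normr_prod ler_wpM2r ?prodr_ge0// ler_pM// /hat1 /hat2; [exact: h1|exact: h2].
under eq_bigr do rewrite -mulr_sumr.
rewrite -mulr_sumr.
have -> : \sum_(th : {ffun 'I_n -> 'F_q}) \sum_(th' : {ffun 'I_n -> 'F_q'}) \prod_i `|D i (e_p R (th i) * e_p R (th' i))| =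
  \prod_(i < n) \sum_(t : 'F_q) \sum_(t' : 'F_q') `|D i (e_p R t * e_p R t')|.
  by rewrite bigA_distr_bigA; apply: eq_bigr => th _; rewrite bigA_distr_bigA.
have d1d2 : 0 <= d1 * q%:R ^+ n * (d2 * q'%:R ^+ n).
  by rewrite mulr_ge0// (le_trans (normr_ge0 _) (h1 [ffun=> 0]), le_trans (normr_ge0 _) (h2 [ffun=> 0])).
have -> : q%:R ^+ n * q'%:R ^+ n * (d1 * d2 * (Y%:R + (q * q')%:R * (harmonic (q * q') * 2)) ^+ n) =
  d1 * q%:R ^+ n * (d2 * q'%:R ^+ n) * (Y%:R + (q * q')%:R * (harmonic (q * q') * 2)) ^+ n by ring.
apply: ler_wpM2l => //.
rewrite -[in leRHS](card_ord n) -prodr_const; apply: ler_prod => i _.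
apply/andP; split; first by rewrite sumr_ge0// => t _; rewrite sumr_ge0.
rewrite (expi_crt_sum (fun z => `|D i z|))//; apply: dirichlet_sum => //.
by rewrite muln_gt0 !prime_gt0.
Qed.

End Exponential.

(** * The van der Corput inequality *)

Lemma sqr_sum_le (R : realDomainType) (I : finType) (z : I -> R) :
  (\sum_i z i) ^+ 2 <= #|I|%:R * \sum_i z i ^+ 2.
Proof.
have h : 0 <= \sum_i \sum_j (z i - z j) ^+ 2.
  by apply: sumr_ge0 => i _; apply: sumr_ge0 => j _; exact: sqr_ge0.
have e : \sum_i \sum_j (z i - z j) ^+ 2 =
    (#|I|%:R * \sum_i z i ^+ 2 - (\sum_i z i) ^+ 2) *+ 2.
  under eq_bigr => i _ do under eq_bigr => j _ do rewrite sqrrB.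
  under eq_bigr do rewrite big_split /= sumrB sumr_const sumrMnl -mulr_sumr.
  rewrite big_split /= sumrB sumr_const !sumrMnl -mulr_suml -expr2.
  have -> : #|(xpredT : pred I)| = #|I| by [].
  rewrite -[(\sum_i z i ^+ 2) *+ #|I|]mulr_natl.
  move: (_ * \sum_i z i ^+ 2) (_ ^+ 2) => u v; ring.
by rewrite e pmulrn_lge0// subr_ge0 in h.
Qed.

Section VanDerCorput.
Variables (R : realType) (n : nat).
Hypothesis n0 : (0 < n)%N.

Definition md (q : nat) (a : 'I_n -> nat) : {ffun 'I_n -> 'F_q} := [ffun i => (a i)%:R].

Definition ordv (A : nat) (b : {ffun 'I_n -> 'I_A}) : 'I_n -> nat := fun i => b i.

Definition twisted_bound (q : nat) (m : {ffun 'I_n -> 'F_q} -> int) (d : R) :=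
  forall h th : {ffun 'I_n -> 'F_q}, h != 0 ->
  `|\sum_g (m g * m (g + h))%:~R * e_p R (dotp g th)| <= (d * q%:R ^+ n)%:C%C.

Variables (q q' r L Y k : nat) (F : ('I_n -> nat) -> int).
Variables (m1 : {ffun 'I_n -> 'F_q} -> int) (m2 : {ffun 'I_n -> 'F_q'} -> int).
Variables (d1 d2 : R).
Hypotheses (pq : prime q) (pq' : prime q') (qq' : q != q').
Hypotheses (L0 : (0 < L)%N) (Lq : (L <= q)%N) (Lq' : (L <= q')%N).
Hypotheses (qr : ~~ (q %| r)%N) (qr' : ~~ (q' %| r)%N) (rL : (r * L <= Y)%N).
Hypothesis F1 : forall a, `|F a| <= 1.
Hypothesis Fr : forall a (l : 'I_n -> nat), F (fun i => a i + r * l i)%N = F a.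
Hypotheses (m11 : forall g, `|m1 g| <= 1) (m21 : forall g, `|m2 g| <= 1).
Hypotheses (t1 : twisted_bound m1 d1) (t2 : twisted_bound m2 d2).
Hypothesis sk : (q * q' <= 2 ^ k)%N.

Let kappa : R := d1 * d2 * (Y%:R + (q * q')%N%:R * (k%:R * 2)) ^+ n.
Let A := (2 * Y)%N.

Lemma twisted_shift p (m : {ffun 'I_n -> 'F_p} -> int) d (u v th : {ffun 'I_n -> 'F_p}) :
  prime p -> twisted_bound m d -> u != v ->
  `|\sum_(g : {ffun 'I_n -> 'F_p}) (m (g - u) * m (g - v))%:~R * e_p R (dotp g th)| <= (d * p%:R ^+ n)%:C%C.
Proof.
move=> pp tm uv; have uv0 : u - v != 0 by rewrite subr_eq0.
apply: le_trans (tm _ th uv0).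
rewrite (reindex_inj (addIr u)) /=.
have -> : \sum_(g : {ffun 'I_n -> 'F_p}) (m (g + u - u) * m (g + u - v))%:~R * e_p R (dotp (g + u) th) =
  (\sum_(g : {ffun 'I_n -> 'F_p}) (m g * m (g + (u - v)))%:~R * e_p R (dotp g th)) * e_p R (dotp u th).
  rewrite mulr_suml; apply: eq_bigr => g _; rewrite addrK -addrA -mulrA -e_pD//; congr (_ * e_p R _).
  by rewrite /dotp -big_split /=; apply: eq_bigr => i _; rewrite !ffunE mulrDl.
by rewrite normrM norm_e_p// mulr1.
Qed.

Let inbox (b : {ffun 'I_n -> 'I_A}) (l : {ffun 'I_n -> 'I_L}) :=
  [forall i, (r * l i <= b i < r * l i + Y)%N].

Let sh p (l : {ffun 'I_n -> 'I_L}) : {ffun 'I_n -> 'F_p} := md p (fun i => r * l i)%N.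

Let G (b : {ffun 'I_n -> 'I_A}) (l : {ffun 'I_n -> 'I_L}) : int :=
  if inbox b l then m1 (md q (ordv b) - sh q l) * m2 (md q' (ordv b) - sh q' l) else 0.

Let G1 b l : `|G b l| <= 1.
Proof.
rewrite /G; case: ifP => _; last by rewrite normr0.
by rewrite normrM mulr_ile1.
Qed.

Lemma kappa_ge0 : 0 <= kappa.
Proof.
have nn p (m : {ffun 'I_n -> 'F_p} -> int) d : prime p -> twisted_bound m d -> 0 <= d.
  move=> pp tm.
  have h0 : [ffun=> 1] != 0 :> {ffun 'I_n -> 'F_p}.
    by apply/eqP => /ffunP/(_ (Ordinal n0)); rewrite !ffunE => /eqP; rewrite oner_eq0.
  have := le_trans (normr_ge0 _) (tm _ 0 h0); rewrite -[0 in X in X -> _]/(0%:C)%C lecR.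
  by rewrite pmulr_lge0// exprn_gt0// ltr0n prime_gt0.
by rewrite /kappa !mulr_ge0 ?(nn _ _ _ _ t1) ?(nn _ _ _ _ t2)// exprn_ge0// addr_ge0// !mulr_ge0.
Qed.

(** Distinct shifts stay distinct modulo [q] and [q'], because [r] is prime to both and [L] exceeds
    neither. Two translated boxes meet in a box, where [box_sum] applies to the correlations at the
    two primes. *)
Let offdiag (l l' : {ffun 'I_n -> 'I_L}) : l != l' ->
  (\sum_b (G b l * G b l'))%:~R <= kappa :> R.
Proof.
move=> ll'.
have [i0 li0] : exists i, l i != l' i.
  apply/existsP; rewrite -negb_forall; apply: contra ll' => /forallP h.
  by apply/eqP/ffunP => i; apply/eqP.
have shn p : prime p -> ~~ (p %| r)%N -> (L <= p)%N -> sh p l != sh p l'.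
  move=> pp pr Lp; apply/eqP => /ffunP/(_ i0); rewrite !ffunE => /(congr1 (fun x : 'F_p => x : nat)).
  rewrite !val_Fp_nat// => /eqP; rewrite ![(r * _)%N]mulnC => /eqn_modMr_coprime.
  rewrite prime_coprime// pr => /(_ isT); rewrite !modn_small ?(leq_trans (ltn_ord _))//.
  by move/eqP/val_inj => e; rewrite e eqxx in li0.
pose u (i : 'I_n) := maxn (r * l i) (r * l' i).
pose v (i : 'I_n) := (minn (r * l i) (r * l' i) + Y)%N.
have uv i : (v i <= u i + Y)%N by rewrite /u /v; lia.
have := @box_sum R n q q' A Y u v
  (fun g => (m1 (g - sh q l) * m1 (g - sh q l'))%:~R)
  (fun g => (m2 (g - sh q' l) * m2 (g - sh q' l'))%:~R) d1%:C%C d2%:C%C pq pq' qq' uv.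
have cvt p (d : R) : (d * p%:R ^+ n)%:C%C = d%:C%C * p%:R ^+ n.
  by rewrite rmorphM rmorphXn rmorph_nat.
have h1 th : `|\sum_(g : {ffun 'I_n -> 'F_q}) (m1 (g - sh q l) * m1 (g - sh q l'))%:~R * e_p R (dotp g th)| <= d1%:C%C * q%:R ^+ n.
  by rewrite -cvt; apply: twisted_shift => //; apply: shn.
have h2 th : `|\sum_(g : {ffun 'I_n -> 'F_q'}) (m2 (g - sh q' l) * m2 (g - sh q' l'))%:~R * e_p R (dotp g th)| <= d2%:C%C * q'%:R ^+ n.
  by rewrite -cvt; apply: twisted_shift => //; apply: shn.
move=> /(_ h1 h2) bnd.
have {}bnd : (`|\sum_b G b l * G b l'|%:~R : R)%:C%C <= kappa%:C%C.
  have -> : (`|\sum_b G b l * G b l'|%:~R : R)%:C%C = `|(\sum_b G b l * G b l')%:~R : R[i]|.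
    by rewrite rmorph_int intr_norm.
  have -> : (\sum_b G b l * G b l')%:~R = \sum_(b : {ffun 'I_n -> 'I_A} | [forall i, (u i <= b i < v i)%N])
   ((m1 ([ffun i => (b i : nat)%:R] - sh q l) * m1 ([ffun i => (b i : nat)%:R] - sh q l'))%:~R : R[i]) *
   (m2 ([ffun i => (b i : nat)%:R] - sh q' l) * m2 ([ffun i => (b i : nat)%:R] - sh q' l'))%:~R.
    rewrite [RHS]big_mkcond rmorph_sum /=; apply: eq_bigr => b _.
    have -> : [forall i, (u i <= b i < v i)%N] = inbox b l && inbox b l'.
      apply/forallP/andP => [h|[/forallP h /forallP h'] i].
        by split; apply/forallP => i; have := h i; rewrite /u /v; lia.
      by have := h i; have := h' i; rewrite /u /v; lia.
    rewrite /G; case: (inbox b l); case: (inbox b l'); rewrite ?mulr0 ?mul0r//=.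
    by rewrite -!rmorphM; congr (_%:~R); rewrite /md; ring.
  apply: le_trans bnd _.
  rewrite /kappa !(rmorph_nat, rmorphM, rmorphXn, rmorphD) /=.
  have dd : 0 <= d1%:C%C * d2%:C%C :> R[i].
    have a1 := le_trans (normr_ge0 _) (h1 0); have a2 := le_trans (normr_ge0 _) (h2 0).
    rewrite pmulr_lge0 ?exprn_gt0 ?ltr0n ?prime_gt0// in a1.
    rewrite pmulr_lge0 ?exprn_gt0 ?ltr0n ?prime_gt0// in a2.
    exact: mulr_ge0.
  apply: ler_wpM2l => //.
  have hs := harmonic_le R sk.
  have h0 : 0 <= harmonic R (q * q') by rewrite sumr_ge0// => i _; rewrite invr_ge0 ler0n.
  rewrite lerXn2r ?nnegrE ?addr_ge0 ?mulr_ge0//.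
  by rewrite lerD2l ler_wpM2l ?mulr_ge0// ler_wpM2r.
by move: bnd; rewrite lecR; apply: le_trans; rewrite ler_int ler_norm.
Qed.

Let T : int := \sum_(a : {ffun 'I_n -> 'I_Y}) F (ordv a) * (m1 (md q (ordv a)) * m2 (md q' (ordv a))).

Let shifted (l : {ffun 'I_n -> 'I_L}) : T = \sum_(b : {ffun 'I_n -> 'I_A}) F (ordv b) * G b l.
Proof.
have lt (a : {ffun 'I_n -> 'I_Y}) (i : 'I_n) : (a i + r * l i < A)%N.
  have := ltn_ord (a i); have := ltn_ord (l i) => ll.
  have : (r * l i <= r * L)%N by rewrite leq_mul2l (ltnW ll) orbT.
  by rewrite /A; lia.
pose h (a : {ffun 'I_n -> 'I_Y}) : {ffun 'I_n -> 'I_A} := [ffun i => Ordinal (lt a i)].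
have hinj : injective h.
  move=> a a' /ffunP e; apply/ffunP => i; have := e i; rewrite !ffunE => /(congr1 val) /= /addIn.
  exact: val_inj.
have him : [set h a | a : {ffun 'I_n -> 'I_Y}]%SET = [set b | inbox b l]%SET.
  apply/setP => b; rewrite inE; apply/imsetP/forallP => [[a _ ->] i|hb].
    by rewrite ffunE /= leq_addl addnC ltn_add2l ltn_ord.
  have /fin_all_exists[a aE] : forall i, exists x : 'I_Y, (x + r * l i = b i)%N.
    move=> i; have /andP[h1 h2] := hb i.
    have lx : (b i - r * l i < Y)%N by rewrite ltn_subLR.
    by exists (Ordinal lx) => /=; rewrite subnK.
  by exists [ffun i => a i] => //; apply/ffunP => i; apply: val_inj; rewrite !ffunE /= ffunE aE.
rewrite (bigID (fun b => inbox b l)) /= [X in _ + X]big1 ?addr0; last first.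
  by move=> b /negPf bl; rewrite /G bl mulr0.
rewrite (eq_bigl (mem [set h a | a : {ffun 'I_n -> 'I_Y}]%SET)); last by move=> b; rewrite him !inE.
rewrite big_imset /=; last by move=> ? ? _ _; exact: hinj.
apply: eq_big => [a|a _]; first by rewrite inE.
have il : inbox (h a) l.
  have : h a \in [set b | inbox b l]%SET by rewrite -him imset_f.
  by rewrite inE.
rewrite /G il; congr (_ * (m1 _ * m2 _)).
- by rewrite -(Fr (ordv a) (ordv l)); congr F; apply/funext => i; rewrite /ordv ffunE.
- by apply/ffunP => i; rewrite !ffunE /ordv ffunE /= natrD addrK.
- by apply/ffunP => i; rewrite !ffunE /ordv ffunE /= natrD addrK.
Qed.

(** The box is translated by the multiples [r * l], which do not change [F], and the average over
    [l] is taken. After Cauchy's inequality over the box of side [2 * Y] containing all translates,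
    [F] has disappeared; equal shifts are counted trivially, the others by [offdiag]. *)
Lemma van_der_corput :
  T%:~R ^+ 2 * L%:R ^+ n <= (2 * Y%:R) ^+ n * ((2 * Y%:R) ^+ n + L%:R ^+ n * kappa).
Proof.
pose S (b : {ffun 'I_n -> 'I_A}) : int := \sum_l G b l.
have LT : L%:R ^+ n * T = \sum_(b : {ffun 'I_n -> 'I_A}) F (ordv b) * S b.
  have -> : \sum_(b : {ffun 'I_n -> 'I_A}) F (ordv b) * S b = \sum_(l : {ffun 'I_n -> 'I_L}) T.
    under eq_bigr do rewrite mulr_sumr.
    by rewrite exchange_big /=; apply: eq_bigr => l _; rewrite -shifted.
  by rewrite sumr_const card_ffun !card_ord -natrX mulr_natl.
have cardB : #|{ffun 'I_n -> 'I_A}| = (A ^ n)%N by rewrite card_ffun !card_ord.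
have cardL : #|{ffun 'I_n -> 'I_L}| = (L ^ n)%N by rewrite card_ffun !card_ord.
have s1 : (L%:R ^+ n * T) ^+ 2 <= (A ^ n)%:R * \sum_b S b ^+ 2.
  rewrite LT; apply: le_trans (sqr_sum_le _) _; rewrite cardB ler_wpM2l//.
  apply: ler_sum => b _; rewrite exprMn -[leRHS]mul1r ler_wpM2r ?sqr_ge0//.
  by rewrite -[F (ordv b) ^+ 2]ger0_norm ?sqr_ge0// normrX exprn_ile1.
have s2 : (\sum_b S b ^+ 2)%:~R <= (L%:R ^+ n * A%:R ^+ n + L%:R ^+ n * L%:R ^+ n * kappa : R).
  have -> : \sum_b S b ^+ 2 = \sum_l \sum_l' \sum_b G b l * G b l'.
    under eq_bigr do rewrite expr2 /S big_distrlr /=.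
    by rewrite exchange_big /=; apply: eq_bigr => l _; rewrite exchange_big.
  rewrite rmorph_sum /=.
  apply: (@le_trans _ _ (\sum_(l : {ffun 'I_n -> 'I_L}) (A%:R ^+ n + L%:R ^+ n * kappa))); last first.
    by rewrite sumr_const cardL -[leLHS]mulr_natl natrX mulrDr mulrA.
  apply: ler_sum => l _; rewrite (bigD1 l)//= rmorphD rmorph_sum /= lerD//.
    apply: (@le_trans _ _ (\sum_(b : {ffun 'I_n -> 'I_A}) 1)); last first.
      by rewrite sumr_const cardB natrX.
    apply: ler_sum => b _; rewrite /=.
    by rewrite -expr2 -[X in X%:~R]ger0_norm ?sqr_ge0// normrX -[1](mulr1z) ler_int exprn_ile1.
  apply: (@le_trans _ _ (\sum_(l' : {ffun 'I_n -> 'I_L} | l' != l) kappa)).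
    by rewrite rmorph_sum /=; apply: ler_sum => l' l'l; apply: offdiag; rewrite eq_sym.
  rewrite sumr_const -[leLHS]mulr_natl ler_wpM2r ?kappa_ge0// -natrX ler_nat -cardL.
  exact: max_card.
have Ln : (0 : R) < L%:R ^+ n by rewrite exprn_gt0 ?ltr0n.
rewrite -(ler_pM2l Ln).
have s1' : ((L%:R ^+ n * T%:~R) ^+ 2 <= (A ^ n)%:R * (\sum_b S b ^+ 2)%:~R :> R).
  by move: s1; rewrite -(ler_int R) !(rmorphXn, rmorphM, rmorph_nat).
have -> : 2 * Y%:R = A%:R :> R by rewrite natrM.
have := le_trans s1' (ler_wpM2l _ s2); rewrite natrX => /(_ (exprn_ge0 _ (ler0n _ _))).
by congr (_ <= _); ring.
Qed.

End VanDerCorput.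

(** * Correlations of the Moebius functions at four primes *)

Section Exponents.
Variable R : realType.

(** All sizes are powers of [W]: the side [W ^ N] of the box, the small primes up to [W ^ x], the
    large ones up to [W ^ z], and the target [W ^ E], one factor [W] below the [(n - 1)]-st power of
    the side. A pair of large primes saves [W ^ j], a pair of small ones [W ^ j']. [ex_diag] is for
    terms with both primes repeated; [ex_L1] and [ex_k1] are for two distinct large primes, [ex_L2]
    and [ex_k2] for a repeated large prime, where the first covers equal shifts and the second
    distinct ones. *)
Record exponents (n : nat) (tau : R) (N E x z j j' : nat) : Prop := Exponents {
  ex_E : E.+1 = (N * n.-1)%N;
  ex_x : (1 < x)%N; ex_xz : (x < z)%N; ex_xN : ((2 * x).+1 <= N)%N; ex_zN : (z <= N <= 2 * z)%N;
  ex_Lz : (N - 2 * x <= z.-1)%N; ex_Lx : (N - z <= x.-1)%N;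
  ex_j : j%:R <= 2 * (z.-1)%:R * tau; ex_j' : j'%:R <= 2 * (x.-1)%:R * tau;
  ex_diag : (N * n + 2 <= E + x + z)%N;
  ex_L1 : (N * n + n * (2 * x) <= 2 * E)%N;
  ex_k1 : (N * n + (2 * z).+1 * n <= 2 * E + j)%N;
  ex_L2 : (N * n + n * z <= 2 * E + 2 * z.-1)%N;
  ex_k2 : (2 * (N * n) <= 2 * E + 2 * z.-1 + j')%N }.

(** Up to bounded terms, [x = N (n - 2) / (2 n)] is the largest value that [ex_L1] permits and
    [z = N - x] the smallest that [ex_diag] permits; [ex_k1] then reads [4 n <= (n + 2) tau]. The
    scale [T] is so large that the strict inequality absorbs the bounded terms. *)
Lemma exponents_exist (n : nat) (tau : R) : (3 <= n)%N -> 4 * n%:R / (n%:R + 2) < tau ->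
  exists N E x z j j', exponents n tau N E x z j j'.
Proof.
move=> n3 htau.
have n0 : (0 : R) < n%:R + 2 by rewrite ltr_wpDl.
have g0 : 0 < (n%:R + 2) * tau - 4 * n%:R.
  by rewrite subr_gt0 [_ * tau]mulrC -ltr_pdivrMr.
set g := (X in 0 < X) in g0.
have tau2 : 2 <= tau.
  apply/ltW/(le_lt_trans _ htau); rewrite ler_pdivlMr//.
  have : (3 : R) <= n%:R by rewrite (ler_nat _ 3).
  lra.
have [T [hT T10]] : exists T : nat, 9 * n%:R + 3 <= T%:R * g /\ (4 * n + 50 <= T)%N.
  exists (Num.truncn ((9 * n%:R + 3) / g)%R + (4 * n + 50))%N; split; last exact: leq_addl.
  rewrite -ler_pdivrMr//; apply: (le_trans (ltW (truncnS_gt _))).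
  by rewrite ler_nat -addn1 leq_add2l; lia.
pose x := ((n - 2) * T).-1; pose z := ((n + 2) * T + 4)%N; pose N := (2 * n * T)%N.
have nT : (12 * 3 + 10 <= (n - 2) * T)%N by nia.
have Ex : x.+1 = ((n - 2) * T)%N by rewrite /x; lia.
have Ex2 : (x.+1 + 4 * T = (n + 2) * T)%N by rewrite Ex; nia.
have NE : (2 * x.+1 + 4 * T = N)%N by rewrite Ex /N; nia.
have h1 : ((2 * (z.-1)%:R * tau : R) < (Num.truncn (2 * (z.-1)%:R * tau)).+1%:R) by exact: truncnS_gt.
have h2 : ((2 * (x.-1)%:R * tau : R) < (Num.truncn (2 * (x.-1)%:R * tau)).+1%:R) by exact: truncnS_gt.
exists N, (N * n.-1).-1, x, z, (Num.truncn (2 * (z.-1)%:R * tau)), (Num.truncn (2 * (x.-1)%:R * tau)).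
have Nn : (N * n.-1 + N = N * n)%N by rewrite -mulnSr prednK//; lia.
have Nn1 : (N <= N * n.-1)%N by rewrite leq_pmulr//; lia.
have zz : z = (x.+1 + 4 * T + 4)%N by rewrite /z -Ex2.
split; rewrite ?truncn_le ?mulr_ge0 ?(le_trans _ tau2)//; try lia.
- move: h1; set j := Num.truncn _ => h1.
  have : ((N * n + (2 * z).+1 * n + 2 * N + 2)%N%:R <= (2 * (N * n) + j)%N%:R + 0 :> R).
    rewrite addr0 !(natrD, natrM) /=.
    have zr : z%:R = (n%:R + 2) * T%:R + 4 :> R by rewrite /z !(natrD, natrM).
    have z1r : (z.-1)%:R = z%:R - 1 :> R by rewrite -subn1 natrB//; lia.
    have Nr : N%:R = 2 * n%:R * T%:R :> R by rewrite /N !natrM.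
    have sr : (2 * z).+1%:R = 2 * z%:R + 1 :> R by rewrite -addn1 natrD natrM.
    have jr : j.+1%:R = j%:R + 1 :> R by rewrite -natr1.
    rewrite ?sr ?Nr ?zr; move: h1; rewrite z1r zr jr; rewrite /g in hT => h1.
    have t6 : 0 <= 6 * tau by lra.
    have nr : (0 : R) <= n%:R by [].
    lra.
  rewrite addr0 ler_nat; lia.
- have : (n * x.+1 * 2 + 4 * T * n = N * n)%N by rewrite -NE; ring.
  have : (4 * T * n = 2 * N)%N by rewrite /N; ring.
  have : (n * z = n * x.+1 + 4 * T * n + 4 * n)%N by rewrite zz; ring.
  have : (n * x.+1 = (n - 2) * x.+1 + 2 * x.+1)%N by rewrite -mulnDl subnK//; lia.
  have : ((n - 2) * x.+1 >= x.+1)%N by rewrite leq_pmull//; lia.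
  have : (x.+1 >= T)%N by rewrite Ex leq_pmull//; lia.
  lia.
- move: h2; set j := Num.truncn _ => h2.
  have h3 : ((2 * (2 * x.-1))%N%:R < j.+1%:R :> R).
    apply: le_lt_trans h2; rewrite !natrM mulrC ler_wpM2l//.
  rewrite ltr_nat in h3; lia.
Qed.

End Exponents.

Section Sieve.
Variables (R : realType) (n : nat).
Hypothesis n0 : (0 < n)%N.

Lemma powRN_le (W a p p' j : nat) (tau : R) : (0 < W)%N -> 0 <= tau ->
  (W ^ a < p)%N -> (W ^ a < p')%N -> j%:R <= 2 * a%:R * tau ->
  p%:R `^ (- tau) * p'%:R `^ (- tau) <= (W%:R ^+ j)^-1.
Proof.
move=> W0 t0 hp hp' hj.
have W1 : 1 <= W%:R :> R by rewrite (ler_nat _ 1).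
have Wp : (0 : R) < W%:R by rewrite ltr0n.
have key (q : nat) : (W ^ a < q)%N -> W%:R `^ (a%:R * tau) <= q%:R `^ tau.
  move=> hq; rewrite powRrM powR_mulrn ?ler0n//.
  by rewrite ge0_ler_powR ?nnegrE ?exprn_ge0 ?ler0n// -natrX ler_nat ltnW.
have pq0 : 0 < p%:R `^ tau * p'%:R `^ tau.
  by rewrite mulr_gt0// powR_gt0// ltr0n ?(leq_ltn_trans _ hp) ?(leq_ltn_trans _ hp').
rewrite !powRN -invfM lef_pV2 ?posrE ?exprn_gt0//.
rewrite -powR_mulrn ?ler0n//; apply: (@le_trans _ _ (W%:R `^ (2 * a%:R * tau))).
  by rewrite ler_powR.
have -> : 2 * a%:R * tau = a%:R * tau + a%:R * tau by ring.
rewrite powRD; last by rewrite (gt_eqF Wp) implybT.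
by rewrite ler_pM ?powR_ge0 ?key.
Qed.

Lemma van_der_corput_bound (w T kap K : R) (Nn c D b j : nat) : 1 <= w -> 0 <= K ->
  T ^+ 2 * w ^+ c <= (2 ^+ n * w ^+ Nn) * (2 ^+ n * w ^+ Nn + w ^+ c * kap) ->
  kap <= K * w ^+ b / w ^+ j -> (2 * Nn <= D + c)%N -> (Nn + b <= D + j)%N ->
  T ^+ 2 <= (2 ^+ n * (2 ^+ n + K)) * w ^+ D.
Proof.
move=> w1 K0 hT hk h1 h2.
have w0 : 0 < w by rewrite (lt_le_trans ltr01).
have wp m : 0 < w ^+ m by rewrite exprn_gt0.
rewrite -(ler_pM2r (wp c)); apply: le_trans hT _.
have p2 : (0 : R) < 2 ^+ n by rewrite exprn_gt0.
rewrite -!mulrA ler_pM2l// mulrDr [X in _ <= X]mulrDl lerD//.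
  rewrite mulrCA ler_pM2l// -!exprD ler_weXn2l//; lia.
rewrite -(ler_pM2r (wp j)) mulrCA.
apply: (@le_trans _ _ (w ^+ c * w ^+ Nn * (K * w ^+ b))).
  rewrite -!mulrA ler_pM2l// ler_pM2l//.
  by rewrite -ler_pdivlMr.
have -> : w ^+ c * w ^+ Nn * (K * w ^+ b) = K * (w ^+ (Nn + b) * w ^+ c) by rewrite exprD; ring.
have -> : K * (w ^+ D * w ^+ c) * w ^+ j = K * (w ^+ (D + j) * w ^+ c) by rewrite exprD; ring.
by rewrite ler_wpM2l// ler_pM2r// ler_weXn2l.
Qed.

Lemma md_shift (p r : nat) (a l : 'I_n -> nat) : prime p -> (p %| r)%N ->
  md p (fun i => a i + r * l i)%N = md p a.
Proof.
move=> pp pr; apply/ffunP => i; rewrite !ffunE natrD natrM.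
have /eqP -> : (r%:R == 0 :> 'F_p) by rewrite -(dvdn_pcharf (pchar_Fp pp)).
by rewrite mul0r addr0.
Qed.

Lemma double_sub_le (M k b D : nat) : (b <= M)%N -> (M * k + k * b <= D)%N ->
  (2 * (M * k) <= D + (M - b) * k)%N.
Proof.
move=> bM; rewrite mulnBl [(b * k)%N]mulnC.
have : (k * b <= M * k)%N by rewrite mulnC leq_mul2r bM orbT.
lia.
Qed.

Section Correlations.
Variables (tau K0 : R) (N E x z j j' W : nat).
Hypothesis tau0 : 0 <= tau.
Hypothesis ex : exponents n tau N E x z j j'.
Hypothesis Wl : ((4 * z + 1) * (up_log 2 W).+1 <= W)%N.
Variable m : forall p, {ffun 'I_n -> 'F_p} -> int.
Hypothesis m1 : forall p g, `|@m p g| <= 1.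

Let Y := (W ^ N)%N.
Let l := up_log 2 W.
Let good (p : nat) := prime p /\ twisted_bound (@m p) (K0 * p%:R `^ (- tau)).
Let C : R := 2 ^+ n * (2 ^+ n + 2 ^+ n * K0 ^+ 2).

Definition four_corr (p p' q q' : nat) : int :=
  \sum_(a : {ffun 'I_n -> 'I_Y}) m (md p (ordv a)) * m (md p' (ordv a)) *
     (m (md q (ordv a)) * m (md q' (ordv a))).

Let W1 : (1 < W)%N.
Proof.
have z2 : (2 < z)%N by case: ex; lia.
by apply: leq_trans Wl; apply: leq_trans (leq_pmulr _ (ltn0Sn _)); lia.
Qed.
Let W2l : (W <= 2 ^ l)%N. Proof. by have /andP[] := up_log_bounds (isT : 1 < 2)%N W1. Qed.
Let Wk : (1 + l * (2 * z) * 2 <= W)%N.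
Proof.
apply: leq_trans Wl; rewrite -/l.
have -> : ((4 * z + 1) * l.+1 = 1 + l * (2 * z) * 2 + (4 * z + l))%N by ring.
exact: leq_addr.
Qed.
Let w1 : 1 <= W%:R :> R. Proof. by rewrite (ler_nat _ 1) (ltnW W1). Qed.
Let YE : (2 * Y%:R) ^+ n = 2 ^+ n * W%:R ^+ (N * n) :> R.
Proof. by rewrite exprMn /Y natrX -exprM. Qed.

(** The small primes form the periodic factor, of period [p * p']; they may coincide. Shifts of
    length [W ^ (N - 2 * x)] then stay within the box. *)
Lemma four_corr_generic p p' q q' : good p -> good p' -> good q -> good q' -> q != q' ->
  (p <= W ^ x)%N -> (p' <= W ^ x)%N -> (W ^ z.-1 < q <= W ^ z)%N -> (W ^ z.-1 < q' <= W ^ z)%N ->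
  (four_corr p p' q q')%:~R ^+ 2 <= C * W%:R ^+ (2 * E).
Proof.
case: ex => hE hx hxz hxN /andP[hzN hN2z] hLz hLx hj hj' hd hL1 hk1 hL2 hk2.
move=> [pp tp] [pp' tp'] [pq tq] [pq' tq'] qq' px p'x /andP[q1 q2] /andP[q'1 q'2].
have Wxz : (W ^ x <= W ^ z.-1)%N by rewrite leq_pexp2l; clear -hE hx hxz hxN hzN hN2z hLz hLx hj hj' hd hL1 hk1 hL2 hk2 W1; lia.
pose F (a : 'I_n -> nat) := m (md p a) * m (md p' a).
have sk : (q * q' <= 2 ^ (l * (2 * z)))%N.
  by rewrite expnM; apply: (@leq_trans (W ^ (2 * z)));
    rewrite ?leq_exp2r ?(leq_trans _ W2l)//; first rewrite mul2n -addnn expnD leq_mul//; clear -hE hx hxz hxN hzN hN2z hLz hLx hj hj' hd hL1 hk1 hL2 hk2 W1; lia.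
have ndiv q0 (pq0 : prime q0) : (W ^ z.-1 < q0)%N -> ~~ (q0 %| p * p')%N.
  move=> h; rewrite Euclid_dvdM// negb_or !gtnNdvd ?prime_gt0//; clear -px p'x Wxz h; lia.
have := @van_der_corput R n n0 q q' (p * p') (W ^ (N - 2 * x)) Y (l * (2 * z)) F (@m q) (@m q')
  _ _ pq pq' qq' _ _ _ (ndiv _ pq q1) (ndiv _ pq' q'1) _ _ _ (@m1 q) (@m1 q') tq tq' sk.
set G := (X in _ -> X); move=> vdc; apply: (@van_der_corput_bound W%:R _ _ (2 ^+ n * K0 ^+ 2)
   (N * n) ((N - 2 * x) * n) _ ((2 * z).+1 * n) j w1).
- by rewrite mulr_ge0 ?sqr_ge0 ?exprn_ge0.
- rewrite -YE exprM -natrX; apply: vdc.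
  + by rewrite expn_gt0; clear -hE hx hxz hxN hzN hN2z hLz hLx hj hj' hd hL1 hk1 hL2 hk2 W1; lia.
  + by apply: leq_trans (ltnW q1); rewrite leq_pexp2l//; clear -hE hx hxz hxN hzN hN2z hLz hLx hj hj' hd hL1 hk1 hL2 hk2 W1; lia.
  + by apply: leq_trans (ltnW q'1); rewrite leq_pexp2l//; clear -hE hx hxz hxN hzN hN2z hLz hLx hj hj' hd hL1 hk1 hL2 hk2 W1; lia.
  + apply: (@leq_trans (W ^ (2 * x) * W ^ (N - 2 * x))).
      by rewrite leq_mul2r mul2n -addnn expnD leq_mul ?orbT.
    by rewrite -expnD subnKC//; clear -hE hx hxz hxN hzN hN2z hLz hLx hj hj' hd hL1 hk1 hL2 hk2 W1; lia.
  + by move=> a; rewrite /F normrM mulr_ile1.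
  + by move=> a b; rewrite /F (md_shift a b pp (dvdn_mulr _ (dvdnn p))) (md_shift a b pp' (dvdn_mull _ (dvdnn p'))).
- rewrite mulrACA -expr2.
  apply: (@le_trans _ _ (K0 ^+ 2 * (W%:R ^+ j)^-1 * (W%:R ^+ (2 * z).+1) ^+ n)); last first.
    rewrite -exprM mulrAC ler_wpM2r ?invr_ge0 ?exprn_ge0// ler_wpM2r ?exprn_ge0//.
    by rewrite ler_peMl ?sqr_ge0// exprn_ege1// (ler_nat _ 1).
  apply: ler_pM.
  + by rewrite mulr_ge0 ?sqr_ge0// mulr_ge0 ?powR_ge0.
  + by rewrite exprn_ge0// addr_ge0// !mulr_ge0.
  + by rewrite ler_wpM2l ?sqr_ge0// (powRN_le _ _ q1)//; clear -hE hx hxz hxN hzN hN2z hLz hLx hj hj' hd hL1 hk1 hL2 hk2 W1; lia.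
  + rewrite lerXn2r ?nnegrE ?exprn_ge0 ?addr_ge0 ?mulr_ge0//.
    rewrite -!natrM -natrD -natrX ler_nat.
    apply: (@leq_trans (W ^ (2 * z) * (1 + l * (2 * z) * 2))).
      rewrite mulnDr muln1 leq_add//; first by rewrite leq_pexp2l//; clear -hE hx hxz hxN hzN hN2z hLz hLx hj hj' hd hL1 hk1 hL2 hk2 W1; lia.
      by rewrite leq_mul2r mul2n -addnn expnD leq_mul ?orbT.
    by rewrite expnSr leq_mul2l Wk orbT.
- by apply: double_sub_le; clear -hE hx hxz hxN hzN hN2z hLz hLx hj hj' hd hL1 hk1 hL2 hk2 W1; lia.
- by clear -hE hx hxz hxN hzN hN2z hLz hLx hj hj' hd hL1 hk1 hL2 hk2 W1; lia.
Qed.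

(** The squared value at [q] is not constant, as it may vanish, but it has period [q]. So the roles
    are exchanged: [q] gives the shift and the two small primes the correlations. *)
Lemma four_corr_diag p p' q : good p -> good p' -> good q -> p != p' ->
  (W ^ x.-1 < p <= W ^ x)%N -> (W ^ x.-1 < p' <= W ^ x)%N -> (W ^ z.-1 < q <= W ^ z)%N ->
  (four_corr p p' q q)%:~R ^+ 2 <= C * W%:R ^+ (2 * (E + z.-1)).
Proof.
case: ex => hE hx hxz hxN /andP[hzN hN2z] hLz hLx hj hj' hd hL1 hk1 hL2 hk2.
move=> [pp tp] [pp' tp'] [pq tq] nn /andP[p1 p2] /andP[p'1 p'2] /andP[q1 q2].
have Wxz : (W ^ x <= W ^ z.-1)%N by rewrite leq_pexp2l; clear -hE hx hxz hxN hzN hN2z hLz hLx hj hj' hd hL1 hk1 hL2 hk2 W1; lia.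
pose F (a : 'I_n -> nat) := m (md q a) * m (md q a).
have fE : four_corr p p' q q = \sum_(a : {ffun 'I_n -> 'I_Y}) F (ordv a) * (m (md p (ordv a)) * m (md p' (ordv a))).
  by apply: eq_bigr => a _; rewrite mulrC.
rewrite fE.
have sk : (p * p' <= 2 ^ (l * (2 * x)))%N.
  by rewrite expnM; apply: (@leq_trans (W ^ (2 * x)));
    rewrite ?leq_exp2r ?(leq_trans _ W2l)//; first rewrite mul2n -addnn expnD leq_mul//; clear -hE hx hxz hxN hzN hN2z hLz hLx hj hj' hd hL1 hk1 hL2 hk2 W1; lia.
have ndiv p0 (pp0 : prime p0) : (p0 <= W ^ x)%N -> ~~ (p0 %| q)%N.
  move=> h; rewrite dvdn_prime2//; apply/eqP; clear -q1 Wxz h; lia.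
have := @van_der_corput R n n0 p p' q (W ^ (N - z)) Y (l * (2 * x)) F (@m p) (@m p')
  _ _ pp pp' nn _ _ _ (ndiv _ pp p2) (ndiv _ pp' p'2) _ _ _ (@m1 p) (@m1 p') tp tp' sk.
set G := (X in _ -> X); move=> vdc; apply: (@van_der_corput_bound W%:R _ _ (2 ^+ n * K0 ^+ 2)
   (N * n) ((N - z) * n) _ (N * n) j' w1).
- by rewrite mulr_ge0 ?sqr_ge0 ?exprn_ge0.
- rewrite -YE exprM -natrX; apply: vdc.
  + by rewrite expn_gt0; clear -hE hx hxz hxN hzN hN2z hLz hLx hj hj' hd hL1 hk1 hL2 hk2 W1; lia.
  + by apply: leq_trans (ltnW p1); rewrite leq_pexp2l//; clear -hE hx hxz hxN hzN hN2z hLz hLx hj hj' hd hL1 hk1 hL2 hk2 W1; lia.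
  + by apply: leq_trans (ltnW p'1); rewrite leq_pexp2l//; clear -hE hx hxz hxN hzN hN2z hLz hLx hj hj' hd hL1 hk1 hL2 hk2 W1; lia.
  + apply: (@leq_trans (W ^ z * W ^ (N - z))); first by rewrite leq_mul2r q2 orbT.
    by rewrite -expnD subnKC.
  + by move=> a; rewrite /F normrM mulr_ile1.
  + by move=> a b; rewrite /F !md_shift.
- rewrite mulrACA -expr2.
  apply: (@le_trans _ _ (K0 ^+ 2 * (W%:R ^+ j')^-1 * (2 * Y%:R) ^+ n)); last first.
    by rewrite YE le_eqVlt; apply/orP; left; apply/eqP; ring.
  apply: ler_pM.
  + by rewrite mulr_ge0 ?sqr_ge0// mulr_ge0 ?powR_ge0.
  + by rewrite exprn_ge0// addr_ge0// !mulr_ge0.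
  + by rewrite ler_wpM2l ?sqr_ge0// (powRN_le _ _ p1)//; clear -hE hx hxz hxN hzN hN2z hLz hLx hj hj' hd hL1 hk1 hL2 hk2 W1; lia.
  + rewrite lerXn2r ?nnegrE ?addr_ge0 ?mulr_ge0//.
    have -> : 2 * Y%:R = Y%:R + Y%:R :> R by rewrite mulr_natl mulr2n.
    rewrite lerD2l -!natrM ler_nat.
    apply: (@leq_trans (W ^ (2 * x) * (l * (2 * x) * 2))).
      by rewrite leq_mul2r mul2n -addnn expnD leq_mul ?orbT.
    apply: (@leq_trans (W ^ (2 * x).+1)); last by rewrite leq_pexp2l//; clear -hE hx hxz hxN hzN hN2z hLz hLx hj hj' hd hL1 hk1 hL2 hk2 W1; lia.
    rewrite expnSr leq_mul2l; apply/orP; right; apply: leq_trans Wk.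
    by rewrite add1n ltnW// ltnS !leq_mul// ltnW.
- by apply: double_sub_le; clear -hE hx hxz hxN hzN hN2z hLz hLx hj hj' hd hL1 hk1 hL2 hk2 W1; lia.
- by clear -hE hx hxz hxN hzN hN2z hLz hLx hj hj' hd hL1 hk1 hL2 hk2 W1; lia.
Qed.

End Correlations.
End Sieve.

(** * The analytic sieve *)

Section SecondMoment.
Variables (R : realType) (I : finType).

Lemma sum_indicator_le (T : eqType) (P : seq T) (c : R) : 0 <= c -> uniq P ->
  forall x, \sum_(y <- P) c * (x == y)%:R <= c.
Proof.
move=> c0 uP x; rewrite -mulr_sumr ler_piMr// -natr_sum (ler_nat _ _ 1).
elim: P uP => [|y P IH] /=; first by rewrite big_nil.
move=> /andP[yP /IH h]; rewrite big_cons; case: eqP => [->|_]; last by rewrite add0n.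
rewrite big1_seq ?addn0// => z /andP[_ zP].
by case: eqP => // e; rewrite e zP in yP.
Qed.

(* Both [P] and [Q] give one square factor: the correlations with [q <> q'] have the generic
   bound [c1], those with [q = q'] and [p <> p'] the bound [c2]. *)
Lemma second_moment (P Q : seq nat) (f : nat -> I -> int) (c1 c2 c3 : R) :
  uniq P -> uniq Q -> 0 <= c1 -> 0 <= c2 -> 0 <= c3 ->
  (forall p p' q q', p \in P -> p' \in P -> q \in Q -> q' \in Q ->
     `|\sum_a f p a * f p' a * (f q a * f q' a)|%:~R <=
     c1 + (q == q')%:R * c2 + (q == q')%:R * ((p == p')%:R * c3)) ->
  (\sum_a (\sum_(p <- P) f p a) ^+ 2 * (\sum_(q <- Q) f q a) ^+ 2)%:~R <=
  (size P)%:R ^+ 2 * (size Q)%:R ^+ 2 * c1 + (size P)%:R ^+ 2 * (size Q)%:R * c2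
   + (size P)%:R * (size Q)%:R * c3.
Proof.
move=> uP uQ c10 c20 c30 H.
have -> : \sum_a (\sum_(p <- P) f p a) ^+ 2 * (\sum_(q <- Q) f q a) ^+ 2 =
  \sum_(p <- P) \sum_(p' <- P) \sum_(q <- Q) \sum_(q' <- Q) \sum_a f p a * f p' a * (f q a * f q' a).
  under eq_bigr => a _ do rewrite !expr2 big_distrlr [X in _ * X]big_distrlr /= mulr_suml.
  rewrite exchange_big /=; apply: eq_bigr => p _.
  under eq_bigr do rewrite mulr_suml.
  rewrite exchange_big /=; apply: eq_bigr => p' _.
  under eq_bigr do rewrite mulr_sumr.
  rewrite exchange_big /=; apply: eq_bigr => q _.
  under eq_bigr do rewrite mulr_sumr.
  by rewrite exchange_big.
have sumc (T : eqType) (s : seq T) (c : R) : \sum_(x <- s) c = (size s)%:R * c.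
  by rewrite big_const_seq count_predT iter_addr addr0 mulr_natl.
rewrite rmorph_sum /=.
have B p : p \in P -> \sum_(p' <- P) (\sum_(q <- Q) \sum_(q' <- Q)
    \sum_a f p a * f p' a * (f q a * f q' a))%:~R <=
    (size P)%:R * ((size Q)%:R ^+ 2 * c1) + (size P)%:R * ((size Q)%:R * c2) + (size Q)%:R * c3 :> R.
  move=> pP.
  apply: (@le_trans _ _ (\sum_(p' <- P) ((size Q)%:R ^+ 2 * c1 + (size Q)%:R * c2
      + (size Q)%:R * c3 * (p == p')%:R))); last first.
    by rewrite !big_split /= !sumc lerD2l; apply: sum_indicator_le => //; rewrite mulr_ge0.
  rewrite !big_seq; apply: ler_sum => p' p'P.
  rewrite rmorph_sum /=.
  apply: (@le_trans _ _ (\sum_(q <- Q) ((size Q)%:R * c1 + c2 + c3 * (p == p')%:R))); last first.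
    by rewrite sumc le_eqVlt; apply/orP; left; apply/eqP; ring.
  rewrite !big_seq; apply: ler_sum => q qQ.
  rewrite rmorph_sum /=.
  apply: (@le_trans _ _ (\sum_(q' <- Q) (c1 + (c2 + c3 * (p == p')%:R) * (q == q')%:R))); last first.
    rewrite big_split /= sumc -addrA lerD2l; apply: sum_indicator_le => //.
    by rewrite addr_ge0// mulr_ge0.
  rewrite !big_seq; apply: ler_sum => q' q'Q.
  have h := H p p' q q' pP p'P qQ q'Q.
  apply: (le_trans (_ : _ <= `|\sum_a f p a * f p' a * (f q a * f q' a)|%:~R)).
    by rewrite ler_int ler_norm.
  apply: (le_trans h).
  by rewrite le_eqVlt; apply/orP; left; apply/eqP; ring.
apply: (@le_trans _ _ (\sum_(p <- P) ((size P)%:R * ((size Q)%:R ^+ 2 * c1) + (size P)%:R * ((size Q)%:R * c2) + (size Q)%:R * c3))); last first.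
  by rewrite sumc le_eqVlt; apply/orP; left; apply/eqP; ring.
rewrite !big_seq; apply: ler_sum => p pP; rewrite rmorph_sum /=; exact: B.
Qed.

End SecondMoment.

Section AnalyticSieve.
Variables (R : realType) (n : nat) (tau : R).

(** For [a] in [s] nearly all terms of the sums of [eps p * m p] equal 1, over the small primes as
    well as over the large ones. The product of the squares of the two sums is then at least a
    sixteenth of its maximum, and [second_moment] shows that this is rare. *)
Lemma analytic_sieve (N E x z j j' B : nat) (K0 : R) : (0 < n)%N -> 0 <= tau ->
  exponents n tau N E x z j j' ->
  exists (K : R) (W0 : nat), 0 <= K /\ forall W : nat, (W0 <= W)%N ->
  forall (m : forall p, {ffun 'I_n -> 'F_p} -> int) (e0 : int) (eps : nat -> int)
    (s : seq {ffun 'I_n -> 'I_(W ^ N)}) (D : {ffun 'I_n -> 'I_(W ^ N)} -> int),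
  (forall p g, `|m p g| <= 1) -> e0 != 0 -> (`|e0| <= W ^ B)%N ->
  (forall p, prime p -> (W < p)%N -> ~~ (p %| e0)%Z -> twisted_bound (m p) (K0 * p%:R `^ (- tau))) ->
  (forall p, eps p ^+ 2 = 1) -> uniq s ->
  (forall a, a \in s -> D a != 0 /\ (`|D a| <= W ^ B)%N) ->
  (forall a p, a \in s -> prime p -> (W < p)%N -> ~~ (p %| e0)%Z -> ~~ (p %| D a)%Z ->
     m p (md p (ordv a)) = eps p) ->
  (size s)%:R <= K * W%:R ^+ E.
Proof.
move=> n0 t0 ex; have := ex; case=> hE hx hxz hxN /andP[hzN hN2z] hLz hLx hj hj' hd hL1 hk1 hL2 hk2.
have hEE : (N * n <= E + (x.-1 + z.-1))%N by lia.
have [Wx HWx] := many_primes hx.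
have [Wz HWz] := many_primes (ltnW (leq_ltn_trans hx hxz) : (1 < z)%N).
have [Wl HWl] := log_small (4 * z + 1).
pose C : R := 2 ^+ n * (2 ^+ n + 2 ^+ n * K0 ^+ 2).
have C1 : 1 <= C.
  have a1 : 1 <= 2 ^+ n :> R by rewrite exprn_ege1// ler1n.
  have b0 : 0 <= 2 ^+ n * K0 ^+ 2 by rewrite mulr_ge0 ?sqr_ge0 ?exprn_ge0.
  rewrite /C; move: (2 ^+ n) (2 ^+ n * K0 ^+ 2) a1 b0 => a b a1 b0; nra.
exists (16 * (2 * C + 1)), (Wx + Wz + Wl + 4 * B + 5)%N; split.
  by rewrite mulr_ge0// addr_ge0// mulr_ge0// (le_trans ler01).
move=> W hW m e0 eps s D m1 e00 e0B tw eps2 us HD Hs.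
have W1 : (1 < W)%N by lia.
have lW : ((4 * z + 1) * (up_log 2 W).+1 <= W)%N by apply: HWl; lia.
pose Pr y := [seq p : nat <- [seq p <- primes_upto (W ^ y) | (W ^ y.-1 < p)%N] | ~~ (p %| e0)%Z].
have PrP y p : (1 < y)%N -> p \in Pr y -> [/\ prime p, (W < p)%N, (W ^ y.-1 < p <= W ^ y)%N & ~~ (p %| e0)%Z].
  move=> y1; rewrite !mem_filter mem_iota => /andP[pe /andP[lp /andP[pp]]] h; split=> //.
    by apply: leq_ltn_trans lp; rewrite -{1}(expn1 W) leq_pexp2l; lia.
  by rewrite lp; lia.
have uPr y : uniq (Pr y) by rewrite !filter_uniq// iota_uniq.
(* The exceptional primes divide an integer of size at most [W ^ B] and exceed [W], so there are at
   most [B + 1] of them. *)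
have few y (a : int) (t : seq nat) : (1 < y)%N -> {subset t <= [seq p <- primes_upto (W ^ y) | (W ^ y.-1 < p)%N]} ->
    uniq t -> a != 0 -> (`|a| <= W ^ B)%N -> (forall p, p \in t -> (p %| a)%Z) -> (size t <= B.+1)%N.
  move=> y1 ht ut a0 aB hd'; rewrite -addn1; apply: (@size_prime_divisors a W 1 B t) => //; first by rewrite mul1n.
    by lia.
  move=> p pt; have := ht p pt; rewrite !mem_filter => /andP[lp /andP[pp _]]; split=> //; last exact: hd'.
  by apply: leq_ltn_trans lp; rewrite -{1}(expn1 W) leq_pexp2l; lia.
have big y : (1 < y)%N -> (W <= W ^ y.-1)%N.
  by move=> y1; rewrite -{1}(expn1 W) leq_pexp2l; lia.
have szPr y : (1 < y)%N -> (2 * W ^ y.-1 <= size [seq p <- primes_upto (W ^ y) | (W ^ y.-1 < p)%N])%N ->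
    (W ^ y.-1 <= size (Pr y))%N.
  move=> y1; rewrite -(count_predC (fun p : nat => ~~ (p %| e0)%Z)) -!size_filter -/(Pr y).
  set t := [seq p <- _ | predC _ p].
  have : (size t <= B.+1)%N.
    apply: (@few y e0) => //.
    - by move=> p; rewrite mem_filter => /andP[].
    - by rewrite !filter_uniq// iota_uniq.
    - by move=> p; rewrite mem_filter /= negbK => /andP[].
  by have := big _ y1; lia.
have sP := szPr _ hx (HWx W ltac:(lia)).
have z1 : (1 < z)%N by lia.
have sQ := szPr _ z1 (HWz W ltac:(lia)).
pose f p (a : {ffun 'I_n -> 'I_(W ^ N)}) : int := eps p * m p (md p (ordv a)).
have eps1 p : `|eps p| = 1.
  by apply/eqP; rewrite -sqrp_eq1// -normrX eps2.
have lower y a : (1 < y)%N -> a \in s -> (W ^ y.-1 <= size (Pr y))%N ->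
    (size (Pr y))%:R <= 2 * \sum_(p <- Pr y) f p a.
  move=> y1 aS szy; have [D0 DB] := HD a aS.
  (* Each exceptional prime costs at most 2, and [W] is so large compared with [B] that half of the
     sum is left. *)
  have b1 : (size (Pr y))%:R - 2 * (B.+1)%:R <= \sum_(p <- Pr y) f p a.
    pose t := [seq p : nat <- Pr y | (p %| D a)%Z].
    have tB : (size t <= B.+1)%N.
      apply: (@few y (D a)) => //.
      - by move=> p; rewrite /t mem_filter => /andP[_]; rewrite mem_filter => /andP[].
      - by rewrite filter_uniq.
      - by move=> p; rewrite mem_filter => /andP[].
    rewrite (bigID (fun p : nat => (p %| D a)%Z)) /= addrC.
    have -> : \sum_(p <- Pr y | ~~ (p %| D a)%Z) f p a = (count (predC (fun p : nat => (p %| D a)%Z)) (Pr y))%:R.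
      rewrite big_seq_cond (eq_bigr (fun=> 1)) -?big_seq_cond ?big_const_seq ?iter_addr ?addr0//.
      move=> p /andP[pP pD]; have [pp Wp _ pe] := PrP _ _ y1 pP.
      by rewrite /f (Hs a p)// -expr2 eps2.
    have -> : \sum_(p <- Pr y | (p %| D a)%Z) f p a = \sum_(p <- t) f p a by rewrite big_filter.
    have ts : - (size t)%:R <= \sum_(p <- t) f p a.
      rewrite lerNl -sumrN; apply: (@le_trans _ _ (\sum_(p <- t) 1)).
        apply: ler_sum => p _; apply: le_trans (ler_norm _) _.
        by rewrite normrN /f normrM eps1 mul1r.
      by rewrite big_const_seq count_predT iter_addr addr0.
    have := count_predC (fun p : nat => (p %| D a)%Z) (Pr y); rewrite -size_filter -/t => e.
    move: ts tB; rewrite -e natrD; lia.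
  have : ((4 * B.+1)%N%:R <= (size (Pr y))%:R :> int) by rewrite ler_nat; have := big _ y1; lia.
  by rewrite natrM; lia.
have w1 : 1 <= W%:R :> R by rewrite (ler_nat _ 1) ltnW.
have wp k : 0 < W%:R ^+ k :> R by rewrite exprn_gt0// (lt_le_trans ltr01).
pose c1 := C * W%:R ^+ E; pose c2 := C * W%:R ^+ (E + z.-1); pose c3 : R := W%:R ^+ (N * n).
have C0 : 0 <= C by apply: le_trans C1.
have SM := @second_moment R _ (Pr x) (Pr z) f c1 c2 c3 (uPr x) (uPr z)
  (mulr_ge0 C0 (ltW (wp _))) (mulr_ge0 C0 (ltW (wp _))) (ltW (wp _)).
have sqb (T : int) (k : nat) : T%:~R ^+ 2 <= C * W%:R ^+ (2 * k) -> `|T|%:~R <= C * W%:R ^+ k :> R.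
  move=> h; have r0 : 0 <= C * W%:R ^+ k := mulr_ge0 C0 (ltW (wp k)).
  rewrite -(@ler_pXn2r R 2) ?nnegrE ?ler0z//.
  rewrite intr_norm real_normK ?num_real//; apply: le_trans h _.
  rewrite exprMn -exprM mulnC ler_pM2r// expr2 ler_peMl//.
have {}SM := SM _.
have H p p' q q' : p \in Pr x -> p' \in Pr x -> q \in Pr z -> q' \in Pr z ->
     `|\sum_a f p a * f p' a * (f q a * f q' a)|%:~R <=
     c1 + (q == q')%:R * c2 + (q == q')%:R * ((p == p')%:R * c3).
  move=> pP p'P qQ q'Q.
  have -> : `|\sum_a f p a * f p' a * (f q a * f q' a)| = `|four_corr N W m p p' q q'|.
    have -> : \sum_a f p a * f p' a * (f q a * f q' a) = eps p * eps p' * (eps q * eps q') * four_corr N W m p p' q q'.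
      by rewrite /four_corr mulr_sumr; apply: eq_bigr => a _; rewrite /f; ring.
    by rewrite normrM !normrM !eps1 !mul1r.
  have [pp Wp lp pe] := PrP _ _ hx pP; have [pp' Wp' lp' pe'] := PrP _ _ hx p'P.
  have [pq Wq lq qe] := PrP _ _ z1 qQ; have [pq' Wq' lq' qe'] := PrP _ _ z1 q'Q.
  have g0 k (pk : prime k) (Wk : (W < k)%N) (ke : ~~ (k %| e0)%Z) := conj pk (tw k pk Wk ke).
  have [eq_q|neq_q] := eqVneq q q'; last first.
    rewrite !mul0r !addr0; apply: sqb.
    by apply: (@four_corr_generic R n n0 tau K0 N E x z j j' W t0 ex lW m m1 p p' q q');
      rewrite ?(andP lp).2 ?(andP lp').2//; apply: g0.
  rewrite !mul1r -eq_q; have [eq_p|neq_p] := eqVneq p p'; last first.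
    rewrite mul0r addr0; apply: (@le_trans _ _ c2); last by rewrite lerDr mulr_ge0// ltW.
    apply: sqb.
    by apply: (@four_corr_diag R n n0 tau K0 N E x z j j' W t0 ex lW m m1 p p' q) => //; apply: g0.
  rewrite mul1r -eq_p; apply: (@le_trans _ _ c3); last by rewrite lerDr addr_ge0// mulr_ge0// ltW.
  apply: (@le_trans _ _ (\sum_(a : {ffun 'I_n -> 'I_(W ^ N)}) 1)%:~R).
    rewrite ler_int; apply: le_trans (ler_norm_sum _ _ _) _; apply: ler_sum => a _.
    by rewrite !normrM !mulr_ile1 ?mulr_ge0 ?normr_ge0.
  by rewrite sumr_const card_ffun !card_ord rmorph_nat -expnM natrX.
have {H}SM := SM H.
set P := (size (Pr x))%:R in SM; set Q := (size (Pr z))%:R in SM.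
have Pp : W%:R ^+ x.-1 <= P by rewrite /P -natrX ler_nat.
have Qp : W%:R ^+ z.-1 <= Q by rewrite /Q -natrX ler_nat.
have P0 : 0 < P by apply: lt_le_trans Pp.
have Q0 : 0 < Q by apply: lt_le_trans Qp.
have LB : (size s)%:R * (P ^+ 2 * Q ^+ 2) <= 16 * (\sum_a (\sum_(p <- Pr x) f p a) ^+ 2 * (\sum_(q <- Pr z) f q a) ^+ 2)%:~R.
  have : ((size s)%:R * ((size (Pr x))%:R ^+ 2 * (size (Pr z))%:R ^+ 2) <= 16 * (\sum_a (\sum_(p <- Pr x) f p a) ^+ 2 * (\sum_(q <- Pr z) f q a) ^+ 2) :> int).
    apply: (@le_trans _ _ (16 * (\sum_(a <- s) (\sum_(p <- Pr x) f p a) ^+ 2 * (\sum_(q <- Pr z) f q a) ^+ 2))); last first.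
      rewrite ler_pM2l// (big_uniq _ us) /= [leRHS](bigID (mem s)) /= lerDl sumr_ge0// => a _.
      by rewrite mulr_ge0 ?sqr_ge0.
    rewrite mulr_sumr.
    apply: (@le_trans _ _ (\sum_(a <- s) ((size (Pr x))%:R ^+ 2 * (size (Pr z))%:R ^+ 2))).
      by rewrite big_const_seq count_predT iter_addr addr0 mulr_natl.
    rewrite !big_seq; apply: ler_sum => a aS.
    have l1 := lower _ _ hx aS sP; have l2 := lower _ _ z1 aS sQ.
    have -> : 16 * ((\sum_(p <- Pr x) f p a) ^+ 2 * (\sum_(q <- Pr z) f q a) ^+ 2) =
      (2 * (\sum_(p <- Pr x) f p a)) ^+ 2 * (2 * \sum_(q <- Pr z) f q a) ^+ 2 by ring.
    rewrite ler_pM ?sqr_ge0// lerXn2r ?nnegrE ?(le_trans _ l1) ?(le_trans _ l2)//.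
  by rewrite -(ler_int R) !(rmorphM, rmorphXn, rmorph_nat).
rewrite -(ler_pM2r (_ : 0 < P ^+ 2 * Q ^+ 2)); last by rewrite mulr_gt0 ?exprn_gt0.
apply: le_trans LB _; rewrite -!mulrA ler_pM2l//; apply: le_trans SM _.
have e2 : P ^+ 2 * Q * c2 <= P ^+ 2 * Q ^+ 2 * c1.
  rewrite /c2 /c1 exprD.
  have -> : P ^+ 2 * Q * (C * (W%:R ^+ E * W%:R ^+ z.-1)) = (P ^+ 2 * Q * (C * W%:R ^+ E)) * W%:R ^+ z.-1 by ring.
  have -> : P ^+ 2 * Q ^+ 2 * (C * W%:R ^+ E) = (P ^+ 2 * Q * (C * W%:R ^+ E)) * Q by ring.
  apply: ler_wpM2l => //; apply: mulr_ge0; last exact: mulr_ge0 C0 (ltW (wp _)).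
  by apply: mulr_ge0; [exact: sqr_ge0|exact: ltW].
have e3 : P * Q * c3 <= P ^+ 2 * Q ^+ 2 * W%:R ^+ E.
  have -> : P ^+ 2 * Q ^+ 2 * W%:R ^+ E = P * Q * (W%:R ^+ E * (P * Q)) by ring.
  rewrite ler_wpM2l ?mulr_ge0 ?(ltW P0) ?(ltW Q0)//.
  apply: (@le_trans _ _ (W%:R ^+ E * (W%:R ^+ x.-1 * W%:R ^+ z.-1))).
    by rewrite -!exprD ler_weXn2l.
  by rewrite ler_wpM2l ?ler_pM// ltW.
apply: (@le_trans _ _ (P ^+ 2 * Q ^+ 2 * c1 + P ^+ 2 * Q ^+ 2 * c1 + P ^+ 2 * Q ^+ 2 * W%:R ^+ E)).
  by rewrite !lerD.
by rewrite /c1 le_eqVlt; apply/orP; left; apply/eqP; ring.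
Qed.

End AnalyticSieve.

(** * Polynomials whose discriminant has a prescribed square class *)

Section TailPoly.
Variable n : nat.

Definition tailpoly (R : nzRingType) (c : 'I_n -> R) : {poly R} := \sum_(i < n) c i *: 'X^i.

Lemma coef_tailpoly (R : nzRingType) (c : 'I_n -> R) (i : 'I_n) : (tailpoly c)`_i = c i.
Proof.
rewrite coef_sum (bigD1 i)//= coefZ coefXn eqxx mulr1 big1 ?addr0// => j ji.
by rewrite coefZ coefXn eq_sym val_eqE (negPf ji) mulr0.
Qed.

Lemma size_tailpoly (R : nzRingType) (c : 'I_n -> R) : (size (tailpoly c) <= n)%N.
Proof.
apply: (leq_trans (size_sum _ _ _)); apply/bigmax_leqP => i _.
by apply: leq_trans (size_scale_leq _ _) _; rewrite size_polyXn.
Qed.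

Lemma tailpolyD (R : nzRingType) (c d : 'I_n -> R) :
  tailpoly (fun i => c i + d i) = tailpoly c + tailpoly d.
Proof. by rewrite -big_split; apply: eq_bigr => i _; rewrite scalerDl. Qed.

Lemma map_tailpoly (R S : nzRingType) (phi : {rmorphism R -> S}) (c : 'I_n -> R) :
  map_poly phi (tailpoly c) = tailpoly (fun i => phi (c i)).
Proof. by rewrite /tailpoly rmorph_sum; apply: eq_bigr => i _ /=; rewrite map_polyZ map_polyXn. Qed.

Definition fullpoly (R : nzRingType) (a0 : R) (c : 'I_n -> R) : {poly R} := a0 *: 'X^n + tailpoly c.

Lemma lead_fullpoly (R : nzRingType) (a0 : R) (c : 'I_n -> R) : (fullpoly a0 c)`_n = a0.
Proof. by rewrite coefD coefZ coefXn eqxx mulr1 nth_default ?addr0// size_tailpoly. Qed.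

Lemma size_fullpoly (R : idomainType) (a0 : R) (c : 'I_n -> R) : a0 != 0 -> size (fullpoly a0 c) = n.+1.
Proof.
move=> a00; rewrite /fullpoly size_polyDl size_scale// size_polyXn//.
by rewrite ltnS size_tailpoly.
Qed.

End TailPoly.

Section MobiusFamily.
Variables (R : realType) (n : nat).
Hypothesis n0 : (0 < n)%N.
Variables (a0 : int) (C : nat) (b : 'I_n -> int).

Definition mobius_family (p : nat) (g : {ffun 'I_n -> 'F_p}) : int :=
  mobius (fullpoly (a0%:~R : 'F_p) (fun i => (b i)%:~R + C%:R * g i)).

(** The change of variables from [g] to [b + C * g] is a bijection since [p] does not divide [C]. It
    multiplies the frequency by the inverse of [C], and [b] contributes a factor of absolute value
    1. *)
Lemma mobius_twisted (p : nat) (d : R) : prime p -> ~~ (p %| C)%N -> ~~ (p %| a0)%Z ->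
  (forall (a0 : 'F_p) (h theta : {poly_n 'F_p}), a0 != 0 -> h != 0 ->
     ComplexField.Normc.normc (mobius_correlation R a0 h theta) <= d) ->
  twisted_bound (@mobius_family p) d.
Proof.
move=> pp pC pa H h th h0.
have c0 : C%:R != 0 :> 'F_p by rewrite -(dvdn_pcharf (pchar_Fp pp)).
have a00 : a0%:~R != 0 :> 'F_p by rewrite intr_Fp_eq0.
pose G (g : {ffun 'I_n -> 'F_p}) : {poly_n 'F_p} := npolyp n (tailpoly (fun i => (b i)%:~R + C%:R * g i)).
have Gi g (i : 'I_n) : (G g)`_i = (b i)%:~R + C%:R * g i.
  by rewrite coef_npolyp ltn_ord coef_tailpoly.
have GE g : (G g : {poly 'F_p}) = tailpoly (fun i => (b i)%:~R + C%:R * g i).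
  by rewrite npolypK// size_tailpoly.
have Ginj : injective G.
  move=> g g' e; apply/ffunP => i; have := congr1 (fun q : {poly_n 'F_p} => q`_i) e.
  by rewrite !Gi => /addrI/(mulfI c0).
have Gbij : bijective G.
  apply: inj_card_bij => //.
  by rewrite card_npoly card_ffun !card_ord.
pose hp : {poly_n 'F_p} := npolyp n (tailpoly (fun i => C%:R * h i)).
pose tp : {poly_n 'F_p} := npolyp n (tailpoly (fun i => C%:R^-1 * th i)).
have hp0 : hp != 0.
  apply: contra h0 => /eqP e; apply/eqP/ffunP => i.
  have := congr1 (fun q : {poly_n 'F_p} => q`_i) e.
  rewrite coef_npolyp ltn_ord coef_tailpoly coef0 ffunE => /eqP.
  by rewrite mulf_eq0 (negPf c0) => /eqP.
have := H a0%:~R hp tp a00 hp0.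
rewrite -lecR => bnd.
have pn : (0 : R[i]) < p%:R ^+ n by rewrite exprn_gt0// ltr0n prime_gt0.
have E : \sum_g (mobius_family g * mobius_family (g + h))%:~R * e_p R (dotp g th) =
   mobius_correlation R a0%:~R hp tp * p%:R ^+ n * e_p R (- \sum_i C%:R^-1 * (b i)%:~R * th i).
  rewrite /mobius_correlation card_npoly card_Fp// natrX divfK ?gt_eqF//.
  rewrite mulr_suml [RHS](reindex G) /=; last exact: onW_bij.
  apply: eq_bigr => g _; rewrite -[RHS]mulrA -e_pD//; apply: f_equal2; last congr e_p.
    rewrite rmorphM; apply: f_equal2; congr (_%:~R); rewrite /mobius_family /fullpoly; congr mobius.
      by rewrite GE.
    rewrite GE npolypK ?size_tailpoly// -addrA -tailpolyD; congr (_ + _).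
    apply: eq_bigr => i _; congr (_ *: _); rewrite ffunE; ring.
  rewrite /dotp /dot_coef -sumrN -big_split; apply: eq_bigr => i _ /=.
  by rewrite Gi coef_npolyp ltn_ord coef_tailpoly; field.
rewrite E normrM norm_e_p// mulr1 normrM [`|p%:R ^+ n|]ger0_norm ?(ltW pn)//.
rewrite rmorphM rmorphXn rmorph_nat.
by rewrite ler_wpM2r ?(ltW pn)// normc_def.
Qed.

End MobiusFamily.

Section LocalCount.
Variables (R : realType) (n : nat) (tau : R).

Lemma local_count (N E x z j j' B : nat) : (0 < n)%N -> 0 <= tau ->
  exponents n tau N E x z j j' -> TC n tau ->
  exists (K : R) (W0 : nat), 0 <= K /\ forall W : nat, (W0 <= W)%N ->
  forall (a0 : int) (C : nat) (b : 'I_n -> int) (d : int) (s : seq {ffun 'I_n -> 'I_(W ^ N)}),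
  a0 != 0 -> (0 < C)%N -> d != 0 -> (`|(C%:Z * a0 * d)%R| <= W ^ B)%N -> uniq s ->
  (forall a, a \in s ->
     let D := disc (@monic_coefs n _ (fullpoly a0 (fun i => b i + C%:Z * (a i)%:Z))) in
     [/\ D != 0, (`|D| <= W ^ B)%N & exists m, D * d = m ^+ 2]) ->
  (size s)%:R <= K * W%:R ^+ E.
Proof.
move=> n0 t0 ex [K0 [p0 _ HK]].
have [K [W0 [Kp HW]]] := @analytic_sieve R n tau N E x z j j' B K0 n0 t0 ex.
exists K, (W0 + p0 + 2)%N; split=> // W hW a0 C b d s a00 C0 d0 hB us Hs.
have W2 : (2 <= W)%N by lia.
pose e0 : int := C%:Z * a0 * d.
(* The sign that Stickelberger's theorem prescribes for every polynomial whose discriminant is [d]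
   times a rational square. *)
pose eps (p : nat) : int := if d%:~R ^+ (p.-1)./2 == 1 :> 'F_p then (-1) ^+ n else (-1) ^+ n.+1.
have e00 : e0 != 0 by rewrite !mulf_neq0// -lt0n.
have ndiv (p : nat) : ~~ (p %| e0)%Z -> [/\ ~~ (p %| C)%N, ~~ (p %| a0)%Z & ~~ (p %| d)%Z].
  move=> pe; split; apply: contra pe => h; rewrite /e0.
  - by rewrite -mulrA dvdz_mulr.
  - by rewrite dvdz_mulr// dvdz_mull.
  - by rewrite dvdz_mull.
pose F (a : {ffun 'I_n -> 'I_(W ^ N)}) : {poly int} := fullpoly a0 (fun i => b i + C%:Z * (a i)%:Z).
apply: (HW W _ (@mobius_family n a0 C b) e0 eps s (fun a => disc (@monic_coefs n _ (F a)))) => //.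
- by lia.
- by move=> p g; exact: mobius_abs.
- move=> p pp Wp /ndiv[pC pa pd]; apply: mobius_twisted => //.
  by apply: HK => //; rewrite /=; lia.
- by move=> p; rewrite /eps; case: ifP => _; rewrite -exprM muln2 -signr_odd odd_double.
- by move=> a aS; have [D0 DB _] := Hs a aS.
- move=> a p aS pp Wp /ndiv[pC pa pd] pD.
  have [D0 DB [m Dm]] := Hs a aS.
  rewrite /mobius_family; have -> : fullpoly (a0%:~R : 'F_p) (fun i => (b i)%:~R + C%:R * md p (ordv a) i) =
     map_poly (intr : int -> 'F_p) (F a).
    rewrite /F /fullpoly rmorphD /= map_polyZ map_polyXn map_tailpoly; congr (_ + _).
    by apply: eq_bigr => i _; rewrite ffunE rmorphD rmorphM.
  have po : odd p by case: (even_prime pp) => // e; rewrite e ltnNge W2 in Wp.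
  apply: (@mobius_sign p n (F a) d m) => //.
  + by rewrite size_fullpoly.
  + by rewrite lead_fullpoly.
  + by move: pD pd; rewrite !dvdzE abszM Euclid_dvdM// negb_or => -> ->.
Qed.

End LocalCount.

Section GaloisSide.
Variable k : nat.
Implicit Types f : {poly int}.

Definition no_transposition f := exists (L : splittingFieldType rat) (r : k.+3.-tuple L),
  [/\ map_poly (in_alg L) (map_poly (intr : int -> rat) f) %= \prod_(x <- r) ('X - x%:P),
      <<1 & r>>%VS = fullv, uniq r & forall i j, i != j -> tperm i j \notin root_perms r].

Lemma vandet_disc f (L : splittingFieldType rat) (r : k.+3.-tuple L) : size f = k.+4 ->
  map_poly (in_alg L) (map_poly (intr : int -> rat) f) %= \prod_(x <- r) ('X - x%:P) ->
  vandet f r ^+ 2 = (disc (@monic_coefs k.+3 _ f))%:~R.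
Proof.
move=> sf fr; have RF := root_factorisation fr.
rewrite (disc_rmorph (intr : int -> L)) /vandet -disc_roots; congr disc; apply/funext => i.
rewrite /scaled_root -(big_tuple _ _ r xpredT (fun x => 'X - ((lead_coef f)%:~R * x)%:P)).
rewrite coef_prod_scale size_tuple; last exact: ltnW.
have lE : lead_coef f = f`_k.+3 by rewrite lead_coefE sf.
rewrite /monic_coefs rmorphM rmorphXn /=.
have -> : (f`_i)%:~R = (lead_coef f)%:~R * (\prod_(x <- r) ('X - x%:P))`_i :> L.
  by rewrite -coefZ -RF coef_map.
have -> : (k.+3 - i = (k.+2 - i).+1)%N by have := ltn_ord i; lia.
by rewrite lE exprS; ring.
Qed.

Lemma disc_neq0 f : size f = k.+4 -> no_transposition f -> disc (@monic_coefs k.+3 _ f) != 0.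
Proof.
move=> sf [L [r [fr genr ur nt]]]; have v0 := vandet_neq0 sf ur.
apply: contra v0 => /eqP d0; rewrite -sqrf_eq0 (vandet_disc sf fr) d0.
by rewrite mulr0z.
Qed.

End GaloisSide.

(** * Polynomials without transpositions *)

Lemma tailpoly_full (n : nat) (R : nzRingType) (y : 'I_n.+1 -> R) :
  tailpoly y = fullpoly (y ord_max) (fun i : 'I_n => y (widen_ord (leqnSn n) i)).
Proof. by rewrite /tailpoly big_ord_recr /= addrC. Qed.

Section Kernel.
Variable k : nat.
Local Notation point := {ffun 'I_k.+4 -> int}.

Definition pdisc (y : point) : int := disc (@monic_coefs k.+3 _ (tailpoly y)).

Lemma pdisc_bound : exists Kd d : nat, (0 < Kd)%N /\ forall (M : nat) (y : point), (0 < M)%N ->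
  (forall i, `|y i| <= M)%N -> (`|pdisc y| <= Kd * M ^ d)%N.
Proof.
have [K [d Hd]] := disc_bound k.+3.
exists K.+1, (k.+3 * d)%N; split=> // M y M0 yM; rewrite expnM.
apply: (@leq_trans (K * (M ^ k.+3) ^ d)); last by rewrite leq_mul2r leqnSn orbT.
apply: Hd => [|i]; first by rewrite expn_gt0 M0.
rewrite /monic_coefs.
have ci (j : 'I_k.+4) : (`|((tailpoly y)`_j)%R| <= M)%N by rewrite coef_tailpoly.
have := ci (widen_ord (leqnSn _) i); have := ci ord_max => /= h1 h2.
rewrite abszM abszX.
have -> : (M ^ k.+3 = M ^ (i.+1) * M ^ (k.+2 - i))%N by rewrite -expnD; congr (_ ^ _)%N; have := ltn_ord i; lia.
rewrite leq_mul//; last by case: (k.+2 - i)%N => // e; rewrite leq_exp2r.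
by apply: leq_trans h2 _; rewrite expnS leq_pmulr// expn_gt0 M0.
Qed.

Variable p1 : nat.

(** The primes to which the inertia argument applies. The other primes of odd valuation divide [p1!]
    or the leading coefficient and are collected in [goodp]. *)
Definition badp (y : point) : seq nat :=
  [seq p : nat <- odd_primes `|pdisc y| | (p1 < p)%N && ~~ (p %| y ord_max)%Z].

Definition goodp (y : point) : seq nat :=
  [seq p : nat <- primes (p1`! * `|y ord_max|) | odd (logn p `|pdisc y|)].

Definition Cp (y : point) : nat := \prod_(p <- badp y) p.

Lemma badp_prime y : all prime (badp y).
Proof.
apply/allP => p; rewrite !mem_filter => /andP[_ /andP[_]].
by rewrite mem_primes => /andP[].
Qed.

Lemma badp_uniq y : uniq (badp y).
Proof. by rewrite !filter_uniq// primes_uniq. Qed.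

Lemma Cp_gt0 y : (0 < Cp y)%N.
Proof.
rewrite /Cp big_seq; apply: prodn_cond_gt0 => p pb.
exact/prime_gt0/(allP (badp_prime y)).
Qed.

Lemma primes_Cp y : primes (Cp y) =i badp y.
Proof. exact/prod_primes_uniq_primes/badp_prime/badp_uniq. Qed.

Lemma prod_primes_Cp y : (\prod_(p <- primes (Cp y)) p)%N = Cp y.
Proof.
by apply: perm_big; apply: uniq_perm (primes_Cp y); [exact: primes_uniq|exact: badp_uniq].
Qed.

Lemma prime_dvd_fact (p m : nat) : prime p -> (p %| m`!)%N = (p <= m)%N.
Proof.
move=> pp; apply/idP/idP => [|pm]; last by rewrite dvdn_fact// prime_gt0.
elim: m => [|m IH]; first by rewrite fact0 dvdn1 => /eqP e; rewrite e in pp.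
by rewrite factS Euclid_dvdM// => /orP[/dvdn_leq->//|/IH/leqW].
Qed.

Lemma odd_primes_split y : pdisc y != 0 -> y ord_max != 0 ->
  perm_eq (odd_primes `|pdisc y|) (badp y ++ goodp y).
Proof.
move=> D0 l0; apply: uniq_perm; first by rewrite filter_uniq// primes_uniq.
  rewrite cat_uniq badp_uniq filter_uniq ?primes_uniq// andbT /=.
  apply/hasPn => p; rewrite !mem_filter mem_primes => /andP[_ /and3P[pp _]].
  rewrite Euclid_dvdM// prime_dvd_fact// => /orP[h|h]; first by rewrite ltnNge h.
  by rewrite (_ : (p %| y ord_max)%Z) ?andbF// dvdzE.
move=> p; rewrite mem_cat !mem_filter !mem_primes muln_gt0 fact_gt0 !absz_gt0 l0 D0 /=.
case: (boolP (odd (logn p _))) => o; rewrite ?andbF//=.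
have : (0 < logn p `|pdisc y|)%N by case: (logn p _) o.
rewrite logn_gt0 mem_primes absz_gt0 D0 /= => /andP[pp ->]; rewrite pp /= andbT.
by rewrite Euclid_dvdM// prime_dvd_fact// dvdzE; case: leqP => //= _; case: (_ %| _)%N.
Qed.

(** For a non-zero discriminant and leading coefficient, the squarefree integer in the square class
    of the discriminant, split so that [Cp] is controlled by the forms and the rest has few
    possibilities once the leading coefficient is known. *)
Definition kernel (y : point) : int := sgz (pdisc y) * (Cp y * \prod_(p <- goodp y) p)%N%:Z.

Lemma kernelP y : pdisc y != 0 -> y ord_max != 0 ->
  [/\ kernel y != 0, (`|kernel y| <= `|pdisc y|)%N & exists m, pdisc y * kernel y = m ^+ 2].
Proof.
move=> D0 l0; have D0' : (0 < `|pdisc y|)%N by rewrite absz_gt0.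
have e : (Cp y * \prod_(p <- goodp y) p = \prod_(p <- odd_primes `|pdisc y|) p)%N.
  by rewrite (perm_big _ (odd_primes_split D0 l0)) big_cat.
have P0 : (0 < \prod_(p <- odd_primes `|pdisc y|) p)%N.
  by apply: dvdn_gt0 (prod_odd_primes_dvd D0').
have s1 : `|sgz (pdisc y)|%N = 1%N by move: D0; case: sgzP.
rewrite /kernel e; split.
- by rewrite mulf_neq0 ?sgz_eq0// -lt0n.
- by rewrite abszM s1 mul1n /= dvdn_leq// prod_odd_primes_dvd.
- have [m hm] := odd_primes_square D0'; exists m%:Z.
  by rewrite mulrA [pdisc y * _]mulrC -abszEsg -PoszM hm expr2 -PoszM.
Qed.

End Kernel.

(** * Small, middle and large products of bad primes *)

Section SmallFibres.
Variables (k p1 : nat) (bad : nat -> {ffun 'I_k.+4 -> int} -> bool) (V D : nat).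
Local Notation point := {ffun 'I_k.+4 -> int}.
Hypothesis bad_congr : forall (p : nat) (y y' : point), (forall i, (p %| y i - y' i)%Z) -> bad p y -> bad p y'.
Hypothesis bad_count : forall (s : seq point) (Z : nat) (ps : seq nat),
  uniq s -> ffun_bounded Z s -> uniq ps ->
  (forall p, p \in ps -> prime p /\ (p1 < p)%N) ->
  (forall y p, y \in s -> p \in ps -> bad p y) ->
  (size s <= (D ^ size ps * ((2 * (Z * V)) %/ (\prod_(p <- ps) p) + 1) ^ 3) *
     (2 * (Z * V) + 1) ^ k.+1)%N.

Definition similar (C : nat) (y y' : point) :=
  [/\ y ord_max = y' ord_max, forall i, (y i %% C)%Z = (y' i %% C)%Z & kernel p1 y = kernel p1 y'].

(** Three successive fibrations: the residues modulo [C], limited by the forms; the leading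
    coefficient, now in a fixed class modulo [C]; and the sign of the discriminant with its parities
    at the primes of [p1!] and of the leading coefficient. Points agreeing in all three are similar,
    since these data determine the kernel. *)
Lemma count_small (C M Lc w : nat) (s : seq point) : uniq s -> ffun_bounded M s -> (0 < C)%N ->
  (forall y, y \in s -> [/\ Cp p1 y = C, pdisc y != 0, y ord_max != 0,
     forall p, p \in badp p1 y -> bad p y & (2 ^ size (primes (p1`! * `|y ord_max|)) <= w)%N]) ->
  (forall s', uniq s' -> {subset s' <= s} -> {in s' &, forall y y', similar C y y'} ->
     (size s' <= Lc)%N) ->
  (size s <= Lc * (2 * w) * ((2 * M) %/ C + 1) *
    (D ^ size (primes C) * (2 * V + 1) ^ 3 * (2 * (C * V) + 1) ^ k.+1))%N.
Proof.
move=> us bs C0 Hs loc.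
pose f1 (y : point) : point := [ffun i => (y i %% C)%Z].
have f1E y y' : f1 y = f1 y' -> forall i, (y i %% C)%Z = (y' i %% C)%Z.
  by move=> /ffunP e i; have := e i; rewrite !ffunE.
have C0' : (C%:Z != 0) by rewrite -lt0n.
have n1 : (size (undup (map f1 s)) <= D ^ size (primes C) * (2 * V + 1) ^ 3 * (2 * (C * V) + 1) ^ k.+1)%N.
  case: s us bs Hs {loc} => // y0 s us bs Hs.
  have [Cy0 _ _ _ _] := Hs y0 (mem_head _ _).
  have := @bad_count (undup (map f1 (y0 :: s))) C (primes C) (undup_uniq _) _ (primes_uniq _) _ _.
  have -> : (\prod_(p <- primes C) p)%N = C by rewrite -Cy0 prod_primes_Cp.
  have -> : (2 * (C * V) %/ C = 2 * V)%N by rewrite mulnCA mulnC mulnK.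
  apply.
  (* The forms are applied to the residues themselves, in a box of side [C] equal to the product of
     the primes, so that no rounding is lost. *)
  - move=> y; rewrite mem_undup => /mapP[y' y's ->] i; rewrite ffunE.
    have := modz_ge0 (y' i) C0'; have := ltz_pmod (y' i) (_ : 0 < C%:Z); rewrite ltz_nat C0 => /(_ isT).
    by move: (modz _ _) => z; lia.
  - move=> p; rewrite -Cy0 primes_Cp => pb; split; first exact: (allP (badp_prime _ _) p pb).
    by move: pb; rewrite mem_filter => /andP[/andP[]].
  - move=> y p; rewrite mem_undup => /mapP[y' y's ->] pC.
    have [Cy' _ _ by' _] := Hs y' y's.
    have pd : (p %| C)%N by move: pC; rewrite mem_primes => /and3P[].
    apply: (@bad_congr p y'); last by apply: by'; rewrite -primes_Cp Cy'.
    move=> i; rewrite ffunE {1}(divz_eq (y' i) C) addrK dvdz_mull//.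
apply: leq_trans (@size_le_fibers _ _ f1 s (Lc * (2 * w) * ((2 * M) %/ C + 1)) _) _; last first.
  by rewrite leq_mul2l n1 orbT.
move=> b _; set t := [seq y <- s | f1 y == b].
have ut : uniq t by rewrite filter_uniq.
have tS : {subset t <= s} by move=> y; rewrite mem_filter => /andP[].
have tb y : y \in t -> f1 y = b by rewrite mem_filter => /andP[/eqP].
pose f2 (y : point) := y ord_max.
have n2 : (size (undup (map f2 t)) <= (2 * M) %/ C + 1)%N.
  apply: size_congruent => //; first exact: undup_uniq.
    by move=> z; rewrite mem_undup => /mapP[y /tS ys ->]; exact: bs.
  move=> z z'; rewrite !mem_undup => /mapP[y yt ->] /mapP[y' y't ->].
  have e : f1 y = f1 y' by rewrite !tb.
  by rewrite /f2 -eqz_mod_dvd; apply/eqP; exact: f1E.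
apply: leq_trans (@size_le_fibers _ _ f2 t (Lc * (2 * w)) _) _; last first.
  by rewrite leq_mul2l n2 orbT.
move=> a _; set t' := [seq y <- t | f2 y == a].
have ut' : uniq t' by rewrite filter_uniq.
have tS' : {subset t' <= t} by move=> y; rewrite mem_filter => /andP[].
have ta y : y \in t' -> f2 y = a by rewrite mem_filter => /andP[/eqP].
pose q := primes (p1`! * `|a|).
pose f3 (y : point) : bitseq := (0 < pdisc y) :: map (fun p : nat => odd (logn p `|pdisc y|)) q.
have n3 : (size (undup (map f3 t')) <= 2 * w)%N.
  have [->//|[y0 y0t]] : t' = [::] \/ exists y, y \in t'.
    by case: (t') => [|y u]; [left|right; exists y; rewrite mem_head].
  apply: (@leq_trans (2 ^ (size q).+1)).
    apply: size_bitseqs; first exact: undup_uniq.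
    by move=> c; rewrite mem_undup => /mapP[y _ ->] /=; rewrite size_map.
  rewrite expnS leq_mul2l /=; have [_ _ _ _] := Hs y0 (tS _ (tS' _ y0t)).
  by rewrite /q -(ta y0 y0t).
apply: leq_trans (@size_le_fibers _ _ f3 t' Lc _) _; last first.
  by rewrite leq_mul2l n3 orbT.
move=> c _; apply: loc; first by rewrite filter_uniq.
  by move=> y; rewrite mem_filter => /andP[_ /tS'/tS].
move=> y y' hy hy'; have := hy; have := hy'; rewrite mem_filter => /andP[/eqP cy' yt'].
rewrite mem_filter => /andP[/eqP cy yt].
have e1 : y ord_max = y' ord_max by apply: (etrans (ta y yt) (esym (ta y' yt'))).
split; [exact: e1|by apply: f1E; rewrite !tb ?tS'|].
have [Cy Dy _ _ _] := Hs y (tS _ (tS' _ yt)); have [Cy' Dy' _ _ _] := Hs y' (tS _ (tS' _ yt')).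
have := etrans cy (esym cy') => -[sg fl].
have gE (u : point) : goodp p1 u = [seq p : nat <- primes (p1`! * `|u ord_max|) | odd (logn p `|pdisc u|)] by [].
rewrite /kernel Cy Cy'; congr (_ * (_ * _)%N%:Z).
  by move: Dy Dy' sg; case: sgzP => // _; case: sgzP => //= *; lia.
rewrite !gE -e1 -/q.
have -> : primes (p1`! * `|y ord_max|) = q by rewrite /q -(ta y yt).
by rewrite !filter_mask fl.
Qed.

End SmallFibres.

Section LocalFibre.
Variables (R : realType) (k p1 : nat) (tau : R).
Local Notation point := {ffun 'I_k.+4 -> int}.

(** The lower coefficients of similar points are [b + C * a] with [a] in a box of side about
    [2 * Z ^ G / C], the [N]-th power of a number [W]. There [local_count] saves one factor [W] more
    than a variable, and the hypothesis on [C] makes [W] larger than [Z ^ 6]. *)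
Lemma local_fibre (N E x z j j' G : nat) : 0 <= tau -> exponents k.+3 tau N E x z j j' ->
  TC k.+3 tau -> exists (c : R) (Z0 : nat), 0 <= c /\ forall Z C : nat, (Z0 <= Z)%N -> (0 < C)%N ->
  (Z ^ (6 * N) <= (2 * Z ^ G) %/ C)%N ->
  forall s : seq point, uniq s -> ffun_bounded (Z ^ G) s ->
  (forall y, y \in s -> pdisc y != 0 /\ y ord_max != 0) ->
  {in s &, forall y y', similar p1 C y y'} ->
  (size s)%:R <= c * ((Z ^ G)%N%:R / C%:R) ^+ k.+2 / Z%:R ^+ 6.
Proof.
move=> t0 ex tc; have [Kd [d [Kd0 HKd]]] := pdisc_bound k.
have N0 : (0 < N)%N by case: ex; lia.
have EN : E.+1 = (N * k.+2)%N by case: ex.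
pose B := (G * (d + 2) + 1)%N.
have [K [W0 [K0 HW]]] := @local_count R k.+3 tau N E x z j j' B isT t0 ex tc.
exists (K * (2 ^+ N * 2) ^+ k.+2), (W0 + 2 * Kd + 2)%N; split.
  by rewrite mulr_ge0 ?exprn_ge0 ?mulr_ge0 ?exprn_ge0.
move=> Z C hZ C0 hC s us bs hs sim.
set M := (Z ^ G)%N in hC bs *.
have Z1 : (1 < Z)%N by lia.
have M0 : (0 < M)%N by rewrite expn_gt0; lia.
have ZR : (0 : R) < Z%:R by rewrite ltr0n; lia.
have CR : (0 : R) < C%:R by rewrite ltr0n.
have rhs0 : 0 <= (2 ^+ N * 2) ^+ k.+2 * (M%:R / C%:R) ^+ k.+2 :> R.
  by rewrite mulr_ge0 ?exprn_ge0 ?mulr_ge0 ?exprn_ge0 ?divr_ge0.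
case: s us bs hs sim => [|y0 s'] us bs hs sim; first by rewrite -[K * _ * _]mulrA divr_ge0 ?exprn_ge0//; exact: mulr_ge0.
set s := y0 :: s' in us bs hs sim *.
have y0s : y0 \in s by rewrite mem_head.
have [W [WC CW]] := exists_root_above (2 * M %/ C) N0.
have WZ : (Z ^ 6 < W)%N.
  by rewrite -(@ltn_exp2r _ _ N)// -expnM; apply: leq_ltn_trans hC WC.
have Z6 : (Z <= Z ^ 6)%N by rewrite -{1}(expn1 Z) leq_pexp2l; clear -Z1; lia.
have W0Z : (W0 <= W)%N by clear -hZ WZ Z6; lia.
have [D0 l0] := hs y0 y0s.
have [k0 kD _] := kernelP p1 D0 l0.
have C0' : (C%:Z != 0) by rewrite -lt0n.
have C2M : (C <= 2 * M)%N.
  by rewrite leqNgt; apply/negP => /divn_small e; move: hC; rewrite e leqn0 expn_eq0; lia.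
pose o0 : 'I_(W ^ N) := Ordinal (leq_ltn_trans (leq0n _) WC).
pose wi (i : 'I_k.+3) : 'I_k.+4 := widen_ord (leqnSn k.+3) i.
pose q (y : point) (i : 'I_k.+3) : nat := (absz (y (wi i) + M%:Z)%R %/ C)%N.
pose a (y : point) : {ffun 'I_k.+3 -> 'I_(W ^ N)} := [ffun i => insubd o0 (q y i)].
pose b (i : 'I_k.+3) : int := (absz (y0 (wi i) + M%:Z)%R %% C)%N%:Z - M%:Z.
have posM y i : y \in s -> 0 <= y i + M%:Z by move=> ys; have := bs y ys i; clear; lia.
have aE y i : y \in s -> (a y i : nat) = q y i.
  move=> ys; rewrite ffunE val_insubd ifT//; apply: (leq_ltn_trans _ (WC)).
  by rewrite leq_div2r//; have := bs y ys (wi i); move: (y (wi i)) => t; clear; lia.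
have recon y i : y \in s -> y (wi i) = b i + C%:Z * (a y i)%:Z.
  move=> ys; rewrite aE// /b /q.
  have [_ res _] := sim y y0 ys y0s.
  have e : (absz (y (wi i) + M%:Z)%R %% C = absz (y0 (wi i) + M%:Z)%R %% C)%N.
    apply/eqP; rewrite -eqz_nat -!modz_nat !gez0_abs ?posM//.
    by rewrite -modzDml res modzDml.
  rewrite -e -PoszM mulnC addrAC -PoszD addnC -divn_eq gez0_abs ?posM//.
  by rewrite addrK.
have ainj : {in s &, injective a}.
  move=> y y' ys ys' /ffunP e; apply/ffunP => i.
  have [im|il] := eqVneq i ord_max.
    by rewrite im; have [] := sim y y' ys ys'.
  have ilt : (i < k.+3)%N.
    by have := ltn_ord i; rewrite ltnS leq_eqVlt => /orP[/eqP h|//]; case/eqP: il; apply: val_inj.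
  have -> : i = wi (Ordinal ilt) by apply: val_inj.
  by rewrite !recon// e.
have H := HW W W0Z (y0 ord_max) C b (kernel p1 y0) (map a s) l0 C0 k0.
have dbound y : y \in s -> (`|pdisc y| <= Kd * M ^ d)%N by move=> ys; apply: HKd => //; exact: bs.
have WB : (2 * Kd * Z ^ (G * (d + 2)) <= W ^ B)%N.
  rewrite /B expnD expn1 mulnC leq_mul//; last by clear -hZ WZ Z6; lia.
  by case: (G * (d + 2))%N => // e; rewrite leq_exp2r//; clear -WZ Z6 Z1; lia.
have MdE : (M * M * M ^ d = Z ^ (G * (d + 2)))%N by rewrite mulnDr expnD expnM -/M mulnC; congr (_ * _)%N; rewrite mulnC expnM expnS expn1 -expnMn; congr (_ ^ _)%N; rewrite /M -expnMn.
have {}H : (size s)%:R <= K * W%:R ^+ E.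
  rewrite -(size_map a); apply: H.
  - apply: leq_trans WB; rewrite -MdE.
    have h1 := bs y0 y0s ord_max; have h2 := leq_trans kD (dbound y0 y0s).
    move: (kernel p1 y0) h2 => kk h2; rewrite !abszM /=.
    apply: (@leq_trans (2 * M * M * (Kd * M ^ d))); first by rewrite !leq_mul.
    by rewrite leq_eqVlt; apply/orP; left; apply/eqP; ring.
  - by rewrite map_inj_in_uniq.
  - move=> _ /mapP[y ys ->] /=.
    have -> : fullpoly (y0 ord_max) (fun i : 'I_k.+3 => b i + C%:Z * (a y i)%:Z) = tailpoly y.
      rewrite tailpoly_full; have [-> _ _] := sim y y0 ys y0s.
      by rewrite /fullpoly; congr (_ + _); apply: eq_bigr => i _; rewrite -recon.
    have [Dy ly] := hs y ys; have [_ _ [m hm]] := kernelP p1 Dy ly.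
    have [_ _ ke] := sim y y0 ys y0s.
    split=> //; last by exists m; rewrite -ke.
    apply: leq_trans (dbound y ys) (leq_trans _ WB); rewrite -MdE.
    have : (0 < M * M)%N by rewrite muln_gt0 M0.
    by move=> v0; rewrite [(2 * Kd)%N]mulnC -mulnA leq_mul2l mulnA leq_pmull ?orbT// muln_gt0.
apply: (le_trans H).
have -> : K * (2 ^+ N * 2) ^+ k.+2 * (M%:R / C%:R) ^+ k.+2 / Z%:R ^+ 6 =
    K * ((2 ^+ N * 2 * (M%:R / C%:R)) ^+ k.+2 / Z%:R ^+ 6).
  by rewrite [(2 ^+ N * 2 * (M%:R / C%:R)) ^+ _]exprMn !mulrA.
rewrite ler_wpM2l// ler_pdivlMr ?exprn_gt0//.
have WW : (W <= 2 * W.-1)%N by clear -WZ Z6 Z1; lia.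
have h1 : W%:R ^+ N <= 2 ^+ N * 2 * (M%:R / C%:R) :> R.
  apply: (@le_trans _ _ (2 ^+ N * (2 * M %/ C)%N%:R)).
    rewrite -!natrX -natrM ler_nat; apply: leq_trans (leq_mul (leqnn _) CW).
    by rewrite -expnMn leq_exp2r.
  rewrite -mulrA ler_wpM2l ?exprn_ge0// mulrA ler_pdivlMr// -!natrM ler_nat.
  exact: leq_trunc_div.
apply: (@le_trans _ _ ((W%:R ^+ N) ^+ k.+2)); last first.
  by rewrite lerXn2r ?nnegrE ?exprn_ge0 ?mulr_ge0 ?divr_ge0 ?exprn_ge0.
rewrite -exprM -EN [leRHS]exprSr ler_wpM2l ?exprn_ge0// -natrX ler_nat; exact: ltnW.
Qed.

End LocalFibre.

Section Middle.
Variables (R : realType) (k p1 : nat) (bad : nat -> {ffun 'I_k.+4 -> int} -> bool) (V D : nat).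
Local Notation point := {ffun 'I_k.+4 -> int}.
Hypothesis bad_count : forall (s : seq point) (Z : nat) (ps : seq nat),
  uniq s -> ffun_bounded Z s -> uniq ps ->
  (forall p, p \in ps -> prime p /\ (p1 < p)%N) ->
  (forall y p, y \in s -> p \in ps -> bad p y) ->
  (size s <= (D ^ size ps * ((2 * (Z * V)) %/ (\prod_(p <- ps) p) + 1) ^ 3) *
     (2 * (Z * V) + 1) ^ k.+1)%N.

Lemma cube_add1_le (t : R) : 0 <= t -> (t + 1) ^+ 3 <= 4 * (t ^+ 3 + 1).
Proof.
move=> t0; rewrite -subr_ge0.
have -> : 4 * (t ^+ 3 + 1) - (t + 1) ^+ 3 = 3 * (t + 1) * (t - 1) ^+ 2 by ring.
by apply: mulr_ge0; [apply: mulr_ge0; rewrite // addr_ge0|exact: sqr_ge0].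
Qed.

(** For a product [m] of bad primes each form saves a factor [m], up to rounding. Summed over [m]
    above [X], the inverse cubes give [X ^ -2], while the rounding contributes once for each [m] up
    to [X ^ 2]. *)
Lemma count_middle (X M zb : nat) (s : seq point) : uniq s -> ffun_bounded M s -> (0 < X)%N ->
  (forall m, (0 < m <= X ^ 2)%N -> (D ^ size (primes m) <= zb)%N) ->
  (forall y, y \in s -> exists qs, [/\ uniq qs, forall p, p \in qs -> [/\ prime p, (p1 < p)%N & bad p y]
     & (X < \prod_(p <- qs) p <= X ^ 2)%N]) ->
  (size s)%:R <= (2 * (M * V) + 1)%N%:R ^+ k.+1 * zb%:R *
     (4 * ((2 * (M * V))%N%:R ^+ 3 / X%:R ^+ 2 + X%:R ^+ 2)) :> R.
Proof.
move=> us bs X0 HD Hs.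
have XR : (0 : R) < X%:R by rewrite ltr0n.
pose Rl (y : point) (m : nat) := all (fun p => (p1 < p)%N && bad p y) (primes m) && (\prod_(p <- primes m) p == m)%N.
set A : nat := (2 * (M * V))%N.
have cov : (size s <= \sum_(X.+1 <= m < (X ^ 2).+1) size [seq y <- s | Rl y m])%N.
  apply: size_le_cover_sum => y ys; apply/hasP.
  have [qs [uq hq bq]] := Hs y ys; exists (\prod_(p <- qs) p)%N; first by rewrite mem_index_iota ltnS.
  have aq : all prime qs by apply/allP => p /hq[].
  have pq := prod_primes_uniq_primes uq aq.
  rewrite /Rl; apply/andP; split; first by apply/allP => p; rewrite pq => /hq[_ -> ->].
  by apply/eqP; apply: perm_big; apply: uniq_perm => //; exact: primes_uniq.
apply: (@le_trans _ _ (\sum_(X.+1 <= m < (X ^ 2).+1) (A + 1)%N%:R ^+ k.+1 * zb%:R *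
    (4 * (A%:R ^+ 3 / X%:R * m%:R ^- 2 + 1)))).
  apply: (@le_trans _ _ (\sum_(X.+1 <= m < (X ^ 2).+1) size [seq y <- s | Rl y m])%N%:R).
    by rewrite ler_nat.
  rewrite natr_sum; apply: ler_sum_nat => m /andP[Xm mX].
  have m0 : (0 < m)%N by lia.
  have [->|[y yt]] : [seq y <- s | Rl y m] = [::] \/ exists y, y \in [seq y <- s | Rl y m].
    by case: [seq y <- s | Rl y m] => [|y u]; [left|right; exists y; rewrite mem_head].
    by rewrite !mulr_ge0 ?addr_ge0 ?exprn_ge0 ?mulr_ge0 ?invr_ge0 ?exprn_ge0 ?invr_ge0.
  have Rm y' : y' \in [seq y <- s | Rl y m] -> Rl y' m by rewrite mem_filter => /andP[].
  have /andP[_ /eqP pm] := Rm _ yt.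
  have := @bad_count [seq y <- s | Rl y m] M (primes m) (filter_uniq _ us) _ (primes_uniq m) _ _.
  rewrite pm -/A => H; have {}H := H _ _ _.
  have HH : (size [seq y <- s | Rl y m] <= D ^ size (primes m) * (A %/ m + 1) ^ 3 * (A + 1) ^ k.+1)%N.
    apply: H.
    - by move=> y'; rewrite mem_filter => /andP[_ /bs].
    - move=> p pm'; have /andP[/allP/(_ p pm')/andP[-> _] _] := Rm _ yt.
      by move: pm'; rewrite mem_primes => /andP[->].
    - by move=> y' p /Rm /andP[/allP h _] /h/andP[].
  apply: (@le_trans _ _ (D ^ size (primes m) * (A %/ m + 1) ^ 3 * (A + 1) ^ k.+1)%N%:R).
    by rewrite ler_nat.
  rewrite mulnC natrM natrX -mulrA ler_wpM2l ?exprn_ge0// natrM ler_pM//.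
    by rewrite ler_nat HD// m0 -ltnS.
  rewrite natrX natrD; apply: le_trans (cube_add1_le _) _ => //.
  rewrite ler_pM2l// lerD2r.
  have mR : (0 : R) < m%:R by rewrite ltr0n.
  have h1 : (A %/ m)%N%:R <= A%:R / m%:R :> R.
    by rewrite ler_pdivlMr// -natrM ler_nat leq_trunc_div.
  apply: (@le_trans _ _ ((A%:R / m%:R) ^+ 3)).
    by rewrite lerXn2r ?nnegrE ?divr_ge0.
  rewrite exprMn -mulrA ler_wpM2l ?exprn_ge0// exprVn exprS invfM ler_wpM2r ?invr_ge0 ?exprn_ge0//.
  by rewrite lef_pV2 ?posrE// ler_nat ltnW.
rewrite -mulr_sumr ler_wpM2l ?mulr_ge0 ?exprn_ge0// -mulr_sumr ler_pM2l// big_split /= lerD//.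
  rewrite -mulr_sumr [X in _ <= _ / X]expr2 invfM mulrA ler_wpM2l ?divr_ge0 ?exprn_ge0//.
  exact: sum_inv_sq.
rewrite sumr_const_nat -natrX; rewrite ler_nat; lia.
Qed.

End Middle.

(** The exponents of [C] are [-(k + 2)] from the sieve, [-1] from the leading coefficient and
    [k + 1] from the residues, so the sum over [C] converges. Two of the six factors [Z] are spent
    on [2 * Z] and on [Dz]. *)
Lemma small_level_bound (R : realFieldType) (k M C Z V Lc Dz : nat) (cl : R) : 0 <= cl ->
  (0 < C)%N -> (0 < Z)%N -> (C <= M)%N -> (0 < V)%N -> (Dz <= Z)%N ->
  Lc%:R <= cl * (M%:R / C%:R) ^+ k.+2 / Z%:R ^+ 6 ->
  (Lc * (2 * Z) * ((2 * M) %/ C + 1) * (Dz * (2 * V + 1) ^ 3 * (2 * (C * V) + 1) ^ k.+1))%N%:R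
  <= cl * (2 * 3 * (2 * V + 1)%N%:R ^+ 3 * (3 * V)%N%:R ^+ k.+1) *
     (M%:R ^+ k.+3 / Z%:R ^+ 4) * C%:R ^- 2 :> R.
Proof.
move=> cl0 C0 Z0 CM V0 DZ hL.
have CR : 0 < C%:R :> R by rewrite ltr0n.
have ZR : 0 < Z%:R :> R by rewrite ltr0n.
have h1 : ((2 * M) %/ C + 1)%N%:R <= 3 * (M%:R / C%:R) :> R.
  rewrite mulrA ler_pdivlMr// -!natrM ler_nat mulnDl mul1n.
  by have := leq_trunc_div (2 * M) C; lia.
have h2 : (2 * (C * V) + 1)%N%:R <= (3 * V)%N%:R * C%:R :> R by rewrite -natrM ler_nat; nia.
have h2' : (2 * (C * V) + 1)%N%:R ^+ k.+1 <= (3 * V)%N%:R ^+ k.+1 * C%:R ^+ k.+1 :> R.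
  by rewrite -exprMn lerXn2r ?nnegrE ?mulr_ge0.
have e1 : 0 <= M%:R / C%:R :> R by rewrite divr_ge0.
set v := (3 * V)%N%:R in h2 h2' *; set u := (2 * V + 1)%N%:R.
rewrite !natrM !natrX -/u; set A := (2 * (C * V) + 1)%N%:R in h2 h2' *.
have u0 : 0 <= u ^+ 3 by rewrite exprn_ge0.
have v0 : 0 <= v ^+ k.+1 * C%:R ^+ k.+1 by rewrite mulr_ge0 ?exprn_ge0.
apply: (@le_trans _ _ (cl * (M%:R / C%:R) ^+ k.+2 / Z%:R ^+ 6 * (2 * Z%:R) * (3 * (M%:R / C%:R)) *
   (Z%:R * u ^+ 3 * (v ^+ k.+1 * C%:R ^+ k.+1)))).
  rewrite ler_pM ?mulr_ge0 ?exprn_ge0//.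
    rewrite ler_pM ?mulr_ge0//; rewrite ler_wpM2r ?mulr_ge0//.
  rewrite ler_pM ?mulr_ge0 ?exprn_ge0//.
  by rewrite ler_wpM2r// ler_nat.
rewrite le_eqVlt; apply/orP; left; apply/eqP.
rewrite expr_div_n [M%:R ^+ k.+3]exprSr [C%:R ^+ k.+2]exprSr.
set q := C%:R ^+ k.+1; have q0 : q != 0 by rewrite expf_neq0// gt_eqF.
by field; rewrite q0 !gt_eqF.
Qed.

Lemma size_partition (T : eqType) (a : pred T) (s : seq T) :
  size s = (size [seq y <- s | a y] + size [seq y <- s | ~~ a y])%N.
Proof. by rewrite !size_filter; exact/esym/count_predC. Qed.

Lemma middle_power (R : realFieldType) (k G h V Z : nat) : (1 < Z)%N -> (0 < V)%N ->
  (2 * h <= G * 3)%N -> (G * k.+1 + 1 + (G * 3 - 2 * h) <= (G * k.+3).-1)%N ->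
  (G * k.+1 + 1 + 2 * h <= (G * k.+3).-1)%N ->
  (2 * (Z ^ G * V) + 1)%N%:R ^+ k.+1 * Z%:R *
    (4 * ((2 * (Z ^ G * V))%N%:R ^+ 3 / (Z ^ h)%N%:R ^+ 2 + (Z ^ h)%N%:R ^+ 2)) <=
  (3 * V)%N%:R ^+ k.+1 * (4 * ((3 * V)%N%:R ^+ 3 + 1)) * Z%:R ^+ (G * k.+3).-1 :> R.
Proof.
move=> Z1 V0 le3 le1 le2.
have ZR : 1 <= Z%:R :> R by rewrite (ler_nat _ 1) ltnW.
have ZR0 : 0 < Z%:R :> R by rewrite (lt_le_trans ltr01).
have MV : (2 * (Z ^ G * V) + 1 <= 3 * V * Z ^ G)%N.
  have : (0 < Z ^ G)%N by rewrite expn_gt0 ltnW.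
  by move: (Z ^ G)%N => M M0; nia.
set v := (3 * V)%N%:R.
have v0 : 0 <= v by [].
have vM : v * Z%:R ^+ G = (3 * V * Z ^ G)%N%:R by rewrite /v [in RHS]natrM natrX.
have a1 : (2 * (Z ^ G * V) + 1)%N%:R ^+ k.+1 <= v ^+ k.+1 * Z%:R ^+ (G * k.+1).
  by rewrite exprM -exprMn lerXn2r ?nnegrE ?mulr_ge0 ?exprn_ge0// vM ler_nat.
have a2 : (2 * (Z ^ G * V))%N%:R ^+ 3 <= v ^+ 3 * Z%:R ^+ (G * 3).
  rewrite exprM -exprMn lerXn2r ?nnegrE ?mulr_ge0 ?exprn_ge0// vM ler_nat.
  by apply: leq_trans MV; rewrite leq_addr.
have XE : (Z ^ h)%N%:R ^+ 2 = Z%:R ^+ (2 * h) :> R by rewrite natrX -exprM mulnC.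
apply: (@le_trans _ _ (v ^+ k.+1 * Z%:R ^+ (G * k.+1) * Z%:R *
    (4 * (v ^+ 3 * Z%:R ^+ (G * 3) / Z%:R ^+ (2 * h) + Z%:R ^+ (2 * h))))).
  rewrite ler_pM ?mulr_ge0 ?addr_ge0 ?divr_ge0 ?exprn_ge0//.
    by rewrite ler_wpM2r.
  by rewrite ler_pM2l// XE lerD2r ler_wpM2r// invr_ge0 exprn_ge0.
have e1 : Z%:R ^+ (G * 3) / Z%:R ^+ (2 * h) = Z%:R ^+ (G * 3 - 2 * h) :> R.
  by rewrite -[in LHS](subnK le3) exprD mulfK// expf_neq0// gt_eqF.
have b1 : Z%:R ^+ (G * k.+1) * Z%:R * Z%:R ^+ (G * 3 - 2 * h) <= Z%:R ^+ (G * k.+3).-1 :> R.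
  by rewrite -exprSr -exprD ler_weXn2l// -addn1.
have b2 : Z%:R ^+ (G * k.+1) * Z%:R * Z%:R ^+ (2 * h) <= Z%:R ^+ (G * k.+3).-1 :> R.
  by rewrite -exprSr -exprD ler_weXn2l// -addn1.
rewrite -[v ^+ 3 * _ / _]mulrA e1.
move: b1 b2; set P := Z%:R ^+ (G * k.+1); set Q := Z%:R ^+ (G * 3 - 2 * h).
set S := Z%:R ^+ (2 * h); set T := Z%:R ^+ _ => b1 b2.
have -> : v ^+ k.+1 * P * Z%:R * (4 * (v ^+ 3 * Q + S)) =
  v ^+ k.+1 * (4 * (v ^+ 3 * (P * Z%:R * Q) + P * Z%:R * S)) by ring.
have -> : v ^+ k.+1 * (4 * (v ^+ 3 + 1)) * T = v ^+ k.+1 * (4 * (v ^+ 3 * T + T)) by ring.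
by rewrite ler_wpM2l ?exprn_ge0// ler_pM2l// lerD// ler_wpM2l ?exprn_ge0.
Qed.

(** [6 * N + h <= G] makes [local_fibre] applicable for every [C] up to [Z ^ h]. The middle range
    needs [Z ^ (2 * h)] between [Z ^ G] and [Z ^ (2 * G)], with a spare factor on both sides. *)
Lemma exponents_ineq (N k : nat) (G := (12 * N + 20)%N) (h := (6 * N + 15)%N) :
  [/\ (0 < G)%N, (h <= G)%N, (6 * N + h <= G)%N, (G * k.+2 <= (G * k.+3).-1)%N & (G <= h * 2)%N] /\
  [/\ (2 * h <= G * 3)%N, (G * k.+1 + 1 + (G * 3 - 2 * h) <= (G * k.+3).-1)%N,
     (G * k.+1 + 1 + 2 * h <= (G * k.+3).-1)%N & ((G * k.+3).-1 + 4 >= G * k.+3)%N].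
Proof. by rewrite /G /h !mulnS; move: (_ * k)%N => u; repeat split; lia. Qed.

Section Small.
Variables (R : realType) (k p1 : nat) (bad : nat -> {ffun 'I_k.+4 -> int} -> bool) (V D : nat).
Local Notation point := {ffun 'I_k.+4 -> int}.
Hypothesis bad_congr : forall (p : nat) (y y' : point), (forall i, (p %| y i - y' i)%Z) -> bad p y -> bad p y'.
Hypothesis bad_count : forall (s : seq point) (Z : nat) (ps : seq nat),
  uniq s -> ffun_bounded Z s -> uniq ps ->
  (forall p, p \in ps -> prime p /\ (p1 < p)%N) ->
  (forall y p, y \in s -> p \in ps -> bad p y) ->
  (size s <= (D ^ size ps * ((2 * (Z * V)) %/ (\prod_(p <- ps) p) + 1) ^ 3) *
     (2 * (Z * V) + 1) ^ k.+1)%N.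

Lemma count_small_sum (X M Z : nat) (cl : R) (s : seq point) : uniq s -> ffun_bounded M s ->
  0 <= cl -> (0 < Z)%N -> (0 < V)%N -> (X <= M)%N ->
  (forall C, (0 < C <= X)%N -> (D ^ size (primes C) <= Z)%N) ->
  (forall y, y \in s -> [/\ (Cp p1 y <= X)%N, pdisc y != 0, y ord_max != 0,
     forall p, p \in badp p1 y -> bad p y & (2 ^ size (primes (p1`! * `|y ord_max|)) <= Z)%N]) ->
  (forall C s', (0 < C <= X)%N -> uniq s' -> {subset s' <= s} ->
     {in s' &, forall y y', similar p1 C y y'} ->
     (size s')%:R <= cl * (M%:R / C%:R) ^+ k.+2 / Z%:R ^+ 6) ->
  (size s)%:R <= 2 * (cl * (2 * 3 * (2 * V + 1)%N%:R ^+ 3 * (3 * V)%N%:R ^+ k.+1)) *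
     (M%:R ^+ k.+3 / Z%:R ^+ 4) :> R.
Proof.
move=> us bs cl0 Z0 V0 XM HD Hs loc.
have cov : (size s <= \sum_(1 <= C < X.+1) size [seq y <- s | Cp p1 y == C])%N.
  apply: size_le_cover_sum => y ys; apply/hasP; exists (Cp p1 y); last exact: eqxx.
  by rewrite mem_index_iota ltnS Cp_gt0; have [] := Hs y ys.
set c1 := cl * _; set c2 := _ / _.
have c10 : 0 <= c1 by rewrite !mulr_ge0 ?exprn_ge0.
have c20 : 0 <= c2 by rewrite divr_ge0 ?exprn_ge0.
apply: (@le_trans _ _ (\sum_(1 <= C < X.+1) (c1 * c2 * C%:R ^- 2))); last first.
  rewrite -mulr_sumr (_ : 2 * c1 * c2 = c1 * c2 * 2); last by ring.
  by apply: ler_wpM2l; [exact: mulr_ge0|exact: sum_inv_sq2].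
apply: (@le_trans _ _ (\sum_(1 <= C < X.+1) size [seq y <- s | Cp p1 y == C])%N%:R).
  by rewrite ler_nat.
rewrite natr_sum; apply: ler_sum_nat => C /andP[C0 CX]; rewrite ltnS in CX.
have q0 : 0 <= cl * (M%:R / C%:R) ^+ k.+2 / Z%:R ^+ 6.
  by apply: divr_ge0; [apply: mulr_ge0 => //; apply: exprn_ge0; apply: divr_ge0|apply: exprn_ge0].
set t := [seq y <- s | Cp p1 y == C].
have ts : {subset t <= s} by move=> y; rewrite mem_filter => /andP[].
set Lc := Num.truncn (cl * (M%:R / C%:R) ^+ k.+2 / Z%:R ^+ 6).
have lcE : Lc%:R <= cl * (M%:R / C%:R) ^+ k.+2 / Z%:R ^+ 6 by rewrite truncn_le.
apply: le_trans (small_level_bound cl0 C0 Z0 (leq_trans CX XM) V0 (HD C _) lcE); last by rewrite C0.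
rewrite ler_nat.
apply: (count_small bad_congr bad_count (filter_uniq _ us) _ C0).
- by move=> y /ts /bs.
- move=> y; rewrite mem_filter => /andP[/eqP e ys].
  by have [_ h1 h2 h3 h4] := Hs y ys; split.
move=> s' us' s's sim; rewrite truncn_ge_nat//.
by apply: loc => //; [rewrite C0|move=> y /s's/ts].
Qed.

End Small.

Section BadPrimes.
Variables (R : realType) (k : nat) (tau : R).
Local Notation point := {ffun 'I_k.+4 -> int}.

Lemma badp_bad (bad : nat -> point -> bool) (p1 : nat) (y : point) :
  (forall (R : comNzRingType) (Eq : R -> R -> Prop) (a0 : R) (phi : {ffun 'I_k.+3 -> 'I_k})
     (gam : 'I_k -> R) (p : nat) (y : point), ring_congruence Eq ->
     (forall z : int, Eq z%:~R 0 -> (p %| z)%Z) ->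
     (forall i : 'I_k.+4, Eq (y i)%:~R (a0 * (\prod_j ('X - (gam (phi j))%:P))`_i)) -> bad p y) ->
  (k.+3 <= p1)%N -> y ord_max != 0 -> no_transposition k (tailpoly y) ->
  forall p, p \in badp p1 y -> bad p y.
Proof.
move=> Hbad kp l0 [L [r [fr genr ur nt]]] p pb.
have pp := allP (badp_prime p1 y) p pb.
move: pb; rewrite mem_filter => /andP[/andP[p1p pl]]; rewrite mem_filter => /andP[od _].
have lE : lead_coef (tailpoly y) = y ord_max.
  rewrite lead_coefE tailpoly_full size_fullpoly//= lead_fullpoly//.
have sf : size (tailpoly y) = k.+4 by rewrite tailpoly_full size_fullpoly.
have vd := vandet_disc sf fr.
have [|E [phi [gam [cE hE hco]]]] := @bad_prime k (tailpoly y) L r sf fr genr ur p (pdisc y) pp (leq_ltn_trans kp p1p) _ vd od nt.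
  by rewrite lE.
apply: (Hbad L E (lead_coef (tailpoly y))%:~R phi gam p y cE hE) => i.
by have := hco i; rewrite coef_tailpoly.
Qed.

End BadPrimes.

Section SmallAndLargePrimes.
Variables (R : realType) (k : nat) (tau : R).
Local Notation point := {ffun 'I_k.+4 -> int}.

Lemma tailpoly_no_transposition_count : 4 * (k.+3)%:R / ((k.+3)%:R + 2) < tau -> TC k.+3 tau ->
  exists (G : nat) (c : R) (Z0 : nat), (0 < G)%N /\ 0 <= c /\ forall Z : nat, (Z0 <= Z)%N ->
  forall s : seq point, uniq s -> ffun_bounded (Z ^ G) s ->
  (forall y, y \in s -> y ord_max != 0 /\ no_transposition k (tailpoly y)) ->
  (size s)%:R <= c * Z%:R ^+ (G * k.+3).-1.
Proof.
move=> htau tc.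
have t0 : 0 <= tau by apply/ltW/(le_lt_trans _ htau); rewrite divr_ge0// ?mulr_ge0// addr_ge0.
have [N [E [x [z [j [j' ex]]]]]] := exponents_exist (isT : (3 <= k.+3)%N) htau.
have [bad [E0 [V [D [K [V0 [D0 [Hbad Hcongr Hcount Hlarge]]]]]]]] := flag_package k.
(* Primes above [p1] exceed both the exceptional bound of the forms and the degree, hence do not
   divide the order of the Galois group. *)
pose p1 := (E0 + k.+3)%N; pose G := (12 * N + 20)%N; pose h := (6 * N + 15)%N.
have [cl [Zl [cl0 Hl]]] := @local_fibre R k p1 tau N E x z j j' G t0 ex tc.
have [Za Ha] := exp_omega_small (2 * h) D0.
have [Zb Hb] := exp_omega_small (G + 1) (isT : (0 < 2)%N).
pose v : R := (3 * V)%N%:R.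
pose cS : R := 2 * (cl * (2 * 3 * (2 * V + 1)%N%:R ^+ 3 * v ^+ k.+1)).
pose cM : R := v ^+ k.+1 * (4 * (v ^+ 3 + 1)).
exists G, (K%:R + cM + cS), (Zl + Za + Zb + p1`! + 2)%N.
have v0 : 0 <= v by [].
have [[G0 hG NhG G2 Gh2] [E1 E2 E3 E4]] := exponents_ineq N k.
have cS0 : 0 <= cS by rewrite !mulr_ge0// ?exprn_ge0.
have cM0 : 0 <= cM by rewrite !mulr_ge0// ?addr_ge0 ?exprn_ge0.
split=> //.
split; first by rewrite !addr_ge0.
move=> Z hZ s us bs Hs.
have [Z1 ZlZ ZaZ ZbZ ZpZ] : [/\ (1 < Z)%N, (Zl <= Z)%N, (Za <= Z)%N, (Zb <= Z)%N & (p1`! <= Z)%N].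
  by clear -hZ; split; lia.
have ZR : 1 <= Z%:R :> R by rewrite (ler_nat _ 1) ltnW.
have ZR0 : 0 < Z%:R :> R by rewrite (lt_le_trans ltr01).
set M := (Z ^ G)%N in bs; pose X := (Z ^ h)%N.
have M0 : (0 < M)%N by rewrite expn_gt0 ltnW.
have X0 : (0 < X)%N by rewrite expn_gt0 ltnW.
have MX : (M <= X ^ 2)%N by rewrite /M /X -expnM leq_pexp2l// ltnW.
have Hb1 (p : nat) : (p1 < p)%N -> (E0 < p)%N by rewrite /p1; lia.
have bad_s y : y \in s -> forall p, p \in badp p1 y -> [/\ prime p, (p1 < p)%N & bad p y].
  move=> ys p pb; have [l0 nt] := Hs y ys; split.
  - exact: (allP (badp_prime p1 y) p pb).
  - by move: pb; rewrite mem_filter => /andP[/andP[]].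
  - by apply: (@badp_bad k bad p1 y Hbad _ l0 nt p pb); rewrite /p1 leq_addl.
have disc_s y : y \in s -> pdisc y != 0.
  move=> ys; have [l0 nt] := Hs y ys; apply: (@disc_neq0 k) nt.
  by rewrite tailpoly_full size_fullpoly.
(* Three classes of points: those with a bad prime above [M]; among the others, those whose bad
   primes have a product above [X]; and the rest, to which the analytic sieve applies. *)
pose isL (y : point) := has (fun p => (M < p)%N) (badp p1 y).
pose isM (y : point) := (X < Cp p1 y)%N.
pose sL := [seq y <- s | isL y]; pose s' := [seq y <- s | ~~ isL y].
pose sM := [seq y <- s' | isM y]; pose sS := [seq y <- s' | ~~ isM y].
have sz : (size s = size sL + (size sM + size sS))%N.
  by rewrite (size_partition isL s) (size_partition isM s').
have us' : uniq s' by rewrite filter_uniq.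
have sub' y : y \in s' -> y \in s by rewrite mem_filter => /andP[].
have bsub (t : seq point) : {subset t <= s} -> ffun_bounded M t by move=> ts y /ts/bs.
have Hcount' t Z' ps : uniq t -> ffun_bounded Z' t -> uniq ps ->
      (forall p, p \in ps -> prime p /\ (p1 < p)%N) -> (forall y p, y \in t -> p \in ps -> bad p y) -> _ :=
    fun a b c d e => Hcount t Z' ps a b c (fun p hp => conj (d p hp).1 (Hb1 p (d p hp).2)) e.
have szL : (size sL)%:R <= K%:R * Z%:R ^+ (G * k.+3).-1 :> R.
  have le : (size sL <= K * M ^ k.+2)%N.
    apply: (Hlarge sL M M0); first by rewrite filter_uniq.
      by apply: bsub => y; rewrite mem_filter => /andP[].
    move=> y; rewrite mem_filter => /andP[/hasP[p pb Mp] ys].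
    by have [pp p1p by_] := bad_s y ys p pb; exists p; split=> //; exact: Hb1.
  apply: (@le_trans _ _ (K * M ^ k.+2)%N%:R); first by rewrite ler_nat.
  rewrite natrM ler_wpM2l// /M -expnM natrX ler_weXn2l//.
have szM : (size sM)%:R <= cM * Z%:R ^+ (G * k.+3).-1.
  have HD m : (0 < m <= X ^ 2)%N -> (D ^ size (primes m) <= Z)%N.
    move=> /andP[m0 mX]; apply: Ha => //.
    by rewrite mulnC expnM.
  have hq y : y \in sM -> exists qs, [/\ uniq qs, forall p, p \in qs -> [/\ prime p, (p1 < p)%N & bad p y]
     & (X < \prod_(p <- qs) p <= X ^ 2)%N].
    rewrite !mem_filter => /andP[yM /andP[/hasPn yL ys]].
    have [|qs [uq sq bq]] := subproduct_between (badp_uniq p1 y) _ X0 yM.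
      by apply/allP => p /yL; rewrite -leqNgt => /leq_trans; apply.
    by exists qs; split=> // p /sq; exact: bad_s.
  apply: le_trans (@count_middle R k p1 bad V D Hcount' X M Z sM (filter_uniq _ us') _ X0 HD hq) _.
    by apply: bsub => y; rewrite mem_filter => /andP[_ /sub'].
  by rewrite /M /X; apply: middle_power.
have szS : (size sS)%:R <= cS * Z%:R ^+ (G * k.+3).-1.
  have XM : (X <= M)%N by rewrite /X /M leq_pexp2l// ltnW.
  have ZC C : (0 < C <= X)%N -> (Z ^ (6 * N) <= (2 * Z ^ G) %/ C)%N.
    move=> /andP[C0 CX]; rewrite leq_divRL//; apply: (@leq_trans (Z ^ (6 * N + h))).
      by rewrite expnD leq_mul2l CX orbT.
    by apply: leq_trans (leq_pmull _ (isT : 0 < 2)%N); rewrite leq_pexp2l// ltnW.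
  have Z0 : (0 < Z)%N by rewrite ltnW.
  apply: le_trans (@count_small_sum R k p1 bad V D Hcongr Hcount' X M Z cl sS (filter_uniq _ us') _ cl0 Z0 V0 XM _ _ _) _.
  - by apply: bsub => y; rewrite mem_filter => /andP[_ /sub'].
  - move=> C /andP[C0 CX]; apply: Ha => //; apply: leq_trans CX _.
    by rewrite /X leq_pexp2l// leq_pmull.
  - move=> y; rewrite mem_filter -leqNgt => /andP[yC /sub' ys].
    have [l0 _] := Hs y ys; split=> //; first exact: disc_s.
      by move=> p /(bad_s y ys)[].
    have l1 : (0 < `|y ord_max|)%N by rewrite absz_gt0.
    apply: Hb => //; first by rewrite muln_gt0 fact_gt0.
    by rewrite addn1 expnS leq_mul//; exact: bs.
  - move=> C t /[dup] /ZC hC /andP[C0 CX] ut ts sim.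
    apply: (Hl Z C ZlZ C0 hC t ut) => //.
      by apply: bsub => y /ts; rewrite mem_filter => /andP[_ /sub'].
    move=> y /ts; rewrite mem_filter => /andP[_ /sub' ys]; split; first exact: disc_s.
    by have [] := Hs y ys.
  rewrite /cS ler_wpM2l// ler_pdivrMr ?exprn_gt0// /M natrX -exprM -exprD.
  by rewrite ler_weXn2l.
rewrite sz !natrD !mulrDl -addrA.
by rewrite lerD// lerD.
Qed.

End SmallAndLargePrimes.

From mathcomp Require Import finmap.

(** * The theorem *)

(** [H] is compared with the [G]-th power of an integer, which turns fractional powers of [H] into
    integral powers of [Z]. A single factor [Z] saved is about [H ^ (1 / G)] and tends to
    infinity. *)
Lemma near_pinfty_power_bound (R : realType) (n G Z0 : nat) (c : R) (f : R -> nat) :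
  (0 < n)%N -> (0 < G)%N -> 0 <= c ->
  (forall (Z : nat) (H : R), (Z0 <= Z)%N -> H <= Z%:R ^+ G -> (f H)%:R <= c * Z%:R ^+ (G * n).-1) ->
  forall eps : R, 0 < eps -> \forall H \near +oo_R, (f H)%:R <= eps * `|H ^+ n|.
Proof.
move=> n0 G0 c0 hf eps eps0.
pose Q : nat := (Z0 + (Num.truncn (c * 2 ^+ (G * n) / eps)).+1 + 2)%N.
near=> H.
have HQ : Q%:R ^+ G <= H by near: H; apply: nbhs_pinfty_ge; rewrite num_real.
have H0 : 0 <= H by apply: le_trans HQ; rewrite exprn_ge0.
have [W [HW WH]] := exists_root_above (Num.truncn H) G0.
have /andP[t1 t2] := truncn_itv H0.
have H1 : H <= W%:R ^+ G by apply: ltW; apply: lt_le_trans t2 _; rewrite -natrX ler_nat.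
have H2 : W.-1%:R ^+ G <= H by apply: le_trans t1; rewrite -natrX ler_nat.
have QW : (Q <= W)%N.
  by rewrite -(@leq_exp2r _ _ G)// -(ler_nat R) !natrX (le_trans HQ).
have W1 : (2 <= W)%N by apply: leq_trans QW; rewrite /Q addn2.
have ZW : (Z0 <= W)%N by apply: leq_trans QW; rewrite /Q -!addnA leq_addr.
apply: le_trans (hf W H ZW H1) _.
have W0 : 0 < W%:R :> R by rewrite ltr0n ltnW.
have Gn : ((G * n).-1.+1 = G * n)%N by rewrite prednK// muln_gt0 G0.
rewrite ger0_norm ?exprn_ge0// -(ler_pM2r W0) -mulrA -exprSr Gn.
apply: (@le_trans _ _ (c * 2 ^+ (G * n) * H ^+ n)).
  rewrite -mulrA ler_wpM2l// !exprM -exprMn lerXn2r ?nnegrE ?mulr_ge0 ?exprn_ge0//.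
  apply: (@le_trans _ _ (2 ^+ G * W.-1%:R ^+ G)); last by rewrite ler_wpM2l ?exprn_ge0.
  rewrite -exprMn lerXn2r ?nnegrE ?mulr_ge0// -natrM ler_nat; clear -W1; lia.
rewrite -[leRHS]mulrA [H ^+ n * _]mulrC mulrA ler_wpM2r ?exprn_ge0//.
rewrite -ler_pdivrMl// mulrC; apply: le_trans (ltW (truncnS_gt _)) _.
by rewrite ler_nat; apply: leq_trans QW; rewrite /Q addnAC leq_addl.
Unshelve. all: by end_near.
Qed.

Lemma alt_tperm_full (n : nat) (G : {group 'S_n}) (i j : 'I_n) : ('Alt_('I_n) \subset G)%g ->
  i != j -> tperm i j \in G -> G :=: [set: 'S_n]%SET.
Proof.
move=> /fintype.subsetP AG ij tG; apply/setP => s; rewrite inE.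
case os : (odd_perm s); last by apply: AG; rewrite Alt_even os.
rewrite -(groupMr _ tG); apply: AG.
by rewrite Alt_even odd_permM os odd_tperm ij.
Qed.

Lemma full_isog_Sym (n : nat) (G : {group 'S_n}) : G :=: [set: 'S_n]%SET -> (G \isog 'Sym_('I_n))%g.
Proof. by move=> ->; exact: isog_refl. Qed.

Section Assembly.
Variables (R : realType) (k : nat) (tau : R).

Lemma galZ_data (f : {poly int}) : size f = k.+4 ->
  exists (L : splittingFieldType rat) (r : k.+3.-tuple L),
    [/\ map_poly (in_alg L) (map_poly (intr : int -> rat) f) %= \prod_(x <- r) ('X - x%:P),
        <<1 & r>>%VS = fullv & galZ k.+3 f = root_perms_group r].
Proof.
move=> sf; apply: galois_groupP.
by rewrite size_map_inj_poly//; exact: intr_inj.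
Qed.

Lemma nonSn_transposition (f : {poly int}) (H : R) : nonSn_set k.+3 H f ->
  no_transposition k f \/ has_transposition k f.
Proof.
move=> [[sf irr bf] nS]; have [L [r [fr genr Gr]]] := galZ_data sf.
have nT : root_perms r != [set: 'S_k.+3]%SET.
  apply: contra nS => /eqP e; rewrite Gr; exact: full_isog_Sym.
have [ex|nex] := pselect (exists i j : 'I_k.+3, i != j /\ tperm i j \in root_perms r).
  by right; exists L, r.
left; exists L, r; split=> //; first exact: irreducible_uniq_roots irr fr.
by move=> i j ij; apply/negP => h; apply: nex; exists i, j.
Qed.

(** The alternating group and one transposition generate the symmetric group. *)
Lemma alt_no_transposition (f : {poly int}) (H : R) : nonSn_set k.+3 H f -> ~ nonAn_set k.+3 H f ->
  no_transposition k f.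
Proof.
move=> [[sf irr bf] nS] nA; have [L [r [fr genr Gr]]] := galZ_data sf.
have AG : ('Alt_('I_k.+3) \subset galZ k.+3 f)%g.
  by apply: contraT => h; case: nA; split.
exists L, r; split=> //; first exact: irreducible_uniq_roots irr fr.
move=> i j ij; apply/negP => h; case/negP: nS; apply: full_isog_Sym.
by apply: alt_tperm_full AG ij _; rewrite Gr.
Qed.

Lemma nonAn_nonSn (H : R) (f : {poly int}) : nonAn_set k.+3 H f -> nonSn_set k.+3 H f.
Proof.
move=> [bf nA]; split=> //; apply: contra nA => iS.
have : galZ k.+3 f = [set: 'S_k.+3]%SET :> {set _}.
  apply/eqP; rewrite eqEcard finset.subsetT /= (card_isog iS); exact: leqnn.
by move=> ->; exact: finset.subsetT.
Qed.

Lemma box_absz (f : {poly int}) (H : R) (M : nat) (j : nat) : irred_box k.+3 H f -> H <= M%:R ->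
  (absz (f`_j)%R <= M)%N.
Proof.
move=> [_ _ bf] HM; rewrite -(ler_nat R); apply: le_trans HM.
by have := bf j; rewrite -abszE -pmulrn.
Qed.

Lemma no_transposition_count : 4 * (k.+3)%:R / ((k.+3)%:R + 2) < tau -> TC k.+3 tau ->
  exists (G : nat) (c : R) (Z0 : nat), (0 < G)%N /\ 0 <= c /\ forall Z : nat, (Z0 <= Z)%N ->
  forall s : seq {poly int}, uniq s ->
  (forall f, f \in s -> [/\ size f = k.+4, no_transposition k f & forall i : nat, (absz (f`_i)%R <= Z ^ G)%N]) ->
  (size s)%:R <= c * Z%:R ^+ (G * k.+3).-1.
Proof.
move=> ht tc; have [G [c [Z0 [G0 [c0 Hc]]]]] := tailpoly_no_transposition_count ht tc.
exists G, c, Z0; split=> //; split=> // Z hZ s us Hs.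
pose y (f : {poly int}) : {ffun 'I_k.+4 -> int} := [ffun i : 'I_k.+4 => f`_i].
have yE f : f \in s -> tailpoly (y f) = f.
  move=> /Hs[sf _ _]; apply/polyP => i.
  have [ik|ik] := ltnP i k.+4; first by rewrite (coef_tailpoly _ (Ordinal ik)) ffunE.
  by rewrite !nth_default ?sf// (leq_trans (size_tailpoly _)).
rewrite -(size_map y); apply: Hc => //.
- rewrite map_inj_in_uniq// => f f' fs fs' e.
  by rewrite -(yE f fs) -(yE f' fs') e.
- by move=> _ /mapP[f fs ->] i; rewrite ffunE; have [_ _] := Hs f fs.
move=> _ /mapP[f fs ->]; have [sf nt _] := Hs f fs; rewrite yE//; split=> //.
by rewrite ffunE /= -[k.+3]/(k.+4.-1) -sf -lead_coefE lead_coef_eq0 -size_poly_gt0 sf.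
Qed.

Definition nonSn_seq (H : R) : seq {poly int} := fset_set (nonSn_set k.+3 H).

Lemma mem_nonSn_seq H f : (f \in nonSn_seq H) = `[< nonSn_set k.+3 H f >].
Proof.
rewrite -[LHS]/(f \in fset_set (nonSn_set k.+3 H)) in_fset_set.
  by apply/idP/asboolP => [/set_mem|h]; last exact/mem_set.
by apply: sub_finite_set (finite_irred_box k.+3 H) => g [].
Qed.

Lemma uniq_nonSn_seq H : uniq (nonSn_seq H).
Proof. exact: fset_uniq. Qed.

(** This count also includes groups not containing the alternating group. It bounds the difference
    in the first assertion, and with its complement it gives the second. *)
Definition without_transposition (H : R) : nat := size [seq f <- nonSn_seq H | `[< no_transposition k f >]].
Definition with_transposition (H : R) : nat := size [seq f <- nonSn_seq H | ~~ `[< no_transposition k f >]].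

Lemma E_count_split (H : R) : E_count k.+3 H = (without_transposition H + with_transposition H)%N.
Proof. by rewrite /E_count -[LHS]/(size (nonSn_seq H)) (size_partition (fun f => `[< no_transposition k f >])). Qed.

Lemma E_dagger_le (H : R) : (E_dagger_count k.+3 H <= E_count k.+3 H)%N.
Proof.
have fin (A : set {poly int}) : (A `<=` irred_box k.+3 H)%classic -> finite_set A.
  by move=> AH; apply: sub_finite_set AH _; exact: finite_irred_box.
apply: fsubset_leq_card; rewrite -fset_set_sub; [exact: nonAn_nonSn| |]; apply: fin => g; by case.
Qed.

Lemma E_count_le (H : R) : (E_count k.+3 H <= E_dagger_count k.+3 H + without_transposition H)%N.
Proof.
have fin : finite_set (nonAn_set k.+3 H).
  by apply: sub_finite_set (finite_irred_box k.+3 H) => g [].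
rewrite /E_count -[X in (X <= _)%N]/(size (nonSn_seq H)) (size_partition (fun f => `[< nonAn_set k.+3 H f >])).
apply: leq_add.
  apply: uniq_leq_size; first by rewrite filter_uniq// uniq_nonSn_seq.
  move=> f; rewrite mem_filter => /andP[/asboolP h _].
  by rewrite -[_ \in _]/(f \in fset_set (nonAn_set k.+3 H)) in_fset_set//; exact/mem_set.
rewrite /without_transposition !size_filter -!size_filter; apply: uniq_leq_size.
  by rewrite filter_uniq// uniq_nonSn_seq.
move=> f; rewrite !mem_filter => /andP[/asboolP h fs]; rewrite fs andbT; apply/asboolP.
by move: fs; rewrite mem_nonSn_seq => /asboolP fs; exact: alt_no_transposition fs h.
Qed.

Lemma without_transposition_bound : 4 * (k.+3)%:R / ((k.+3)%:R + 2) < tau -> TC k.+3 tau ->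
  forall eps : R, 0 < eps -> \forall H \near +oo_R, (without_transposition H)%:R <= eps * `|H ^+ k.+3|.
Proof.
move=> ht tc; have [G [c [Z0 [G0 [c0 Hc]]]]] := no_transposition_count ht tc.
apply: (@near_pinfty_power_bound _ _ G Z0 c) => // Z H hZ HZ.
apply: Hc => //; first by rewrite filter_uniq// uniq_nonSn_seq.
move=> f; rewrite mem_filter mem_nonSn_seq => /andP[/asboolP nt /asboolP[bf _]].
split=> //; first by case: bf.
by move=> i; apply: (box_absz _ bf); rewrite natrX.
Qed.

Lemma with_transposition_bound : (10 <= k.+3)%N ->
  forall eps : R, 0 < eps -> \forall H \near +oo_R, (with_transposition H)%:R <= eps * `|H ^+ k.+3|.
Proof.
move=> n10; have [G [c [Z0 [G0 Hc]]]] := has_transposition_count n10.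
apply: (@near_pinfty_power_bound _ _ G Z0 c%:R) => // Z H hZ HZ.
rewrite -natrX -natrM ler_nat; apply: Hc => //; first by rewrite filter_uniq// uniq_nonSn_seq.
move=> f; rewrite mem_filter mem_nonSn_seq => /andP[/asboolP nt /asboolP nS].
have [bf _] := nS; have [sf irr _] := bf; split=> //.
  by case: (nonSn_transposition nS).
by move=> i; apply: (box_absz _ bf); rewrite natrX.
Qed.

End Assembly.

Theorem theorem5p2 (R : realType) (n : nat) (tau : R) :
  (3 <= n)%N ->
  4 * n%:R / (n%:R + 2) < tau ->
  TC n tau ->
  ((fun H : R => (E_count n H)%:R : R^o)
     = (fun H : R => (E_dagger_count n H)%:R : R^o)
       +o_ (+oo_R) (fun H : R => H ^+ n : R^o))
  /\ ((10 <= n)%N ->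
      (fun H : R => (E_count n H)%:R : R^o)
        =o_ (+oo_R) (fun H : R => H ^+ n : R^o)).
Proof.
case: n => [|[|[|k]]]// _ ht tc; split.
  apply/eqaddoP => eps eps0; have := without_transposition_bound ht tc eps0.
  apply: filterS => H; apply: le_trans.
  rewrite -[(_ - _) H]/((E_count k.+3 H)%:R - (E_dagger_count k.+3 H)%:R).
  rewrite -natrB ?E_dagger_le// normr_nat ler_nat leq_subLR.
  exact: E_count_le.
move=> n10; apply/eqoP => eps eps0.
have e20 : 0 < eps / 2 by rewrite divr_gt0.
have := with_transposition_bound n10 e20; have := without_transposition_bound ht tc e20.
apply: filterS2 => H hA hB; rewrite normr_nat E_count_split natrD.
by rewrite [eps](splitr eps) mulrDl lerD.
Qed.
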